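(* Let $(X,\mathcal{P})$ and $(Y,\mathcal{Q})$ be disjointly tree-graded spaces, with the topology of $X$ induced by a path-diameter metric $d$, such that $\mathbf{Pc}(X)$ is uniformly $1$-$UV_0$. Let $f:X\to Y$ be a continuous function such that every piece of $X$ is mapped into some piece of $Y$ and such that no two distinct pieces of $X$ are mapped into the same piece of $Y$. Then $f$ is $\pi_1$-injective if and only if $f|_{\mathbf{Pc}(X)}:\mathbf{Pc}(X)\to\mathbf{Pc}(Y)$ is $\pi_1$-injective.
   Context: All spaces are Hausdorff; maps are continuous. A simple closed curve is a space homeomorphic to the unit circle $S^1$; $\mathbb{D}$ is the closed unit disk. A loop $\alpha:S^1\to X$ is inessential (in $X$) if it extends to a map $\mathbb{D}\to X$. A map is $\pi_1$-injective if it induces an injective homomorphism on fundamental groups at every basepoint of its domain. A disjointly tree-graded space is a pair $(X,\mathcal{P})$ where $X$ is a path-connected, locally path-connected, metrizable space and $\mathcal{P}$ is a collection of non-empty closed subsets of $X$ (called pieces) such that (1) $\bigcup\mathcal{P}$ is closed in $X$; (2) the elements of $\mathcal{P}$ are the path-components of $\bigcup\mathcal{P}$; (3) every simple closed curve in $X$ is contained in one piece. Write $\mathbf{Pc}(X)=\bigcup\mathcal{P}$, and likewise $\mathbf{Pc}(Y)=\bigcup\mathcal{Q}$. A path-diameter metric on $X$ is a metric $d$ with $d(a,b)=\inf\{\operatorname{diam}(\operatorname{im}(\alpha))\mid \alpha\text{ is a path in }X\text{ from }a\text{ to }b\}$ for all $a,b$. Subsets of $X$ carry the subspace metric. A metric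 space $A$ is uniformly $1$-$UV_0$ if for every $\epsilon>0$ there exists $\delta\in(0,\epsilon)$ such that for every inessential loop $\alpha:S^1\to A$ with $\operatorname{diam}(\operatorname{im}(\alpha))<\delta$ there exists a map $g:\mathbb{D}\to A$ with $\operatorname{diam}(\operatorname{im}(g))<\epsilon$ and $g|_{S^1}=\alpha$. *)

(* Defs.v *)
From HB Require Import structures.
From mathcomp Require Import all_boot all_order all_algebra generic_quotient.
From mathcomp Require Import all_classical all_reals all_analysis.
From mathcomp Require Import homotopy lra.
Set Implicit Arguments.
Unset Strict Implicit.
Unset Printing Implicit Defensive.
Import Order.TTheory GRing.Theory Num.Theory.
Import numFieldNormedType.Exports.
Local Open Scope classical_set_scope.
Local Open Scope ring_scope.
Local Open Scope quotient_scope.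

Lemma continuous_set_val (T : topologicalType) (A : set T) : continuous (@set_val T A).
Proof. exact: initial_continuous. Qed.

Lemma continuous_to_set_type (T U : topologicalType) (A : set U) (f : T -> A) :
  continuous (fun x => set_val (f x)) -> continuous f.
Proof.
move=> /continuousP cf; apply/continuousP => _ [B oB <-].
exact: (cf _ oB).
Qed.

Section restriction.
Context {T U : topologicalType}.

Definition set_restr (A : set T) (B : set U) (f : T -> U)
  (fAB : {homo f : x / A x >-> B x}) (x : A) : B :=
  SigSub (mem_set (fAB _ (set_valP x))).

Lemma set_restr_continuous (A : set T) (B : set U) (f : continuousType T U)
  (fAB : {homo f : x / A x >-> B x}) : continuous (set_restr fAB).
Proof.
apply: continuous_to_set_type => x.
apply: (@continuous_comp _ _ _ set_val f); first exact: continuous_set_val.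
exact: cts_fun.
Qed.

HB.instance Definition _ (A : set T) (B : set U) (f : continuousType T U)
    (fAB : {homo f : x / A x >-> B x}) :=
  isContinuous.Build A B (set_restr fAB) (@set_restr_continuous A B f fAB).

End restriction.

Section subspace_metric.
Context {R : realType} {T : metricType R} (A : set T).

Let dist (x y : A) : R := mdist (set_val x) (set_val y).

Let dist_ge0 x y : 0 <= dist x y. Proof. exact: mdist_ge0. Qed.

Let dist_positivity x y : dist x y = 0 -> x = y.
Proof. by move=> /mdist_positivity /val_inj. Qed.

Let ball_dist x d : ball x d = [set y | dist x y < d].
Proof. by rewrite -initial_ballE ballEmdist. Qed.

HB.instance Definition _ := PseudoMetric_isMetric.Build R A
  dist_ge0 dist_positivity ball_dist.

End subspace_metric.

Definition homeomorphic (T U : topologicalType) : Prop :=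
  exists (f : T -> U) (g : U -> T),
    [/\ continuous f, continuous g, cancel f g & cancel g f].

Section unit_interval.
Variable R : realType.

Definition unit_itv : Type := set_type `[0 : R, 1]%classic.
HB.instance Definition _ := Topological.on unit_itv.

Lemma unit_itv0P : (0 : R) \in `[0 : R, 1]%classic.
Proof. by rewrite inE /= in_itv /= lexx ler01. Qed.

Lemma unit_itv1P : (1 : R) \in `[0 : R, 1]%classic.
Proof. by rewrite inE /= in_itv /= lexx ler01. Qed.

Lemma unit_itv_neq : SigSub unit_itv0P != SigSub unit_itv1P :> unit_itv.
Proof. by apply/eqP => /(congr1 val) /= /esym/eqP; rewrite oner_eq0. Qed.

HB.instance Definition _ := isBiPointed.Build unit_itv unit_itv_neq.

Definition ival (s : unit_itv) : R := set_val s.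

Lemma ival_continuous : continuous ival.
Proof. exact: continuous_set_val. Qed.

Lemma ival_inj : injective ival. Proof. exact: val_inj. Qed.

Lemma ival0 : ival zero = 0. Proof. by []. Qed.
Lemma ival1 : ival one = 1. Proof. by []. Qed.

Lemma ival_ge0 s : 0 <= ival s.
Proof. by have := set_valP s; rewrite /= in_itv /= => /andP[]. Qed.

Lemma ival_le1 s : ival s <= 1.
Proof. by have := set_valP s; rewrite /= in_itv /= => /andP[]. Qed.

Lemma clampP (r : R) : Num.max 0 (Num.min r 1) \in `[0 : R, 1]%classic.
Proof.
by rewrite inE /= in_itv /= le_max lexx /= ge_max ler01 ge_min lexx orbT.
Qed.

Definition clamp (r : R) : unit_itv := SigSub (clampP r).

Lemma ival_clamp r : ival (clamp r) = Num.max 0 (Num.min r 1).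
Proof. by []. Qed.

Lemma clamp_id r : 0 <= r <= 1 -> ival (clamp r) = r.
Proof. by move=> /andP[r0 r1]; rewrite ival_clamp min_l // max_r. Qed.

Lemma clampK s : clamp (ival s) = s.
Proof. by apply: ival_inj; rewrite clamp_id// ival_ge0 ival_le1. Qed.

Lemma clamp_le0 r : r <= 0 -> clamp r = zero.
Proof.
move=> r0; apply: ival_inj; rewrite ival_clamp ival0 max_l// ge_min.
by rewrite r0.
Qed.

Lemma clamp_ge1 r : 1 <= r -> clamp r = one.
Proof.
by move=> r1; apply: ival_inj; rewrite ival_clamp ival1 min_r// max_r.
Qed.

Lemma clamp_continuous : continuous clamp.
Proof.
apply: continuous_to_set_type => x.
apply: (@continuous_max _ _ (cst 0) (fun r : R => Num.min r 1)).
  exact: cvg_cst.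
apply: (@continuous_min _ _ id (cst 1)); first exact: cvg_id.
exact: cvg_cst.
Qed.

End unit_interval.

Lemma paste_continuous (R : realType) (T U : topologicalType) (c : R)
    (u : T -> R) (f g : T -> U) :
    continuous u -> continuous f -> continuous g ->
    (forall x, u x = c -> f x = g x) ->
  continuous (fun x => if u x <= c then f x else g x).
Proof.
move=> cu cf cg fg; set h := fun x => _.
have AB : [set x | u x <= c] `|` [set x | c <= u x] = setT.
  by apply/seteqP; split=> // x _; have [|/ltW] := leP (u x) c; [left|right].
apply/continuous_subspace_setT; rewrite -AB.
apply: withinU_continuous.
- exact: (preimage_closed (fun x _ => cu x) (@closed_le R c)).
- exact: (preimage_closed (fun x _ => cu x) (@closed_ge R c)).
- apply: (@subspace_eq_continuous _ _ _ f); last exact: continuous_subspaceT.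
  by move=> x /set_mem /= xc; rewrite /h /from_subspace /= xc.
- apply: (@subspace_eq_continuous _ _ _ g); last exact: continuous_subspaceT.
  move=> x /set_mem /= cx; rewrite /h /from_subspace /=; case: ifPn => // xc.
  by rewrite fg//; apply/eqP; rewrite eq_le xc.
Qed.

Section homotopy.
Context {R : realType} {T : topologicalType}.
Local Notation I := (unit_itv R).

Lemma path_cts (x y : T) (p : {path I from x to y}) : continuous p.
Proof. exact: cts_fun. Qed.

Lemma clamp_comp_continuous (V : topologicalType) (f : I -> T) (u : V -> R) :
  continuous f -> continuous u -> continuous (fun v => f (clamp (u v))).
Proof.
move=> cf cu v; apply: (@continuous_comp _ _ _ (fun v => clamp (u v)) f).
  by apply: continuous_comp; [exact: cu|exact: clamp_continuous].
exact: cf.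
Qed.

(** Homotopy relative to the endpoints; the second coordinate is the time. *)
Definition path_homotopic (x y : T) (p q : {path I from x to y}) : Prop :=
  exists H : I * I -> T,
    [/\ continuous H,
        forall s, H (s, zero) = p s,
        forall s, H (s, one) = q s,
        forall t, H (zero, t) = x &
        forall t, H (one, t) = y].

Let fst_cts : continuous (fun st : I * I => ival st.1).
Proof.
move=> st; apply: (@continuous_comp _ _ _ fst (@ival R)).
  exact: cvg_fst.
exact: ival_continuous.
Qed.

Let snd_cts : continuous (fun st : I * I => ival st.2).
Proof.
move=> st; apply: (@continuous_comp _ _ _ snd (@ival R)).
  exact: cvg_snd.
exact: ival_continuous.
Qed.

Lemma path_homotopic_refl (x y : T) (p : {path I from x to y}) :
  path_homotopic p p.
Proof.
exists (fun st => p st.1); split=> //.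
- move=> st; apply: (@continuous_comp _ _ _ fst p); first exact: cvg_fst.
  exact: path_cts.
- by move=> t /=; exact: path_zero.
- by move=> t /=; exact: path_one.
Qed.

Lemma comp2_continuous (V : topologicalType) (H : I * I -> T) (u v : V -> R) :
  continuous H -> continuous u -> continuous v ->
  continuous (fun z => H (clamp (u z), clamp (v z))).
Proof.
move=> cH cu cv z.
apply: (@continuous_comp _ _ _ (fun z => (clamp (u z), clamp (v z))) H).
have cc (w : V -> R) :
    continuous w -> clamp (w z') @[z' --> z] --> clamp (w z).
  by move=> cw; apply: continuous_comp; [exact: cw|exact: clamp_continuous].
exact: (cvg_pair (cc u cu) (cc v cv)).
exact: cH.
Qed.

Lemma path_homotopic_sym (x y : T) (p q : {path I from x to y}) :
  path_homotopic p q -> path_homotopic q p.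
Proof.
move=> [H [cH Hp Hq Hx Hy]].
exists (fun st => H (clamp (ival st.1), clamp (1 - ival st.2))); split.
- apply: comp2_continuous => // st.
  by apply: cvgB; [exact: cvg_cst|exact: snd_cts].
- by move=> s /=; rewrite clampK ival0 subr0 clamp_ge1.
- by move=> s /=; rewrite clampK ival1 subrr clamp_le0.
- by move=> t /=; rewrite clampK.
- by move=> t /=; rewrite clampK.
Qed.

Lemma affine_continuous (V : topologicalType) (u : V -> R) (a b : R) :
  continuous u -> continuous (fun v => a * u v + b).
Proof.
move=> cu v; apply: cvgD; last exact: cvg_cst.
by apply: cvgM; [exact: cvg_cst|exact: cu].
Qed.

Lemma path_homotopic_trans (x y : T) (p q r : {path I from x to y}) :
  path_homotopic p q -> path_homotopic q r -> path_homotopic p r.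
Proof.
move=> [H [cH Hp Hq Hx Hy]] [K [cK Kq Kr Kx Ky]].
exists (fun st => if ival st.2 <= 2^-1
  then H (clamp (1 * ival st.1 + 0), clamp (2 * ival st.2 + 0))
  else K (clamp (1 * ival st.1 + 0), clamp (2 * ival st.2 + -1))); split.
- apply: paste_continuous => //.
  + by apply: comp2_continuous => //; exact: affine_continuous.
  + by apply: comp2_continuous => //; exact: affine_continuous.
  + move=> st /= e; rewrite (@clamp_ge1 _ (2 * _ + 0)); last by lra.
    by rewrite (@clamp_le0 _ (2 * _ + -1)) ?Hq ?Kq//; lra.
- move=> s /=; rewrite ival0 ifT; last by lra.
  by rewrite mul1r addr0 clampK clamp_le0 ?Hp//; lra.
- move=> s /=; rewrite ival1 ifF; last by apply/negbTE; lra.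
  by rewrite mul1r addr0 clampK clamp_ge1 ?Kr//; lra.
- by move=> t /=; rewrite mul1r addr0 clampK Hx Kx if_same.
- by move=> t /=; rewrite mul1r addr0 clampK Hy Ky if_same.
Qed.

(** Straight-line homotopy between two reparametrizations of [f]. Out of
    range values of [phi] and [psi] are clamped to the unit interval. *)
Lemma path_homotopic_reparam (x y : T) (p q : {path I from x to y})
    (f : I -> T) (phi psi : I -> R) :
    continuous f -> continuous phi -> continuous psi ->
    (forall s, p s = f (clamp (phi s))) ->
    (forall s, q s = f (clamp (psi s))) ->
    phi zero = psi zero -> phi one = psi one ->
  path_homotopic p q.
Proof.
move=> cf cphi cpsi pE qE e0 e1.
have cfst (g : I -> R) : continuous g -> continuous (fun st : I * I => g st.1).
  move=> cg st; apply: (@continuous_comp _ _ _ fst g); last exact: cg.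
  exact: cvg_fst.
exists (fun st => f (clamp (phi st.1 + ival st.2 * (psi st.1 - phi st.1)))).
split.
- apply: clamp_comp_continuous => // st.
  apply: cvgD; first exact: cfst.
  apply: cvgM; first exact: snd_cts.
  by apply: cvgB; exact: cfst.
- by move=> s /=; rewrite ival0 mul0r addr0 pE.
- by move=> s /=; rewrite ival1 mul1r addrC subrK qE.
- by move=> t /=; rewrite e0 subrr mulr0 addr0 -e0 -pE path_zero.
- by move=> t /=; rewrite e1 subrr mulr0 addr0 -e1 -pE path_one.
Qed.

Lemma clamp_id1 (s : I) : clamp (1 * ival s + 0) = s.
Proof. by rewrite mul1r addr0 clampK. Qed.

Lemma minr_continuous (V : topologicalType) (u v : V -> R) :
  continuous u -> continuous v -> continuous (fun x => Num.min (u x) (v x)).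
Proof. by move=> cu cv x; exact: continuous_min (cu x) (cv x). Qed.

Lemma maxr_continuous (V : topologicalType) (u v : V -> R) :
  continuous u -> continuous v -> continuous (fun x => Num.max (u x) (v x)).
Proof. by move=> cu cv x; exact: continuous_max (cu x) (cv x). Qed.

Section concatenation.
Variables (x y z : T) (p : {path I from x to y}) (q : {path I from y to z}).

Definition path_concat_fun (s : I) : T :=
  if ival s <= 2^-1 then p (clamp (2 * ival s + 0))
  else q (clamp (2 * ival s + -1)).

Lemma path_concat_cts : continuous path_concat_fun.
Proof.
apply: paste_continuous; first exact: ival_continuous.
- by apply: clamp_comp_continuous; [exact: path_cts|];
    apply: affine_continuous; exact: ival_continuous.
- by apply: clamp_comp_continuous; [exact: path_cts|];
    apply: affine_continuous; exact: ival_continuous.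
- move=> s e; rewrite clamp_ge1; last by lra.
  by rewrite clamp_le0 ?path_one ?path_zero//; lra.
Qed.

Lemma path_concat0 : path_concat_fun zero = x.
Proof.
rewrite /path_concat_fun ival0 ifT; last by lra.
by rewrite clamp_le0 ?path_zero//; lra.
Qed.

Lemma path_concat1 : path_concat_fun one = z.
Proof.
rewrite /path_concat_fun ival1 ifF; last by apply/negbTE; lra.
by rewrite clamp_ge1 ?path_one//; lra.
Qed.

Definition path_concat : {path I from x to z} :=
  mk_path path_concat_cts path_concat0 path_concat1.

Lemma path_concatE s : path_concat s =
  if ival s <= 2^-1 then p (clamp (2 * ival s + 0))
  else q (clamp (2 * ival s + -1)).
Proof. by []. Qed.

End concatenation.

Section reversal.
Variables (x y : T) (p : {path I from x to y}).

Definition path_rev_fun (s : I) : T := p (clamp (-1 * ival s + 1)).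

Lemma path_rev_cts : continuous path_rev_fun.
Proof.
apply: clamp_comp_continuous; first exact: path_cts.
by apply: affine_continuous; exact: ival_continuous.
Qed.

Lemma path_rev0 : path_rev_fun zero = y.
Proof.
by rewrite /path_rev_fun ival0 mulr0 add0r clamp_ge1 ?path_one.
Qed.

Lemma path_rev1 : path_rev_fun one = x.
Proof.
by rewrite /path_rev_fun ival1 mulr1 addrC subrr clamp_le0 ?path_zero.
Qed.

Definition path_rev : {path I from y to x} :=
  mk_path path_rev_cts path_rev0 path_rev1.

Lemma path_revE s : path_rev s = p (clamp (-1 * ival s + 1)).
Proof. by []. Qed.

End reversal.

Definition path_cst (x : T) : {path I from x to x} := cst x.

Lemma path_concat_homotopic (x y z : T) (p p' : {path I from x to y})
    (q q' : {path I from y to z}) :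
  path_homotopic p p' -> path_homotopic q q' ->
  path_homotopic (path_concat p q) (path_concat p' q').
Proof.
move=> [H [cH Hp Hq Hx Hy]] [K [cK Kq Kr Kx Ky]].
exists (fun st => if ival st.1 <= 2^-1
  then H (clamp (2 * ival st.1 + 0), clamp (1 * ival st.2 + 0))
  else K (clamp (2 * ival st.1 + -1), clamp (1 * ival st.2 + 0))); split.
- apply: paste_continuous => //.
  + by apply: comp2_continuous => //; exact: affine_continuous.
  + by apply: comp2_continuous => //; exact: affine_continuous.
  + move=> st /= e; rewrite (@clamp_ge1 _ (2 * _ + 0)); last by lra.
    by rewrite (@clamp_le0 _ (2 * _ + -1)) ?Hy ?Kx//; lra.
- by move=> s /=; rewrite clamp_id1 Hp Kq.
- by move=> s /=; rewrite clamp_id1 Hq Kr.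
- move=> t /=; rewrite ival0 ifT; last by lra.
  by rewrite clamp_le0 ?Hx//; lra.
- move=> t /=; rewrite ival1 ifF; last by apply/negbTE; lra.
  by rewrite clamp_ge1 ?Ky//; lra.
Qed.

Lemma path_rev_homotopic (x y : T) (p q : {path I from x to y}) :
  path_homotopic p q -> path_homotopic (path_rev p) (path_rev q).
Proof.
move=> [H [cH Hp Hq Hx Hy]].
exists (fun st => H (clamp (-1 * ival st.1 + 1), clamp (1 * ival st.2 + 0))).
split.
- by apply: comp2_continuous => //; exact: affine_continuous.
- by move=> s /=; rewrite clamp_id1 Hp.
- by move=> s /=; rewrite clamp_id1 Hq.
- by move=> t /=; rewrite ival0 mulr0 add0r clamp_ge1.
- by move=> t /=; rewrite ival1 mulr1 addrC subrr clamp_le0.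
Qed.

Lemma path_concatA (w x y z : T) (p : {path I from w to x})
    (q : {path I from x to y}) (r : {path I from y to z}) :
  path_homotopic (path_concat p (path_concat q r))
                 (path_concat (path_concat p q) r).
Proof.
apply: (@path_homotopic_reparam _ _ _ _ (path_concat p (path_concat q r))
  (@ival R) (fun s => Num.min (Num.min (2 * ival s + 0) (1 * ival s + 4^-1))
                              (2^-1 * ival s + 2^-1))).
- exact: path_cts.
- exact: ival_continuous.
- by apply: minr_continuous; [apply: minr_continuous|];
    apply: affine_continuous; exact: ival_continuous.
- by move=> s; rewrite clampK.
- move=> s; have s0 := ival_ge0 s; have s1 := ival_le1 s.
  rewrite !path_concatE.
  have [s2|s2] := leP (ival s) 2^-1; last first.
    rewrite min_r; last by rewrite le_min; apply/andP; split; lra.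
    rewrite clamp_id; last by apply/andP; split; lra.
    rewrite ifF; last by apply/negbTE; lra.
    rewrite clamp_id; last by apply/andP; split; lra.
    rewrite ifF; last by apply/negbTE; lra.
    by congr (r (clamp _)); lra.
  have -> : ival (clamp (2 * ival s + 0)) = 2 * ival s.
    by rewrite clamp_id ?addr0//; apply/andP; split; lra.
  have [s4|s4] := leP (2 * ival s) 2^-1.
    rewrite (@min_l _ _ (Num.min _ _)); last first.
      by rewrite ge_min; apply/orP; left; lra.
    rewrite min_l; last by lra.
    rewrite clamp_id; last by apply/andP; split; lra.
    rewrite ifT; last by lra.
    by congr (p (clamp _)); lra.
  rewrite (@min_r _ _ (2 * ival s + 0)); last by lra.
  rewrite min_l; last by lra.
  rewrite clamp_id; last by apply/andP; split; lra.
  rewrite ifF; last by apply/negbTE; lra.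
  rewrite clamp_id; last by apply/andP; split; lra.
  rewrite ifT; last by lra.
  by congr (q (clamp _)); lra.
- by rewrite ival0 !mulr0 !add0r (@min_l _ _ 0) ?min_l//; lra.
- by rewrite ival1 min_r; [lra|rewrite le_min; apply/andP; split; lra].
Qed.

Lemma path_concat_cstl (x y : T) (p : {path I from x to y}) :
  path_homotopic (path_concat (path_cst x) p) p.
Proof.
apply: (@path_homotopic_reparam _ _ _ _ p
  (fun s => Num.max 0 (2 * ival s + -1)) (@ival R)).
- exact: path_cts.
- apply: maxr_continuous; first exact: cst_continuous.
  by apply: affine_continuous; exact: ival_continuous.
- exact: ival_continuous.
- move=> s; rewrite !path_concatE.
  case: (leP (ival s) 2^-1) => s2.
    by rewrite max_l ?(@clamp_le0 _ 0) ?path_zero//; lra.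
  by rewrite max_r//; lra.
- by move=> s; rewrite clampK.
- by rewrite ival0 max_l//; lra.
- by rewrite ival1 max_r//; lra.
Qed.

Lemma path_concat_cstr (x y : T) (p : {path I from x to y}) :
  path_homotopic (path_concat p (path_cst y)) p.
Proof.
apply: (@path_homotopic_reparam _ _ _ _ p
  (fun s => Num.min 1 (2 * ival s + 0)) (@ival R)).
- exact: path_cts.
- apply: minr_continuous; first exact: cst_continuous.
  by apply: affine_continuous; exact: ival_continuous.
- exact: ival_continuous.
- move=> s; rewrite !path_concatE.
  case: (leP (ival s) 2^-1) => s2.
    by rewrite min_r//; lra.
  by rewrite min_l ?(@clamp_ge1 _ 1) ?path_one//; lra.
- by move=> s; rewrite clampK.
- by rewrite ival0 min_r//; lra.
- by rewrite ival1 min_l//; lra.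
Qed.

Lemma path_concat_revl (x y : T) (p : {path I from x to y}) :
  path_homotopic (path_concat (path_rev p) p) (path_cst y).
Proof.
apply: (@path_homotopic_reparam _ _ _ _ p
  (fun s => Num.max (-2 * ival s + 1) (2 * ival s + -1)) (cst 1)).
- exact: path_cts.
- by apply: maxr_continuous;
    apply: affine_continuous; exact: ival_continuous.
- exact: cst_continuous.
- move=> s; have s0 := ival_ge0 s; have s1 := ival_le1 s.
  rewrite !path_concatE.
  case: (leP (ival s) 2^-1) => s2.
    rewrite max_l; last by lra.
    rewrite path_revE.
    rewrite clamp_id; last by apply/andP; split; lra.
    by congr (p (clamp _)); lra.
  by rewrite max_r//; lra.
- by move=> s; rewrite clamp_ge1// path_one.
- by rewrite ival0 max_l /=; lra.
- by rewrite ival1 max_r /=; lra.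
Qed.

Lemma path_concat_revr (x y : T) (p : {path I from x to y}) :
  path_homotopic (path_concat p (path_rev p)) (path_cst x).
Proof.
apply: (@path_homotopic_reparam _ _ _ _ p
  (fun s => Num.min (2 * ival s + 0) (-2 * ival s + 2)) (cst 0)).
- exact: path_cts.
- by apply: minr_continuous;
    apply: affine_continuous; exact: ival_continuous.
- exact: cst_continuous.
- move=> s; have s0 := ival_ge0 s; have s1 := ival_le1 s.
  rewrite !path_concatE.
  case: (leP (ival s) 2^-1) => s2.
    by rewrite min_l//; lra.
  rewrite min_r; last by lra.
  rewrite path_revE.
  rewrite clamp_id; last by apply/andP; split; lra.
  by congr (p (clamp _)); lra.
- by move=> s; rewrite clamp_le0// path_zero.
- by rewrite ival0 min_l /=; lra.
- by rewrite ival1 min_r /=; lra.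
Qed.

End homotopy.

Section fundamental_group.
Context (R : realType) {T : topologicalType} (x : T).
Local Notation I := (unit_itv R).
Local Notation loop := {path I from x to x}.

Definition loop_rel (p q : loop) : bool := `[< path_homotopic p q >].

Lemma loop_rel_refl : reflexive loop_rel.
Proof. by move=> p; apply/asboolP; exact: path_homotopic_refl. Qed.

Lemma loop_rel_sym : symmetric loop_rel.
Proof.
by move=> p q; apply/asboolP/asboolP; exact: path_homotopic_sym.
Qed.

Lemma loop_rel_trans : transitive loop_rel.
Proof.
move=> q p r /asboolP pq /asboolP qr; apply/asboolP.
exact: path_homotopic_trans pq qr.
Qed.

Canonical loop_equiv :=
  EquivRel loop_rel loop_rel_refl loop_rel_sym loop_rel_trans.

(** The fundamental group of [T] at [x]; in a product the left factor is
    traversed first. *)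
Definition pi1 : Type := {eq_quot loop_equiv}.
HB.instance Definition _ := Choice.on pi1.
HB.instance Definition _ := EqQuotient.on pi1.

Lemma pi1P (p q : loop) : \pi_pi1 p = \pi_pi1 q <-> path_homotopic p q.
Proof. by split=> [/eqmodP/asboolP|h]; [|apply/eqmodP/asboolP]. Qed.

Lemma pi1_repr (p : loop) : path_homotopic (repr (\pi_pi1 p)) p.
Proof. by apply/pi1P; rewrite reprK. Qed.

Lemma pi1_surj (a : pi1) : exists p : loop, a = \pi_pi1 p.
Proof. by exists (repr a); rewrite reprK. Qed.

Definition pi1_one : pi1 := \pi_pi1 (path_cst x : loop).
Definition pi1_inv (a : pi1) : pi1 := \pi_pi1 (path_rev (repr a)).
Definition pi1_mul (a b : pi1) : pi1 :=
  \pi_pi1 (path_concat (repr a) (repr b)).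

Lemma pi1_mulE (p q : loop) :
  pi1_mul (\pi_pi1 p) (\pi_pi1 q) = \pi_pi1 (path_concat p q).
Proof. by apply/pi1P; apply: path_concat_homotopic; exact: pi1_repr. Qed.

Lemma pi1_invE (p : loop) : pi1_inv (\pi_pi1 p) = \pi_pi1 (path_rev p).
Proof. by apply/pi1P; apply: path_rev_homotopic; exact: pi1_repr. Qed.

Lemma pi1_mulA : associative pi1_mul.
Proof.
move=> a b c; have [p ->] := pi1_surj a; have [q ->] := pi1_surj b.
have [r ->] := pi1_surj c.
rewrite (pi1_mulE q r) (pi1_mulE p q) (pi1_mulE p) (pi1_mulE _ r).
by apply/pi1P; exact: path_concatA.
Qed.

Lemma pi1_mul1g : left_id pi1_one pi1_mul.
Proof.
move=> a; have [p ->] := pi1_surj a; rewrite (pi1_mulE _ p).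
by apply/pi1P; exact: path_concat_cstl.
Qed.

Lemma pi1_mulg1 : right_id pi1_one pi1_mul.
Proof.
move=> a; have [p ->] := pi1_surj a; rewrite (pi1_mulE p).
by apply/pi1P; exact: path_concat_cstr.
Qed.

Lemma pi1_mulVg : left_inverse pi1_one pi1_inv pi1_mul.
Proof.
move=> a; have [p ->] := pi1_surj a; rewrite (pi1_invE p) (pi1_mulE _ p).
by apply/pi1P; exact: path_concat_revl.
Qed.

Lemma pi1_mulgV : right_inverse pi1_one pi1_inv pi1_mul.
Proof.
move=> a; have [p ->] := pi1_surj a; rewrite (pi1_invE p) (pi1_mulE p).
by apply/pi1P; exact: path_concat_revr.
Qed.

HB.instance Definition _ := isGroup.Build pi1
  pi1_mulA pi1_mul1g pi1_mulg1 pi1_mulVg pi1_mulgV.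

End fundamental_group.

Section induced_homomorphism.
Context (R : realType) {T U : topologicalType} (f : continuousType T U) (x : T).
Local Notation I := (unit_itv R).

Definition path_map (y z : T) (p : {path I from y to z}) :
  {path I from f y to f z} := f \o p.

Lemma path_map_homotopic (y z : T) (p q : {path I from y to z}) :
  path_homotopic p q -> path_homotopic (path_map p) (path_map q).
Proof.
move=> [H [cH Hp Hq Hy Hz]]; exists (f \o H); split=> /=.
- by move=> st; apply: continuous_comp; [exact: cH|exact: cts_fun].
- by move=> s; rewrite Hp.
- by move=> s; rewrite Hq.
- by move=> t; rewrite Hy.
- by move=> t; rewrite Hz.
Qed.

Definition pi1_map (a : pi1 R x) : pi1 R (f x) :=
  \pi_(pi1 R (f x)) (path_map (repr a)).

Lemma pi1_mapE (p : {path I from x to x}) :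
  pi1_map (\pi_(pi1 R x) p) = \pi_(pi1 R (f x)) (path_map p).
Proof. by apply/pi1P; apply: path_map_homotopic; exact: pi1_repr. Qed.

Lemma pi1_map_mul : {morph pi1_map : a b / (a * b)%g >-> (a * b)%g}.
Proof.
move=> a b; have [p ->] := pi1_surj a; have [q ->] := pi1_surj b.
rewrite [(\pi_(pi1 R x) p * _)%g]pi1_mulE !pi1_mapE [RHS]pi1_mulE.
by congr (\pi _); apply/path_eqP => s /=; rewrite !path_concatE; case: ifP.
Qed.

Lemma pi1_map_one : pi1_map 1%g = 1%g.
Proof. by rewrite pi1_mapE; congr (\pi _); exact/path_eqP. Qed.

HB.instance Definition _ :=
  isMultiplicative.Build _ _ pi1_map pi1_map_mul.
HB.instance Definition _ :=
  Multiplicative_isUMagmaMorphism.Build _ _ pi1_map pi1_map_one.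

End induced_homomorphism.

Definition pi1_injective (R : realType) (T U : topologicalType)
    (f : continuousType T U) : Prop :=
  forall x : T, injective (@pi1_map R T U f x).

Section path_connected.
Variable R : realType.
Context {T : topologicalType}.

(** Paths in the subspace [A] are the paths of [T] with image in [A]. *)
Definition path_joined (A : set T) (x y : T) : Prop :=
  exists p : {path unit_itv R from x to y}, range p `<=` A.

Definition path_connected (A : set T) : Prop :=
  forall x y, A x -> A y -> path_joined A x y.

Definition path_component (A : set T) (x : T) : set T :=
  [set y | path_joined A x y].

Definition path_components (A : set T) : set (set T) :=
  [set path_component A x | x in A].

Definition locally_path_connected : Prop :=
  forall (x : T) (U : set T), nbhs x U ->
    exists V, [/\ open V, V x, V `<=` U & path_connected V].

End path_connected.

Definition circle (R : realType) : set (R * R) :=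
  [set z | z.1 ^+ 2 + z.2 ^+ 2 = 1].

Definition disk (R : realType) : set (R * R) :=
  [set z | z.1 ^+ 2 + z.2 ^+ 2 <= 1].

Arguments circle R _ : clear implicits.
Arguments disk R _ : clear implicits.

Lemma circle_sub_disk (R : realType) : circle R `<=` disk R.
Proof. by move=> z; rewrite /disk /circle /= => ->. Qed.

Definition simple_closed_curve (R : realType) (T : topologicalType)
    (C : set T) : Prop :=
  homeomorphic (set_type (circle R)) (set_type C).

Definition metrizable (R : realType) (T : topologicalType) : Prop :=
  exists M : metricType R, homeomorphic T M.

Definition Pc (T : Type) (P : set (set T)) : set T := \bigcup_(C in P) C.

Record disjointly_tree_graded (R : realType) (T : topologicalType)
    (P : set (set T)) : Prop := {
  dtg_path_connected : path_connected R [set: T];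
  dtg_locally_path_connected : locally_path_connected R (T := T);
  dtg_metrizable : metrizable R T;
  dtg_nonempty : forall C, P C -> C !=set0;
  dtg_closed : forall C, P C -> closed C;
  dtg_closed_Pc : closed (Pc P);
  dtg_components : P = path_components R (Pc P);
  dtg_simple_closed_curve :
    forall C, simple_closed_curve R C -> exists2 D, P D & C `<=` D
}.

(** Supremum in the extended reals; [-oo] on the empty set. *)
Definition diam (R : realType) (T : metricType R) (A : set T) : \bar R :=
  ereal_sup [set (mdist z.1 z.2)%:E | z in A `*` A].

Definition path_diameter_metric (R : realType) (T : metricType R) : Prop :=
  forall a b : T,
    (mdist a b)%:E =
    ereal_inf [set diam (range p) | p in [set: {path unit_itv R from a to b}]].

Definition extends_to_disk (R : realType) (T : topologicalType)
    (g : set_type (disk R) -> T) (alpha : set_type (circle R) -> T) : Prop :=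
  continuous g /\ forall z, g (subfun (@circle_sub_disk R) z) = alpha z.

Definition inessential (R : realType) (T : topologicalType)
    (alpha : set_type (circle R) -> T) : Prop :=
  exists g : set_type (disk R) -> T, extends_to_disk g alpha.

Definition uniformly_1_UV0 (R : realType) (A : metricType R) : Prop :=
  forall e : R, 0 < e -> exists delta : R, 0 < delta < e /\
    forall alpha : set_type (circle R) -> A,
      continuous alpha -> inessential alpha ->
      (diam (range alpha) < delta%:E)%E ->
      exists g : set_type (disk R) -> A,
        extends_to_disk g alpha /\ (diam (range g) < e%:E)%E.

Definition maps_pieces_into_pieces (T U : Type) (P : set (set T))
    (Q : set (set U)) (f : T -> U) : Prop :=
  forall C, P C -> exists2 D, Q D & f @` C `<=` D.

Definition distinct_pieces_separated (T U : Type) (P : set (set T))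
    (Q : set (set U)) (f : T -> U) : Prop :=
  forall C C' D, P C -> P C' -> Q D ->
    f @` C `<=` D -> f @` C' `<=` D -> C = C'.

Lemma maps_Pc_into_Pc (T U : Type) (P : set (set T)) (Q : set (set U))
    (f : T -> U) :
  maps_pieces_into_pieces P Q f -> {homo f : x / Pc P x >-> Pc Q x}.
Proof.
move=> PQ x [C PC Cx]; have [D QD CD] := PQ C PC.
by exists D => //; apply: CD; exists x.
Qed.

(* Main.v *)
(** A loop [p] of [X] whose image is null in [Y] is contracted as follows. With
    the retractions onto the pieces, paths are developed into words in the free
    product of copies of the path groups of [Pc Q], one copy for each of finitely
    many pieces. Null loops of [Y] have trivial words; the word of [f \o p] is
    obtained from that of [p] by conjugating the letters of every piece by a
    common element, and different pieces go to different pieces, so that the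
    word of [p] is trivial as well. Take a maximal lamination of the disk by
    chords that join two times at which [p] takes the same value and between
    which its words are trivial. The path that [p] induces on the boundary of a
    complementary region then stays in one piece, since a cut point outside of the
    pieces would give one more chord, and it is null in [Pc P], by injectivity on
    the pieces. The regions are filled by null homotopies that are almost as
    small as possible; by the uniform [UV_0] property these fillings are
    equicontinuous, so that they form a contraction of [p]. Conversely, a
    contraction in [X] of a loop of a piece is retracted onto the piece. *)

From HB Require Import structures.
Require Import Defs.
From mathcomp Require Import all_boot all_order all_algebra generic_quotient.
From mathcomp Require Import all_classical all_reals all_analysis.
From mathcomp Require Import perm homotopy lra.
Set Implicit Arguments.
Unset Strict Implicit.
Unset Printing Implicit Defensive.
Import Order.TTheory GRing.Theory Num.Theory.
Import numFieldNormedType.Exports.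
Local Open Scope classical_set_scope.
Local Open Scope ring_scope.
Local Open Scope quotient_scope.

(** Pieces may accumulate and need not be locally simply connected, and a loop may meet infinitely
    many of them, so van Kampen arguments do not apply. Hence only finitely many pieces are recorded
    at a time: these are disjoint closed sets, a path meets at most one of them near each time, and
    words are finite products. Trivial words do not contract anything by themselves; they decide
    which times a chord may join. That the admissible chords form a closed set is a second use of
    the [UV_0] property: limits of chords require infinite concatenations of homotopies in a piece
    ([chi_assemble]). Letters are classes in [Pc Q], where [p] and [f \o p] can be compared; nothing
    is lost, by injectivity on the pieces ([letter_chi]). The conjugating elements come from
    retracting after [f] instead of before: the two differ by a term that depends on the current
    point ([transfer]), and the accumulated terms depend only on the ends of a path
    ([loop_potential]). Path classes with arbitrary ends live in a single group, a product over all
    base points, so that letters can be multiplied freely. *)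

Section real_line.
Variable R : realType.

(** The supremum of the times reachable from [s] is itself reached, and can be passed unless it is
    [t]. This form of compactness replaces subdivisions by Lebesgue numbers: an identity that is
    additive along a path has to be checked only near each time. *)
Lemma interval_chain (E : R -> R -> Prop) :
  (forall s t u, s <= t -> t <= u -> E s t -> E t u -> E s u) ->
  (forall x, exists2 d, 0 < d &
    forall s t, x - d < s -> s <= t -> t < x + d -> E s t) ->
  forall s t, s <= t -> E s t.
Proof.
move=> Etr Eloc s t st; pose S := [set x | s <= x <= t /\ E s x].
have Ss : S s.
  by have [d d0 Ed] := Eloc s; split; [rewrite lexx|apply: Ed; lra].
have hS : has_sup S by split; [exists s|exists t => x [/andP[]]].
have sS : s <= sup S by exact: sup_upper_bound hS _ Ss.
have St : sup S <= t by apply: ge_sup; [exists s|move=> x [/andP[]]].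
have [d d0 Ed] := Eloc (sup S).
have [x [/andP[sx xt] Esx] xd] := sup_adherent d0 hS.
have xS : x <= sup S.
  by apply: (sup_upper_bound hS); split => //; apply/andP.
pose y := Num.min t (sup S + d / 2).
have [yt ySd] : y <= t /\ y <= sup S + d / 2.
  by rewrite /y !ge_min !lexx orbT.
have xy : x <= y by rewrite /y le_min xt /=; lra.
have Esy : E s y by apply: (Etr s x y) => //; apply: Ed; lra.
have yS : y <= sup S.
  apply: (sup_upper_bound hS); split => //; apply/andP; split => //.
  exact: le_trans xy.
have <- // : y = t.
rewrite /y; apply: min_l; rewrite leNgt; apply/negP => h.
by move: yS; rewrite /y min_r ?(ltW h)//; lra.
Qed.

Lemma nbhs_real (x : R) (A : set R) : nbhs x A <->
  exists2 d, 0 < d & forall t, x - d < t -> t < x + d -> A t.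
Proof.
split=> [/nbhs_ballP[d /= d0 dA]|[d d0 dA]].
  exists d => // t xt tx; apply: dA; rewrite /ball /= ltr_distlC.
  by apply/andP; split; lra.
apply/nbhs_ballP; exists d => // t; rewrite /ball /= ltr_distlC => /andP[? ?].
by apply: dA; lra.
Qed.

Lemma continuous_real_nbhs (T : topologicalType) (p : R -> T) (x : R)
    (U : set T) : continuous p -> nbhs (p x) U ->
  exists2 d, 0 < d & forall t, x - d < t -> t < x + d -> U (p t).
Proof. by move=> cp /(cp x)/nbhs_real. Qed.

Lemma closed_gap (K : set R) (x : R) : closed K -> ~ K x ->
  exists2 d, 0 < d & forall t, x - d < t -> t < x + d -> ~ K t.
Proof.
move=> cK Kx; apply/(nbhs_real x (~` K)).
by apply: open_nbhs_nbhs; split => //; exact: closed_openC.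
Qed.

Lemma first_time (K : set R) (a b : R) : closed K -> a <= b -> K b ->
  exists m, [/\ a <= m <= b, K m & forall x, a <= x -> x < m -> ~ K x].
Proof.
move=> cK ab Kb; have cA : compact (K `&` `[a, b]).
  rewrite setIC; apply: (subclosed_compact _ (@segment_compact _ a b)).
    by apply: closedI; [exact: itv_closed|].
  exact: subIsetl.
have A0 : K `&` `[a, b] !=set0 by exists b; split; rewrite //= in_itv /= ab lexx.
have cid : {within K `&` `[a, b], continuous (@idfun R)}.
  by apply: continuous_subspaceT => x; exact: cvg_id.
have [m] := compact_EVT_min A0 cA cid.
rewrite inE => -[Km]; rewrite /= in_itv /= => mab mmin.
exists m; split=> // x ax xm Kx.
have /mmin : x \in K `&` `[a, b].
  by rewrite inE; split=> //=; rewrite in_itv /= ax; case/andP: mab; lra.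
by rewrite leNgt xm.
Qed.

Lemma last_time (K : set R) (a b : R) : closed K -> a <= b -> K a ->
  exists m, [/\ a <= m <= b, K m & forall x, m < x -> x <= b -> ~ K x].
Proof.
move=> cK ab Ka.
have cN : closed [set x | K (- x)].
  by apply: (@closed_comp _ _ (@GRing.opp R)) => // x _; exact: opp_continuous.
have [||m [/andP[? ?] Km mmin]] := @first_time [set x | K (- x)] (- b) (- a) cN.
- by rewrite lerN2.
- by rewrite /= opprK.
exists (- m); split=> //; first by apply/andP; split; lra.
by move=> x mx xb Kx; apply: (mmin (- x)); rewrite /= ?opprK//; lra.
Qed.

Lemma sandwich_continuous (T : topologicalType) (p : R -> T) :
  (forall x U, nbhs (p x) U ->
    exists2 d, 0 < d & forall t, x - d < t -> t < x + d -> U (p t)) ->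
  continuous p.
Proof. by move=> cp x U /cp; rewrite -nbhs_real. Qed.

End real_line.

(** * Collapsing the gaps of a closed set of times *)

Section gap_collapse.
Context {R : realType}.
Variables (K : set R) (l r : R).
Hypotheses (cK : closed K) (Kl : forall t, t <= l -> K t) (Kr : forall t, r <= t -> K t).

Definition is_gap (a b : R) := [/\ a < b, K a, K b & forall x, a < x -> x < b -> ~ K x].

Lemma last_in_ex t : exists m, [/\ m <= t, K m & forall x, m < x -> x <= t -> ~ K x].
Proof.
have [tl|/ltW lt] := leP t l; first by exists t; split=> //; [exact: Kl|move=> x *; lra].
have [m [/andP[_ mt] Km ml]] := last_time cK lt (Kl (lexx l)).
by exists m.
Qed.

Definition last_in t : R := sval (cid (last_in_ex t)).

Lemma last_in_le t : last_in t <= t.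
Proof. by rewrite /last_in; case: (cid _) => m []. Qed.

Lemma last_in_in t : K (last_in t).
Proof. by rewrite /last_in; case: (cid _) => m []. Qed.

Lemma last_in_after t x : last_in t < x -> x <= t -> ~ K x.
Proof. by rewrite /last_in; case: (cid _) => m [] ? ? h /=; exact: h. Qed.

Lemma last_in_ge a t : K a -> a <= t -> a <= last_in t.
Proof. by move=> Ka at_; rewrite leNgt; apply/negP => /last_in_after/(_ at_). Qed.

Lemma last_in_id t : K t -> last_in t = t.
Proof. by move=> Kt; apply/eqP; rewrite eq_le last_in_le last_in_ge. Qed.

Lemma last_in_mono s t : s <= t -> last_in s <= last_in t.
Proof.
move=> st; apply: last_in_ge; first exact: last_in_in.
exact: le_trans (last_in_le s) st.
Qed.

Lemma last_in_gap t : ~ K t -> exists2 b, t < b & is_gap (last_in t) b.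
Proof.
move=> Kt; have tr : t <= r by rewrite leNgt; apply/negP => /ltW/Kr.
have [b [/andP[tb _] Kb bf]] := first_time cK tr (Kr (lexx r)).
have tb' : t < b by rewrite lt_neqAle tb andbT; apply/eqP => E; apply: Kt; rewrite E.
exists b => //; split=> //; first exact: le_lt_trans (last_in_le t) tb'.
- exact: last_in_in.
- move=> x tx xb; have [xt|/ltW tx'] := leP x t; first exact: last_in_after tx xt.
  exact: bf.
Qed.

(** [last_in] is only discontinuous at the right end of a gap, where it jumps
    between the two ends of that gap. *)
Lemma last_in_near x d : 0 < d -> exists2 e, 0 < e & forall t, x - e < t ->
  t < x + e -> exists b, [/\ K b, last_in x - d < b, b < last_in x + d,
    last_in t <= b & b = last_in t \/ is_gap (last_in t) b /\ t < b].
Proof.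
move=> d0; have [Kx|nKx] := pselect (K x); last first.
  have [e e0 eK] := closed_gap cK nKx.
  exists e => // t xt tx; have <- : last_in t = last_in x.
    have [tx'|/ltW xt'] := leP t x; apply/eqP; rewrite eq_le.
      rewrite last_in_mono//=; apply: last_in_ge; first exact: last_in_in.
      rewrite leNgt; apply/negP => h; apply: (eK (last_in x) _ _ (last_in_in x)).
        lra.
      by have := last_in_le x; lra.
    rewrite andbC last_in_mono//=; apply: last_in_ge; first exact: last_in_in.
    rewrite leNgt; apply/negP => h; apply: (eK (last_in t) _ _ (last_in_in t)).
      lra.
    by have := last_in_le t; lra.
  by exists (last_in t); split; [exact: last_in_in|lra|lra| |left].
rewrite (last_in_id Kx); exists d => // t xt tx; have kt := last_in_le t.
have [h|h] := ltP (x - d) (last_in t).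
  by exists (last_in t); split=> //; [exact: last_in_in|lra|left].
have [tx'|xt'] := leP x t; first by have := last_in_ge Kx tx'; lra.
have [Kt|/last_in_gap[b tb gb]] := pselect (K t).
  by have := last_in_ge Kt (lexx t); lra.
have bx : b <= x.
  by rewrite leNgt; apply/negP => xb; case: gb => _ _ _ /(_ x); apply => //; lra.
by exists b; split; [case: gb|lra|lra|case: gb => /ltW|right].
Qed.

(** The only jumps of [last_in] are across gaps, where [p] does not see them. *)
Lemma last_in_comp_continuous (T : topologicalType) (p : R -> T) :
  continuous p -> (forall a b, is_gap a b -> p a = p b) ->
  continuous (p \o last_in).
Proof.
move=> cp gp; apply: sandwich_continuous => x U /(continuous_real_nbhs cp)[d d0 dU].
have [e e0 eP] := last_in_near x d0; exists e => // t xt tx.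
have [b [_ xb bx _ E]] := eP t xt tx.
have pb : p (last_in t) = p b by case: E => [->//|[/gp]].
by rewrite /= pb; exact: dU.
Qed.

End gap_collapse.

(** Removal of loops from a path: [k t] is the last time before [t] in a
    minimal closed set of times such that the path takes the same value at both
    ends of every gap. *)
Section loop_erasure.
Context {R : realType} {T : topologicalType}.
Hypothesis hT : hausdorff_space T.

Lemma loop_erasure (p : R -> T) : continuous p ->
  exists k : R -> R,
    [/\ forall t, k t <= t,
        forall s t, s <= t -> k s <= k t,
        forall t, ~ (0 < t < 1) -> k t = t,
        continuous (p \o k) &
        forall s t, 0 <= s -> s <= t -> t <= 1 -> p (k s) = p (k t) ->
          forall x, s <= x -> x <= t -> p (k x) = p (k s)].
Proof.
move=> cp.
(* [W] collects the times to be erased: a minimal closed set of remaining times is the complement of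
   a maximal good [W]. *)
pose good (W : set R) := [/\ open W, forall x, W x -> 0 < x < 1 &
  forall a b, a < b -> ~ W a -> ~ W b ->
    (forall x, a < x -> x < b -> W x) -> p a = p b].
have chain (F : set (set R)) : F `<=` good -> total_on F subset ->
    good (\bigcup_(X in F) X).
  move=> FG Ft; split.
  - by apply: bigcup_open => W /FG[].
  - by move=> x [W /FG[_ W01 _]] /W01.
  - move=> a b ab Wa Wb abO; apply: hT => U V Ua Vb.
    have [d1 d10 U1] := continuous_real_nbhs cp Ua.
    have [d2 d20 V2] := continuous_real_nbhs cp Vb.
    (* A component of the union need not be a component of a member of the chain. But
       [[a + d, b - d]] is compact, hence inside a single member, whose component there has its ends
       within [d] of [a] and [b]; so [p a] and [p b] cannot be separated. *)
    pose d := Num.min (Num.min d1 d2) (b - a) / 4.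
    have d0 : 0 < d by rewrite divr_gt0// !lt_min d10 d20 subr_gt0 ab.
    have [dd1 dd2 dab] : [/\ d * 4 <= d1, d * 4 <= d2 & d * 4 <= b - a].
      by rewrite /d mulfVK ?pnatr_eq0// !ge_min !lexx ?orbT.
    have mab : a < (a + b) / 2 < b by apply/andP; split; lra.
    have [W0 FO0 _] : (\bigcup_(X in F) X) ((a + b) / 2).
      by case/andP: mab => ? ?; apply: abO.
    have [W FW Wad] : exists2 W, F W & forall x, a + d <= x -> x <= b - d -> W x.
      pose E s t := exists2 W, F W & forall x, s <= x -> x <= t ->
        a + d <= x -> x <= b - d -> W x.
      have: E (a + d) (b - d); last by move=> [W FW OE]; exists W => // x *; apply: OE.
      apply: interval_chain; last by lra.
      - move=> s t u st tu [W FW EO] [W' FW' EO'].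
        have [sub|sub] := Ft _ _ FW FW'; [exists W'|exists W] => // x sx xu *.
          by have [xt|/ltW tx] := leP x t; [apply/sub/EO|apply: EO'].
        by have [xt|/ltW tx] := leP x t; [apply: EO|apply/sub/EO'].
      - move=> x; have [ax|xa] := leP (a + d) x; last first.
          by exists (a + d - x); [lra|move=> s t ? ? ?; exists W0 => // y; lra].
        have [xb|bx] := leP x (b - d); last first.
          by exists (x - (b - d)); [lra|move=> s t ? ? ?; exists W0 => // y; lra].
        have [W FW Wx] : (\bigcup_(X in F) X) x by apply: abO; lra.
        have [oO _ _] := FG _ FW.
        have /nbhs_real[e e0 eO] : nbhs x W by exact: open_nbhs_nbhs.
        by exists e => // s t ? ? ?; exists W => // y *; apply: eO; lra.
    have [oO W01 gO] := FG _ FW.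
    have cK : closed (~` W) by exact: open_closedC.
    have subO x : W x -> (\bigcup_(X in F) X) x by exists W.
    have [a' [/andP[aa' a'm] Ka' a'l]] : exists m,
        [/\ a <= m <= (a + b) / 2, (~` W) m &
          forall x, m < x -> x <= (a + b) / 2 -> ~ (~` W) x].
      by apply: last_time => //; [lra|move=> /subO].
    have [b' [/andP[mb' b'b] Kb' b'l]] : exists m,
        [/\ (a + b) / 2 <= m <= b, (~` W) m &
          forall x, (a + b) / 2 <= x -> x < m -> ~ (~` W) x].
      by apply: first_time => //; [lra|move=> /subO].
    have a'd : a' < a + d.
      by rewrite ltNge; apply/negP => h; apply: Ka'; apply: Wad => //; lra.
    have b'd : b - d < b'.
      by rewrite ltNge; apply/negP => h; apply: Kb'; apply: Wad => //; lra.
    have pab' : p a' = p b'.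
      apply: gO => //; first by lra.
      move=> x ax xb; apply: contrapT => nOx.
      have [xm|mx] := leP x ((a + b) / 2); first exact: (a'l x).
      by apply: (b'l x) => //; lra.
    by exists (p a'); split; [apply: U1; lra|rewrite pab'; apply: V2; lra].
have [W [[oO W01 gO] Wmax]] := Zorn_bigcup chain.
have cK : closed (~` W) by exact: open_closedC.
have Kl t : t <= 0 -> (~` W) t by move=> t0 /W01; lra.
have Kr t : 1 <= t -> (~` W) t by move=> t1 /W01; lra.
pose k := last_in cK Kl.
have nOk t : ~ W (k t) := last_in_in cK Kl t.
(* An interval between two remaining times of equal value could be added to [W]; by maximality it is
   erased already. *)
have min s t : ~ W s -> ~ W t -> 0 <= s -> s < t -> t <= 1 -> p s = p t ->
    forall x, s < x -> x < t -> W x.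
  move=> nOs nOt s0 st t1 pst.
  pose W' := W `|` [set x | s < x < t].
  apply: contrapT => nst; apply: (Wmax W').
    split; first by move=> x; left.
    by move=> sub; apply: nst => x sx xt; apply: sub; right; apply/andP.
  split.
  - apply: openU => //; rewrite (_ : [set x | _] = `]s, t[%classic).
      exact: interval_open.
    by apply/seteqP; split=> x /=; rewrite in_itv.
  - by move=> x [/W01//|/andP[? ?]]; apply/andP; split; lra.
  - move=> a b ab Wa Wb abO'.
    have [nOa nOb] : ~ W a /\ ~ W b by split => ?; [apply: Wa|apply: Wb]; left.
    have nsta : ~ (s < a < t) by move=> ?; apply: Wa; right.
    have nstb : ~ (s < b < t) by move=> ?; apply: Wb; right.
    have nO's : ~ W' s by move=> [//|/andP[]]; rewrite ltxx.
    have nO't : ~ W' t by move=> [//|/andP[_]]; rewrite ltxx.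
    have [bs|sb] := leP b s.
      by apply: gO => // x ax xb; case: (abO' _ ax xb) => // /andP[? ?]; lra.
    have [ta|at_] := leP t a.
      by apply: gO => // x ax xb; case: (abO' _ ax xb) => // /andP[? ?]; lra.
    have as_ : a <= s.
      by rewrite leNgt; apply/negP => ?; apply: nsta; apply/andP.
    have tb : t <= b.
      by rewrite leNgt; apply/negP => ?; apply: nstb; apply/andP.
    have -> : a = s.
      apply/eqP; rewrite eq_le as_ leNgt; apply/negP => ?.
      by apply: nO's; apply: abO'.
    have -> // : b = t.
    apply/eqP; rewrite eq_le tb andbT leNgt; apply/negP => ?.
    by apply: nO't; apply: abO'.
exists k; split=> //.
- exact: last_in_le.
- by move=> s t st; exact: last_in_mono.
- by move=> t n01; apply: last_in_id => /W01.
- rewrite /k; apply: (@last_in_comp_continuous R _ _ _ cK Kl Kr) => // a b [ab Wa Wb abW]; apply: gO => // x ax xb.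
  by apply: contrapT; exact: abW.
- move=> s t s0 st t1 pst x sx xt.
  have ks0 : 0 <= k s := last_in_ge cK Kl (Kl 0 (lexx 0)) s0.
  have kt1 : k t <= 1 by exact: le_trans (last_in_le _ _ t) t1.
  have kst : k s <= k t by exact: last_in_mono.
  have ksx : k s <= k x by exact: last_in_mono.
  have kxt : k x <= k t by exact: last_in_mono.
  have [e|ne] := eqVneq (k x) (k s); first by rewrite e.
  have [e|ne'] := eqVneq (k x) (k t); first by rewrite e.
  case: (nOk x); apply: (min (k s) (k t)) => //.
  + by rewrite lt_neqAle kst andbT; apply: contra ne => /eqP e;
      rewrite eq_le ksx e kxt.
  + by rewrite lt_neqAle eq_sym ne ksx.
  + by rewrite lt_neqAle ne' kxt.
Qed.

End loop_erasure.

(** * Free products *)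

Section free_product.
Variables (I : choiceType) (H : groupType).
Local Open Scope group_scope.

Definition family_action (Om : Type) (t : I -> H -> Om -> Om) : Prop :=
  (forall i o, t i 1 o = o) /\
  (forall i x y o, t i (x * y) o = t i y (t i x o)).

Definition act_word (Om : Type) (t : I -> H -> Om -> Om) (w : seq (I * H))
    (o : Om) : Om :=
  foldl (fun o l => t l.1 l.2 o) o w.

Lemma act_word_cat (Om : Type) (t : I -> H -> Om -> Om) w w' o :
  act_word t (w ++ w') o = act_word t w' (act_word t w o).
Proof. by rewrite /act_word foldl_cat. Qed.

Definition inv_word (w : seq (I * H)) : seq (I * H) :=
  rev [seq (l.1, l.2^-1) | l <- w].

Lemma act_word_invl (Om : Type) (t : I -> H -> Om -> Om) w o :
  family_action t -> act_word t (inv_word w) (act_word t w o) = o.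
Proof.
move=> [t1 tM]; elim: w o => [|[i h] w IHw] o //=.
rewrite /inv_word /= rev_cons -cats1 act_word_cat IHw /=.
by rewrite -tM mulgV t1.
Qed.

Lemma inv_wordK : involutive inv_word.
Proof.
move=> w; rewrite /inv_word -map_rev revK -map_comp -[RHS]map_id.
by apply: eq_map => -[i h] /=; rewrite invgK.
Qed.

(** Equality in the free product of copies of [H] indexed by [I], tested on
    all sets on which every copy of [H] acts on the right. *)
Definition word_equiv (w w' : seq (I * H)) : bool :=
  `[< forall (Om : Type) (t : I -> H -> Om -> Om), family_action t ->
        forall o, act_word t w o = act_word t w' o >].

Lemma word_equiv_refl : reflexive word_equiv.
Proof. by move=> w; apply/asboolP. Qed.

Lemma word_equiv_sym : symmetric word_equiv.
Proof.
by move=> w w'; apply/asboolP/asboolP => E Om t ta o; rewrite E.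
Qed.

Lemma word_equiv_trans : transitive word_equiv.
Proof.
move=> w' w w'' /asboolP E /asboolP E'; apply/asboolP => Om t ta o.
by rewrite E// E'.
Qed.

Canonical word_equiv_rel :=
  EquivRel word_equiv word_equiv_refl word_equiv_sym word_equiv_trans.

Definition free_product : Type := {eq_quot word_equiv_rel}.
HB.instance Definition _ := Choice.on free_product.
HB.instance Definition _ := EqQuotient.on free_product.

Definition lift_act (Om : Type) (t : I -> H -> Om -> Om) (a : free_product) :=
  act_word t (repr a).

Lemma lift_act_pi (Om : Type) (t : I -> H -> Om -> Om) w o :
  family_action t -> lift_act t (\pi_free_product w) o = act_word t w o.
Proof.
move=> ta; have /eqmodP/asboolP E : \pi_free_product (repr (\pi_free_product w))
  = \pi_free_product w by rewrite reprK.
exact: E.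
Qed.

Lemma eq_free_product (a b : free_product) :
  (forall (Om : Type) (t : I -> H -> Om -> Om), family_action t ->
    forall o, lift_act t a o = lift_act t b o) -> a = b.
Proof.
by move=> E; rewrite -[a]reprK -[b]reprK; apply/eqmodP/asboolP => Om t /E.
Qed.

Definition fp_one : free_product := \pi_free_product [::].
Definition fp_mul (a b : free_product) : free_product :=
  \pi_free_product (repr a ++ repr b).
Definition fp_inv (a : free_product) : free_product :=
  \pi_free_product (inv_word (repr a)).

Lemma lift_act_mul (Om : Type) (t : I -> H -> Om -> Om) a b o :
  family_action t ->
  lift_act t (fp_mul a b) o = lift_act t b (lift_act t a o).
Proof. by move=> ta; rewrite lift_act_pi// act_word_cat. Qed.

Lemma lift_act_one (Om : Type) (t : I -> H -> Om -> Om) o :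
  family_action t -> lift_act t fp_one o = o.
Proof. by move=> ta; rewrite lift_act_pi. Qed.

Lemma fp_mulA : associative fp_mul.
Proof.
by move=> a b c; apply: eq_free_product => Om t ta o; rewrite !lift_act_mul.
Qed.

Lemma fp_mul1g : left_id fp_one fp_mul.
Proof.
move=> a; apply: eq_free_product => Om t ta o.
by rewrite lift_act_mul// lift_act_one.
Qed.

Lemma fp_mulg1 : right_id fp_one fp_mul.
Proof.
move=> a; apply: eq_free_product => Om t ta o.
by rewrite lift_act_mul// lift_act_one.
Qed.

Lemma fp_mulVg : left_inverse fp_one fp_inv fp_mul.
Proof.
move=> a; apply: eq_free_product => Om t ta o.
rewrite lift_act_mul// lift_act_one// /fp_inv lift_act_pi// /lift_act.
by rewrite -{1}[repr a]inv_wordK act_word_invl.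
Qed.

Lemma fp_mulgV : right_inverse fp_one fp_inv fp_mul.
Proof.
move=> a; apply: eq_free_product => Om t ta o.
by rewrite lift_act_mul// lift_act_one// /fp_inv lift_act_pi// act_word_invl.
Qed.

HB.instance Definition _ := isGroup.Build free_product
  fp_mulA fp_mul1g fp_mulg1 fp_mulVg fp_mulgV.

Lemma lift_actM (Om : Type) (t : I -> H -> Om -> Om) (a b : free_product) o :
  family_action t -> lift_act t (a * b) o = lift_act t b (lift_act t a o).
Proof. exact: lift_act_mul. Qed.

Lemma lift_act1 (Om : Type) (t : I -> H -> Om -> Om) o :
  family_action t -> lift_act t (1 : free_product) o = o.
Proof. exact: lift_act_one. Qed.

Definition letter (i : I) (h : H) : free_product := \pi_free_product [:: (i, h)].

Lemma lift_act_letter (Om : Type) (t : I -> H -> Om -> Om) i h o :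
  family_action t -> lift_act t (letter i h) o = t i h o.
Proof. by move=> ta; rewrite lift_act_pi. Qed.

Lemma letterM i h h' : letter i (h * h') = letter i h * letter i h'.
Proof.
apply: eq_free_product => Om t ta o.
by rewrite lift_actM// !lift_act_letter//; case: ta => _ ->.
Qed.

Lemma letter1 i : letter i 1 = 1.
Proof.
apply: eq_free_product => Om t ta o.
by rewrite lift_act1// lift_act_letter//; case: ta => ->.
Qed.

Lemma letterV i h : letter i h^-1 = (letter i h)^-1.
Proof.
by apply: (mulgI (letter i h)); rewrite -letterM !mulgV letter1.
Qed.

Lemma pi_free_product w :
  \pi_free_product w = \big[*%g/1]_(l <- w) letter l.1 l.2.
Proof.
elim: w => [|[i h] w IHw]; first by rewrite big_nil.
rewrite big_cons -IHw; apply: eq_free_product => Om t ta o.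
by rewrite lift_actM// !lift_act_pi.
Qed.

Lemma free_product_ind (Q : free_product -> Prop) :
  Q 1 -> (forall a i h, Q a -> Q (a * letter i h)) -> forall a, Q a.
Proof.
move=> Q1 QM a; rewrite -[a]reprK pi_free_product.
elim/last_ind: (repr a) => [|w [i h] IHw]; first by rewrite big_nil.
by rewrite -cats1 big_cat big_seq1; exact: QM.
Qed.

Section hom.
Variables (G : groupType) (t : I -> H -> G).
Hypothesis tM : forall i, {morph t i : x y / x * y}.

(** The universal property, obtained from the action of words on [G] by right translations. *)
Definition fp_hom (a : free_product) : G :=
  lift_act (fun i h g => g * t i h) a 1.

Let ta : family_action (fun i h (g : G) => g * t i h).
Proof.
split=> [i g|i x y g]; last by rewrite tM mulgA.
by apply: (mulIg (t i 1)); rewrite -mulgA -tM mulg1.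
Qed.

Let fp_homE a g : lift_act (fun i h g => g * t i h) a g = g * fp_hom a.
Proof.
rewrite /fp_hom; elim/free_product_ind: a => [|a i h IHa].
  by rewrite !lift_act1// mulg1.
by rewrite !lift_actM// !lift_act_letter// IHa mulgA.
Qed.

Lemma fp_homM : {morph fp_hom : a b / a * b}.
Proof. by move=> a b; rewrite {1}/fp_hom lift_actM// fp_homE. Qed.

Lemma fp_hom_letter i h : fp_hom (letter i h) = t i h.
Proof. by rewrite /fp_hom lift_act_letter// mul1g. Qed.

Lemma fp_hom1 : fp_hom 1 = 1.
Proof. by rewrite /fp_hom lift_act1. Qed.

Lemma fp_homV a : fp_hom a^-1 = (fp_hom a)^-1.
Proof. by apply: (mulgI (fp_hom a)); rewrite -fp_homM !mulgV fp_hom1. Qed.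

End hom.

(** Retraction onto a free factor; it compares the words of one path for different finite sets of
    pieces ([devX_keep]). *)
Definition keep (J : I -> bool) : free_product -> free_product :=
  fp_hom (fun i h => if J i then letter i h else 1).

Let keep_morph (J : I -> bool) i :
  {morph (fun h => if J i then letter i h else 1) : x y / x * y}.
Proof. by move=> x y; case: ifP => _; rewrite ?letterM// mulg1. Qed.

Lemma keepM J : {morph keep J : a b / a * b}.
Proof. exact: (fp_homM (keep_morph J)). Qed.

Lemma keep1 J : keep J 1 = 1.
Proof. exact: (fp_hom1 (keep_morph J)). Qed.

Lemma keepV J a : keep J a^-1 = (keep J a)^-1.
Proof. exact: (fp_homV (keep_morph J)). Qed.

Lemma keep_letter J i h : keep J (letter i h) = if J i then letter i h else 1.
Proof. exact: (fp_hom_letter (keep_morph J)). Qed.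

Definition project (i : I) : free_product -> H :=
  fp_hom (fun j h => if j == i then h else 1).

Let project_morph (i j : I) :
  {morph (fun h : H => if j == i then h else 1) : x y / x * y}.
Proof. by move=> x y; case: ifP => _; rewrite ?mulg1. Qed.

Lemma letter_inj i : injective (letter i).
Proof.
apply: (@can_inj _ _ _ (project i)) => h.
by rewrite /project (fp_hom_letter (project_morph i)) eqxx.
Qed.

(** A skew product: the second coordinate is updated by an amount that depends on the prefix read so
    far, and the hypotheses are the cocycle identities of this amount. *)
Lemma cocycle_action (B : groupType) (s : I -> H -> free_product -> B) :
  (forall i a, s i 1 a = 1) ->
  (forall i x y a, s i (x * y) a = s i x a * s i y (a * letter i x)) ->
  family_action (fun i h (ab : free_product * B) =>
    (ab.1 * letter i h, ab.2 * s i h ab.1)).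
Proof.
move=> s1 sM; split=> [i [a b]|i x y [a b]] /=.
  by rewrite letter1 s1 !mulg1.
by rewrite letterM sM !mulgA.
Qed.

End free_product.

(** Injectivity of [letter i h |-> u i * letter (phi i) h * (u i)^-1].
    Induction on the word: the letters with the first index [i0] have trivial
    product, and the other letters are rewritten as conjugates, i.e., as a
    shorter word in the kernel of the projection onto the factor [i0], which is
    itself a free product, of copies of the other factors. *)
Section conjugated_factors.
Variable H : groupType.
Local Open Scope group_scope.
Local Notation FP M := (free_product M H).

Definition conj_word (I M : choiceType) (phi : I -> M) (u : I -> FP M)
    (w : seq (I * H)) : FP M :=
  \big[*%g/1]_(l <- w) (u l.1 * letter (phi l.1) l.2 * (u l.1)^-1).

Section unroll.
Variables (M : choiceType) (m0 : M).

(** Reidemeister-Schreier rewriting for the projection onto the factor [m0]. In a state [(x, y)],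
    [y] is the product of the letters of [m0] read so far and [x] collects the other letters; the
    index [(m, y)] stands for the factor [m] conjugated by [y]. *)
Definition unroll_act (m : M) (h : H) (xy : FP (M * H)%type * H) :=
  if m == m0 then (xy.1, xy.2 * h) else (xy.1 * letter (m, xy.2) h, xy.2).

Lemma unroll_actP : family_action unroll_act.
Proof.
split=> [m [x y]|m h h' [x y]]; rewrite /unroll_act /=; case: eqP => //= _.
- by rewrite mulg1.
- by rewrite letter1 mulg1.
- by rewrite mulgA.
- by rewrite letterM mulgA.
Qed.

Definition unroll y (a : FP M) : FP (M * H)%type :=
  (lift_act unroll_act a (1, y)).1.
Definition shift (a : FP M) : H := (lift_act unroll_act a (1, 1)).2.

Let unroll_act_fst m h p : (unroll_act m h p).1 =
  if m == m0 then p.1 else p.1 * letter (m, p.2) h.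
Proof. by rewrite /unroll_act; case: ifP. Qed.

Let unroll_act_snd m h p : (unroll_act m h p).2 =
  if m == m0 then p.2 * h else p.2.
Proof. by rewrite /unroll_act; case: ifP. Qed.

Let lift_unroll_snd a p : (lift_act unroll_act a p).2 = p.2 * shift a.
Proof.
rewrite /shift; elim/free_product_ind: a => [|a i h IHa].
  by rewrite !(lift_act1 _ unroll_actP) mulg1.
rewrite !(lift_actM _ _ _ unroll_actP) !(lift_act_letter _ _ _ unroll_actP).
by rewrite !unroll_act_snd IHa; case: ifP => _ //; rewrite mulgA.
Qed.

Lemma unrollE a x y :
  lift_act unroll_act a (x, y) = (x * unroll y a, y * shift a).
Proof.
rewrite [LHS]surjective_pairing lift_unroll_snd; congr pair.
rewrite /unroll; elim/free_product_ind: a => [|a i h IHa].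
  by rewrite !(lift_act1 _ unroll_actP) mulg1.
rewrite !(lift_actM _ _ _ unroll_actP) !(lift_act_letter _ _ _ unroll_actP).
rewrite !unroll_act_fst IHa !lift_unroll_snd.
by case: ifP => _ //; rewrite mulgA.
Qed.

Lemma shiftM : {morph shift : a b / a * b}.
Proof.
by move=> a b; rewrite {1}/shift (lift_actM _ _ _ unroll_actP) !unrollE/= mul1g.
Qed.

Lemma shift1 : shift 1 = 1.
Proof. by rewrite /shift (lift_act1 _ unroll_actP). Qed.

Lemma shiftV a : shift a^-1 = (shift a)^-1.
Proof. by apply: (mulgI (shift a)); rewrite -shiftM !mulgV shift1. Qed.

Lemma shift_letter m h : shift (letter m h) = if m == m0 then h else 1.
Proof.
rewrite /shift (lift_act_letter _ _ _ unroll_actP) /unroll_act.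
by case: ifP => //= _; rewrite mul1g.
Qed.

Lemma unrollM y a b : unroll y (a * b) = unroll y a * unroll (y * shift a) b.
Proof.
by rewrite {1}/unroll (lift_actM _ _ _ unroll_actP) !unrollE/= mul1g.
Qed.

Lemma unroll1 y : unroll y 1 = 1.
Proof. by rewrite /unroll (lift_act1 _ unroll_actP). Qed.

Lemma unrollV y a : unroll (y * shift a) a^-1 = (unroll y a)^-1.
Proof. by apply: (mulgI (unroll y a)); rewrite -unrollM !mulgV unroll1. Qed.

Lemma unroll_letter y m h :
  unroll y (letter m h) = if m == m0 then 1 else letter (m, y) h.
Proof.
rewrite /unroll (lift_act_letter _ _ _ unroll_actP) /unroll_act.
by case: ifP => //= _; rewrite mul1g.
Qed.

End unroll.

Lemma conj_word_inj n (I M : choiceType) (phi : I -> M) (u : I -> FP M)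
    (w : seq (I * H)) :
  (size w <= n)%N -> injective phi -> conj_word phi u w = 1 ->
  \big[*%g/1]_(l <- w) letter l.1 l.2 = 1 :> FP I.
Proof.
elim: n I M phi u w => [|n IHn] I M phi u w.
  by rewrite leqn0 size_eq0 => /eqP -> _ _; rewrite big_nil.
case: w => [|[i0 h0] w0] sw phiI; first by rewrite big_nil.
set w := (_ :: _) => w1.
pose m0 := phi i0.
pose nu := shift m0 (u i0).
pose Y g := nu * g * nu^-1.
pose A y := unroll m0 y (u i0).
pose fix conv g (w : seq (I * H)) : seq ((I * H) * H) :=
  if w is l :: w' then
    if l.1 == i0 then conv (g * l.2) w' else ((l.1, g), l.2) :: conv g w'
  else [::].
pose gend g (w : seq (I * H)) :=
  g * \big[*%g/1]_(l <- w) (if l.1 == i0 then l.2 else 1).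
pose phi' (ig : I * H) := (phi ig.1, Y ig.2 * shift m0 (u ig.1)).
pose u' (ig : I * H) := (A (Y ig.2))^-1 * unroll m0 (Y ig.2) (u ig.1).
have Yshift g v : Y g * shift m0 (conj_word phi u v) = Y (gend g v).
  elim: v g => [|[i h] v IHv] g.
    by rewrite /conj_word /gend !big_nil shift1 !mulg1.
  rewrite /conj_word /gend !big_cons shiftM mulgA /=.
  rewrite !shiftM shiftV shift_letter (inj_eq phiI).
  have [->|ne] := eqVneq i i0.
    rewrite -/nu -/(conj_word phi u v).
    have -> : Y g * (nu * h * nu^-1) = Y (g * h).
      by rewrite /Y -!mulgA mulKg.
    by rewrite IHv /gend !mulgA.
  by rewrite mulg1 mulgV mulg1 mul1g IHv.
(* A letter [h] of [i0] unrolls to [A (Y g) * (A (Y (g * h)))^-1], so that consecutive ones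
   telescope; the factor with [A] in [u'] makes the other letters fit in between. *)
have D g v : unroll m0 (Y g) (conj_word phi u v) =
    A (Y g) * conj_word phi' u' (conv g v) * (A (Y (gend g v)))^-1.
  elim: v g => [|[i h] v IHv] g.
    by rewrite /conj_word /gend !big_nil unroll1 !mulg1 mulgV.
  rewrite /conj_word /gend !big_cons unrollM -/(conj_word phi u v) /=.
  rewrite !shiftM shiftV shift_letter (inj_eq phiI).
  have [->|ne] := eqVneq i i0.
    rewrite -/nu.
    have E : Y g * (nu * h * nu^-1) = Y (g * h).
      by rewrite /Y -!mulgA mulKg.
    rewrite E IHv !unrollM !shiftM shift_letter unroll_letter eqxx mulg1.
    rewrite -/nu.
    have -> : Y g * (nu * h) = Y (g * h) * shift m0 (u i0).
      by rewrite -E -!mulgA mulVg mulg1.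
    by rewrite unrollV -/(A _) -/(A _) -/(gend _ _) /gend !mulgA mulgVK.
  rewrite mulg1 mulgV mulg1 mul1g IHv !unrollM unroll_letter (inj_eq phiI).
  rewrite (negbTE ne) !shiftM shift_letter (inj_eq phiI) (negbTE ne) mulg1.
  rewrite unrollV -/(gend g v) /conj_word big_cons /= /phi' /u' /=.
  by rewrite invgM invgK !mulgA mulgV mul1g.
have gE : gend 1 w = 1.
  have := Yshift 1 w; rewrite w1 shift1 mulg1 /Y => e.
  by apply: esym; apply: (mulgI nu); apply: (mulIg nu^-1).
have w'1 : conj_word phi' u' (conv 1 w) = 1.
  have := D 1 w; rewrite w1 unroll1 gE => E.
  apply: (mulgI (A (Y 1))); apply: (mulIg (A (Y 1))^-1).
  by rewrite mulg1 mulgV -E.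
have szc g v : (size (conv g v) <= size v)%N.
  elim: v g => [|[i h] v IHv] g //=; case: eqP => _ /=.
    exact: leq_trans (IHv _) (leqnSn _).
  by rewrite ltnS.
(* The first coordinate determines the index, after which the shift of its conjugator cancels and
   conjugation by [nu] can be undone. *)
have phi'I : injective phi'.
  move=> [i g] [j g'] e; have eij : i = j by exact/phiI/(congr1 fst e).
  by case: _ / eij e => /(congr1 snd) /= e; congr pair;
    apply: (mulgI nu); apply: (mulIg nu^-1); exact: mulIg e.
(* The first letter of [w] belongs to [i0], so at least this one is dropped. *)
have /(IHn _ _ phi' u' (conv 1 w)) : (size (conv 1%g w) <= n)%N.
  by rewrite /w /= eqxx mul1g; apply: leq_trans (szc _ _) _.
move=> /(_ phi'I w'1) c1.
(* [K] undoes [conv]: letters labelled by [g] return as conjugates by [letter i0 g]. *)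
pose K : FP (I * H)%type -> FP I := fp_hom (fun ig h =>
  letter i0 ig.2 * letter ig.1 h * (letter i0 ig.2)^-1).
have Km (ig : I * H) : {morph (fun h => letter i0 ig.2 * letter ig.1 h *
    (letter i0 ig.2)^-1 : FP I) : x y / x * y}.
  by move=> x y; rewrite letterM !mulgA mulgVK.
have KE g v : K (\big[*%g/1]_(l <- conv g v) letter l.1 l.2) *
    letter i0 (gend g v) =
    letter i0 g * \big[*%g/1]_(l <- v) letter l.1 l.2.
  elim: v g => [|[i h] v IHv] g.
    by rewrite /gend !big_nil /K (fp_hom1 Km) mul1g !mulg1.
  rewrite /gend !big_cons /=; have [->|ne] := eqVneq i i0.
    by rewrite [in LHS]mulgA -/(gend _ _) IHv letterM mulgA.
  rewrite big_cons /K (fp_homM Km) (fp_hom_letter Km) /= mul1g -mulgA IHv.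
  by rewrite !mulgA mulgVK.
by have := KE 1 w; rewrite c1 gE letter1 mulg1 mul1g /K (fp_hom1 Km).
Qed.

End conjugated_factors.

(** * Arcs and paths *)

Section monotone_factorization.
Context {R : realType} {M : metricType R}.
Implicit Types (q : R -> M) (r s t : R).

(** Telescoping positive weights: partial sums stay below 1, so weighted sums of bounded
    oscillations have a supremum. *)
Let weight (n : nat) : R := n.+1%:R^-1 - n.+2%:R^-1.

Let weight_gt0 n : 0 < weight n.
Proof. by rewrite subr_gt0 ltf_pV2 ?posrE ?ltr0n// ltr_nat. Qed.

Let sum_weight N : \sum_(n < N) weight n <= 1.
Proof.
suff -> : \sum_(n < N) weight n = 1 - N.+1%:R^-1.
  by rewrite gerBl invr_ge0 ler0n.
elim: N => [|N IHN]; first by rewrite big_ord0 invr1 subrr.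
by rewrite big_ord_recr /= IHN /weight addrA subrK.
Qed.

(** The cutoff at 1 bounds the supremum; the extra value 0 makes it 0 as long as [t < r]. *)
Let runs q r t : set R :=
  [set y | y = 0 \/ exists s, [/\ r <= s, s <= t & y = Num.min 1 (mdist (q r) (q s))]].
Let run q r t : R := sup (runs q r t).

Let has_sup_runs q r t : has_sup (runs q r t).
Proof.
split; first by exists 0; left.
by exists 1 => y [->|[s [_ _ ->]]]; rewrite ?ler01// ge_min lexx.
Qed.

Let run_ge0 q r t : 0 <= run q r t.
Proof. by apply: (sup_upper_bound (has_sup_runs q r t)); left. Qed.

Let run_le1 q r t : run q r t <= 1.
Proof.
apply: ge_sup; first by exists 0; left.
by move=> y [->|[s [_ _ ->]]]; rewrite ?ler01// ge_min lexx.
Qed.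

Let run_mono q r s t : s <= t -> run q r s <= run q r t.
Proof.
move=> st; apply: ge_sup; first by exists 0; left.
move=> y ry; apply: (sup_upper_bound (has_sup_runs q r t)).
case: ry => [->|[u [ru us ->]]]; first by left.
by right; exists u; split => //; exact: le_trans st.
Qed.

Let run_le q r s t e : s <= t ->
  (forall u, s <= u -> u <= t -> mdist (q s) (q u) <= e) ->
  run q r t <= run q r s + 2 * e.
Proof.
move=> st qe; have e0 : 0 <= e by rewrite (le_trans _ (qe _ _ st))// mdist_ge0.
apply: ge_sup; first by exists 0; left.
move=> y [->|[u [ru ut ->]]].
  by have := run_ge0 q r s; lra.
have [us|su] := leP u s.
  have : Num.min 1 (mdist (q r) (q u)) <= run q r s.
    by apply: (sup_upper_bound (has_sup_runs q r s)); right; exists u.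
  lra.
have [rs|sr] := leP r s.
  have : Num.min 1 (mdist (q r) (q s)) <= run q r s.
    by apply: (sup_upper_bound (has_sup_runs q r s)); right; exists s.
  have := metric_triangle (q r) (q s) (q u); have := qe u (ltW su) ut.
  by rewrite /Order.min; case: ifP => _; case: ifP => *; lra.
have := metric_triangle (q r) (q s) (q u); have := qe u (ltW su) ut.
rewrite (metric_sym (q r) (q s)); have := qe r (ltW sr) (le_trans ru ut).
by have := run_ge0 q r s; rewrite /Order.min; case: ifP => *; lra.
Qed.

Let rnum (n : nat) : R := if unpickle n is Some x then ratr (x : rat) else 0.

Let psum q N t : R := \sum_(n < N) weight n * run q (rnum n) t.

Let psum_le q N t : psum q N t <= 1.
Proof.
apply: le_trans (sum_weight N); apply: ler_sum => n _.
by rewrite ler_piMr ?run_le1// ltW.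
Qed.

Let total q t : R := sup (range (psum q ^~ t)).

Let has_sup_total q t : has_sup (range (psum q ^~ t)).
Proof.
by split; [exists (psum q 0 t), 0|exists 1 => _ [N _ <-]; exact: psum_le].
Qed.

Let total_le q s t e : s <= t ->
  (forall u, s <= u -> u <= t -> mdist (q s) (q u) <= e) ->
  total q t <= total q s + 2 * e.
Proof.
move=> st qe; have e0 : 0 <= e by rewrite (le_trans _ (qe _ _ st))// mdist_ge0.
apply: ge_sup; first by exists (psum q 0 t), 0.
move=> _ [N _ <-]; apply: (@le_trans _ _ (psum q N s + 2 * e)).
  apply: (@le_trans _ _ (psum q N s + \sum_(n < N) weight n * (2 * e))).
    rewrite -big_split; apply: ler_sum => n _ /=.
    by rewrite -mulrDr ler_wpM2l ?run_le// ltW.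
  rewrite lerD2l -mulr_suml ler_piMl ?sum_weight//; lra.
by rewrite lerD2r (sup_upper_bound (has_sup_total q s))//; exists N.
Qed.

Let total_mono q s t : s <= t -> total q s <= total q t.
Proof.
move=> st; apply: ge_sup; first by exists (psum q 0 s), 0.
move=> _ [N _ <-]; apply: (@le_trans _ _ (psum q N t)).
  by apply: ler_sum => n _; rewrite ler_wpM2l ?run_mono// ltW.
by rewrite (sup_upper_bound (has_sup_total q t))//; exists N.
Qed.

(** All terms increase with time, so a strict gain in one of them is not compensated by the
    others. *)
Let total_eq q s t n : s <= t -> total q s = total q t ->
  run q (rnum n) s = run q (rnum n) t.
Proof.
move=> st tot; apply/eqP; rewrite eq_le run_mono//= leNgt; apply/negP => lt.
pose g := weight n * (run q (rnum n) t - run q (rnum n) s).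
have g0 : 0 < g by rewrite mulr_gt0// subr_gt0.
have [_ [N _ <-] NS] := sup_adherent g0 (has_sup_total q s).
suff : psum q (maxn N n.+1) s + g <= total q t.
  rewrite -tot -/(total q s) in NS *.
  have : psum q N s <= psum q (maxn N n.+1) s.
    rewrite /psum -!(big_mkord xpredT (fun n => weight n * run q (rnum n) s)).
    rewrite [leRHS](big_cat_nat (leq0n N))/= ?leq_maxl// lerDl sumr_ge0// => m _.
    by rewrite mulr_ge0 ?run_ge0// ltW.
  lra.
apply: (@le_trans _ _ (psum q (maxn N n.+1) t)); last first.
  by apply: (sup_upper_bound (has_sup_total q t)); exists (maxn N n.+1).
have nN : (n < maxn N n.+1)%N by rewrite leq_maxr.
pose rest u := \sum_(i < maxn N n.+1 | i != Ordinal nN) weight i * run q (rnum i) u.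
have E u : psum q (maxn N n.+1) u = weight n * run q (rnum n) u + rest u.
  by rewrite /psum (bigD1 (Ordinal nN)).
have rest_le : rest s <= rest t.
  by apply: ler_sum => i _; rewrite ler_wpM2l ?run_mono// ltW.
rewrite !E /g; move: (rest s) (rest t) rest_le => x y; rewrite mulrBr.
by move: (weight n * _) (weight n * _) => z w *; lra.
Qed.

(** [phi] is a weighted sum, over the rational numbers [r], of the oscillation
    of [q] between [r] and [t]. *)
Lemma monotone_factorization q a b : continuous q -> a < b ->
  (exists2 t, a <= t <= b & q t <> q a) ->
  exists (phi : R -> R) (alpha : R -> M),
    [/\ continuous phi /\ continuous alpha, phi a = 0 /\ phi b = 1,
        forall s t, s <= t -> phi s <= phi t,
        forall t, a <= t -> t <= b -> q t = alpha (phi t) &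
        forall s t, s <= t ->
          phi s = phi t <-> (forall x, s <= x -> x <= t -> q x = q s)].
Proof.
move=> cq ab [t0 /andP[at0 t0b] qt0].
have ctot : continuous (total q).
  apply: sandwich_continuous => x U /nbhs_real[e e0 eU].
  have e40 : 0 < e / 8 by lra.
  have : nbhs (q x) (ball (q x) (e / 8)) by exact: nbhsx_ballx.
  move=> /(continuous_real_nbhs cq)[d d0 dq]; exists d => // t xt tx.
  have close s u : x - d < s -> s <= u -> u < x + d -> total q u <= total q s + e / 2.
    move=> xs su ux; have <- : 2 * (e / 4) = e / 2 by lra.
    apply: total_le => // v sv vu.
    have := dq s; have := dq v; rewrite !ballEmdist /= => h1 h2.
    have := metric_triangle (q s) (q x) (q v); rewrite (metric_sym (q s) (q x)).
    have := h1 ltac:(lra) ltac:(lra); have := h2 ltac:(lra) ltac:(lra).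
    lra.
  have [xt'|/ltW tx'] := leP x t.
    have := close x t ltac:(lra) xt' tx; have := total_mono q xt' => h1 h2.
    by apply: eU; lra.
  have := close t x xt tx' ltac:(lra); have := total_mono q tx' => h1 h2.
  by apply: eU; lra.
have tot_eq s t : s <= t ->
    total q s = total q t <-> (forall x, s <= x -> x <= t -> q x = q s).
  move=> st; split=> [tot x sx xt|qc]; last first.
    apply/eqP; rewrite eq_le total_mono//=.
    have := @total_le q s t 0 st; rewrite mulr0 addr0; apply=> u su ut.
    by rewrite qc// mdistxx.
  apply: contrapT => /eqP; rewrite -mdist_gt0 => qx.
  have : nbhs (q s) (ball (q s) (mdist (q x) (q s) / 2)).
    by apply: nbhsx_ballx; lra.
  move=> /(continuous_real_nbhs cq)[d d0 dq].
  have sx' : s < x.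
    by rewrite lt_neqAle sx andbT; apply/eqP => E; move: qx; rewrite E mdistxx ltxx.
  (* If [q x] differs from [q s], then [q] is still close to [q s] at a rational time slightly after
     [s]. The oscillation from this time is 0 at [s] and positive at [t], against [total_eq]. *)
  have oI : open `]s, Num.min x (s + d)[%classic by exact: interval_open.
  have [|z [sr [y _ yz]]] := @dense_rat R `]s, Num.min x (s + d)[%classic _ oI.
    exists (s + Num.min (x - s) d / 2); rewrite /= in_itv /= lt_min.
    have : 0 < Num.min (x - s) d by rewrite lt_min d0 subr_gt0 sx'.
    have : Num.min (x - s) d <= x - s by rewrite ge_min lexx.
    have : Num.min (x - s) d <= d by rewrite ge_min lexx orbT.
    by move=> *; apply/and3P; split; lra.
  move: sr; rewrite -yz /= in_itv /= lt_min => /and3P[sr rx rd].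
  have := @total_eq q s t (pickle y) st tot; rewrite /rnum pickleK.
  have -> : run q (ratr y) s = 0.
    apply/eqP; rewrite eq_le run_ge0 andbT; apply: ge_sup; first by exists 0; left.
    by move=> v [->//|[u [? ? _]]]; lra.
  suff : 0 < run q (ratr y) t by move=> /[swap] <-; rewrite ltxx.
  apply: (@lt_le_trans _ _ (Num.min 1 (mdist (q (ratr y)) (q x)))).
    rewrite lt_min ltr01 /=; have := dq (ratr y); rewrite ballEmdist /= => h.
    have := metric_triangle (q x) (q (ratr y)) (q s).
    rewrite (metric_sym (q x) (q (ratr y))) (metric_sym (q (ratr y)) (q s)).
    by have := h ltac:(lra) ltac:(lra); lra.
  apply: (sup_upper_bound (has_sup_runs q (ratr y) t)); right; exists x.
  by split=> //; exact: ltW.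
pose D := total q b - total q a.
have D0 : 0 < D.
  rewrite subr_gt0 lt_neqAle total_mono ?ltW// andbT; apply/eqP.
  by move=> /(tot_eq _ _ (ltW ab)) /(_ t0 at0 t0b).
pose phi t := (total q t - total q a) / D.
have cphi : continuous phi.
  move=> x; apply: cvgM; last exact: cvg_cst.
  by apply: cvgB; [exact: ctot|exact: cvg_cst].
have phi_eq s t : phi s = phi t <-> total q s = total q t.
  split=> [/(mulIf (invr_neq0 (lt0r_neq0 D0)))/addIr//|E].
  by rewrite /phi E.
have phia : phi a = 0 by rewrite /phi subrr mul0r.
have phib : phi b = 1 by rewrite /phi divff// gt_eqF.
have phim s t : s <= t -> phi s <= phi t.
  by move=> st; rewrite ler_pM2r ?invr_gt0// lerD2r total_mono.
have inv y : exists2 t, a <= t <= b & phi t = Num.max 0 (Num.min y 1).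
  have := @IVT R phi a b (Num.max 0 (Num.min y 1)) (ltW ab).
  rewrite phia phib; move=> [].
  - by apply: continuous_subspaceT.
  - by rewrite (min_l ler01) (max_r ler01) le_max lexx /= ge_max ler01 ge_min lexx orbT.
  - by move=> t; rewrite in_itv /= => ? ?; exists t.
pose tau y := sval (cid2 (inv y)).
have tauP y : a <= tau y <= b /\ phi (tau y) = Num.max 0 (Num.min y 1).
  by rewrite /tau; case: (cid2 _).
have q_eq s t : a <= s -> a <= t -> phi s = phi t -> q s = q t.
  wlog st : s t / s <= t.
    move=> W; have [/W//|/ltW/W h] := leP s t; move=> as_ at_ /esym /h-> //.
  by move=> _ _ /phi_eq/(tot_eq _ _ st)/(_ t st (lexx t)).
exists phi, (q \o tau); split=> //.
(* [phi] is a quotient map by compactness of [[a, b]]: up to clamping, the preimage of a closed set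
   under [alpha] is the image under [phi] of a compact set. *)
- split=> //; apply/continuous_closedP => A cA.
  have -> : (q \o tau) @^-1` A =
      (fun y => Num.max 0 (Num.min y 1)) @^-1` (phi @` ([set t | a <= t <= b] `&` q @^-1` A)).
    apply/seteqP; split=> [y /= Ay|y /= [t [/andP[at_ tb] Aqt] E]].
      by have [tab <-] := tauP y; exists (tau y).
    have [/andP[atau _] Et] := tauP y.
    by rewrite (q_eq (tau y) t)// Et E.
  apply: closed_comp => [y _|].
    apply: (@continuous_max _ _ (cst 0) (fun r : R => Num.min r 1)).
      exact: cvg_cst.
    by apply: (@continuous_min _ _ id (cst 1)); [exact: cvg_id|exact: cvg_cst].
  apply: compact_closed; first exact: Rhausdorff.
  apply: continuous_compact; first exact: continuous_subspaceT.
  apply: (subclosed_compact _ (@segment_compact _ a b)).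
    apply: closedI; last by apply: closed_comp => // y _; exact: cq.
    rewrite (_ : [set t | _] = `[a, b]%classic); first exact: itv_closed.
    by apply/seteqP; split=> t /=; rewrite in_itv.
  by move=> t [/=]; rewrite in_itv.
- move=> t at_ tb /=; have [/andP[atau _] Et] := tauP (phi t).
  apply: q_eq => //; rewrite Et min_l ?max_r//.
    by rewrite -phia phim.
  by rewrite -phib phim.
- by move=> s t st; rewrite phi_eq; exact: tot_eq.
Qed.

End monotone_factorization.

Lemma pair_continuous (V T U : topologicalType) (f : V -> T) (g : V -> U) :
  continuous f -> continuous g -> continuous (fun x => (f x, g x)).
Proof. by move=> cf cg x; exact: (cvg_pair (cf x) (cg x)). Qed.

Lemma comp_continuous (T U V : topologicalType) (f : T -> U) (g : U -> V) :
  continuous f -> continuous g -> continuous (fun x => g (f x)).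
Proof. by move=> cf cg x; exact: (continuous_comp (cf x) (cg (f x))). Qed.

Lemma closed_set_type (T : topologicalType) (A : set T) (B : set A) :
  closed B -> exists2 C : set T, closed C & B = set_val @^-1` C.
Proof.
move=> /closed_openC[U oU UB]; exists (~` U); first exact: open_closedC.
by rewrite -[LHS]setCK; congr (~` _); apply: esym; exact: UB.
Qed.

Section closed_curves.
Context {R : realType} {T : topologicalType}.
Hypothesis hT : hausdorff_space T.

Lemma compact_image_segment (p : R -> T) (a b : R) : continuous p ->
  compact (p @` `[a, b]).
Proof.
move=> cp; apply: continuous_compact; last exact: segment_compact.
exact: continuous_subspaceT.
Qed.

(** The circle is cut at [(-1, 0)] and [(1, 0)], with [al] on the lower half and [be] on the upper
    one, both parametrized by the rescaled first coordinate. The inverse is continuous because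
    images of closed subsets of [[0, 1]] are compact. *)
Lemma simple_closed_curve_arcs (al be : R -> T) :
  continuous al -> continuous be ->
  (forall s t : R, 0 <= s -> s < t -> t <= 1 -> al s <> al t) ->
  (forall s t : R, 0 <= s -> s < t -> t <= 1 -> be s <> be t) ->
  al 0 = be 0 -> al 1 = be 1 ->
  (forall s t : R, 0 < s -> s < 1 -> 0 <= t -> t <= 1 -> al s <> be t) ->
  simple_closed_curve R (al @` `[0, 1] `|` be @` `[0, 1]).
Proof.
move=> cal cbe ial ibe e0 e1 dis; set C := _ `|` _.
have injl (f : R -> T) : (forall s t : R, 0 <= s -> s < t -> t <= 1 -> f s <> f t) ->
    forall s t, 0 <= s -> s <= 1 -> 0 <= t -> t <= 1 -> f s = f t -> s = t.
  move=> fi s t s0 s1 t0 t1 E; apply/eqP; rewrite eq_le !leNgt.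
  by apply/andP; split; apply/negP => /fi; apply.
pose half (z : circle R) := 2^-1 * (set_val z).1 + 2^-1.
have circ (z : circle R) : (set_val z).1 ^+ 2 + (set_val z).2 ^+ 2 = 1 by exact: (set_valP z).
have half01 z : 0 <= half z /\ half z <= 1.
  by have := circ z; rewrite /half => h; split; nra.
pose f (z : circle R) := if (set_val z).2 <= 0 then al (half z) else be (half z).
have cfst : continuous (fun z : circle R => (set_val z).1).
  move=> z; apply: (@continuous_comp _ _ _ set_val fst); first exact: continuous_set_val.
  exact: cvg_fst.
have csnd : continuous (fun z : circle R => (set_val z).2).
  move=> z; apply: (@continuous_comp _ _ _ set_val snd); first exact: continuous_set_val.
  exact: cvg_snd.
have chalf : continuous half by exact: affine_continuous.
have cf : continuous f.
  apply: paste_continuous => //.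
  - by move=> z; apply: continuous_comp; [exact: chalf|exact: cal].
  - by move=> z; apply: continuous_comp; [exact: chalf|exact: cbe].
  - move=> z z0; have := circ z; rewrite z0 expr0n addr0 => /eqP.
    rewrite sqrf_eq1 => /orP[] /eqP E; rewrite /half E.
      by rewrite (_ : _ + _ = 1) ?e1//; lra.
    by rewrite (_ : _ + _ = 0) ?e0//; lra.
have fC z : C (f z).
  have [? ?] := half01 z.
  by rewrite /f; case: ifP => _; [left|right]; exists (half z); rewrite //= in_itv; apply/andP.
have mid (z : circle R) : 0 < (set_val z).2 -> 0 < half z /\ half z < 1.
  by have := circ z; rewrite /half => h z0; split; nra.
have mid' (z z' : circle R) : half z = half z' -> (set_val z).1 = (set_val z').1.
  by rewrite /half => ?; lra.
have finj : injective f.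
  move=> z z' E; apply: val_inj; apply/eqP; rewrite -[val z]/(set_val z) -[val z']/(set_val z').
  have := circ z; have := circ z'.
  have [? ?] := half01 z; have [? ?] := half01 z'.
  rewrite [set_val z]surjective_pairing [set_val z']surjective_pairing.
  move: E; rewrite /f; case: leP => y0; case: leP => y0' E c' c.
  - have xx := mid' _ _ (injl _ ial _ _ _ _ _ _ E); rewrite xx// xpair_eqE eqxx /=.
    apply/eqP; move: c c'; rewrite xx//; nra.
  - exfalso; have [? ?] := mid _ y0'; have [?|?] := leP (half z) 0.
      by apply: (ibe 0 (half z')) => //; rewrite -E -e0; congr al; lra.
    have [?|?] := leP 1 (half z).
      by apply: (ibe (half z') 1) => //; rewrite -E -e1; congr al; lra.
    exact: (dis (half z) (half z')).
  - exfalso; have [? ?] := mid _ y0; have [?|?] := leP (half z') 0.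
      by apply: (ibe 0 (half z)) => //; rewrite E -e0; congr al; lra.
    have [?|?] := leP 1 (half z').
      by apply: (ibe (half z) 1) => //; rewrite E -e1; congr al; lra.
    exact: (dis (half z') (half z)).
  - have xx := mid' _ _ (injl _ ibe _ _ _ _ _ _ E); rewrite xx// xpair_eqE eqxx /=.
    apply/eqP; move: c c'; rewrite xx//; nra.
have sq (s : R) : 0 <= s -> s <= 1 -> 0 <= 1 - (2 * s - 1) ^+ 2 by move=> *; nra.
have pt (e s : R) : e ^+ 2 = 1 -> 0 <= s -> s <= 1 ->
    (2 * s - 1, e * Num.sqrt (1 - (2 * s - 1) ^+ 2)) \in circle R.
  move=> e2 s0 s1; rewrite inE /circle /= exprMn e2 mul1r sqr_sqrtr ?sq//.
  lra.
have hpt (e s : R) (e2 : e ^+ 2 = 1) (s0 : 0 <= s) (s1 : s <= 1) :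
    half (SigSub (pt e s e2 s0 s1)) = s.
  by rewrite /half /=; lra.
have m1 : (-1 : R) ^+ 2 = 1 by rewrite sqrrN expr1n.
have falE (s : R) (s0 : 0 <= s) (s1 : s <= 1) : f (SigSub (pt (-1) s m1 s0 s1)) = al s.
  by rewrite /f /= hpt mulN1r oppr_le0 sqrtr_ge0.
have fbeE (s : R) (s0 : 0 <= s) (s1 : s <= 1) : f (SigSub (pt 1 s (expr1n _ _) s0 s1)) = be s.
  rewrite /f /= hpt mul1r; case: leP => // h.
  have : Num.sqrt (1 - (2 * s - 1) ^+ 2) == 0 by rewrite eq_le h sqrtr_ge0.
  rewrite sqrtr_eq0 => h'.
  have [] : s = 0 \/ s = 1; first by have [|] := leP s (1/2); [left|right]; nra.
    by move=> ->.
  by move=> ->.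
have fsurj (c : C) : exists z, f z = set_val c.
  have [[s]|[s]] := set_valP c; rewrite /= in_itv /= => /andP[s0 s1] E.
    by eexists; rewrite -[RHS]E; exact: (falE s s0 s1).
  by eexists; rewrite -[RHS]E; exact: (fbeE s s0 s1).
pose g c := sval (cid (fsurj c)).
have gK c : f (g c) = set_val c by rewrite /g; case: (cid _).
exists (fun z => SigSub (mem_set (fC z))), g; split.
- exact: continuous_to_set_type.
- apply/continuous_closedP => A /closed_set_type[B cB ->].
  have cpt (e : R) (h : R -> T) : continuous h ->
      closed (h @` (`[0, 1] `&` [set s : R | B (2 * s - 1, e * Num.sqrt (1 - (2 * s - 1) ^+ 2))])).
    move=> ch; apply: compact_closed => //; apply: continuous_compact.
      exact: continuous_subspaceT.
    apply: (subclosed_compact _ (@segment_compact _ 0 1)); last exact: subIsetl.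
    apply: closedI; first by apply: itv_closed.
    apply: closed_comp cB => s _; move: s; apply: pair_continuous.
      by apply: affine_continuous => x; exact: cvg_id.
    have c2 : continuous (fun s : R => 1 - (2 * s - 1) ^+ 2).
      move=> s; apply: cvgB; first exact: cvg_cst.
      apply: (@comp_continuous _ _ _ (fun s : R => (2 * s - 1)) (fun x => x ^+ 2)).
        by apply: affine_continuous => x; exact: cvg_id.
      exact: exprn_continuous.
    move=> s; apply: cvgM; first exact: cvg_cst.
    by apply: (comp_continuous c2) => x; exact: sqrt_continuous.
  have -> : g @^-1` (set_val @^-1` B) = set_val @^-1`
     (al @` (`[0, 1] `&` [set s : R | B (2 * s - 1, -1 * Num.sqrt (1 - (2 * s - 1) ^+ 2))])
      `|` be @` (`[0, 1] `&` [set s : R | B (2 * s - 1, 1 * Num.sqrt (1 - (2 * s - 1) ^+ 2))])).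
    apply/seteqP; split=> c /=.
      move=> Bg; have [h0 h1] := half01 (g c); have cg := circ (g c).
      have x1 : (set_val (g c)).1 = 2 * half (g c) - 1 by rewrite /half; lra.
      have sy : Num.sqrt (1 - (2 * half (g c) - 1) ^+ 2) = `|(set_val (g c)).2|.
        by rewrite -x1 -sqrtr_sqr; congr Num.sqrt; lra.
      have := gK c; rewrite /f; case: leP => y0 E; [left|right]; exists (half (g c)) => //; split.
      - by rewrite /= in_itv /= h0.
      - by rewrite /= sy ler0_norm// mulN1r opprK -x1 -surjective_pairing.
      - by rewrite /= in_itv /= h0.
      - by rewrite /= sy gtr0_norm// mul1r -x1 -surjective_pairing.
    move=> [[s [/=]]|[s [/=]]]; rewrite in_itv /= => /andP[s0 s1] Bs E.
      by move: E; rewrite -(falE s s0 s1) -gK => /finj <-.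
    by move: E; rewrite -(fbeE s s0 s1) -gK => /finj <-.
  apply: closed_comp => [x _|]; first exact: continuous_set_val.
  by apply: closedU; exact: cpt.
- by move=> z; apply: finj; rewrite gK.
- by move=> c; apply: val_inj => /=; exact: gK.
Qed.

End closed_curves.

(** * Retractions onto pieces *)

Section path_joined.
Context {R : realType} {T : topologicalType}.
Implicit Types (A : set T) (x y z : T).

(** From here on paths are maps on all of [R], so that restricting them to intervals and gluing them
    needs no change of type. *)
Lemma path_joinedP A x y : path_joined R A x y <->
  exists p : R -> T, [/\ continuous p, p 0 = x, p 1 = y & forall t, A (p t)].
Proof.
split=> [[p pA]|[p [cp p0 p1 pA]]].
  exists (fun t => p (clamp t)); split.
  - apply: comp_continuous; first exact: clamp_continuous.
    exact: path_cts.
  - by rewrite clamp_le0// path_zero.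
  - by rewrite clamp_ge1// path_one.
  - by move=> t; apply: pA; exists (clamp t).
have cq : continuous (fun s : unit_itv R => p (ival s)).
  by apply: comp_continuous => //; exact: ival_continuous.
have q0 : p (ival (zero : unit_itv R)) = x by rewrite ival0.
have q1 : p (ival (one : unit_itv R)) = y by rewrite ival1.
by exists (mk_path cq q0 q1) => _ [s _ <-]; exact: pA.
Qed.

Lemma path_joined_refl A x : A x -> path_joined R A x x.
Proof. by move=> Ax; apply/path_joinedP; exists (cst x); split=> // t; exact: cvg_cst. Qed.

Lemma path_joined_sym A x y : path_joined R A x y -> path_joined R A y x.
Proof.
move=> /path_joinedP[p [cp p0 p1 pA]]; apply/path_joinedP.
exists (fun t => p (-1 * t + 1)); split=> //.
- apply: comp_continuous cp; apply: affine_continuous => t; exact: cvg_id.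
- by rewrite mulr0 add0r.
- by rewrite mulr1 addrC subrr.
Qed.

Lemma concat_continuous (p q : R -> T) (c : R) : continuous p -> continuous q ->
  p c = q c -> continuous (fun t => if t <= c then p t else q t).
Proof.
move=> cp cq pq; apply: (paste_continuous (u := id)) => //; first by move=> t; exact: cvg_id.
by move=> t ->.
Qed.

Lemma path_joined_trans A x y z :
  path_joined R A x y -> path_joined R A y z -> path_joined R A x z.
Proof.
move=> /path_joinedP[p [cp p0 p1 pA]] /path_joinedP[q [cq q0 q1 qA]].
apply/path_joinedP; exists (fun t => if t <= 2^-1 then p (2 * t + 0) else q (2 * t + -1)).
split.
- have caf a b : continuous (fun t : R => a * t + b).
    by apply: affine_continuous => t; exact: cvg_id.
  apply: (@concat_continuous (fun t => p (2 * t + 0)) (fun t => q (2 * t + -1))).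
  + exact: comp_continuous (caf _ _) cp.
  + exact: comp_continuous (caf _ _) cq.
  + have -> : p (2 * 2^-1 + 0) = y by rewrite -p1; congr p; lra.
    by rewrite -q0; congr q; lra.
- by rewrite ifT ?mulr0 ?addr0//; lra.
- rewrite ifF; last by apply/negbTE; lra.
  by rewrite -q1; congr q; lra.
- by move=> t; case: ifP.
Qed.

Lemma path_joined_between (p : R -> T) A a b : continuous p -> a <= b ->
  (forall t, a <= t -> t <= b -> A (p t)) -> path_joined R A (p a) (p b).
Proof.
move=> cp ab pA; apply/path_joinedP.
exists (fun t => p (a + (b - a) * Num.max 0 (Num.min t 1))); split.
- apply: comp_continuous cp => t; apply: cvgD; first exact: cvg_cst.
  apply: cvgM; first exact: cvg_cst.
  apply: (@continuous_max _ _ (cst 0) (fun r : R => Num.min r 1)); first exact: cvg_cst.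
  by apply: (@continuous_min _ _ id (cst 1)); [exact: cvg_id|exact: cvg_cst].
- by rewrite min_l ?ler01// max_l// mulr0 addr0.
- by rewrite min_l// max_r ?ler01// mulr1 addrC subrK.
- move=> t; have : 0 <= Num.max 0 (Num.min t 1) by rewrite le_max lexx.
  have : Num.max 0 (Num.min t 1) <= 1 by rewrite ge_max ler01 ge_min lexx orbT.
  by move=> *; apply: pA; nra.
Qed.

End path_joined.

Lemma metrizable_hausdorff (R : realType) (T : topologicalType) :
  metrizable R T -> hausdorff_space T.
Proof.
move=> [M [h [g [ch cg hK gK]]]] x y xy; apply: (can_inj hK).
apply: (@metric_hausdorff R M) => U V Uh Vh.
have [z [Uz Vz]] := xy _ _ (ch x U Uh) (ch y V Vh).
by exists (h z).
Qed.

(** After loop erasure, the path takes a value twice only by staying there in between; the monotone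
    factorization then removes the intervals of constancy. *)
Lemma arc_in_path (R : realType) (T : topologicalType) (q : R -> T) :
  metrizable R T -> continuous q -> q 0 <> q 1 ->
  exists al : R -> T, [/\ continuous al, al 0 = q 0, al 1 = q 1,
    forall s t, 0 <= s -> s < t -> t <= 1 -> al s <> al t &
    forall t, 0 <= t -> t <= 1 -> exists2 u, 0 <= u <= 1 & al t = q u].
Proof.
move=> mT cq q01; have hT := metrizable_hausdorff mT.
have [k [kt km kid cqk AL]] := loop_erasure hT cq.
have [M [h [g [ch cg hK gK]]]] := mT.
have k0 : k 0 = 0 by apply: kid; rewrite ltxx.
have k1 : k 1 = 1 by apply: kid; rewrite ltxx andbF.
have cr : continuous (fun t => h (q (k t))) by exact: comp_continuous cqk ch.
have [phi [al [[cphi cal] [p0 p1] pm pE peq]]] : exists (phi : R -> R) (alpha : R -> M),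
    [/\ continuous phi /\ continuous alpha, phi 0 = 0 /\ phi 1 = 1,
        forall s t, s <= t -> phi s <= phi t,
        forall t, 0 <= t -> t <= 1 -> h (q (k t)) = alpha (phi t) &
        forall s t, s <= t -> phi s = phi t <->
          (forall x, s <= x -> x <= t -> h (q (k x)) = h (q (k s)))].
  apply: monotone_factorization => //; exists 1; first by rewrite ler01 lexx.
  by rewrite k0 k1 => /(can_inj hK)/esym.
have inv y : 0 <= y -> y <= 1 -> exists t, [/\ 0 <= t, t <= 1 & phi t = y].
  move=> y0 y1; have := @IVT R phi 0 1 y ler01.
  rewrite p0 p1 (min_l ler01) (max_r ler01) y0 y1 => -[||t].
  - exact: continuous_subspaceT.
  - by [].
  - by rewrite in_itv /= => /andP[? ?] ?; exists t.
exists (fun y => g (al y)); split.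
- exact: comp_continuous cal cg.
- by rewrite -{1}p0 -pE ?ler01// hK k0.
- by rewrite -{1}p1 -pE ?ler01// hK k1.
- move=> y z y0 yz z1; have [s [s0 s1 Es]] := inv y y0 ltac:(lra).
  have [t [t0 t1 Et]] := inv z ltac:(lra) z1.
  rewrite -Es -Et -!pE// !hK => E.
  have st : s <= t by rewrite leNgt; apply/negP => /ltW/pm; lra.
  have /(peq _ _ st) : forall x, s <= x -> x <= t -> h (q (k x)) = h (q (k s)).
    by move=> x sx xt; rewrite (AL s t).
  lra.
- move=> y y0 y1; have [s [s0 s1 Es]] := inv y y0 y1.
  exists (k s); last by rewrite -Es -pE// hK.
  by apply/andP; split; [rewrite -k0 km|exact: le_trans s1].
Qed.

Section tree_graded.
Context {R : realType} {T : topologicalType} (P : set (set T)).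
Hypothesis tg : disjointly_tree_graded R P.
Implicit Types (C D : set T) (x y : T) (p : R -> T) (a b s t : R).

Lemma tree_graded_hausdorff : hausdorff_space T.
Proof. exact: metrizable_hausdorff (dtg_metrizable tg). Qed.

Lemma pieceE C x : P C -> C x -> C = path_component R (Pc P) x.
Proof.
move=> PC Cx; have : path_components R (Pc P) C by rewrite -(dtg_components tg).
move=> [y Py E]; have jyx : path_joined R (Pc P) y x.
  by rewrite -[path_joined _ _ y x]/(path_component R (Pc P) y x) E.
rewrite -E; apply/seteqP; split=> z jz; rewrite /path_component/=.
  exact: path_joined_trans (path_joined_sym jyx) jz.
exact: path_joined_trans jyx jz.
Qed.

Lemma piece_unique C D x : P C -> P D -> C x -> D x -> C = D.
Proof. by move=> PC PD Cx Dx; rewrite (pieceE PC Cx) (pieceE PD Dx). Qed.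

Lemma path_in_piece C p a b : P C -> continuous p -> a <= b ->
  (forall t, a <= t -> t <= b -> Pc P (p t)) -> C (p a) ->
  forall t, a <= t -> t <= b -> C (p t).
Proof.
move=> PC cp ab pP Ca t at_ tb; rewrite (pieceE PC Ca).
by apply: path_joined_between => // u au ut; apply: pP => //; exact: le_trans tb.
Qed.

Lemma piece_path C x y : P C -> C x -> C y ->
  exists p, [/\ continuous p, p 0 = x, p 1 = y & forall t, C (p t)].
Proof.
move=> PC Cx Cy; have : path_component R (Pc P) x y by rewrite -(pieceE PC Cx).
move=> /path_joinedP[p [cp p0 p1 pP]].
exists (fun t => p (Num.max 0 (Num.min t 1))); split.
- apply: comp_continuous cp => t.
  apply: (@continuous_max _ _ (cst 0) (fun r : R => Num.min r 1)); first exact: cvg_cst.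
  by apply: (@continuous_min _ _ id (cst 1)); [exact: cvg_id|exact: cvg_cst].
- by rewrite min_l ?ler01// max_l.
- by rewrite min_l// max_r ?ler01.
- move=> t; apply: (@path_in_piece C p 0 1) => //.
  + by rewrite p0.
  + by rewrite le_max lexx.
  + by rewrite ge_max ler01 ge_min lexx orbT.
Qed.

Lemma arcs_in_piece (al be : R -> T) :
  continuous al -> continuous be ->
  (forall s t, 0 <= s -> s < t -> t <= 1 -> al s <> al t) ->
  (forall s t, 0 <= s -> s < t -> t <= 1 -> be s <> be t) ->
  al 0 = be 0 -> al 1 = be 1 ->
  (forall s t, 0 < s -> s < 1 -> 0 <= t -> t <= 1 -> al s <> be t) ->
  exists2 D, P D & forall t, 0 <= t -> t <= 1 -> D (al t) /\ D (be t).
Proof.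
move=> cal cbe ial ibe e0 e1 dis.
have := simple_closed_curve_arcs tree_graded_hausdorff cal cbe ial ibe e0 e1 dis.
move=> /(dtg_simple_closed_curve tg)[D PD CD]; exists D => // t t0 t1.
by split; apply: CD; [left|right]; exists t; rewrite //= in_itv /= t0.
Qed.

(** Otherwise an arc in [C] and an arc in the excursion form a simple closed curve. It lies in one
    piece, which is [C] because it meets [C]; but the interior of the second arc is off [C]. *)
Lemma excursion C p a b : P C -> continuous p -> a < b -> C (p a) -> C (p b) ->
  (forall t, a < t -> t < b -> ~ C (p t)) -> p a = p b.
Proof.
move=> PC cp ab Ca Cb off; apply: contrapT => pab.
have [q [cq q0 q1 qC]] := piece_path PC Ca Cb.
have [|al [cal al0 al1 ial alq]] := arc_in_path (dtg_metrizable tg) cq.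
  by rewrite q0 q1.
pose p' t := p ((b - a) * t + a).
have p'0 : p' 0 = p a by rewrite /p' mulr0 add0r.
have p'1 : p' 1 = p b by rewrite /p' mulr1 subrK.
have cp' : continuous p'.
  by apply: comp_continuous cp; apply: affine_continuous => t; exact: cvg_id.
have [|be [cbe be0 be1 ibe beq]] := arc_in_path (dtg_metrizable tg) cp'.
  by rewrite p'0 p'1.
have offbe t : 0 < t -> t < 1 -> ~ C (be t).
  move=> t0 t1; have [u /andP[u0 u1] E] := beq t (ltW t0) (ltW t1).
  have nu0 : u <> 0 by move=> u0'; apply: (ibe 0 t) => //; [exact: ltW|rewrite E u0'].
  have nu1 : u <> 1 by move=> u1'; apply: (ibe t 1) => //; [exact: ltW|rewrite E u1'].
  have {}u0 : 0 < u by rewrite lt_neqAle u0 andbT; apply/eqP => /esym.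
  have {}u1 : u < 1 by rewrite lt_neqAle u1 andbT; apply/eqP.
  by rewrite E; apply: off; nra.
have Cal t : 0 <= t -> t <= 1 -> C (al t).
  by move=> t0 t1; have [u _ ->] := alq t t0 t1.
have [||s t s0 s1 t0 t1 E|D PD DC] := arcs_in_piece cal cbe ial ibe.
- by rewrite al0 q0 be0 p'0.
- by rewrite al1 q1 be1 p'1.
- have : C (be t) by rewrite -E; apply: Cal; exact: ltW.
  have [t0'|t0'] := leP t 0.
    move=> _; apply: (ial 0 s) => //; first exact: ltW.
    by rewrite E al0 q0 -p'0 -be0; congr be; lra.
  have [t1'|t1'] := leP 1 t; last exact: offbe.
  move=> _; apply: (ial s 1) => //; first exact: ltW.
  by rewrite E al1 q1 -p'1 -be1; congr be; lra.
have DE : D = C.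
  have [Da _] := DC 0 (lexx 0) ler01; apply: (piece_unique PD PC Da).
  by rewrite al0 q0.
have [_] := DC (1 / 2) ltac:(lra) ltac:(lra); rewrite DE.
by apply: offbe; lra.
Qed.

Section retraction.
Variables (C : set T) (PC : P C).

(** The initial point of such a path is the gate of [x] in [C], which will be the value of the
    retraction; it is the same for all such paths ([entry_unique]). *)
Definition entry x (n : R -> T) : Prop :=
  [/\ continuous n, C (n 0), n 1 = x, C x -> forall t, n t = x &
      ~ C x -> forall t, 0 < t -> t <= 1 -> ~ C (n t)].

Lemma entry_ex x : exists n, entry x n.
Proof.
have [Cx|nCx] := pselect (C x).
  by exists (cst x); split=> // t; exact: cvg_cst.
have [c Cc] := dtg_nonempty tg PC.
have /path_joinedP[q [cq q0 q1 _]] := dtg_path_connected tg (I : setT c) (I : setT x).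
have cK : closed (q @^-1` C).
  by apply: closed_comp (dtg_closed tg PC) => t _; exact: cq.
have [|m [/andP[m0 m1] Cm mmax]] := @last_time _ _ 0 1 cK ler01.
  by rewrite /= q0.
exists (fun t => q ((1 - m) * t + m)); split=> //.
- by apply: comp_continuous cq; apply: affine_continuous => t; exact: cvg_id.
- by rewrite mulr0 add0r.
- by rewrite mulr1 subrK.
- move=> _ t t0 t1; apply: mmax; last by nra.
  have : m < 1 by rewrite lt_neqAle m1 andbT; apply/eqP => E; apply: nCx; rewrite -q1 -E.
  by move=> ?; nra.
Qed.

Definition entry_path x : R -> T := sval (cid (entry_ex x)).
Definition ret x : T := entry_path x 0.

Lemma entry_pathP x : entry x (entry_path x).
Proof. by rewrite /entry_path; case: (cid _). Qed.

Lemma ret_in x : C (ret x).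
Proof. by have [] := entry_pathP x. Qed.

Lemma ret_id x : C x -> ret x = x.
Proof. by move=> Cx; have [_ _ _ /(_ Cx) E _] := entry_pathP x; exact: E. Qed.

(** Two such paths, run back to back, form an excursion from [C]. *)
Lemma entry_unique x n : entry x n -> n 0 = ret x.
Proof.
move=> [cn n0 n1 nx noff]; have [Cx|nCx] := pselect (C x).
  by rewrite ret_id// nx.
rewrite /ret; have [cm m0 m1 mx moff] := entry_pathP x.
pose p t := if t <= 1 then n (1 * t + 0) else entry_path x (-1 * t + 2).
have caf c d : continuous (fun t : R => c * t + d).
  by apply: affine_continuous => t; exact: cvg_id.
have cp : continuous p.
  apply: concat_continuous; [exact: comp_continuous cn|exact: comp_continuous cm|].
  rewrite mulr1 addr0 n1 -{1}m1; congr (entry_path x _); lra.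
have p0 : p 0 = n 0 by rewrite /p ler01 mulr0 addr0.
have p2 : p 2 = entry_path x 0.
  rewrite /p ifF; last by apply/negbTE; lra.
  by congr (entry_path x _); lra.
rewrite -p0 -p2; apply: (excursion PC cp); rewrite ?p0 ?p2//.
move=> t t0 t2; rewrite /p; case: leP => t1.
  by apply: noff => //; lra.
by apply: moff => //; lra.
Qed.

Lemma ret_path p a b : continuous p -> a <= b ->
  (forall t, a < t -> t <= b -> ~ C (p t)) -> ret (p a) = ret (p b).
Proof.
move=> cp ab off; have [->//|ne] := eqVneq a b.
have ab' : a < b by rewrite lt_neqAle ne.
have nCb : ~ C (p b) by exact: off.
have [cn n0 n1 nx noff] := entry_pathP (p a).
have caf c d : continuous (fun t : R => c * t + d).
  by apply: affine_continuous => t; exact: cvg_id.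
pose n t := if t <= 2^-1 then entry_path (p a) (2 * t + 0) else p ((2 * (b - a)) * t + (2 * a - b)).
have <- : n 0 = ret (p a) by rewrite /n ifT ?mulr0 ?addr0//; lra.
have [Ca|nCa] := pselect (C (p a)).
  have -> : n 0 = p a by rewrite /n ifT ?nx//; lra.
  pose n' t := p ((b - a) * t + a).
  have <- : n' 0 = p a by rewrite /n' mulr0 add0r.
  apply: entry_unique; split=> //.
  - exact: comp_continuous cp.
  - by rewrite /n' mulr0 add0r.
  - by rewrite /n' mulr1 subrK.
  - by move=> _ t t0 t1; apply: off; nra.
apply: entry_unique; split=> //.
- apply: concat_continuous; [exact: comp_continuous cn|exact: comp_continuous cp|].
  have -> : entry_path (p a) (2 * 2^-1 + 0) = p a.
    by rewrite -[RHS]n1; congr (entry_path (p a) _); lra.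
  by congr p; lra.
- by rewrite /n ifT ?mulr0 ?addr0//; lra.
- by rewrite /n ifF; [congr p; lra|apply/negbTE; lra].
- move=> _ t t0 t1; rewrite /n; case: leP => t2; first by apply: noff => //; lra.
  by apply: off; nra.
Qed.

Lemma ret_entry_path x t : 0 <= t -> t <= 1 -> ret (entry_path x t) = ret x.
Proof.
move=> t0 t1; have [cn n0 n1 nx noff] := entry_pathP x.
have [Cx|nCx] := pselect (C x); first by rewrite nx.
have E s : 0 <= s -> s <= 1 -> ret (entry_path x 0) = ret (entry_path x s).
  by move=> s0 s1; apply: ret_path => // u u0 us; apply: noff => //; lra.
by rewrite -(E t t0 t1) (E 1 ler01 (lexx 1)) n1.
Qed.

(** Off [C] the retraction is locally constant, by [ret_path] in a path connected neighborhood. Near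
    a point of [C], the value at [y] is the last point of [C] on a short path to [y], hence in the
    same neighborhood. *)
Lemma ret_continuous : continuous ret.
Proof.
move=> x U Ux; have [Cx|nCx] := pselect (C x); last first.
  have : nbhs x (~` C).
    apply: open_nbhs_nbhs; split; last exact: nCx.
    by apply: closed_openC; exact: (dtg_closed tg PC).
  move=> /(dtg_locally_path_connected tg)[V [oV Vx VC pV]].
  apply: (filterS _ (open_nbhs_nbhs (conj oV Vx))) => y Vy.
  rewrite /= -(_ : ret x = ret y); first exact: nbhs_singleton.
  have /path_joinedP[p [cp <- <- pVt]] := pV _ _ Vx Vy.
  by apply: ret_path => // t _ _; apply: VC.
move: Ux; rewrite ret_id// => /(dtg_locally_path_connected tg)[V [oV Vx VU pV]].
apply: (filterS _ (open_nbhs_nbhs (conj oV Vx))) => y Vy; apply: VU.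
have /path_joinedP[p [cp p0 p1 pVt]] := pV _ _ Vx Vy.
have cK : closed (p @^-1` C).
  by apply: closed_comp (dtg_closed tg PC) => t _; exact: cp.
have [|m [/andP[m0 m1] Cm mmax]] := @last_time _ _ 0 1 cK ler01.
  by rewrite /= p0.
by rewrite -p1 -(@ret_path p m 1)// ret_id.
Qed.

End retraction.

(** The point [x] is taken on an arc from [a] to [b], outside the pieces: a path
    from [a] to [b] that avoids [x] would create a simple closed curve through
    [x]. *)
Lemma cut_point (a b : T) : a <> b -> (forall C, P C -> C a -> C b -> False) ->
  exists (x : T) (V W : set T), [/\ ~ Pc P x, open V /\ open W, V a /\ W b,
    (forall y, (V y -> W y -> False) /\ (V y \/ W y <-> y <> x)) &
    forall C, P C -> C `<=` V \/ C `<=` W].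
Proof.
move=> ab nC; have mT := dtg_metrizable tg.
have /path_joinedP[q [cq q0 q1 _]] := dtg_path_connected tg (I : setT a) (I : setT b).
have [|al [cal al0 al1 ial _]] := arc_in_path mT cq; first by rewrite q0 q1.
rewrite q0 in al0; rewrite q1 in al1.
(* If the pieces covered the open arc, a single one would contain it, and also its ends by
   closedness; but no piece contains both [a] and [b]. *)
have [t0 /andP[t00 t01] nPt] : exists2 t, 0 < t < 1 & ~ Pc P (al t).
  apply: contrapT => alP.
  have {}alP t : 0 < t -> t < 1 -> Pc P (al t).
    by move=> *; apply: contrapT => nP; apply: alP; exists t => //; apply/andP.
  have [C PC Ch] := alP (1 / 2) ltac:(lra) ltac:(lra).
  have cK : closed (al @^-1` C).
    by apply: closed_comp (dtg_closed tg PC) => t _; exact: cal.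
  have Cm t : 0 < t -> t < 1 -> C (al t).
    move=> t0 t1; have [h|/ltW h] := leP (1 / 2) t.
      by apply: (@path_in_piece C al (1 / 2) t) => // u u0 u1; apply: alP; lra.
    pose al' u := al (-1 * u + 0).
    have E u : al' (- u) = al u by rewrite /al' mulrNN mul1r addr0.
    rewrite -E; apply: (@path_in_piece C al' (- (1 / 2)) (- t)) => //.
    - by apply: comp_continuous cal; apply: affine_continuous => u; exact: cvg_id.
    - by lra.
    - by move=> u u0 u1; apply: alP; lra.
    - by rewrite E.
    - by lra.
  apply: (nC C PC).
    rewrite -al0; apply: contrapT => /(closed_gap cK)[d d0 dK].
    pose u := Num.min (1 / 2) (d / 2).
    have [u0 u1 ud] : [/\ 0 < u, u <= 1 / 2 & u <= d / 2].
      rewrite /u lt_min !ge_min !lexx orbT; split=> //; apply/andP; split; lra.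
    by apply: (dK u); [lra|lra|apply: Cm; lra].
  rewrite -al1; apply: contrapT => /(closed_gap cK)[d d0 dK].
  pose u := Num.min (1 / 2) (d / 2).
  have [u0 u1 ud] : [/\ 0 < u, u <= 1 / 2 & u <= d / 2].
    rewrite /u lt_min !ge_min !lexx orbT; split=> //; apply/andP; split; lra.
  by apply: (dK (1 - u)); [lra|lra|apply: Cm; lra].
pose x := al t0.
have xa : a <> x by rewrite -al0; apply: ial => //; exact: ltW.
have xb : b <> x by rewrite -al1 => /esym; apply: ial => //; exact: ltW.
have hit : ~ path_joined R (~` [set x]) a b.
  move=> /path_joinedP[ga [cga ga0 ga1 gax]].
  have cK : closed (al @^-1` (ga @` `[0, 1])).
    apply: closed_comp => [t _|]; first exact: cal.
    by apply: compact_closed; [exact: tree_graded_hausdorff|exact: compact_image_segment].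
  (* Between the last time before [t0] and the first time after [t0] at which [al] is on [ga], the
     two meet only at the ends. This subarc and an arc in [ga] put [x] on a simple closed curve,
     hence in a piece. *)
  have [|u [/andP[u0 ut] [s1 /= s1i E1] umax]] := last_time cK (ltW t00).
    by exists 0; rewrite /= ?in_itv /= ?lexx ?ler01// al0.
  have [|v [/andP[tv v1] [s2 /= s2i E2] vmin]] := first_time cK (ltW t01).
    by exists 1; rewrite /= ?in_itv /= ?lexx ?ler01// al1.
  have ut' : u < t0.
    by rewrite lt_neqAle ut andbT; apply/eqP => E; apply: (gax s1); rewrite /= E1 E.
  have tv' : t0 < v.
    by rewrite lt_neqAle tv andbT; apply/eqP => E; apply: (gax s2); rewrite /= E2 -E.
  move: s1i s2i; rewrite !in_itv /= => /andP[s10 s11] /andP[s20 s21].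
  pose ga' t := ga ((s2 - s1) * t + s1).
  have caf c d : continuous (fun t : R => c * t + d).
    by apply: affine_continuous => t; exact: cvg_id.
  have cga' : continuous ga' by exact: comp_continuous cga.
  have ga'0 : ga' 0 = al u by rewrite /ga' mulr0 add0r.
  have ga'1 : ga' 1 = al v by rewrite /ga' mulr1 subrK.
  have [|be [cbe be0 be1 ibe beg]] := arc_in_path mT cga'.
    by rewrite ga'0 ga'1; apply: ial => //; lra.
  pose al' t := al ((v - u) * t + u).
  have cal' : continuous al' by exact: comp_continuous cal.
  have ial' s t : 0 <= s -> s < t -> t <= 1 -> al' s <> al' t.
    by move=> s0 st t1; apply: ial; nra.
  have [||s t sp sl t0' t1' E|D PD DC] := arcs_in_piece cal' cbe ial' ibe.
  - by rewrite be0 ga'0 /al' mulr0 add0r.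
  - by rewrite be1 ga'1 /al' mulr1 subrK.
  - pose w := (v - u) * s + u.
    have [w0 w1] : u < w /\ w < v by rewrite /w; split; nra.
    have Kw : (al @^-1` (ga @` `[0, 1])) w.
      rewrite /= -/(al' s) E; have [z /andP[z0 z1] ->] := beg t t0' t1'.
      by exists ((s2 - s1) * z + s1) => //=; rewrite in_itv /=; apply/andP; split; nra.
    by have [wt|/ltW tw] := leP w t0; [exact: (umax w)|exact: (vmin w)].
  apply: nPt; exists D => //.
  have vu : 0 < v - u by lra.
  have [||Dx _] := DC ((t0 - u) / (v - u)).
  - by rewrite divr_ge0//; lra.
  - by rewrite ler_pdivrMr//; lra.
  suff E : (v - u) * ((t0 - u) / (v - u)) + u = t0 by rewrite -/(al' _) /al' E in Dx.
  by rewrite mulrC divfK ?subrK// gt_eqF.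
(* Both sides are open by local path connectedness; pieces are path connected and miss [x], so none
   of them is split. *)
pose V := [set y | path_joined R (~` [set x]) a y].
pose W := [set y | y <> x /\ ~ V y].
have nbx y : y <> x -> exists N, [/\ open N, N y & path_connected R N /\ N `<=` ~` [set x]].
  move=> yx; have : nbhs y (~` [set x]).
    apply: open_nbhs_nbhs; split=> //; apply: closed_openC.
    apply: accessible_closed_set1; exact/hausdorff_accessible/tree_graded_hausdorff.
  by move=> /(dtg_locally_path_connected tg)[N [oN Ny NC pN]]; exists N.
have Vx y : V y -> y <> x.
  by move=> /path_joinedP[p [_ _ <- px]]; exact: px.
have join (N : set T) y z : path_connected R N -> N `<=` ~` [set x] -> N y -> N z -> V y -> V z.
  move=> pN Nx Ny Nz Vy; apply: (path_joined_trans Vy).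
  have /path_joinedP[p [cp p0 p1 pN']] := pN _ _ Ny Nz.
  by apply/path_joinedP; exists p; split=> // t; apply/Nx.
exists x, V, W; split=> //.
- split; rewrite openE => y.
    move=> Vy; have [N [oN Ny [pN Nx]]] := nbx y (Vx _ Vy).
    apply: (filterS _ (open_nbhs_nbhs (conj oN Ny))) => z Nz; exact: (join N y).
  move=> [yx nVy]; have [N [oN Ny [pN Nx]]] := nbx y yx.
  apply: (filterS _ (open_nbhs_nbhs (conj oN Ny))) => z Nz; split; first exact: Nx.
  by move=> Vz; apply: nVy; exact: (join N z).
- split; first exact: path_joined_refl.
  by split.
- move=> y; split; first by move=> Vy [].
  split; first by move=> [/Vx|[]].
  by move=> yx; have [?|?] := pselect (V y); [left|right].
- move=> C PC; have Cx : C `<=` ~` [set x] by move=> y Cy E; apply: nPt; exists C => //; rewrite -/x -E.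
  have [[y [Cy Vy]]|nCV] := pselect (exists y, C y /\ V y); [left|right] => z Cz.
    apply: (join C y) => // u v Cu Cv; apply/path_joinedP.
    exact: piece_path.
  by split; [exact: Cx|move=> Vz; apply: nCV; exists z].
Qed.

End tree_graded.

(** * Homotopy classes of paths *)

Section group_product.
Variables (B : Type) (G : B -> groupType).
Local Open Scope group_scope.

Definition group_product : Type := forall b, G b.

HB.instance Definition _ := gen_eqMixin group_product.
HB.instance Definition _ := gen_choiceMixin group_product.

Definition gprod_one : group_product := fun b => 1.
Definition gprod_inv (x : group_product) : group_product := fun b => (x b)^-1.
Definition gprod_mul (x y : group_product) : group_product := fun b => x b * y b.

Lemma gprod_mulA : associative gprod_mul.
Proof. by move=> x y z; apply: functional_extensionality_dep => b; exact: mulgA. Qed.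

Lemma gprod_mul1g : left_id gprod_one gprod_mul.
Proof. by move=> x; apply: functional_extensionality_dep => b; exact: mul1g. Qed.

Lemma gprod_mulg1 : right_id gprod_one gprod_mul.
Proof. by move=> x; apply: functional_extensionality_dep => b; exact: mulg1. Qed.

Lemma gprod_mulVg : left_inverse gprod_one gprod_inv gprod_mul.
Proof. by move=> x; apply: functional_extensionality_dep => b; exact: mulVg. Qed.

Lemma gprod_mulgV : right_inverse gprod_one gprod_inv gprod_mul.
Proof. by move=> x; apply: functional_extensionality_dep => b; exact: mulgV. Qed.

HB.instance Definition _ := isGroup.Build group_product
  gprod_mulA gprod_mul1g gprod_mulg1 gprod_mulVg gprod_mulgV.

End group_product.

Section path_classes.
Context {R : realType} {T : topologicalType}.
Local Notation I := (unit_itv R).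
Local Open Scope group_scope.

Lemma path_concat_homl (x y z : T) (p p' : {path I from x to y}) (q : {path I from y to z}) :
  path_homotopic p p' -> path_homotopic (path_concat p q) (path_concat p' q).
Proof. by move=> h; apply: path_concat_homotopic => //; exact: path_homotopic_refl. Qed.

Lemma path_concat_homr (x y z : T) (p : {path I from x to y}) (q q' : {path I from y to z}) :
  path_homotopic q q' -> path_homotopic (path_concat p q) (path_concat p q').
Proof. by move=> h; apply: path_concat_homotopic => //; exact: path_homotopic_refl. Qed.

Lemma path_concatVK (x y z : T) (j : {path I from x to y}) (q : {path I from y to z}) :
  path_homotopic (path_concat (path_rev j) (path_concat j q)) q.
Proof.
apply: path_homotopic_trans (path_concatA _ _ _) _.
apply: path_homotopic_trans (path_concat_homl _ (path_concat_revl _)) _.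
exact: path_concat_cstl.
Qed.

Lemma path_concat_rev (x y z : T) (j : {path I from z to y}) (q : {path I from x to y}) :
  path_homotopic (path_concat (path_concat q (path_rev j)) j) q.
Proof.
apply: path_homotopic_trans (path_homotopic_sym (path_concatA _ _ _)) _.
apply: path_homotopic_trans (path_concat_homr _ (path_concat_revl _)) _.
exact: path_concat_cstr.
Qed.

Definition joining (b x : T) (j : path_joined R setT b x) : {path I from b to x} :=
  sval (cid j).

(** The connecting paths depend only on [b] and on the ends of [g], so that they cancel in
    concatenations. The value is 1 at base points from which [g] cannot be reached. *)
Definition class_at (g : I -> T) (b : T) : pi1 R b :=
  match pselect (continuous g), pselect (path_joined R setT b (g zero)),
        pselect (path_joined R setT b (g one)) with
  | left cg, left j, left j' =>
    \pi_(pi1 R b) (path_concat (joining j)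
      (path_concat (mk_path cg erefl erefl) (path_rev (joining j'))))
  | _, _, _ => 1
  end.

Lemma class_atE (g : I -> T) (b x y : T) (cg : continuous g) (g0 : g zero = x)
    (g1 : g one = y) (j : path_joined R setT b x) (j' : path_joined R setT b y) :
  class_at g b = \pi_(pi1 R b) (path_concat (joining j)
      (path_concat (mk_path cg g0 g1) (path_rev (joining j')))).
Proof.
move: j j'; case: x / g0; case: y / g1 => j j'.
rewrite /class_at; case: pselect => [cg'|//]; case: pselect => [i|//].
case: pselect => [i'|//].
by rewrite (Prop_irrelevance cg' cg) (Prop_irrelevance i j) (Prop_irrelevance i' j').
Qed.

Lemma class_at_unjoined (g : I -> T) (b : T) :
  ~ path_joined R setT b (g zero) -> class_at g b = 1.
Proof.
by move=> nj; rewrite /class_at; case: pselect => // ?; case: pselect.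
Qed.

(** A functor from the fundamental groupoid to one group, faithful on paths with common ends
    ([loop_class_inj]). *)
Definition loop_class (g : I -> T) : group_product (fun b : T => pi1 R b) :=
  class_at g.

Definition square_homotopic (g g' : I -> T) : Prop :=
  exists H : I * I -> T, [/\ continuous H, forall s, H (s, zero) = g s,
    forall s, H (s, one) = g' s, forall t, H (zero, t) = g zero &
    forall t, H (one, t) = g one].

Lemma path_joined_ends (g : I -> T) : continuous g ->
  path_joined R setT (g zero) (g one).
Proof. by move=> cg; exists (mk_path cg erefl erefl). Qed.

Lemma loop_class_homotopic (g g' : I -> T) : continuous g -> continuous g' ->
  square_homotopic g g' -> loop_class g = loop_class g'.
Proof.
move=> cg cg' [H [cH Hg Hg' H0 H1]].
have e0 : g' zero = g zero by rewrite -Hg' H0.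
have e1 : g' one = g one by rewrite -Hg' H1.
apply: functional_extensionality_dep => b; rewrite /loop_class.
have [j|nj] := pselect (path_joined R setT b (g zero)); last first.
  by rewrite !class_at_unjoined ?e0.
have j' := path_joined_trans j (path_joined_ends cg).
rewrite (class_atE cg erefl erefl j j') (class_atE cg' e0 e1 j j').
apply/pi1P/path_concat_homr/path_concat_homl.
by exists H; split.
Qed.

(** The component at the base point [g zero] suffices: its connecting paths are cancelled on both
    sides. *)
Lemma loop_class_inj (g g' : I -> T) : continuous g -> continuous g' ->
  g zero = g' zero -> g one = g' one ->
  loop_class g = loop_class g' -> square_homotopic g g'.
Proof.
move=> cg cg' e0 e1 E; pose b := g zero.
have j : path_joined R setT b (g zero) by exact: path_joined_refl.
have j' := path_joined_ends cg.
have : class_at g b = class_at g' b by rewrite -/(loop_class g b) E.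
rewrite (class_atE cg erefl erefl j j') (class_atE cg' (esym e0) (esym e1) j j').
move=> /pi1P h.
have {}h := path_homotopic_trans (path_homotopic_sym (path_concatVK _ _))
  (path_homotopic_trans (path_concat_homr (path_rev (joining j)) h) (path_concatVK _ _)).
have [H [cH Hg Hg' H0 H1]] := path_homotopic_trans (path_homotopic_sym (path_concat_rev _ _))
  (path_homotopic_trans (path_concat_homl (joining j') h) (path_concat_rev _ _)).
by exists H.
Qed.

Lemma loop_class_concat (x y z : T) (p : {path I from x to y}) (q : {path I from y to z}) :
  loop_class p * loop_class q = loop_class (path_concat p q).
Proof.
apply: functional_extensionality_dep => b.
rewrite -[LHS]/(class_at p b * class_at q b) -[RHS]/(class_at _ b).
have [ep ep1] : p zero = x /\ p one = y by rewrite path_zero path_one.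
have [eq0 eq1] : q zero = y /\ q one = z by rewrite path_zero path_one.
have [er0 er1] : path_concat p q zero = x /\ path_concat p q one = z.
  by split; [exact: path_concat0|exact: path_concat1].
have [j|nj] := pselect (path_joined R setT b x); last first.
  rewrite !class_at_unjoined ?mulg1 ?ep ?er0//.
  rewrite eq0 => j; apply: nj; apply: path_joined_trans j _.
  by apply: path_joined_sym; exists p.
have jy : path_joined R setT b y by apply: (path_joined_trans j); exists p.
have jz : path_joined R setT b z by apply: (path_joined_trans jy); exists q.
rewrite (class_atE (@path_cts _ _ _ _ p) ep ep1 j jy).
rewrite (class_atE (@path_cts _ _ _ _ q) eq0 eq1 jy jz).
rewrite (class_atE (@path_cts _ _ _ _ (path_concat p q)) er0 er1 j jz).
rewrite [LHS]pi1_mulE; apply/pi1P.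
have -> : mk_path (@path_cts _ _ _ _ p) ep ep1 = p :> {path I from x to y} by apply/path_eqP.
have -> : mk_path (@path_cts _ _ _ _ q) eq0 eq1 = q :> {path I from y to z} by apply/path_eqP.
have -> : mk_path (@path_cts _ _ _ _ (path_concat p q)) er0 er1 = path_concat p q :> {path I from x to z}.
  by apply/path_eqP.
apply: path_homotopic_trans (path_homotopic_sym (path_concatA _ _ _)) _.
apply: path_concat_homr.
apply: path_homotopic_trans (path_homotopic_sym (path_concatA _ _ _)) _.
apply: path_homotopic_trans _ (path_concatA _ _ _).
by apply: path_concat_homr; exact: path_concatVK.
Qed.

End path_classes.

Lemma affine_continuousC (R : realType) (V : topologicalType) (u : V -> R) (a b : R) :
  continuous u -> continuous (fun v => b + a * u v).
Proof.
by move=> cu; under [X in continuous X]funext do rewrite addrC; exact: affine_continuous.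
Qed.

Section chi.
Context {R : realType} {T : topologicalType}.
Local Notation I := (unit_itv R).
Implicit Types (c : R -> T) (s t u : R).

(** Two paths with the same ends are homotopic if and only if they have the same
    [chi]; it records, for every base point [b], the loop at [b] made of [c],
    from [s] to [t], and of fixed paths from [b]. *)
Definition chi c s t := loop_class (fun u : I => c (s + (t - s) * ival u)).

Let seg_continuous c s t : continuous c ->
  continuous (fun u : I => c (s + (t - s) * ival u)).
Proof.
by move=> cc; apply: (comp_continuous _ cc); apply: affine_continuousC; exact: ival_continuous.
Qed.

Let seg_zero c s t : c (s + (t - s) * ival (zero : I)) = c s.
Proof. by rewrite ival0 mulr0 addr0. Qed.

Let seg_one c s t : c (s + (t - s) * ival (one : I)) = c t.
Proof. by rewrite ival1 mulr1 addrC subrK. Qed.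

Lemma chi_homotopic c s t c' s' t' (K : R * R -> T) :
  continuous c -> continuous c' -> continuous K ->
  (forall u, 0 <= u -> u <= 1 -> K (u, 0) = c (s + (t - s) * u)) ->
  (forall u, 0 <= u -> u <= 1 -> K (u, 1) = c' (s' + (t' - s') * u)) ->
  (forall v, 0 <= v -> v <= 1 -> K (0, v) = c s) ->
  (forall v, 0 <= v -> v <= 1 -> K (1, v) = c t) ->
  chi c s t = chi c' s' t'.
Proof.
move=> cc cc' cK Kc Kc' K0 K1; apply: loop_class_homotopic; [exact: seg_continuous|exact: seg_continuous|].
exists (fun z => K (ival z.1, ival z.2)); split.
- apply: comp_continuous cK; apply: pair_continuous.
    by apply: (@comp_continuous _ _ _ fst); [move=> z; exact: cvg_fst|exact: ival_continuous].
  by apply: (@comp_continuous _ _ _ snd); [move=> z; exact: cvg_snd|exact: ival_continuous].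
- by move=> u /=; rewrite ival0 Kc// ?ival_ge0 ?ival_le1.
- by move=> u /=; rewrite ival1 Kc'// ?ival_ge0 ?ival_le1.
- by move=> v /=; rewrite seg_zero ival0 K0// ?ival_ge0 ?ival_le1.
- by move=> v /=; rewrite seg_one ival1 K1// ?ival_ge0 ?ival_le1.
Qed.

Lemma chi_faithful c s t c' s' t' : continuous c -> continuous c' ->
  c s = c' s' -> c t = c' t' -> chi c s t = chi c' s' t' ->
  exists K : R * R -> T, [/\ continuous K,
    forall u, 0 <= u -> u <= 1 -> K (u, 0) = c (s + (t - s) * u),
    forall u, 0 <= u -> u <= 1 -> K (u, 1) = c' (s' + (t' - s') * u),
    forall v, K (0, v) = c s & forall v, K (1, v) = c t].
Proof.
move=> cc cc' es et /loop_class_inj[||||H [cH Hc Hc' H0 H1]].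
- exact: seg_continuous.
- exact: seg_continuous.
- by rewrite !seg_zero.
- by rewrite !seg_one.
exists (fun z => H (clamp z.1, clamp z.2)); split.
- by apply: comp2_continuous => // z; [exact: cvg_fst|exact: cvg_snd].
- by move=> u u0 u1 /=; rewrite (clamp_le0 (lexx 0)) Hc clamp_id// u0.
- by move=> u u0 u1 /=; rewrite (clamp_ge1 (lexx 1)) Hc' clamp_id// u0.
- by move=> v /=; rewrite clamp_le0// H0 seg_zero.
- by move=> v /=; rewrite clamp_ge1// H1 seg_one.
Qed.

Lemma chi_linear (f g : R -> R) c s t s' t' : continuous c ->
  continuous f -> continuous g -> f s = g s' -> f t = g t' ->
  chi (fun u => c (f u)) s t = chi (fun u => c (g u)) s' t'.
Proof.
move=> cc cf cg e0 e1; have caf (a b : R) : continuous (fun t : R => a + b * t).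
  by apply: affine_continuousC => x; exact: cvg_id.
have cfst (h : R -> R) : continuous h -> continuous (fun z : R * R => h z.1).
  by apply: (@comp_continuous _ _ _ fst) => z; exact: cvg_fst.
pose F u := f (s + (t - s) * u); pose G u := g (s' + (t' - s') * u).
have cF : continuous F by exact: comp_continuous cf.
have cG : continuous G by exact: comp_continuous cg.
apply: (@chi_homotopic _ _ _ _ _ _ (fun z => c (F z.1 + z.2 * (G z.1 - F z.1)))).
- exact: comp_continuous cc.
- exact: comp_continuous cc.
- apply: comp_continuous cc => z; apply: cvgD; first exact: cfst.
  apply: cvgM; first exact: cvg_snd.
  by apply: cvgB; exact: cfst.
- by move=> u _ _ /=; rewrite mul0r addr0.
- by move=> u _ _ /=; rewrite mul1r addrC subrK.
- by move=> v _ _ /=; rewrite /F /G !mulr0 !addr0 e0 subrr mulr0 addr0.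
- move=> v _ _ /=; rewrite /F /G !mulr1 !(addrC s) !(addrC s') !subrK e1.
  by rewrite subrr mulr0 addr0.
Qed.

Lemma chi_comp (k : R -> R) c s t : continuous c -> continuous k ->
  chi (fun u => c (k u)) s t = chi c (k s) (k t).
Proof. by move=> cc ck; apply: (@chi_linear k id) => // x; exact: cvg_id. Qed.

Lemma eq_chi c c' s t : continuous c -> continuous c' -> s <= t ->
  (forall u, s <= u -> u <= t -> c u = c' u) -> chi c s t = chi c' s t.
Proof.
move=> cc cc' st E; apply: (@chi_homotopic _ _ _ _ _ _ (fun z => c (s + (t - s) * z.1))) => //.
- apply: (@comp_continuous _ _ _ fst (fun x => c (s + (t - s) * x))).
    by move=> z; exact: cvg_fst.
  by apply: (comp_continuous _ cc); apply: affine_continuousC => x; exact: cvg_id.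
- by move=> u u0 u1 /=; apply: E; nra.
Qed.

Lemma chi_cst x s t : chi (cst x) s t = 1%g.
Proof.
have -> : chi (cst x) s t = loop_class (path_cst x : {path I from x to x}).
  by congr loop_class.
have := loop_class_concat (path_cst x : {path I from x to x}) (path_cst x).
have -> : loop_class (path_concat (path_cst x : {path I from x to x}) (path_cst x)) =
    loop_class (path_cst x : {path I from x to x}).
  apply: loop_class_homotopic; [exact: path_cts|exact: path_cts|].
  have [H [cH H1 H2 H3 H4]] := path_concat_cstl (path_cst x : {path I from x to x}).
  by exists H; split=> // v; rewrite ?path_zero ?path_one.
by set l := loop_class _ => E; apply: (mulIg l); rewrite mul1g.
Qed.

Lemma chiM c s t u : continuous c -> (chi c s t * chi c t u)%g = chi c s u.
Proof.
(* [f] runs from [s] to [t] and then from [t] to [u], in whatever order these times are; this is the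
   parametrization of [path_concat]. *)
move=> cc; pose f (w : R) := s + (t - s) * Num.min 1 (2 * w) + (u - t) * Num.max 0 (2 * w - 1).
have cf : continuous f.
  move=> w; apply: cvgD; first (apply: cvgD; first exact: cvg_cst).
    apply: cvgM; first exact: cvg_cst.
    apply: (@continuous_min _ _ (cst 1) (fun w : R => 2 * w)); first exact: cvg_cst.
    by apply: cvgM; [exact: cvg_cst|exact: cvg_id].
  apply: cvgM; first exact: cvg_cst.
  apply: (@continuous_max _ _ (cst 0) (fun w : R => 2 * w - 1)); first exact: cvg_cst.
  by apply: cvgB; [apply: cvgM; [exact: cvg_cst|exact: cvg_id]|exact: cvg_cst].
have <- : chi (fun w => c (f w)) 0 1 = chi c s u.
  rewrite chi_comp// /f mulr0 (min_r ler01) sub0r max_l; last by lra.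
  rewrite min_l; last by lra.
  rewrite max_r; last by lra.
  by congr chi; lra.
pose p : {path I from c s to c t} := mk_path (seg_continuous cc) (seg_zero c s t) (seg_one c s t).
pose q : {path I from c t to c u} := mk_path (seg_continuous cc) (seg_zero c t u) (seg_one c t u).
rewrite -[chi c s t]/(loop_class p) -[chi c t u]/(loop_class q) loop_class_concat.
congr loop_class; apply/funext => w; rewrite path_concatE.
have w0 := ival_ge0 w; have w1 := ival_le1 w.
rewrite /f subr0 mul1r add0r; case: leP => h.
  rewrite -[LHS]/(c (s + (t - s) * ival (clamp (2 * ival w + 0)))) clamp_id; last by apply/andP; split; lra.
  by rewrite min_r ?max_l; [congr c; lra|lra|lra].
rewrite -[LHS]/(c (t + (u - t) * ival (clamp (2 * ival w + -1)))) clamp_id; last by apply/andP; split; lra.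
by rewrite min_l ?max_r; [congr c; lra|lra|lra].
Qed.

Lemma chi_refl c s : continuous c -> chi c s s = 1%g.
Proof.
by move=> cc; apply: (mulIg (chi c s s)); rewrite chiM// mul1g.
Qed.

Lemma chiV c s t : continuous c -> chi c t s = ((chi c s t)^-1)%g.
Proof.
by move=> cc; apply: (mulgI (chi c s t)); rewrite chiM// chi_refl// mulgV.
Qed.

Lemma chi_const c s t : continuous c -> s <= t ->
  (forall u, s <= u -> u <= t -> c u = c s) -> chi c s t = 1%g.
Proof.
move=> cc st E; rewrite -(chi_cst (c s) s t); apply: eq_chi => // u.
exact: cvg_cst.
Qed.

End chi.

(** Multiplicative functions of time intervals that are prescribed on the
    intervals that meet at most one of finitely many disjoint closed sets. *)
Section development.
Context {R : realType} {G : groupType} {I : eqType}.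
Implicit Types (F : seq I) (K : I -> set R) (lam : I -> R -> R -> G).
Local Open Scope group_scope.

Record increments F K lam : Prop := {
  inc_closed : forall i, i \in F -> closed (K i);
  inc_disjoint : forall i j t, i \in F -> j \in F -> K i t -> K j t -> i = j;
  inc_mul : forall i s t u, i \in F -> lam i s t * lam i t u = lam i s u;
  inc_one : forall i s t, i \in F -> (s <= t)%R ->
    (forall u, (s <= u)%R -> (u <= t)%R -> ~ K i u) -> lam i s t = 1 }.

Definition isolates F K i s t : Prop :=
  forall j, j \in F -> j <> i -> forall u, (s <= u)%R -> (u <= t)%R -> ~ K j u.

Definition increment F lam i s t : G := if i \in F then lam i s t else 1.

(** The derivations are the subdivisions into intervals that meet at most one of the sets. The
    product does not depend on the subdivision, since any two are compared by cutting one along the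
    other ([dev_split], [dev_unique]). *)
Inductive development F K lam : R -> R -> G -> Prop :=
| dev_inc i s t of (s <= t)%R & isolates F K i s t : development F K lam s t (increment F lam i s t)
| dev_cat s t u g h of (s <= t)%R & (t <= u)%R & development F K lam s t g & development F K lam t u h :
    development F K lam s u (g * h).

Definition develop F K lam s t : G :=
  if (s <= t)%R then xget 1 [set g | development F K lam s t g]
  else (xget 1 [set g | development F K lam t s g])^-1.

Variables (F : seq I) (K : I -> set R) (lam : I -> R -> R -> G) (i0 : I).
Hypothesis data : increments F K lam.
Local Notation dev := (development F K lam).
Local Notation inc := (increment F lam).
Local Notation isolated := (isolates F K).
Local Notation dvl := (develop F K lam).

Lemma incM i s t u : inc i s t * inc i t u = inc i s u.
Proof. by rewrite /increment; case: ifP => [/(inc_mul data)|_]; rewrite ?mulg1. Qed.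

Lemma inc_refl i s : inc i s s = 1.
Proof. by apply: (mulIg (inc i s s)); rewrite incM mul1g. Qed.

Lemma incV i s t : inc i t s = (inc i s t)^-1.
Proof. by apply: (mulgI (inc i s t)); rewrite incM inc_refl mulgV. Qed.

Lemma isolated_sub i s t s' t' : (s <= s')%R -> (t' <= t)%R ->
  isolated i s t -> isolated i s' t'.
Proof.
move=> ss tt iso j jF ji u su ut; apply: (iso j jF ji); [exact: le_trans su|exact: le_trans tt].
Qed.

(** At most one of finitely many disjoint closed sets contains [x], and the others keep a positive
    distance; [i0] serves as index when none of them contains [x]. *)
Lemma isolated_near x : exists (d : R) (i : I),
  [/\ (0 < d)%R, (i \in F /\ K i x) \/ (forall j, j \in F -> ~ K j x) &
      forall s t, (x - d < s)%R -> (t < x + d)%R -> isolated i s t].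
Proof.
have near_one j : j \in F -> ~ K j x -> exists2 d : R, (0 < d)%R &
    forall t, (x - d < t)%R -> (t < x + d)%R -> ~ K j t.
  by move=> jF; apply: closed_gap; exact: inc_closed data _ jF.
have near_all i (F' : seq I) : {subset F' <= F} ->
    (forall j, j \in F' -> j <> i -> ~ K j x) -> exists2 d : R, (0 < d)%R &
    forall j t, j \in F' -> j <> i -> (x - d < t)%R -> (t < x + d)%R -> ~ K j t.
  elim: F' => [|j F' IHF] sub nK; first by exists 1%R.
  have [||d d0 dF] := IHF.
  - by move=> k kF; apply: sub; rewrite inE kF orbT.
  - by move=> k kF; apply: nK; rewrite inE kF orbT.
  have [ji|/eqP ji] := eqVneq j i.
    exists d => // k t; rewrite inE => /orP[/eqP -> //|kF]; exact: dF.
  have [||e e0 eK] := near_one j.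
  - by apply: sub; rewrite inE eqxx.
  - by apply: nK => //; rewrite inE eqxx.
  exists (Num.min d e); first by rewrite lt_min d0.
  have [m1 m2] : (Num.min d e <= d /\ Num.min d e <= e)%R by rewrite !ge_min !lexx orbT.
  move=> k t; rewrite inE => /orP[/eqP -> _ ? ?|kF ki ? ?]; first by apply: eK; lra.
  by apply: (dF k) => //; lra.
have [[i [iF Kx]]|nK] := pselect (exists i, i \in F /\ K i x).
  have [//||d d0 dF] := @near_all i F.
    by move=> j jF ji Kj; apply: ji; exact: (inc_disjoint data jF iF Kj Kx).
  exists d, i; split=> //; first by left.
  by move=> s t xs tx j jF ji u su ut; apply: (dF j) => //; lra.
have {}nK j : j \in F -> ~ K j x by move=> jF Kj; apply: nK; exists j.
have [//|j jF _|d d0 dF] := @near_all i0 F; first exact: nK.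
exists d, i0; split=> //; first by right.
by move=> s t xs tx j jF ji u su ut; apply: (dF j) => //; lra.
Qed.

Lemma dev_ex s t : (s <= t)%R -> exists g, dev s t g.
Proof.
move: s t; apply: interval_chain.
  by move=> s t u st tu [g dg] [h dh]; exists (g * h); exact: dev_cat dg dh.
move=> x; have [d [i [d0 _ iso]]] := isolated_near x; exists d => // s t xs st tx.
by exists (inc i s t); apply: dev_inc => //; exact: iso.
Qed.

(** For two different indices neither set meets the interval, and both increments are 1. *)
Lemma inc_unique i i' s t : (s <= t)%R -> isolated i s t -> isolated i' s t ->
  inc i s t = inc i' s t.
Proof.
move=> st iso iso'; have [->//|/eqP ne] := eqVneq i i'.
suff E j j' : j <> j' -> isolated j' s t -> inc j s t = 1.
  by rewrite (E i i')// (E i' i)// => /esym.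
move=> jj isoj; rewrite /increment; case: ifP => // jF.
by apply: (inc_one data) => //; exact: isoj.
Qed.

Lemma dev_split s t g : dev s t g -> forall x, (s <= x)%R -> (x <= t)%R ->
  exists g1 g2, [/\ dev s x g1, dev x t g2 & g = g1 * g2].
Proof.
elim=> {s t g} [i s t st iso x sx xt|s t u g h st tu dg IHg dh IHh x sx xu].
  exists (inc i s x), (inc i x t); rewrite incM; split=> //; apply: dev_inc => //.
    exact: isolated_sub iso.
  exact: isolated_sub iso.
have [xt|/ltW tx] := leP x t.
  have [g1 [g2 [d1 d2 ->]]] := IHg x sx xt.
  by exists g1, (g2 * h); rewrite mulgA; split=> //; exact: dev_cat d2 dh.
have [g1 [g2 [d1 d2 ->]]] := IHh x tx xu.
by exists (g * g1), g2; rewrite mulgA; split=> //; exact: dev_cat dg d1.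
Qed.

Lemma dev_unique s t g g' : dev s t g -> dev s t g' -> g = g'.
Proof.
move=> dg; elim: dg g' => {s t g} [i s t st iso g' dg'|s t u g h st tu dg IHg dh IHh g' dg'].
  elim: dg' i iso st => {s t g'} [i' s t st' iso' i iso _|s t u g h st tu dg IHg dh IHh i iso su].
    exact: inc_unique.
  rewrite -(incM i s t u) (IHg i) ?(IHh i)//; exact: isolated_sub iso.
have [g1 [g2 [d1 d2 ->]]] := dev_split dg' st tu.
by rewrite (IHg _ d1) (IHh _ d2).
Qed.

Lemma developE s t g : (s <= t)%R -> dev s t g -> dvl s t = g.
Proof.
move=> st dg; rewrite /develop st; apply: (dev_unique (s := s) (t := t)) => //.
by apply: (xgetPex 1); exists g.
Qed.

Lemma developV s t : dvl t s = (dvl s t)^-1.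
Proof.
wlog st : s t / (s <= t)%R => [W|].
  by have [/W //|/ltW/W ->] := leP s t; rewrite invgK.
have [->|ne] := eqVneq s t.
  rewrite (@developE t t 1) ?invg1//; rewrite -(inc_refl i0 t).
  have [d [i [d0 _ iso]]] := isolated_near t.
  rewrite inc_refl -(inc_refl i t); apply: dev_inc => //; apply: iso; lra.
by rewrite /develop st ifF//; apply/negbTE; rewrite -ltNge lt_neqAle ne.
Qed.

Lemma develop_refl s : dvl s s = 1.
Proof.
have [d [i [d0 _ iso]]] := isolated_near s.
rewrite -(inc_refl i s); apply: developE => //; apply: dev_inc => //; apply: iso; lra.
Qed.

Lemma developM s t u : dvl s t * dvl t u = dvl s u.
Proof.
have D a b c : (a <= b)%R -> (b <= c)%R -> dvl a b * dvl b c = dvl a c.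
  move=> ab bc; have [g dg] := dev_ex ab; have [h dh] := dev_ex bc.
  rewrite (developE ab dg) (developE bc dh); apply/esym/developE.
    exact: le_trans bc.
  exact: dev_cat dg dh.
have [st|/ltW ts] := leP s t; have [tu|/ltW ut] := leP t u.
- exact: D.
- have [su|/ltW us] := leP s u.
    by rewrite -(D s u t)// -mulgA (developV t u) mulVg mulg1.
  by rewrite (developV u t) (developV u s) -(D u s t)// invgM mulgA mulgV mul1g.
- have [su|/ltW us] := leP s u.
    by rewrite (developV t s) -(D t s u)// mulgA mulVg mul1g.
  by rewrite (developV t s) (developV u s) -(D t u s)// invgM -mulgA mulVg mulg1.
- by rewrite (developV t s) (developV u t) (developV u s) -(D u t s)// invgM.
Qed.

Lemma develop_isolated i s t : (s <= t)%R -> isolated i s t -> dvl s t = inc i s t.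
Proof. by move=> st iso; apply: developE => //; exact: dev_inc. Qed.

Lemma develop_near x : exists (d : R) (i : I),
  [/\ (0 < d)%R, (i \in F /\ K i x) \/ (forall j, j \in F -> ~ K j x),
      forall s t, (x - d < s)%R -> (t < x + d)%R -> isolated i s t &
      forall s t, (x - d < s)%R -> (x - d < t)%R -> (s < x + d)%R -> (t < x + d)%R ->
        dvl s t = inc i s t].
Proof.
have [d [i [d0 Ki iso]]] := isolated_near x; exists d, i; split=> // s t xs xt sx tx.
have [st|/ltW ts] := leP s t.
  by apply: develop_isolated => //; exact: iso.
by rewrite (developV t s) incV (develop_isolated (i := i))//; exact: iso.
Qed.

End development.

(** The sets [K'] may be smaller than the preimages of [K]: short intervals whose images are
    isolated for [K] are isolated for [K'] as well, and there both sides are single increments. *)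
Lemma develop_comp (R : realType) (G : groupType) (I : eqType) (F : seq I)
    (K K' : I -> set R) (lam lam' : I -> R -> R -> G) (i0 : I) (k : R -> R) (s t : R) :
  increments F K lam -> increments F K' lam' -> continuous k -> s <= t ->
  (forall i u, i \in F -> s <= u -> u <= t -> K' i u -> K i (k u)) ->
  (forall i u v, i \in F -> s <= u -> u <= t -> s <= v -> v <= t ->
     lam' i u v = lam i (k u) (k v)) ->
  develop F K' lam' s t = develop F K lam (k s) (k t).
Proof.
move=> D D' ck st KK ll.
pose E a b := s <= a -> b <= t ->
  develop F K' lam' a b = develop F K lam (k a) (k b).
suff : E s t by apply.
apply: interval_chain st => [a b c ab bc Eab Ebc sa ct|x].
  rewrite -(developM i0 D' a b c) -(developM i0 D (k a) (k b) (k c)).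
  rewrite Eab ?Ebc//; [exact: le_trans ab|exact: le_trans ct].
have [d [i [d0 _ iso dE]]] := develop_near i0 D (k x).
have : nbhs (k x) [set y | k x - d < y /\ y < k x + d].
  by apply/nbhs_real; exists d.
move=> /(continuous_real_nbhs ck)[e e0 ke].
exists e => // a b xa ab bx sa bt.
rewrite (@develop_isolated _ _ _ _ _ _ D' i) => //.
  have [? ?] := ke a ltac:(lra) ltac:(lra); have [? ?] := ke b ltac:(lra) ltac:(lra).
  by rewrite dE// /increment; case: ifP => // iF; apply: ll => //; lra.
move=> j jF ji u au ub /(KK j u jF ltac:(lra) ltac:(lra)).
have [? ?] := ke u ltac:(lra) ltac:(lra).
by apply: (iso (k u) (k u)).
Qed.

(** * Laminations *)

Section planar_sets.
Context {R : realType}.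

Lemma min2_gt0 (x y : R) : 0 < x -> 0 < y -> exists2 m, 0 < m & m <= x /\ m <= y.
Proof.
move=> x0 y0; exists (Num.min x y); first by rewrite lt_min x0.
by rewrite !ge_min !lexx orbT.
Qed.

Lemma min3_gt0 (x y z : R) : 0 < x -> 0 < y -> 0 < z ->
  exists2 m, 0 < m & [/\ m <= x, m <= y & m <= z].
Proof.
move=> x0 y0 z0; have [m m0 [mx my]] := min2_gt0 x0 y0.
have [n n0 [nm nz]] := min2_gt0 m0 z0.
by exists n => //; split=> //; exact: le_trans nm _.
Qed.

Lemma nbhs_box (x y : R) (A : set (R * R)) : nbhs (x, y) A <->
  exists2 d, 0 < d & forall u v, x - d < u -> u < x + d -> y - d < v -> v < y + d -> A (u, v).
Proof.
split=> [[[U V] /= [/nbhs_real[d d0 dU] /nbhs_real[e e0 eV]] UV]|[d d0 dA]].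
  exists (Num.min d e); first by rewrite lt_min d0.
  have [m1 m2] : Num.min d e <= d /\ Num.min d e <= e by rewrite !ge_min !lexx orbT.
  by move=> u v *; apply: UV; split => /=; [apply: dU|apply: eV]; lra.
exists ([set u | x - d < u < x + d], [set v | y - d < v < y + d]) => /=.
  by split; apply/nbhs_real; exists d => // t ? ?; apply/andP.
by move=> [u v] /= [/andP[? ?] /andP[? ?]]; apply: dA.
Qed.

Lemma closed_box (A : R -> R -> Prop) : closed [set z : R * R | A z.1 z.2] <->
  forall a b, (forall d, 0 < d -> exists a' b', [/\ A a' b', a - d < a', a' < a + d,
    b - d < b' & b' < b + d]) -> A a b.
Proof.
split=> [cA a b near|nA [a b] clA /=]; last first.
  apply: nA => d d0; have : nbhs (a, b) [set z : R * R |
      [/\ a - d < z.1, z.1 < a + d, b - d < z.2 & z.2 < b + d]].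
    by apply/nbhs_box; exists d.
  by move=> /clA[[a' b'] /= [Aab [? ? ? ?]]]; exists a', b'.
apply: (cA (a, b)) => B /nbhs_box[d d0 dB].
have [a' [b' [Aab ? ? ? ?]]] := near d d0.
by exists (a', b'); split=> //; apply: dB.
Qed.

End planar_sets.

(** Heine's theorem, with only the first point confined to the square. *)
Lemma square_unif_continuous (R : realType) (M : metricType R) (f : R * R -> M) (a b : R) :
  continuous f -> forall e, 0 < e -> exists2 d, 0 < d &
    forall s t s' t', a <= s -> s <= b -> a <= t -> t <= b ->
      `|s - s'| < d -> `|t - t'| < d -> mdist (f (s, t)) (f (s', t')) < e.
Proof.
move=> cf e e0; have cK : compact (`[a, b]%classic `*` `[a, b]%classic).
  by apply: compact_setX; exact: segment_compact.
pose Q (d : R) (z : R * R) := forall s' t', `|z.1 - s'| < d -> `|z.2 - t'| < d ->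
  mdist (f z) (f (s', t')) < e.
have : \forall d \near (0 : R)^'+, `[a, b]%classic `*` `[a, b]%classic `<=` Q d.
  apply: (proj1 (compact_near_coveringP _) cK) => -[s t] _.
  have : nbhs (f (s, t)) (ball (f (s, t)) (e / 2)) by apply: nbhsx_ballx; lra.
  move=> /(cf (s, t))/nbhs_box[d d0 dB].
  exists ([set z | [/\ s - d / 2 < z.1, z.1 < s + d / 2, t - d / 2 < z.2 & z.2 < t + d / 2]],
    [set r | r < d / 2]) => /=.
    split; last by apply: nbhs_right_lt; lra.
    by apply/nbhs_box; exists (d / 2); first lra.
  move=> [[x y] r] /= [[? ? ? ?] rd] s' t'; rewrite !ltr_distl /= => /andP[? ?] /andP[? ?].
  have := dB x y ltac:(lra) ltac:(lra) ltac:(lra) ltac:(lra).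
  have := dB s' t' ltac:(lra) ltac:(lra) ltac:(lra) ltac:(lra).
  rewrite /= !ballEmdist /= => h1 h2.
  have := metric_triangle (f (x, y)) (f (s, t)) (f (s', t')).
  by rewrite (metric_sym (f (x, y)) (f (s, t))); lra.
move=> near; have /filter_ex[d [d0 Qd]] : \forall d \near (0 : R)^'+,
    0 < d /\ `[a, b]%classic `*` `[a, b]%classic `<=` Q d.
  by apply: filterI near; exact: nbhs_right_gt.
exists d => // s t s' t' as_ sb at_ tb ss tt; apply: Qd => //.
by split; rewrite /= in_itv /=; apply/andP.
Qed.

Lemma segment_unif_continuous (R : realType) (M : metricType R) (f : R -> M) (a b : R) :
  continuous f -> forall e, 0 < e -> exists2 d, 0 < d &
    forall s t, a <= s -> s <= b -> `|s - t| < d -> mdist (f s) (f t) < e.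
Proof.
move=> cf e e0; have cf1 : continuous (fun z : R * R => f z.1).
  by apply: (@comp_continuous _ _ _ fst) => // z; exact: cvg_fst.
have [d d0 dP] := @square_unif_continuous R M _ a b cf1 e e0.
by exists d => // s t as_ sb st; exact: (dP s s t t).
Qed.

Section lamination.
Context {R : realType}.
Implicit Types (L : R -> R -> Prop) (a b c d l r s t u : R).

(** A leaf [L a b] stands for a chord that joins the points [a] and [b] of the
    circle obtained from [[0, 1]]. *)
Record lamination L : Prop := {
  leaf_closed : closed [set z : R * R | L z.1 z.2];
  leaf_noncrossing : forall a b c d, L a b -> L c d -> a < c -> c < b -> b < d -> False;
  leaf_range : forall a b, L a b -> [/\ 0 <= a, a <= b & b <= 1];
  leaf_refl : forall a, 0 <= a -> a <= 1 -> L a a }.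

Definition crosses a b c d := a < c /\ c < b /\ b < d.

(** Zorn's lemma for sets of pairwise noncrossing chords. The maximal set is closed: crossing is an
    open condition, so a limit of leaves crosses no leaf, and it is in [E]; hence it is a leaf. *)
Lemma maximal_lamination (E : R -> R -> Prop) :
  closed [set z : R * R | E z.1 z.2] ->
  (forall a b, E a b -> [/\ 0 <= a, a <= b & b <= 1]) ->
  (forall a, 0 <= a -> a <= 1 -> E a a) ->
  exists L, [/\ lamination L, forall a b, L a b -> E a b &
    forall a b, E a b ->
      (forall c d, L c d -> ~ crosses a b c d /\ ~ crosses c d a b) -> L a b].
Proof.
move=> /closed_box cE Er Ed.
pose good (A : set (R * R)) := (forall z, A z -> E z.1 z.2) /\
  forall z w, A z -> A w -> ~ crosses z.1 z.2 w.1 w.2.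
have chain (FF : set (set (R * R))) : FF `<=` good -> total_on FF subset ->
    good (\bigcup_(X in FF) X).
  move=> FG Ft; split; first by move=> z [A /FG[AE _] /AE].
  move=> z w [A FA Az] [B FB Bw]; have [AB|BA] := Ft _ _ FA FB.
    by have [_ nB] := FG _ FB; apply: nB => //; exact: AB.
  by have [_ nA] := FG _ FA; apply: nA => //; exact: BA.
have [A [[AE nA] Amax]] := Zorn_bigcup chain.
have max a b : E a b -> (forall c d, A (c, d) -> ~ crosses a b c d /\ ~ crosses c d a b) ->
    A (a, b).
  move=> Eab nc; apply: contrapT => nAab; apply: (Amax (A `|` [set (a, b)])).
    split; first by move=> z; left.
    by move=> sub; apply: nAab; apply: sub; right.
  split; first by move=> z [/AE//|->].
  move=> z w [Az|->] [Aw|->]; first exact: nA.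
  - by have [_] := nc z.1 z.2 ltac:(by rewrite -surjective_pairing).
  - by have [] := nc w.1 w.2 ltac:(by rewrite -surjective_pairing).
  - by rewrite /crosses /=; lra.
exists (fun a b => A (a, b)); split; last exact: max.
- split.
  + apply/(closed_box (fun a b => A (a, b))) => a b near; apply: max.
      by apply: cE => d /near[a' [b' [/AE ? ? ? ?]]]; exists a', b'.
    move=> c d Acd; rewrite /crosses; split => -[h1 [h2 h3]].
    have [m m0 [m1 m2 m3]] := @min3_gt0 R (c - a) (b - c) (d - b) ltac:(lra) ltac:(lra) ltac:(lra).
    have [a' [b' [Aab ? ? ? ?]]] := near m m0.
      by apply: (nA _ _ Aab Acd); rewrite /crosses/=; lra.
    have [m m0 [m1 m2 m3]] := @min3_gt0 R (a - c) (d - a) (b - d) ltac:(lra) ltac:(lra) ltac:(lra).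
    have [a' [b' [Aab ? ? ? ?]]] := near m m0.
    by apply: (nA _ _ Acd Aab); rewrite /crosses/=; lra.
  + by move=> a b c d Aab Acd ? ? ?; apply: (nA _ _ Aab Acd).
  + by move=> a b /AE/Er.
  + move=> a a0 a1; apply: max; first exact: Ed.
    by move=> c d _; rewrite /crosses; lra.
- by move=> a b /AE.
Qed.

Variable L : R -> R -> Prop.
Hypothesis lamL : lamination L.

Lemma leaf_le a b : L a b -> a <= b. Proof. by move=> /(leaf_range lamL)[]. Qed.

Definition innermost l r s t : Prop :=
  [/\ L l r, l <= s, t <= r & forall a b, L a b -> a <= s -> t <= b -> a <= l /\ r <= b].

Definition covered s t : Prop := exists a b, [/\ L a b, a <= s & t <= b].

Lemma innermost_refl s : 0 <= s -> s <= 1 -> innermost s s s s.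
Proof. by move=> s0 s1; split=> //; exact: leaf_refl. Qed.

(** Among the leaves over [[s, t]], a compact set, one has minimal length; as leaves do not cross,
    all others contain it. For [s = t] this is a degenerate leaf. *)
Lemma innermost_ex s t : s <= t -> covered s t -> exists l r, innermost l r s t.
Proof.
move=> st cov; have [->|ne] := eqVneq s t.
  have [a [b [Lab as_ tb]]] := cov; have [a0 ab b1] := leaf_range lamL Lab.
  by exists t, t; apply: innermost_refl; lra.
have {ne} st' : s < t by rewrite lt_neqAle ne.
pose A := [set z : R * R | L z.1 z.2 /\ z.1 <= s /\ t <= z.2].
have cA : compact A.
  apply: (@subclosed_compact _ _ (`[0 : R, 1]%classic `*` `[0 : R, 1]%classic)).
  - apply/(closed_box (fun a b => L a b /\ a <= s /\ t <= b)) => a b near; split; [|split].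
    + apply: ((closed_box L).1 (leaf_closed lamL)) => d /near[a' [b' [[? _] ? ? ? ?]]].
      by exists a', b'.
    + rewrite leNgt; apply/negP => h.
      by have [|a' [b' [[_ [? ?]] ? ? ? ?]]] := near (a - s); lra.
    + rewrite leNgt; apply/negP => h.
      by have [|a' [b' [[_ [? ?]] ? ? ? ?]]] := near (t - b); lra.
  - by apply: compact_setX; exact: segment_compact.
  - move=> [a b] /= [/(leaf_range lamL)[/= a0 ab b1] _].
    by split; rewrite /= in_itv /=; apply/andP; split; lra.
have A0 : A !=set0 by have [a [b [? ? ?]]] := cov; exists (a, b).
have cd : {within A, continuous (fun z : R * R => z.2 - z.1)}.
  apply: continuous_subspaceT => z.
  by apply: cvgB; [exact: cvg_snd|exact: cvg_fst].
have [[l r]] := compact_EVT_min A0 cA cd; rewrite inE /= => -[Llr [ls tr]] mn.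
exists l, r; split=> // a b Lab as_ tb.
have mab : r - l <= b - a by apply: (mn (a, b)); rewrite inE.
have n1 := leaf_noncrossing lamL Lab Llr; have n2 := leaf_noncrossing lamL Llr Lab.
split; rewrite leNgt; apply/negP => h.
  have [rb|?] := ltP r b; last by lra.
  by apply: n2 => //; lra.
have [al|?] := ltP a l; last by lra.
  by apply: n1 => //; lra.
Qed.

Lemma innermost_unique l r l' r' s t : innermost l r s t -> innermost l' r' s t ->
  l = l' /\ r = r'.
Proof.
move=> [L1 ? ? m1] [L2 ? ? m2].
have [? ?] := m1 _ _ L2 ltac:(by []) ltac:(by []).
by have [? ?] := m2 _ _ L1 ltac:(by []) ltac:(by []); split; apply/eqP; rewrite eq_le; apply/andP; split.
Qed.

Section region.
Variables (l r : R).
Hypothesis leaf : L l r.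

Definition below a b : Prop := [/\ L a b, l <= a, b <= r & l < a \/ b < r].

(** Boundary times of the complementary region just below the leaf. *)
Definition boundary : set R :=
  [set t | t <= l \/ r <= t \/ forall a b, below a b -> ~ (a < t /\ t < b)].

Lemma boundary_closed : closed boundary.
Proof.
rewrite -openC openE => t nKt.
have [[lt tr] [a [b [bab at_ tb]]]] : (l < t /\ t < r) /\ exists a b, [/\ below a b, a < t & t < b].
  split; first by split; rewrite ltNge; apply/negP => ?; apply: nKt; [left|right; left].
  apply: contrapT => nex; apply: nKt; right; right => a b bab [? ?]; apply: nex.
  by exists a, b.
apply/nbhs_real; have [m m0 [m1 m2]] := @min2_gt0 R (t - a) (b - t) ltac:(lra) ltac:(lra).
exists m => //.
move=> u tu ut; have [? ? ? ?] := bab.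
by move=> [?|[?|/(_ a b bab)]]; [lra|lra|apply; split; lra].
Qed.

Lemma boundary_le t : t <= l -> boundary t. Proof. by left. Qed.
Lemma boundary_ge t : r <= t -> boundary t. Proof. by right; left. Qed.

Lemma boundary_below a b t : below a b -> boundary t -> a < t -> t < b -> False.
Proof.
by move=> bab [?|[?|/(_ a b bab) h]] ? ?; [case: bab; lra|case: bab; lra|apply: h].
Qed.

Local Notation k := (last_in boundary_closed boundary_le).

(** Every time in a gap is under some lower leaf. If two lower leaves overlap, one contains the
    other because they do not cross, so a compact part of the gap is under a single one. *)
Lemma gap_exhausted a b : is_gap boundary a b -> forall s t, s <= t -> a < s -> t < b ->
  exists c d, [/\ below c d, a <= c, c < s, t < d & d <= b].
Proof.
move=> [ab Ka Kb nK] s0 t0 st0 as0 tb0.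
pose E s t := s0 <= s -> t <= t0 ->
  exists c d, [/\ below c d, a <= c, c < s, t < d & d <= b].
suff : E s0 t0 by apply.
apply: interval_chain st0 => [s t u st tu E1 E2 ss ut|x].
  have [c [d [bcd ac cs td db]]] := E1 ss ltac:(lra).
  have [c' [d' [bcd' ac' cs' td' db']]] := E2 ltac:(lra) ut.
  have [Lcd _ _ _] := bcd; have [Lcd' _ _ _] := bcd'.
  have n1 := leaf_noncrossing lamL Lcd Lcd'.
  have [cc|cc] := leP c' c; first by exists c', d'; split=> //; lra.
  exists c, d; split=> //; rewrite ltNge; apply/negP => du.
  by apply: n1; lra.
have [xs|sx] := ltP x s0.
  by exists (s0 - x); [lra|move=> s t ? ? ? ? ?; lra].
have [tx|xt] := ltP t0 x.
  by exists (x - t0); [lra|move=> s t ? ? ? ? ?; lra].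
have nKx : ~ boundary x by apply: nK; lra.
have [c [d [bcd cx xd]]] : exists c d, [/\ below c d, c < x & x < d].
  apply: contrapT => nex; apply: nKx; right; right => c d bcd [? ?]; apply: nex.
  by exists c, d.
have [m m0 [m1 m2]] := @min2_gt0 R (x - c) (d - x) ltac:(lra) ltac:(lra); exists m => //.
move=> s t xs st tx ss tt; exists c, d; split=> //; [|lra|lra|].
  by rewrite leNgt; apply/negP => h; apply: (boundary_below bcd Ka); lra.
by rewrite leNgt; apply/negP => h; apply: (boundary_below bcd Kb); lra.
Qed.

(** The lower leaves of [gap_exhausted] converge to the gap, and the lamination is closed. *)
Lemma gap_leaf a b : is_gap boundary a b -> [/\ L a b, l <= a & b <= r].
Proof.
move=> gab; have [ab Ka Kb nK] := gab; have ex := gap_exhausted gab.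
have near e : 0 < e -> exists c d, [/\ below c d, a <= c, c < a + e, b - e < d & d <= b].
  move=> e0; have [m m0 [m1 m2]] := @min2_gt0 R e ((b - a) / 2) ltac:(lra) ltac:(lra).
  have [c [d [bcd ? ? ? ?]]] := ex (a + m) (b - m) ltac:(lra) ltac:(lra) ltac:(lra).
  by exists c, d; split=> //; lra.
split.
- apply: ((closed_box L).1 (leaf_closed lamL)) => e /near[c [d [[? _ _ _] ? ? ? ?]]].
  by exists c, d; split=> //; lra.
- rewrite leNgt; apply/negP => h.
  by have [|c [d [[_ ? _ _] ? ? ? ?]]] := near (l - a); lra.
- rewrite leNgt; apply/negP => h.
  by have [|c [d [[_ _ ? _] ? ? ? ?]]] := near (b - r); lra.
Qed.

Context {M : metricType R}.
Variable g : R -> M.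
Hypotheses (cg : continuous g) (gL : forall a b, L a b -> g a = g b).

(** The path [g] restricted to the boundary of the region, and constant on the
    gaps. *)
Definition region_path t : M := g (k t).

Lemma region_path_continuous : continuous region_path.
Proof.
apply: (@last_in_comp_continuous R _ _ _ boundary_closed boundary_le boundary_ge _ _ cg) => a b /gap_leaf[+ _ _].
exact: gL.
Qed.

Lemma region_path_boundary t : boundary t -> region_path t = g t.
Proof. by move=> Kt; rewrite /region_path last_in_id. Qed.

(** Under a lower leaf [last_in] does not move, except perhaps at the right end, where it may jump
    across a gap; the leaf over this gap has equal values at its ends. *)
Lemma region_path_below a b s : below a b -> a <= s -> s <= b ->
  region_path s = region_path a.
Proof.
move=> bab as_ sb; have ab : a <= b by case: bab => /leaf_le.
have [->//|ne] := eqVneq s a.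
have as' : a < s by rewrite lt_neqAle eq_sym ne.
have nK u : a < u -> u < b -> ~ boundary u.
  by move=> ? ? Ku; exact: (boundary_below bab Ku).
have kE u : a <= u -> k u <= a -> k u = k a.
  move=> au kua; apply/eqP; rewrite eq_le; apply/andP; split; last exact: last_in_mono.
  by apply: last_in_ge kua; exact: last_in_in.
have kle u : a <= u -> u < b -> k u <= a.
  move=> au ub; rewrite leNgt; apply/negP => h; apply: (nK (k u)) => //.
    exact: le_lt_trans (last_in_le _ _ _) ub.
  exact: last_in_in.
have [sb'|bs] := ltP s b; first by rewrite /region_path kE// kle//.
have -> : s = b by apply/eqP; rewrite eq_le sb.
have [Kb|nKb] := pselect (boundary b); last first.
  rewrite /region_path kE// leNgt; apply/negP => h.
  have kb := last_in_le boundary_closed boundary_le b.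
  have Kkb := last_in_in boundary_closed boundary_le b.
  have [E|ne'] := eqVneq (k b) b; first by rewrite E in Kkb.
  by apply: (nK (k b)) => //; rewrite lt_neqAle ne'.
have nKm : ~ boundary ((a + b) / 2) by apply: nK; lra.
have [c mc gc] := last_in_gap boundary_closed boundary_le boundary_ge nKm.
have kmE : k ((a + b) / 2) = k a by apply: kE; [|apply: kle]; lra.
have cb : c = b.
  have [_ _ Kc nKc] := gc; apply/eqP; rewrite eq_le; apply/andP; split.
    rewrite leNgt; apply/negP => h; apply: (nKc b) => //; rewrite kmE.
    by have := last_in_le boundary_closed boundary_le a; lra.
  by rewrite leNgt; apply/negP => h; apply: (nK c) => //; lra.
have [/gL + _ _] := gap_leaf gc; rewrite kmE cb => E.
by rewrite region_path_boundary// /region_path E.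
Qed.

End region.

Arguments region_path l r {M} g t.

Section filling.
Context {M : metricType R}.
Variables (g : R -> M) (F : R -> R -> R -> R -> M).
Hypotheses (cg : continuous g) (gL : forall a b, L a b -> g a = g b).
Hypothesis F_left : forall l r t, L l r -> l <= t -> t <= r -> F l r l t = g l.
Hypothesis F_right : forall l r s, L l r -> l <= s -> s <= r -> F l r s r = g l.
Hypothesis F_below : forall l r a b s t, L l r -> below l r a b ->
  a <= s -> s <= t -> t <= b -> F l r s t = region_path l r g s.

Definition equicontinuous_leaves := forall e, 0 < e -> exists2 d, 0 < d &
  forall l r s t s' t', L l r -> l <= s -> s <= t -> t <= r ->
    l <= s' -> s' <= t' -> t' <= r -> `|s - s'| < d -> `|t - t'| < d ->
    mdist (F l r s t) (F l r s' t') < e.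

Hypothesis F_equi : equicontinuous_leaves.

(** The triangle of the pairs [s <= t] serves as the disk, with the loop on the diagonal. A pair is
    treated as a chord, and its value is taken in the region right under the innermost leaf over it;
    [g s] is a default for pairs under no leaf. *)
Definition fill s t : M :=
  match pselect (exists lr : R * R, innermost lr.1 lr.2 s t) with
  | left ex => F (sval (cid ex)).1 (sval (cid ex)).2 s t
  | right _ => g s
  end.

Lemma fillE l r s t : innermost l r s t -> fill s t = F l r s t.
Proof.
move=> inn; rewrite /fill; case: pselect => [ex|[]]; last by exists (l, r).
have := svalP (cid ex) => inn'.
by have [-> ->] := innermost_unique inn' inn.
Qed.

Lemma fill_refl s : 0 <= s -> s <= 1 -> fill s s = g s.
Proof.
move=> s0 s1; have inn := innermost_refl s0 s1.
by rewrite (fillE inn) F_left//; case: inn.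
Qed.

Lemma fill_left a b t : L a b -> a <= t -> t <= b -> fill a t = g a.
Proof.
move=> Lab at_ tb; have [|l [r inn]] := @innermost_ex a t at_.
  by exists a, b.
have [Llr la tr mx] := inn; have [al _] := mx _ _ Lab (lexx a) tb.
have E : l = a by apply/eqP; rewrite eq_le la.
by rewrite (fillE inn) E F_left// -?E.
Qed.

Lemma fill_right a b s : L a b -> a <= s -> s <= b -> fill s b = g a.
Proof.
move=> Lab as_ sb; have [|l [r inn]] := @innermost_ex s b sb.
  by exists a, b.
have [Llr ls br mx] := inn; have [_ rb] := mx _ _ Lab as_ (lexx b).
have E : r = b by apply/eqP; rewrite eq_le br rb.
move: inn Llr ls br; rewrite E => inn Llr ls _.
by rewrite (fillE inn) F_right// (gL Lab) (gL Llr).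
Qed.

(** The innermost leaf over [[s, t]] is squeezed between the chord and [(a, b)]. So its end is near
    [a] or [b], and the chord is near the corresponding side of its triangle, where [F] is known. *)
Let near_sides e : 0 < e -> exists2 d, 0 < d & forall a b s t, L a b ->
  a <= s -> s <= t -> t <= b -> s - a < d \/ b - t < d -> mdist (fill s t) (g a) < e.
Proof.
move=> e0; have [d d0 dF] := F_equi (e := e / 2) ltac:(lra).
have [d' d'0 dg] := @segment_unif_continuous R M g 0 1 cg (e / 2) ltac:(lra).
have [m m0 [md md']] := min2_gt0 d0 d'0.
exists m => // a b s t Lab as_ st tb side.
have [|l [r inn]] := @innermost_ex s t st; first by exists a, b.
have [Llr ls tr mx] := inn; have [al rb] := mx _ _ Lab as_ tb.
have [a0 _ b1] := leaf_range lamL Lab; have [l0 lr r1] := leaf_range lamL Llr.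
rewrite (fillE inn); case: side => side.
  have h1 : mdist (F l r s t) (F l r l t) < e / 2.
    by apply: dF => //; rewrite ?subrr ?normr0 ?ger0_norm//; lra.
  have h2 : mdist (g l) (g a) < e / 2.
    by apply: dg => //; rewrite ?ger0_norm//; lra.
  have := metric_triangle (F l r s t) (g l) (g a).
  by rewrite F_left // in h1; lra.
have h1 : mdist (F l r s t) (F l r s r) < e / 2.
  by apply: dF => //; rewrite ?subrr ?normr0 ?ler0_norm//; lra.
have h2 : mdist (g r) (g b) < e / 2.
  by apply: dg => //; rewrite ?ler0_norm//; lra.
have := metric_triangle (F l r s t) (g l) (g a).
by rewrite F_right // in h1; rewrite -(gL Llr) -(gL Lab) in h2; lra.
Qed.

(** Two near chords are compared in one region, that of the innermost leaf over both. Each value of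
    [fill] is within [e / 3] of the value of [F] there, and equicontinuity gives the last third. *)
Lemma fill_unif_continuous e : 0 < e -> exists2 d, 0 < d & forall s t s' t',
  s <= t -> s' <= t' -> covered (Num.min s s') (Num.max t t') ->
  `|s - s'| < d -> `|t - t'| < d -> mdist (fill s t) (fill s' t') < e.
Proof.
move=> e0; have [d1 d10 dF] := F_equi (e := e / 3) ltac:(lra).
have [d2 d20 dS] := @near_sides (e / 3) ltac:(lra).
have [d d0 [dd1 dd2]] := min2_gt0 d10 d20.
have hull s t s0 t0 l r : innermost l r s0 t0 -> s0 <= s -> s <= t -> t <= t0 ->
    s - s0 < d -> t0 - t < d -> mdist (fill s t) (F l r s t) < e / 3.
  move=> inn0 ss st tt sd td; have [Llr ls tr mx0] := inn0.
  have [|a [b inn]] := @innermost_ex s t st; first by exists l, r; split=> //; lra.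
  have [Lab as_ tb mx] := inn; have [la br] := mx _ _ Llr ltac:(lra) ltac:(lra).
  have [E|ne] := pselect (a = l /\ b = r).
    by rewrite (fillE inn) E.1 E.2 mdistxx; lra.
  have bab : below l r a b.
    split=> //; have [?|la'] := ltP l a; [by left|right].
    rewrite lt_neqAle br andbT; apply/eqP => br'; apply: ne; split=> //.
    by apply/eqP; rewrite eq_le la'.
  have [a0 ab b1] := leaf_range lamL Lab.
  rewrite (F_below Llr bab)//.
  have [Ks|nKs] := pselect (boundary l r s).
    (* A boundary time under a lower leaf is an end of it. It is not the right end: then [s = t],
       and the innermost leaf would be degenerate. *)
    have sE : s = a.
      have [//|as'] : s = a \/ a < s.
        by have [?|?] := ltP a s; [right|left; apply/eqP; rewrite eq_le as_ andbT].
      have [?|bs] := ltP s b; first by case: (boundary_below bab Ks as').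
      have [_ ? ? _] := inn; have sb : s = t by apply/eqP; rewrite eq_le st; lra.
      have [? _] := mx s t ltac:(by rewrite -sb; apply: leaf_refl => //; lra) ltac:(lra) ltac:(lra).
      lra.
    by rewrite region_path_boundary// sE (fill_left Lab)// ?mdistxx -?sE//; lra.
  have [c sc gc] := last_in_gap (@boundary_closed l r) (@boundary_le l r) (@boundary_ge l r) nKs.
  rewrite /region_path; set k := last_in _ _ s in gc *.
  have [Lkc lk cr] := gap_leaf gc.
  have ks : k <= s by exact: last_in_le.
  have tc : t <= c.
    apply: (le_trans tb); rewrite leNgt; apply/negP => cb.
    by case: gc => _ _ Kc _; apply: (boundary_below bab Kc); lra.
  (* The chord is near a side of the leaf over the gap [(k, c)]. Otherwise the gap would contain all
     of [[s0, t0]] in its interior, and [gap_exhausted] would give a leaf over it that is lower than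
     the innermost one. *)
  apply: (dS k c) => //; have [?|sk] := ltP (s - k) d2; first by left.
  right; rewrite ltNge; apply/negP => ct.
  have [p [q [[Lpq lp qr pq] ? ? ? ?]]] := gap_exhausted gc (s := s0) (t := t0) ltac:(lra) ltac:(lra) ltac:(lra).
  by have [? ?] := mx0 _ _ Lpq ltac:(lra) ltac:(lra); lra.
exists d => // s t s' t' st st' cov sd td.
have [m1 m2] : Num.min s s' <= s /\ Num.min s s' <= s' by rewrite !ge_min !lexx orbT.
have [n1 n2] : t <= Num.max t t' /\ t' <= Num.max t t' by rewrite !le_max !lexx orbT.
have [l [r inn]] := @innermost_ex _ _ (le_trans m1 (le_trans st n1)) cov.
move: sd td; rewrite !ltr_norml => /andP[sd1 sd2] /andP[td1 td2].
have m3 : Num.min s s' = s \/ Num.min s s' = s' by rewrite /Order.min; case: ifP; [left|right].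
have n3 : Num.max t t' = t \/ Num.max t t' = t' by rewrite /Order.max; case: ifP; [right|left].
have [Llr lm nr _] := inn.
have h1 := hull s t _ _ l r inn m1 st n1 ltac:(by case: m3 => ->; lra) ltac:(by case: n3 => ->; lra).
have h2 := hull s' t' _ _ l r inn m2 st' n2 ltac:(by case: m3 => ->; lra) ltac:(by case: n3 => ->; lra).
have h3 : mdist (F l r s t) (F l r s' t') < e / 3.
  by apply: dF => //; rewrite ?ltr_norml; try (apply/andP; split); lra.
have := metric_triangle (fill s t) (F l r s t) (fill s' t').
have := metric_triangle (F l r s t) (F l r s' t') (fill s' t').
by rewrite (metric_sym (F l r s' t') (fill s' t')); lra.
Qed.

End filling.
End lamination.

(** * Equicontinuity of the fillings of the regions *)

Section equicontinuity.
Context {R : realType} {M : metricType R}.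
Variables (L : R -> R -> Prop) (g : R -> M) (F : R -> R -> R -> R -> M).
Hypotheses (lamL : lamination L) (cg : continuous g).
Hypothesis gL : forall a b, L a b -> g a = g b.
Implicit Types (a b c d e l r s t u v : R).

Lemma leaf_cases l r l' r' : L l r -> L l' r' -> l < r -> l' < r' ->
  [\/ r <= l', r' <= l, below L l r l' r' | below L l' r' l r \/ (l = l' /\ r = r')].
Proof.
move=> L1 L2 lr lr'; have n1 := leaf_noncrossing lamL L1 L2.
have n2 := leaf_noncrossing lamL L2 L1.
have [?|rl'] := leP r l'; first by constructor 1.
have [?|rl''] := leP r' l; first by constructor 2.
have [ll|ll|ll] := ltgtP l l'.
- constructor 3; split=> //; [exact: ltW| |by left].
  by rewrite leNgt; apply/negP => h; apply: n1.
- constructor 4; left; split=> //; [exact: ltW| |by left].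
  by rewrite leNgt; apply/negP => h; apply: n2.
have [rr|rr|rr] := ltgtP r r'.
- by constructor 4; left; split; rewrite // ?ll ?(ltW rr)//; right.
- by constructor 3; split; rewrite // ?ll ?(ltW rr)//; right.
- by constructor 4; right.
Qed.

Let wide e l r u v := [/\ L l r, l <= u /\ u <= v, v <= r, boundary L l r u /\ boundary L l r v &
  e <= mdist (g u) (g v)].

(** If the leaves differ, one of the leaves lies between the pairs: its ends are within [d] of the
    two times of the outer pair. As [g] agrees at its ends, the outer pair has values closer than
    [e / 2]. Regions side by side are excluded since the two times of a wide pair are at least [d]
    apart. *)
Let wide_unique e d l r u v l' r' u' v' : 0 < e ->
  (forall s t, 0 <= s -> s <= 1 -> `|s - t| < d -> mdist (g s) (g t) < e / 4) ->
  wide e l r u v -> wide e l' r' u' v' -> `|u - u'| < d -> `|v - v'| < d ->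
  l = l' /\ r = r'.
Proof.
move=> e0 dg.
have half l1 r1 u1 v1 l2 r2 u2 v2 : wide e l1 r1 u1 v1 -> wide e l2 r2 u2 v2 ->
    `|u1 - u2| < d -> `|v1 - v2| < d -> r1 <= l2 \/ below L l1 r1 l2 r2 -> False.
  move=> [L1 [lu1 uv1] vr1 [Bu1 Bv1] big1] [L2 [lu2 uv2] vr2 _ _].
  rewrite !ltr_norml => /andP[? ?] /andP[? ?] C.
  have [l10 lr1 r11] := leaf_range lamL L1.
  have far : d <= v1 - u1.
    rewrite leNgt; apply/negP => h; suff : mdist (g u1) (g v1) < e / 4 by lra.
    by apply: dg; rewrite ?ltr_norml; try (apply/andP; split); lra.
  case: C => [?|bel]; first lra.
  have nu := boundary_below bel Bu1; have nv := boundary_below bel Bv1.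
  have [ul|lu] := leP u1 l2; last first.
    have [?|?] := ltP u1 r2; [by apply: nu|lra].
  have [?|lv] := leP v1 l2; first lra.
  have [?|rv] := ltP v1 r2; first by apply: nv.
  have h1 : mdist (g u1) (g l2) < e / 4.
    by apply: dg; rewrite ?ltr_norml; try (apply/andP; split); lra.
  have h2 : mdist (g v1) (g r2) < e / 4.
    by apply: dg; rewrite ?ltr_norml; try (apply/andP; split); lra.
  have := metric_triangle (g u1) (g l2) (g v1).
  by rewrite {2}(gL L2) (metric_sym (g r2)); lra.
move=> W W' uu vv; have uu' : `|u' - u| < d by rewrite distrC.
have vv' : `|v' - v| < d by rewrite distrC.
have pos l1 r1 u1 v1 : wide e l1 r1 u1 v1 -> l1 < r1.
  move=> [_ [? ?] ? _ big]; rewrite ltNge; apply/negP => ?.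
  by have E : u1 = v1 by [lra]; move: big; rewrite E mdistxx; lra.
have [L1 _ _ _ _] := W; have [L2 _ _ _ _] := W'.
have [h|h|h|[h|//]] := leaf_cases L1 L2 (pos _ _ _ _ W) (pos _ _ _ _ W').
- by case: (half _ _ _ _ _ _ _ _ W W' uu vv); left.
- by case: (half _ _ _ _ _ _ _ _ W' W uu' vv'); left.
- by case: (half _ _ _ _ _ _ _ _ W W' uu vv); right.
- by case: (half _ _ _ _ _ _ _ _ W' W uu' vv'); right.
Qed.

Definition triangle_within l r d e := forall s t s' t',
  l <= s -> s <= t -> t <= r -> l <= s' -> s' <= t' -> t' <= r ->
  `|s - s'| < d -> `|t - t'| < d -> mdist (F l r s t) (F l r s' t') < e.

Hypothesis F_unif : forall l r, L l r ->
  forall e, 0 < e -> exists2 d, 0 < d & triangle_within l r d e.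
Hypothesis F_small : forall e, 0 < e -> exists2 h, 0 < h & forall l r, L l r ->
  (forall u v, l <= u -> u <= r -> l <= v -> v <= r ->
     mdist (region_path L l r g u) (region_path L l r g v) < h) ->
  forall d, triangle_within l r d e.

(** By [wide_unique] and compactness, finitely many regions are not small. *)
Lemma equicontinuous_small : equicontinuous_leaves L F.
Proof.
move=> e e0; have [h h0 small] := F_small e0.
have [d0 d00 dg] := @segment_unif_continuous R M g 0 1 cg (h / 4) ltac:(lra).
pose Q d (z : R * R) := forall l r, wide h l r z.1 z.2 -> triangle_within l r d e.
have cK : compact (`[0 : R, 1]%classic `*` `[0 : R, 1]%classic).
  by apply: compact_setX; exact: segment_compact.
have near : \forall d \near (0 : R)^'+, `[0, 1]%classic `*` `[0, 1]%classic `<=` Q d.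
  apply: (proj1 (compact_near_coveringP _) cK) => -[x y] _.
  pose B := [set z : R * R | [/\ x - d0 / 2 < z.1, z.1 < x + d0 / 2, y - d0 / 2 < z.2 & z.2 < y + d0 / 2]].
  have nB : nbhs (x, y) B by apply/nbhs_box; exists (d0 / 2); first lra.
  have [[l1 [r1 [z1 [[? ? ? ?] W1]]]]|none] :=
      pselect (exists l r z, B z /\ wide h l r z.1 z.2).
    have [L1 _ _ _ _] := W1; have [d1 d10 tw] := F_unif L1 e0.
    exists (B, [set d | d < d1]) => /=; first by split=> //; exact: nbhs_right_lt.
    move=> [z d] /= [[? ? ? ?] dd1] l r W.
    have [] := wide_unique h0 dg W1 W.
    - by rewrite ltr_norml; apply/andP; split; lra.
    - by rewrite ltr_norml; apply/andP; split; lra.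
    move=> <- <- s t s' t' *; apply: tw => //; exact: lt_trans dd1.
  exists (B, setT) => /=; first by split=> //; exact: filterT.
  by move=> [z d] /= [Bz _] l r W; case: none; exists l, r, z.
have /filter_ex[d [d00' Qd]] : \forall d \near (0 : R)^'+,
    0 < d /\ `[0, 1]%classic `*` `[0, 1]%classic `<=` Q d.
  by apply: filterI near; exact: nbhs_right_gt.
exists d => // l r s t s' t' Llr.
have [sm|nsm] := pselect (forall u v, l <= u -> u <= r -> l <= v -> v <= r ->
    mdist (region_path L l r g u) (region_path L l r g v) < h).
  exact: small.
suff [u [v W]] : exists u v, wide h l r u v.
  have [? ? ?] := leaf_range lamL Llr; have [_ [? ?] ? _ _] := W.
  by apply: (Qd (u, v) _ l r W); split; rewrite /= in_itv /=; apply/andP; split; lra.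
have {nsm} [u [v [lu ur lv vr big]]] : exists u v, [/\ l <= u, u <= r, l <= v, v <= r &
    h <= mdist (region_path L l r g u) (region_path L l r g v)].
  apply: contrapT => none; apply: nsm => u v lu ur lv vr; rewrite ltNge; apply/negP => big.
  by apply: none; exists u, v.
pose k := last_in (@boundary_closed R L l r) (@boundary_le R L l r).
have kP w : l <= w -> w <= r -> [/\ l <= k w, k w <= r & boundary L l r (k w)].
  move=> lw wr; split; last exact: last_in_in.
    by apply: last_in_ge lw; exact: boundary_le.
  exact: le_trans (last_in_le _ _ _) wr.
have [lku kur Ku] := kP u lu ur; have [lkv kvr Kv] := kP v lv vr.
have [kuv|/ltW kvu] := leP (k u) (k v); first by exists (k u), (k v).
by exists (k v), (k u); split=> //; rewrite metric_sym.
Qed.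

End equicontinuity.

Section triangle.
Context {R : realType} {M : metricType R}.
Variables (H : R * R -> M) (x0 : M).
Hypotheses (cH : continuous H) (H_one : forall v, 0 <= v -> v <= 1 -> H (1, v) = x0).

(** The value of the quotient at [s = t = 1] does not matter. *)
Definition cone (s t : R) : M := H (s, (t - s) / (1 - s)).

Lemma cone_quotient (s t : R) : 0 <= s -> s <= t -> t <= 1 -> 0 <= (t - s) / (1 - s) <= 1.
Proof.
move=> s0 st t1; have [->|ne] := eqVneq s 1; first by rewrite subrr invr0 mulr0 lexx ler01.
have s1 : s < 1 by rewrite lt_neqAle ne; lra.
apply/andP; split; first by rewrite divr_ge0 ?subr_ge0// ltW.
by rewrite ler_pdivrMr ?subr_gt0//; lra.
Qed.

Lemma cone_unif_continuous (e : R) : 0 < e -> exists2 d, 0 < d & forall s t s' t' : R,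
  0 <= s -> s <= t -> t <= 1 -> 0 <= s' -> s' <= t' -> t' <= 1 ->
  `|s - s'| < d -> `|t - t'| < d -> mdist (cone s t) (cone s' t') < e.
Proof.
move=> e0; have [d d0 dH] := @square_unif_continuous R M H 0 1 cH (e / 2) ltac:(lra).
(* For [s] within [d / 2] of 1, all values are near [x0]. Otherwise [1 - s > d / 2], and the
   quotients differ by less than [2 * m / (1 - s)], which is at most [d / 2] because [m] is at most
   [d ^+ 2 / 8]. *)
have [m m0 [md mdd]] := @min2_gt0 R (d / 2) (d ^+ 2 / 8) ltac:(lra) ltac:(by rewrite divr_gt0 ?exprn_gt0).
exists m => // s t s' t' s0 st t1 s'0 st' t1' ss tt.
have /andP[q0 q1] := cone_quotient s0 st t1.
have /andP[q0' q1'] := cone_quotient s'0 st' t1'.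
have [far|near] := ltP s (1 - d / 2); last first.
  move: ss tt; rewrite !ltr_norml => /andP[? ?] /andP[? ?].
  have to1 u v : 0 <= u -> u <= 1 -> 1 - d < u -> 0 <= v -> v <= 1 -> mdist (H (u, v)) x0 < e / 2.
    move=> u0 u1 du v0 v1; rewrite -(H_one v0 v1).
    by apply: dH => //; rewrite ?subrr ?normr0// ltr_norml; apply/andP; split; lra.
  have h1 := to1 s _ s0 ltac:(lra) ltac:(lra) q0 q1.
  have h2 := to1 s' _ s'0 ltac:(lra) ltac:(lra) q0' q1'.
  have := metric_triangle (cone s t) x0 (cone s' t').
  by rewrite (metric_sym x0); rewrite /cone in h1 h2 *; lra.
apply: (@lt_trans _ _ (e / 2)); last by lra.
apply: dH => //; [lra|lra|].
move: q0 q1 q0' q1'; set x := (t - s) / (1 - s); set y := (t' - s') / (1 - s').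
move=> q0 q1 q0' q1'.
move: ss tt; rewrite !ltr_norml => /andP[? ?] /andP[? ?].
have xE : x * (1 - s) = t - s by rewrite /x divfK// gt_eqF//; lra.
have yE : y * (1 - s') = t' - s' by rewrite /y divfK// gt_eqF//; lra.
have E : (x - y) * (1 - s) = (t - t') - (1 - y) * (s - s').
  have : (x - y) * (1 - s) = x * (1 - s) - y * (1 - s') - y * (s' - s) by lra.
  by rewrite xE yE; lra.
have b1 : (1 - y) * (s - s') < m by nra.
have b2 : - m < (1 - y) * (s - s') by nra.
have dd : d ^+ 2 = d * d by [].
apply/andP; split; rewrite ltNge; apply/negP => h; nra.
Qed.

End triangle.

Section simple_loops.
Context {R : realType}.
Implicit Types (a b c d l r s t u v : R).

Definition maximal_in (L E : R -> R -> Prop) := forall a b, E a b ->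
  (forall c d, L c d -> ~ crosses a b c d /\ ~ crosses c d a b) -> L a b.

(** A leaf that passes strictly over a boundary time of the region is not below it, hence contains
    [(l, r)]; so no leaf crosses a chord between two boundary times, and maximality applies. *)
Lemma boundary_chord (L E : R -> R -> Prop) l r u v : lamination L -> maximal_in L E ->
  L l r -> boundary L l r u -> boundary L l r v -> l <= u -> u <= v -> v <= r ->
  E u v -> L u v.
Proof.
move=> lamL mx Llr Bu Bv lu uv vr Euv.
have [l0 _ r1] := leaf_range lamL Llr.
have [->|ne] := eqVneq u v; first by apply: (leaf_refl lamL); lra.
have {ne} uv' : u < v by rewrite lt_neqAle ne.
apply: mx => // c d Lcd.
have outside w : boundary L l r w -> l <= w -> w <= r -> c < w -> w < d -> c <= l /\ r <= d.
  move=> Bw lw wr cw wd; have [] := leaf_cases lamL Llr Lcd ltac:(lra) ltac:(lra).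
  - lra.
  - lra.
  - by move=> /boundary_below/(_ Bw cw wd).
  - by move=> [[_ ? ? _]|[-> ->]]; lra.
rewrite /crosses; split=> -[? [? ?]].
  by have [] := outside v Bv ltac:(lra) vr ltac:(lra) ltac:(lra); lra.
by have [] := outside u Bu lu ltac:(lra) ltac:(lra) ltac:(lra); lra.
Qed.

Definition constant_on (T : Type) (p : R -> T) a b := forall x, a <= x -> x <= b -> p x = p a.

(** Without its intervals of constancy, the loop takes a value twice only at its two ends: it is a
    simple closed curve. *)
Lemma simple_loop_in_piece (X : metricType R) (P : set (set X)) (rho : R -> X) l r :
  disjointly_tree_graded R P -> continuous rho -> l < r -> rho l = rho r ->
  (forall s t, l <= s -> s <= t -> t <= r -> rho s = rho t ->
    constant_on rho s t \/ (constant_on rho l s /\ constant_on rho t r)) ->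
  constant_on rho l r \/ exists2 C, P C & forall t, l <= t -> t <= r -> C (rho t).
Proof.
move=> tg crho lr elr simple.
have [con|ncon] := pselect (constant_on rho l r); [by left|right].
have [|phi [al [[cphi cal] [p0 p1] pm pE peq]]] := monotone_factorization crho lr.
  apply: contrapT => nex; apply: ncon => x lx xr; apply: contrapT => ne; apply: nex.
  by exists x => //; apply/andP.
have inv y : 0 <= y -> y <= 1 -> exists t, [/\ l <= t, t <= r & phi t = y].
  move=> y0 y1; have := @IVT R phi l r y (ltW lr).
  rewrite p0 p1 (min_l ler01) (max_r ler01) y0 y1 => -[||t].
  - exact: continuous_subspaceT.
  - by [].
  - by rewrite in_itv /= => /andP[? ?] ?; exists t.
have inj y z : 0 <= y -> y < z -> z <= 1 -> al y = al z -> y = 0 /\ z = 1.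
  move=> y0 yz z1 E.
  have [s [ls sr sy]] := inv y y0 ltac:(lra); have [t [lt tr tz]] := inv z ltac:(lra) z1.
  have st : s <= t by rewrite leNgt; apply/negP => /ltW/pm; lra.
  have Est : rho s = rho t by rewrite !pE// sy tz.
  have [c|[c1 c2]] := simple s t ls st tr Est.
    by have := (peq s t st).2 c; lra.
  split; first by rewrite -sy -p0; apply/esym; apply/(peq l s ls) => x *; exact: c1.
  by rewrite -tz -p1; apply/(peq t r tr) => x *; exact: c2.
have caf a b : continuous (fun t : R => a * t + b).
  by apply: affine_continuous => t; exact: cvg_id.
have al01 : al 0 = al 1.
  by rewrite -p0 -{1}p1 -!pE// ltW.
(* The loop is cut at time [2^-1], and its second half is run backwards, so that both arcs have the
   same ends. *)
pose a1 u := al (2^-1 * u + 0); pose b1 u := al (- 2^-1 * u + 1).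
have [||||||s t s0 s1 t0 t1 E|D PD DC] := @arcs_in_piece R X P tg a1 b1.
- exact: comp_continuous cal.
- exact: comp_continuous cal.
- by move=> s t s0 st t1 /inj[]; lra.
- by move=> s t s0 st t1 /esym /inj[]; lra.
- rewrite /a1 /b1 !mulr0 !add0r; exact: al01.
- by rewrite /a1 /b1; congr al; lra.
- by have [] := inj _ _ _ _ _ E; lra.
exists D => // t lt tr; rewrite pE//.
have [y0 y1] : 0 <= phi t /\ phi t <= 1 by rewrite -p0 -p1 !pm.
have [h|h] := leP (phi t) 2^-1.
  have [] := DC (2 * phi t) ltac:(lra) ltac:(lra).
  by rewrite /a1 (_ : 2^-1 * (2 * phi t) + 0 = phi t)//; lra.
have [] := DC (2 - 2 * phi t) ltac:(lra) ltac:(lra).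
by rewrite /b1 (_ : - 2^-1 * (2 - 2 * phi t) + 1 = phi t)//; lra.
Qed.

Section value_lamination.
Context {X : metricType R} {P : set (set X)}.
Hypothesis tg : disjointly_tree_graded R P.
Variable p : R -> X.
Hypothesis cp : continuous p.

Definition same_value s t := [/\ 0 <= s, s <= t, t <= 1 & p s = p t].

Lemma same_value_closed a b :
  (forall d, 0 < d -> exists a' b', [/\ same_value a' b', a - d < a', a' < a + d,
    b - d < b' & b' < b + d]) -> same_value a b.
Proof.
move=> near; split.
- rewrite leNgt; apply/negP => h.
  by have [|a' [b' [[? ? ? _] ? ? ? ?]]] := near (- a); lra.
- rewrite leNgt; apply/negP => h.
  by have [|a' [b' [[? ? ? _] ? ? ? ?]]] := near ((a - b) / 2); lra.
- rewrite leNgt; apply/negP => h.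
  by have [|a' [b' [[? ? ? _] ? ? ? ?]]] := near (b - 1); lra.
- apply: (metric_hausdorff (R := R)) => U V Ua Vb.
  have [d d0 dU] := continuous_real_nbhs cp Ua.
  have [e e0 eV] := continuous_real_nbhs cp Vb.
  have [m m0 [md me]] := min2_gt0 d0 e0.
  have [a' [b' [[_ _ _ E] ? ? ? ?]]] := near m m0.
  by exists (p a'); split; [apply: dU; lra|rewrite E; apply: eV; lra].
Qed.

(** The restriction to a set [G] of intervals serves for laminations in which
    all leaves lie under given ones. *)
Lemma same_value_lamination (G : R -> R -> Prop) :
  (forall a b, (forall d, 0 < d -> exists a' b', [/\ G a' b', a - d < a', a' < a + d,
    b - d < b' & b' < b + d]) -> G a b) -> (forall a, G a a) ->
  exists L, [/\ lamination L,
    forall a b, L a b -> same_value a b /\ G a b &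
    maximal_in L (fun a b => same_value a b /\ G a b)].
Proof.
move=> cG Gd; apply: maximal_lamination.
- apply/(closed_box (fun a b => same_value a b /\ G a b)) => a b near; split.
    by apply: same_value_closed => d /near[a' [b' [[? _] ? ? ? ?]]]; exists a', b'.
  by apply: cG => d /near[a' [b' [[_ ?] ? ? ? ?]]]; exists a', b'.
- by move=> a b [[]].
- by move=> a a0 a1; split.
Qed.

(** Two boundary times with the same value are joined by a leaf. If it is a lower leaf, the region
    path is constant under it, otherwise it is [(l, r)]; so [simple_loop_in_piece] applies. *)
Lemma value_region_in_piece L l r : lamination L ->
  (forall a b, L a b -> same_value a b) -> L l r ->
  (forall u v, boundary L l r u -> boundary L l r v -> l <= u -> u <= v -> v <= r ->
     p u = p v -> L u v) ->
  constant_on (region_path L l r p) l r \/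
  exists2 C, P C & forall t, l <= t -> t <= r -> C (region_path L l r p t).
Proof.
move=> lamL LE Llr chord; have [l0 lr r1 plr] := LE _ _ Llr.
have gL a b : L a b -> p a = p b by move=> /LE[].
pose k := last_in (@boundary_closed R L l r) (@boundary_le R L l r).
have rpE t : region_path L l r p t = p (k t) by [].
have crp := region_path_continuous lamL cp gL.
have [->|ne] := eqVneq l r.
  by left => x rx xr; congr (region_path _ _ _ _ _); apply/eqP; rewrite eq_le rx xr.
have lr' : l < r by rewrite lt_neqAle ne.
apply: (simple_loop_in_piece tg (crp l r)) => //.
  by rewrite !region_path_boundary//; [exact: boundary_ge|exact: boundary_le].
move=> s t ls st tr; rewrite !rpE => E.
have ks : k s <= s := last_in_le _ _ _; have kt : k t <= t := last_in_le _ _ _.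
have Bs : boundary L l r (k s) := last_in_in _ _ _.
have Bt : boundary L l r (k t) := last_in_in _ _ _.
have lks : l <= k s by apply: last_in_ge ls; exact: boundary_le.
have kst : k s <= k t by exact: last_in_mono.
have Lk : L (k s) (k t).
  by apply: chord => //; exact: le_trans tr.
have [bel|nbel] := pselect (below L l r (k s) (k t)).
  left => x sx xt; have [xk|kx] := leP x (k t).
    rewrite (region_path_below lamL gL bel); [|lra|lra].
    by rewrite (region_path_below lamL gL bel (s := s)) //; lra.
  rewrite !rpE; have -> : k x = k t; last by rewrite E.
  apply/eqP; rewrite eq_le; apply/andP; split; first exact: last_in_mono.
  by apply: last_in_ge => //; exact: ltW.
have kl : k s = l /\ k t = r.
  have [h|h] := ltP l (k s).
    by case: nbel; split=> //; [lra|left].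
  have [h'|h'] := ltP (k t) r; first by case: nbel; split=> //; [lra|right].
  by split; apply/eqP; rewrite eq_le; apply/andP; split=> //; lra.
right; split=> x.
  move=> lx xs; rewrite !rpE; have Kl : k l = l by apply: last_in_id; exact: boundary_le.
  rewrite Kl; congr p; apply/eqP; rewrite eq_le; apply/andP; split.
    by rewrite -kl.1; exact: last_in_mono.
  by apply: last_in_ge lx; exact: boundary_le.
by move=> tx xr; congr (region_path _ _ _ _ _); have [_ ?] := kl; lra.
Qed.

End value_lamination.
End simple_loops.

Lemma metrizable_subspace (R : realType) (Y : topologicalType) (A : set Y) :
  metrizable R Y -> metrizable R (set_type A).
Proof.
move=> [M [h [g [ch cg hK gK]]]]; exists (set_type (h @` A)).
have hA (x : A) : (h @` A) (h (set_val x)) by exists (set_val x) => //; exact: set_valP.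
have gA (y : h @` A) : A (g (set_val y)).
  by have [x Ax E] := set_valP y; rewrite -[set_val y]E hK.
exists (fun x => SigSub (mem_set (hA x))), (fun y => SigSub (mem_set (gA y))); split.
- apply: continuous_to_set_type; apply: comp_continuous ch; exact: continuous_set_val.
- apply: continuous_to_set_type; apply: comp_continuous cg; exact: continuous_set_val.
- by move=> x; apply: val_inj; rewrite /= hK.
- by move=> y; apply: val_inj; rewrite /= gK.
Qed.

Lemma clamp_lipschitz (R : realType) (x y d : R) : `|x - y| < d ->
  `|Num.max 0 (Num.min x 1) - Num.max 0 (Num.min y 1)| < d.
Proof.
have cl (z : R) : Num.max 0 (Num.min z 1) = if z <= 0 then 0 else if 1 <= z then 1 else z.
  case: (ltP 0 z) => z0.
    by case: (leP 1 z) => z1; apply: max_r; lra.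
  by rewrite min_l ?max_l//; lra.
rewrite !cl !ltr_norml => /andP[? ?].
case: (leP x 0) => ?; case: (leP y 0) => ?; try case: (leP 1 x) => ?; try case: (leP 1 y) => ?;
  apply/andP; split; lra.
Qed.

(** * Sweeping a filling from the diagonal to the starts of the gaps *)

Section sweep.
Context {R : realType} {M : metricType R}.
Variables (fl : R -> R -> M) (g : R -> M) (L : R -> R -> Prop) (k : R -> R) (Kc : set R).
Hypothesis cg : continuous g.
Hypothesis fU : forall e : R, 0 < e -> exists2 d, 0 < d & forall s t s' t', s <= t -> s' <= t' ->
  covered L (Num.min s s') (Num.max t t') -> `|s - s'| < d -> `|t - t'| < d ->
  mdist (fl s t) (fl s' t') < e.
Hypothesis fl_refl : forall s, 0 <= s -> s <= 1 -> fl s s = g s.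
Hypothesis fl_right : forall a b s, L a b -> a <= s -> s <= b -> fl s b = g a.
Hypothesis gL : forall a b, L a b -> g a = g b.
Hypothesis Lr : forall a b, L a b -> [/\ 0 <= a, a <= b & b <= 1].
Hypothesis gap_of : forall u, ~ Kc u -> exists2 b, u < b &
  L (k u) b /\ (forall u', k u < u' -> u' < b -> k u' = k u).
Hypothesis kK : forall u, Kc u -> k u = u.
Hypothesis nK : forall u, ~ Kc u -> k u < u.
Hypothesis k0 : forall u, 0 <= u -> 0 <= k u.

(** This is the homotopy from [g] to [g \o k]: the left end of a chord moves from [w] back to the
    start [k w] of the gap around [w]. The jumps of [k] do no harm, since chords that end at the
    right end of a gap all have the same value. *)
Lemma sweep_continuous (w0 v0 e : R) (S := fun w v => fl (w - v * (w - k w)) w) :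
  0 <= w0 -> w0 <= 1 -> 0 <= v0 -> v0 <= 1 -> 0 < e ->
  exists2 d, 0 < d & forall w v, 0 <= w -> w <= 1 -> 0 <= v -> v <= 1 ->
    `|w - w0| < d -> `|v - v0| < d -> mdist (S w v) (S w0 v0) < e.
Proof.
have S_K w v : 0 <= w -> w <= 1 -> Kc w -> S w v = g w.
  by move=> w0' w1 Kw; rewrite /S (kK Kw) subrr mulr0 subr0; exact: fl_refl.
move=> w00 w01 v00 v01 e0.
have [d d0 dfl] := fU (e := e / 2) ltac:(lra).
have [d' d'0 dg] := @segment_unif_continuous R M g 0 1 cg (e / 2) ltac:(lra).
have covL a b s t s' t' : L a b -> a <= s -> a <= s' -> t <= b -> t' <= b ->
    covered L (Num.min s s') (Num.max t t').
  by move=> Lab *; exists a, b; split=> //; rewrite ?le_min ?ge_max; apply/andP.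
have [Kw0|nKw0] := pselect (Kc w0); last first.
  have [b wb [Lkb kE]] := gap_of nKw0.
  have kw0 : k w0 < w0.
    exact: nK.
  have [m m0 [m1 m2 m3]] := @min3_gt0 R (w0 - k w0) (b - w0) (d / 2) ltac:(lra) ltac:(lra) ltac:(lra).
  exists m => // w v w0' w1 v0' v1; rewrite !ltr_norml => /andP[? ?] /andP[? ?].
  have kw : k w = k w0 by apply: kE; lra.
  rewrite /S kw; set a := k w0 in kw0 kw Lkb m1 *.
  apply: (@lt_trans _ _ (e / 2)); last by lra.
  have [p1 p2] : w - v * (w - a) <= w /\ a <= w - v * (w - a) by split; nra.
  have [p3 p4] : w0 - v0 * (w0 - a) <= w0 /\ a <= w0 - v0 * (w0 - a) by split; nra.
  apply: dfl => //; first by apply: (covL a b) => //; lra.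
    have a1 : w0 - a <= 1 by have := k0 w00; rewrite -/a; lra.
    have E : w - v * (w - a) - (w0 - v0 * (w0 - a)) = (w - w0) * (1 - v) - (v - v0) * (w0 - a).
      by lra.
    have [q1 q2] : (w - w0) * (1 - v) < m /\ - m < (w - w0) * (1 - v) by split; nra.
    have [q3 q4] : (v - v0) * (w0 - a) < m /\ - m < (v - v0) * (w0 - a) by split; nra.
    by rewrite E ltr_norml; apply/andP; split; lra.
  by rewrite ltr_norml; apply/andP; split; lra.
rewrite (S_K w0)//; have [m m0 [m1 m2]] := min2_gt0 d0 d'0.
exists m => // w v w0' w1 v0' v1; rewrite !ltr_norml => /andP[? ?] _.
have [Kw|nKw] := pselect (Kc w).
  by rewrite S_K//; apply: (@lt_trans _ _ (e / 2));
    [apply: dg; rewrite // ltr_norml; apply/andP; split; lra|lra].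
have [b wb [Lkb kE]] := gap_of nKw.
have [a0 _ b1] := Lr Lkb.
have kw : k w < w.
  exact: nK.
rewrite /S; set a := k w in kw Lkb a0 *; set s := w - v * (w - a).
have [p1 p2] : s <= w /\ a <= s by rewrite /s; split; nra.
have [h1|h1] := leP w0 a.
  have f1 : mdist (fl s w) (fl a a) < e / 2.
    apply: dfl => //; first by apply: (covL a b) => //; lra.
      by rewrite ltr_norml; apply/andP; split; lra.
    by rewrite ltr_norml; apply/andP; split; lra.
  have f2 : mdist (g a) (g w0) < e / 2.
    by apply: dg; rewrite ?ltr_norml; try (apply/andP; split); lra.
  have faa : fl a a = g a by apply: fl_refl; lra.
  by have := metric_triangle (fl s w) (g a) (g w0); rewrite faa in f1; lra.
(* Here [w] approaches [w0] from inside a gap that ends at [b <= w0]. The chord is moved to end at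
   [b], where its left end has no influence on the value. *)
have bw0 : b <= w0.
  rewrite leNgt; apply/negP => w0b.
  have kw0a := kE w0 h1 w0b.
  have kw0 := kK Kw0.
  by move: h1; rewrite /a -kw0a kw0 ltxx.
have f1 : mdist (fl s w) (fl s b) < e / 2.
  apply: dfl => //; [lra|by apply: (covL a b) => //; lra| |].
    by rewrite subrr normr0.
  by rewrite ltr_norml; apply/andP; split; lra.
have f2 : mdist (g b) (g w0) < e / 2.
  by apply: dg; rewrite ?ltr_norml; try (apply/andP; split); lra.
have fsb : fl s b = g b.
  rewrite -(gL Lkb); apply: (fl_right Lkb); lra.
by have := metric_triangle (fl s w) (g b) (g w0); rewrite fsb in f1; lra.
Qed.

End sweep.

Section chi_retract.
Context {R : realType} {X : metricType R} {P : set (set X)}.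
Hypothesis tg : disjointly_tree_graded R P.
Context {Z : topologicalType} (q : X -> Z).
Hypotheses (mZ : metrizable R Z) (cq : continuous q).
Variables (C : set X) (PC : P C).
Hypothesis q_const : forall C', P C' -> C' <> C -> forall x y, C' x -> C' y -> q x = q y.

Let cqr (p : R -> X) : continuous p -> continuous (fun u => q (ret tg PC (p u))).
Proof.
move=> cp; have cr := @ret_continuous R X P tg C PC.
have crp : continuous (fun u => ret tg PC (p u)) := comp_continuous cp cr.
exact: (comp_continuous crp cq).
Qed.

(** Every excursion of [p] from [C] is contracted along a maximal lamination: its
    regions are mapped by [p] into pieces, hence to points by [q]. *)
Let chi_retract01 (p : R -> X) : continuous p -> C (p 0) -> C (p 1) ->
  chi (fun u => q (p u)) 0 1 = chi (fun u => q (ret tg PC (p u))) 0 1.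
Proof.
move=> cp C0 C1; pose G a b := forall u, a < u -> u < b -> ~ C (p u).
have [L [lamL LE mx]] : exists L, [/\ lamination L,
    forall a b, L a b -> same_value p a b /\ G a b &
    maximal_in L (fun a b => same_value p a b /\ G a b)].
  apply: (same_value_lamination cp); last by move=> a u; lra.
  move=> a b near u au ub.
  have [m m0 [m1 m2]] := @min2_gt0 R (u - a) (b - u) ltac:(lra) ltac:(lra).
  have [a' [b' [Gab ? ? ? ?]]] := near m m0.
  by apply: Gab; lra.
have [M [h [h' [ch ch' hK h'K]]]] := mZ.
pose g u := h (q (p u)).
have cg : continuous g by apply: comp_continuous ch; exact: comp_continuous cq.
have gL a b : L a b -> g a = g b by move=> /LE[[_ _ _ E] _]; rewrite /g E.
have pL a b : L a b -> p a = p b by move=> /LE[[_ _ _ E] _].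
(* One value per region is enough: [q \o p] is constant on the boundary of each region, as shown in
   [F_below]. *)
pose F (l r s t : R) := g l.
have F_below l r a b s t : L l r -> below L l r a b -> a <= s -> s <= t -> t <= b ->
    F l r s t = region_path L l r g s.
  move=> Llr bel as_ st tb; have [[l0 lr r1 plr] off] := LE _ _ Llr.
  have [Lab la br _] := bel.
  pose k := last_in (@boundary_closed R L l r) (@boundary_le R L l r).
  have rpE u : region_path L l r p u = p (k u) by [].
  have [kl kr] : l <= k s /\ k s <= r.
    split; first by apply: last_in_ge; [exact: boundary_le|lra].
    by apply: (le_trans (last_in_le _ _ _)); lra.
  have kll : k l = l by apply: last_in_id; exact: boundary_le.
  suff E : q (p l) = q (p (k s)) by rewrite /F /g E.
  have LE' a' b' : L a' b' -> same_value p a' b' by move=> /LE[].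
  have [|con|[C' PC' CC']] := value_region_in_piece tg cp lamL LE' Llr.
  - move=> u v Bu Bv lu uv vr puv; apply: (boundary_chord lamL mx Llr) => //.
    split; first by split=> //; lra.
    by move=> w uw wv; apply: off; lra.
  - by rewrite -rpE (con s) ?rpE ?kll//; lra.
  (* [q] is constant on the pieces other than [C]. If the region lies in [C], then [k s] is an end
     of the leaf, because [p] is off [C] strictly under it. *)
  have [E|ne] := pselect (C' = C); last first.
    apply: (q_const PC') => //.
      by rewrite -{1}kll -rpE; exact: CC'.
    by rewrite -rpE; apply: CC'; lra.
  have [h1|h1] := ltP l (k s); last first.
    by congr (q (p _)); apply/eqP; rewrite eq_le kl h1.
  have [h2|h2] := ltP (k s) r; last first.
    by rewrite plr; congr (q (p _)); apply/eqP; rewrite eq_le kr h2.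
  case: (off (k s)) => //; rewrite -E -rpE; apply: CC'; lra.
have F_equi : equicontinuous_leaves L F.
  move=> e e0; exists 1 => // l r s t s' t' *; by rewrite mdistxx.
pose fl := fill L g F.
have fU := fill_unif_continuous lamL cg gL (F := F) (fun l r t _ _ _ => erefl)
  (fun l r t _ _ _ => erefl) F_below F_equi.
pose Kc := [set t : R | t <= 0 \/ 1 <= t \/ C (p t)].
have cKc : closed Kc.
  rewrite (_ : Kc = [set t | t <= 0] `|` ([set t | 1 <= t] `|` p @^-1` C)).
    apply: closedU; first exact: closed_le.
    apply: closedU; first exact: closed_ge.
    by apply: closed_comp (dtg_closed tg PC) => t _; exact: cp.
  by apply/seteqP; split=> t.
have Kle t : t <= 0 -> Kc t by left.
have Kge t : 1 <= t -> Kc t by right; left.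
pose k := last_in cKc Kle.
have KC t : Kc t -> 0 <= t -> t <= 1 -> C (p t).
  move=> [?|[?|//]] t0 t1; first by have -> : t = 0 by lra.
  by have -> : t = 1 by lra.
have gapL a b : is_gap Kc a b -> [/\ L a b, 0 <= a & b <= 1].
  move=> [ab Ka Kb nK].
  have a0 : 0 <= a.
    rewrite leNgt; apply/negP => h0.
    have [m m0 [m1 m2]] := @min2_gt0 R (- a) ((b - a) / 2) ltac:(lra) ltac:(lra).
    by apply: (nK (a + m)); [lra|lra|left; lra].
  have b1 : b <= 1.
    rewrite leNgt; apply/negP => h0.
    have [m m0 [m1 m2]] := @min2_gt0 R (b - 1) ((b - a) / 2) ltac:(lra) ltac:(lra).
    by apply: (nK (b - m)); [lra|lra|right; left; lra].
  have Ca : C (p a) by apply: KC => //; lra.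
  have Cb : C (p b) by apply: KC => //; lra.
  have off u : a < u -> u < b -> ~ C (p u).
    by move=> au ub Cu; apply: (nK u) => //; right; right.
  (* A gap closes up because its ends are in [C], and a leaf that crosses it would pass over one of
     these ends; so the gap is a leaf by maximality. *)
  have pab := excursion tg PC cp ab Ca Cb off.
  split=> //; apply: mx; first by split=> //; split=> //; lra.
  move=> c d /LE[_ offcd]; rewrite /crosses; split=> -[? [? ?]].
    exact: (offcd b).
  exact: (offcd a).
(* The degenerate chord at [u] grows to the chord from [k u] to [u]. These have the values [g u] and
   [g (k u)], and the latter is the value after retraction, as [p] is off [C] after [k u]. *)
pose H (z : R * R) := let u := Num.max 0 (Num.min z.1 1) in
  fl (u - Num.max 0 (Num.min z.2 1) * (u - k u)) u.
have clamp01 (u : R) : 0 <= Num.max 0 (Num.min u 1) /\ Num.max 0 (Num.min u 1) <= 1.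
  by rewrite le_max lexx ge_max ler01 ge_min lexx orbT.
have clampE (u : R) : 0 <= u -> u <= 1 -> Num.max 0 (Num.min u 1) = u.
  by move=> u0 u1; rewrite min_l ?max_r.
have cclamp : continuous (fun u : R => Num.max 0 (Num.min u 1)).
  move=> t; apply: (@continuous_max _ _ (cst 0) (fun r : R => Num.min r 1)); first exact: cvg_cst.
  by apply: (@continuous_min _ _ id (cst 1)); [exact: cvg_id|exact: cvg_cst].
have k0 u : 0 <= u -> 0 <= k u by move=> u0; exact: (last_in_ge cKc Kle (Kle _ (lexx 0)) u0).
have ku u : k u <= u by exact: last_in_le.
have gap_of u : ~ Kc u -> exists2 b, u < b & L (k u) b /\ (forall u', k u < u' -> u' < b -> k u' = k u).
  move=> nKu; have [b ub gap] := last_in_gap cKc Kle Kge nKu.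
  have [Lkb _ _] := gapL _ _ gap; exists b => //; split=> // u' ku' u'b.
  have [_ Kk _ nK] := gap.
  apply/eqP; rewrite eq_le; apply/andP; split; last first.
    by apply: last_in_ge (ltW ku').
  rewrite leNgt; apply/negP => kk; apply: (nK (k u')) => //; last exact: last_in_in.
  exact: le_lt_trans (ku u') u'b.
pose S w v := fl (w - v * (w - k w)) w.
have kK u : Kc u -> k u = u by exact: last_in_id.
have nK u : ~ Kc u -> k u < u.
  move=> nKu; rewrite lt_neqAle ku andbT; apply/eqP => E; apply: nKu; rewrite -E.
  exact: last_in_in.
have flr s : 0 <= s -> s <= 1 -> fl s s = g s by move=> *; exact: fill_refl.
have flR a b s : L a b -> a <= s -> s <= b -> fl s b = g a.
  by move=> Lab *; apply: (fill_right lamL gL _ Lab).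
have cH : continuous H.
  move=> [u0 v0] U /nbhs_ballP[e /= e0 eU].
  have [[a0 a1] [b0 b1]] := (clamp01 u0, clamp01 v0).
  have [d d0 dS] := sweep_continuous cg fU flr flR
  gL (leaf_range lamL) gap_of kK nK k0 a0 a1 b0 b1 e0.
  apply/nbhs_box; exists d => // u v ? ? ? ?; apply: eU.
  rewrite ballEmdist /= metric_sym; have [c0 c1] := clamp01 u; have [f0 f1] := clamp01 v.
  apply: dS => //; apply: clamp_lipschitz; rewrite /= ltr_norml; apply/andP; split; lra.
have Hg z : exists y, H z = g y.
  rewrite /H /fl /fill; case: pselect => [ex|_]; last by eexists.
  by rewrite /F; eexists.
pose K z := q (p (sval (cid (Hg z)))).
have KE z : K z = h' (H z).
  by rewrite /K; case: (cid _) => y /= ->; rewrite /g hK.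
have cK : continuous K.
  by rewrite (_ : K = fun z => h' (H z)); [exact: comp_continuous ch'|exact/funext].
have k_end u : u = 0 \/ u = 1 -> k u = u.
  by move=> [->|->]; apply: last_in_id; [exact: (Kle _ (lexx _))|exact: (Kge _ (lexx _))].
have HE0 u : 0 <= u -> u <= 1 -> H (u, 0) = g u.
  move=> u0 u1; rewrite /H /= !clampE// mul0r subr0.
  exact: fill_refl.
have HE1 u : 0 <= u -> u <= 1 -> H (u, 1) = g (k u).
  move=> u0 u1; rewrite /H /= !clampE// mul1r subKr.
  have [Ku|nKu] := pselect (Kc u).
    have -> : k u = u by exact: last_in_id.
    exact: fill_refl.
  have [b ub gap] := last_in_gap cKc Kle Kge nKu.
  have [Lkb _ _] := gapL _ _ gap.
  by apply: (fill_left lamL _ Lkb) => //; exact: ltW.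
have Hend u v : u = 0 \/ u = 1 -> H (u, v) = g u.
  move=> u01; have [u0 u1] : 0 <= u /\ u <= 1 by case: u01 => ->; rewrite ?lexx ?ler01.
  by rewrite /H /= clampE// k_end// subrr mulr0 subr0 flr.
have retE u : 0 <= u -> u <= 1 -> q (ret tg PC (p u)) = q (p (k u)).
  move=> u0 u1; have Ck : C (p (k u)).
    apply: KC; [exact: last_in_in|exact: k0|exact: le_trans (ku u) u1].
  rewrite -(ret_path tg PC cp (ku u)) ?ret_id// => t kt tu Ct.
  by apply: (last_in_after kt tu); right; right.
apply: (@chi_homotopic _ _ _ _ _ _ _ _ K).
- exact: comp_continuous cq.
- exact: cqr.
- exact: cK.
- by move=> u u0 u1; rewrite KE HE0// /g hK subr0 mul1r add0r.
- by move=> u u0 u1; rewrite KE HE1// /g hK subr0 mul1r add0r retE.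
- by move=> v v0 v1; rewrite KE Hend ?/g ?hK//; left.
- by move=> v v0 v1; rewrite KE Hend ?/g ?hK//; right.
Qed.

Lemma chi_retract (p : R -> X) s t : continuous p -> s <= t -> C (p s) -> C (p t) ->
  chi (fun u => q (p u)) s t = chi (fun u => q (ret tg PC (p u))) s t.
Proof.
move=> cp st Cs Ct; pose a u := (t - s) * u + s.
have ca : continuous a by apply: affine_continuous => x; exact: cvg_id.
have a0 : a 0 = s by rewrite /a mulr0 add0r.
have a1 : a 1 = t by rewrite /a mulr1 subrK.
have cq1 : continuous (fun u => q (p u)) by exact: comp_continuous cq.
have cq2 : continuous (fun u => q (ret tg PC (p u))).
  exact: cqr.
rewrite -{1 2}a0 -{1 2}a1 -!chi_comp//.
apply: (@chi_retract01 (fun u => p (a u))); rewrite ?a0 ?a1//.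
exact: comp_continuous cp.
Qed.

End chi_retract.

(** A groupoid of increments along paths of a tree-graded space that comes from
    potentials, locally and on every piece, comes from a global potential. *)
Section local_potentials.
Context {R : realType} {X : metricType R} {P : set (set X)} {G : groupType}.
Hypothesis tg : disjointly_tree_graded R P.
Local Open Scope group_scope.
Variable N : (R -> X) -> R -> R -> G.

Definition potential_on (V : set X) := exists h : X -> G, forall q : R -> X, continuous q ->
  forall a b : R, (forall u, (a < u)%R -> (u < b)%R -> V (q u)) ->
  forall s t, (a < s)%R -> (s < b)%R -> (a < t)%R -> (t < b)%R -> N q s t = (h (q s))^-1 * h (q t).

Hypothesis NM : forall (q : R -> X) s t u, continuous q -> N q s t * N q t u = N q s u.
Hypothesis N_near : forall y : X, exists2 V, nbhs y V & potential_on V.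
Hypothesis N_piece : forall C, P C -> forall q, continuous q -> forall s t, (s <= t)%R ->
  (forall u, (s <= u)%R -> (u <= t)%R -> C (q u)) -> q s = q t -> N q s t = 1.

Lemma N_refl q s : continuous q -> N q s s = 1.
Proof. by move=> cq; apply: (mulIg (N q s s)); rewrite NM// mul1g. Qed.

Let N_const q s t : continuous q -> (s <= t)%R -> constant_on q s t -> N q s t = 1.
Proof.
move=> cq st con; pose E a b := (s <= a)%R -> (b <= t)%R -> N q a b = 1.
suff : E s t by apply.
apply: interval_chain (st) => [a b c ab bc E1 E2 sa ct|x].
  by rewrite -(NM a b c cq) E1 ?E2 ?mulg1//; [exact: le_trans ab|exact: le_trans ct].
have [V nV [h hV]] := N_near (q x).
have [d d0 dV] := continuous_real_nbhs cq nV.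
exists d => // a b xa ab bx sa bt.
rewrite (hV q cq (x - d)%R (x + d)%R dV) ?(con a) ?(con b) ?mulVg//; lra.
Qed.

(** The same local potential serves near both times, so that moving the ends conjugates the
    increment. *)
Let N_locally q a b : continuous q -> q a = q b -> exists2 d : R, (0 < d)%R &
  forall a' b', (a - d < a')%R -> (a' < a + d)%R -> (b - d < b')%R -> (b' < b + d)%R ->
    q a' = q b' -> N q a' b' = 1 <-> N q a b = 1.
Proof.
move=> cq qab; have [V nV [h hV]] := N_near (q a).
have [d1 d10 dV1] := continuous_real_nbhs cq nV.
rewrite qab in nV; have [d2 d20 dV2] := continuous_real_nbhs cq nV.
have [d d0 [m1 m2]] := min2_gt0 d10 d20.
exists d => // a' b' ? ? ? ? E.
have -> : N q a' b' = (N q a a')^-1 * N q a b * N q a a'.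
  rewrite -(NM a' a b' cq) -(NM a b b' cq) mulgA.
  have -> : N q a' a = (N q a a')^-1.
    by apply: (mulgI (N q a a')); rewrite NM// N_refl// mulgV.
  congr (_ * _).
  rewrite (hV q cq (a - d1)%R (a + d1)%R dV1 a a'); [|lra..].
  rewrite (hV q cq (b - d2)%R (b + d2)%R dV2 b b'); [|lra..].
  by rewrite qab E.
split=> [/(congr1 (fun g => N q a a' * g * (N q a a')^-1))|->].
  by rewrite !mulgA mulgV mul1g mulgK mulg1 mulgV.
by rewrite mulg1 mulVg.
Qed.

(** Locally both sides are differences of one potential at equal values; where [k] jumps, the
    skipped gap has trivial increment. *)
Let N_gaps q rho l r (K : set R) (cK : closed K) (Kl : forall t, (t <= l)%R -> K t)
    (k := last_in cK Kl) :
  continuous q -> continuous rho -> (forall t, (r <= t)%R -> K t) ->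
  (forall t, rho t = q (k t)) ->
  (forall a b, is_gap K a b -> q a = q b /\ N q a b = 1) ->
  forall s t, (s <= t)%R -> N rho s t = N q (k s) (k t).
Proof.
move=> cq crho Kr rhoE gapN; apply: interval_chain => [s t u st tu|x].
  by move=> E1 E2; rewrite -(NM s t u crho) E1 E2 NM.
have [V nV [h hV]] := N_near (rho x).
have [d1 d10 dV1] := continuous_real_nbhs crho nV.
rewrite rhoE in nV; have [d2 d20 dV2] := continuous_real_nbhs cq nV.
have [e e0 eP] := last_in_near cK Kl Kr x d20.
have [d d0 [m1 m2]] := min2_gt0 d10 e0.
have near t : (x - d < t)%R -> (t < x + d)%R -> exists b, [/\ (k x - d2 < b)%R, (b < k x + d2)%R,
    q (k t) = q b & N q (k t) b = 1].
  move=> xt tx; have [b [_ ? ? _ C]] := eP t ltac:(lra) ltac:(lra).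
  exists b; split=> //; case: C => [->//|[/gapN[]//]].
  exact: N_refl.
exists d => // s t xs st tx.
have [b [? ? qb Nb]] := near s xs ltac:(lra).
have [c [? ? qc Nc]] := near t ltac:(lra) tx.
rewrite -(NM (k s) b (k t) cq) Nb mul1g -(NM b c (k t) cq).
have -> : N q c (k t) = 1.
  by apply: (mulgI (N q (k t) c)); rewrite NM// N_refl// Nc mulg1.
rewrite mulg1 (hV q cq (k x - d2)%R (k x + d2)%R dV2) //.
rewrite (hV rho crho (x - d1)%R (x + d1)%R dV1); [|lra..].
by rewrite !rhoE qb qc.
Qed.

(** Otherwise a shortest leaf with nontrivial increment exists, since these leaves form a compact
    set by [N_locally]. All leaves below it are trivial, so its increment is that of its region
    path, which is constant or a loop in a piece. *)
Lemma loop_potential (q : R -> X) : continuous q -> q 0%R = q 1%R -> N q 0%R 1%R = 1.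
Proof.
move=> cq q01; apply: contrapT => nN.
have [L [lamL LE mx]] := same_value_lamination cq (G := fun _ _ => True)
  (fun _ _ _ => I) (fun _ => I).
have LE' a b : L a b -> same_value q a b by move=> /LE[].
have gL a b : L a b -> q a = q b by move=> /LE'[].
have L01 : L 0%R 1%R.
  apply: mx; first by split=> //; split=> //; exact: ler01.
  by move=> c d /LE'[? ? ? _]; rewrite /crosses; split; lra.
pose B := [set z : R * R | L z.1 z.2 /\ N q z.1 z.2 <> 1].
have cB : compact B.
  apply: (@subclosed_compact _ _ (`[0%R : R, 1%R]%classic `*` `[0%R : R, 1%R]%classic)).
  - apply/(closed_box (fun a b => L a b /\ N q a b <> 1)) => a b near.
    have Lab : L a b.
      apply: ((closed_box L).1 (leaf_closed lamL)) => d /near[a' [b' [[? _] ? ? ? ?]]].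
      by exists a', b'.
    split=> // Nab; have [d d0 dN] := N_locally cq (gL _ _ Lab).
    have [a' [b' [[Lab' nN'] ? ? ? ?]]] := near d d0.
    by apply: nN'; apply/(dN a' b'); rewrite ?(gL _ _ Lab').
  - by apply: compact_setX; exact: segment_compact.
  - move=> [a b] /= [/(leaf_range lamL)[/= a0 ab b1] _].
    by split; rewrite /= in_itv /=; apply/andP; split; lra.
have B0 : B !=set0 by exists (0%R, 1%R).
have cd : {within B, continuous (fun z : R * R => (z.2 - z.1)%R)}.
  apply: continuous_subspaceT => z.
  by apply: cvgB; [exact: cvg_snd|exact: cvg_fst].
have [[l r]] := compact_EVT_min B0 cB cd; rewrite inE /= => -[Llr nNlr] mn.
have shorter a b : L a b -> (b - a < r - l)%R -> N q a b = 1.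
  move=> Lab ab; apply: contrapT => nNab.
  by have := mn (a, b); rewrite inE /= => /(_ (conj Lab nNab)); lra.
have [l0 lr r1 qlr] := LE' _ _ Llr.
pose k := last_in (@boundary_closed R L l r) (@boundary_le R L l r).
have crp := region_path_continuous lamL cq gL (l := l) (r := r).
have gapN a b : is_gap (boundary L l r) a b -> q a = q b /\ N q a b = 1.
  move=> gap; have [Lab la br] := gap_leaf lamL gap; have qab := gL _ _ Lab; split=> //.
  (* The leaf over a gap might be [(l, r)] itself, so minimality is applied to leaves strictly below
     that converge to it. *)
  have [d d0 dN] := N_locally cq qab.
  have [ab _ _ _] := gap.
  have [m m0 [m1 m2]] := @min2_gt0 R d ((b - a) / 2)%R d0 ltac:(lra).
  have [c [c' [[Lcc lc cr str] ? ? ? ?]]] :=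
    gap_exhausted lamL gap (s := a + m) (t := b - m) ltac:(lra) ltac:(lra) ltac:(lra).
  have [c0 cc' c1] := leaf_range lamL Lcc.
  apply/(dN c c'); [lra|lra|lra|lra|exact: gL|].
  by apply: shorter => //; case: str; lra.
have comp := N_gaps cq crp (@boundary_ge R L l r) (fun _ => erefl) gapN lr.
have kl : k l = l by apply: last_in_id; exact: boundary_le.
have kr : k r = r by apply: last_in_id; exact: boundary_ge.
rewrite -/k kl kr in comp; apply: nNlr; rewrite -comp.
have [|con|[C PC CC]] := value_region_in_piece tg cq lamL LE' Llr.
- move=> u v Bu Bv lu uv vr quv; apply: (boundary_chord lamL mx Llr) => //.
  by split=> //; split=> //; lra.
- exact: N_const.
- by apply: (N_piece PC) => //; rewrite /region_path -/k kl kr.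
Qed.

End local_potentials.

(** * Words of paths *)

Section piece_retraction.
Context {R : realType} {T : topologicalType} {P : set (set T)}.
Hypothesis tg : disjointly_tree_graded R P.
Variables (C : set T) (PC : P C).

Lemma ret_Pc x : Pc P (ret tg PC x).
Proof. by exists C => //; exact: ret_in. Qed.

Definition ret_to_Pc (x : T) : Pc P := SigSub (mem_set (ret_Pc x)).

Lemma ret_to_Pc_val x : set_val (ret_to_Pc x) = ret tg PC x.
Proof. by []. Qed.

Lemma ret_to_Pc_continuous : continuous ret_to_Pc.
Proof. by apply: continuous_to_set_type; exact: (@ret_continuous R T P tg C PC). Qed.

Lemma ret_to_Pc_comp (p : R -> T) : continuous p -> continuous (fun u => ret_to_Pc (p u)).
Proof. by move=> cp; exact: (comp_continuous cp (@ret_to_Pc_continuous)). Qed.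

Lemma eq_ret_to_Pc x y : ret tg PC x = ret tg PC y -> ret_to_Pc x = ret_to_Pc y.
Proof. by move=> E; apply: val_inj. Qed.

Lemma ret_to_Pc_off (p : R -> T) (a b : R) : continuous p -> a <= b ->
  (forall t, a < t -> t <= b -> ~ C (p t)) -> ret_to_Pc (p a) = ret_to_Pc (p b).
Proof. by move=> cp ab off; apply: eq_ret_to_Pc; exact: ret_path. Qed.

End piece_retraction.

Section letters.
Context {R : realType} {X : metricType R} {Y : topologicalType}.
Context {P : set (set X)} {Q : set (set Y)} {f : continuousType X Y}.
Hypotheses (tgX : disjointly_tree_graded R P) (tgY : disjointly_tree_graded R Q).
Hypotheses (fPQ : maps_pieces_into_pieces P Q f) (fsep : distinct_pieces_separated P Q f).
Local Open Scope group_scope.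
Implicit Types (C : set X) (s t u : R).

Definition Pc_map : Pc P -> Pc Q := set_restr (maps_Pc_into_Pc fPQ).

Lemma Pc_map_continuous : continuous Pc_map.
Proof. exact: set_restr_continuous. Qed.

Definition path_group : groupType := group_product (fun b : Pc Q => pi1 R b).
(** Letters for [X] and for [Y] are both indexed by pieces of [X], which identifies the pieces of
    [Y] that matter with their sources. All subsets of [X] are allowed as indices; those that are no
    pieces get trivial letters. *)
Definition pieces_group : groupType := free_product (set X) path_group.

Definition target C (PC : P C) : set Y := sval (cid2 (fPQ PC)).

Lemma targetQ C (PC : P C) : Q (target PC).
Proof. by rewrite /target; case: cid2. Qed.

Lemma target_sub C (PC : P C) x : C x -> target PC (f x).
Proof. by rewrite /target; case: cid2 => D /= _ CD Cx; apply: CD; exists x. Qed.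

Lemma target_inj C C' (PC : P C) (PC' : P C') y :
  target PC y -> target PC' y -> C = C'.
Proof.
move=> Dy Dy'; have E := piece_unique tgY (targetQ PC) (targetQ PC') Dy Dy'.
apply: (fsep PC PC' (targetQ PC)).
  by move=> _ [x Cx <-]; exact: target_sub.
by move=> _ [x Cx <-]; rewrite E; exact: target_sub.
Qed.

Definition target_set C : set Y := if pselect (P C) is left PC then target PC else set0.

Lemma target_setE C (PC : P C) : target_set C = target PC.
Proof. by rewrite /target_set; case: pselect => [PC'|//]; rewrite (Prop_irrelevance PC' PC). Qed.

Definition letterX C (q : R -> X) s t : pieces_group :=
  if pselect (P C) is left PC
  then letter C (chi (fun u => Pc_map (ret_to_Pc tgX PC (q u))) s t) else 1.

Definition letterY C (r : R -> Y) s t : pieces_group :=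
  if pselect (P C) is left PC
  then letter C (chi (fun u => ret_to_Pc tgY (targetQ PC) (r u)) s t) else 1.

(** The discrepancy at [x] between retracting after [f] and retracting before [f]: the shadow in the
    target piece of the image of the path from the gate to [x]. *)
Definition transfer C (x : X) : pieces_group :=
  if pselect (P C) is left PC
  then letter C (chi (fun u => ret_to_Pc tgY (targetQ PC) (f (entry_path tgX PC x u))) 0%R 1%R) else 1.

Lemma letterXE C (PC : P C) q s t :
  letterX C q s t = letter C (chi (fun u => Pc_map (ret_to_Pc tgX PC (q u))) s t).
Proof. by rewrite /letterX; case: pselect => [PC'|//]; rewrite (Prop_irrelevance PC' PC). Qed.

Lemma letterYE C (PC : P C) r s t :
  letterY C r s t = letter C (chi (fun u => ret_to_Pc tgY (targetQ PC) (r u)) s t).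
Proof. by rewrite /letterY; case: pselect => [PC'|//]; rewrite (Prop_irrelevance PC' PC). Qed.

Lemma transferE C (PC : P C) x : transfer C x =
  letter C (chi (fun u => ret_to_Pc tgY (targetQ PC) (f (entry_path tgX PC x u))) 0%R 1%R).
Proof. by rewrite /transfer; case: pselect => [PC'|//]; rewrite (Prop_irrelevance PC' PC). Qed.

Let cX C (PC : P C) (q : R -> X) : continuous q ->
  continuous (fun u => Pc_map (ret_to_Pc tgX PC (q u))).
Proof.
move=> cq; have cr : continuous (fun u => ret_to_Pc tgX PC (q u)) := ret_to_Pc_comp cq.
exact: (comp_continuous cr (@Pc_map_continuous)).
Qed.

Let cf : continuous f. Proof. exact: cts_fun. Qed.

Lemma letterXM C q s t u : continuous q -> letterX C q s t * letterX C q t u = letterX C q s u.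
Proof.
move=> cq; rewrite /letterX; case: pselect => [PC|_]; last by rewrite mulg1.
by rewrite -letterM chiM//; exact: cX.
Qed.

Lemma letterYM C r s t u : continuous r -> letterY C r s t * letterY C r t u = letterY C r s u.
Proof.
move=> cr; rewrite /letterY; case: pselect => [PC|_]; last by rewrite mulg1.
by rewrite -letterM chiM//; exact: (ret_to_Pc_comp cr).
Qed.

Lemma letterX_off C q s t : continuous q -> (s <= t)%R ->
  (forall u, (s <= u)%R -> (u <= t)%R -> ~ C (q u)) -> letterX C q s t = 1.
Proof.
move=> cq st off; rewrite /letterX; case: pselect => // PC.
rewrite chi_const ?letter1//; first exact: cX.
move=> u su ut; congr Pc_map; apply/esym/ret_to_Pc_off => // v sv vu; apply: off; first exact: ltW.
exact: le_trans ut.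
Qed.

Lemma letterY_off C r s t : continuous r -> (s <= t)%R ->
  (forall u, (s <= u)%R -> (u <= t)%R -> ~ target_set C (r u)) -> letterY C r s t = 1.
Proof.
move=> cr st; rewrite /letterY /target_set; case: pselect => // PC off.
rewrite chi_const ?letter1//; first exact: (ret_to_Pc_comp cr).
move=> u su ut; apply/esym/ret_to_Pc_off => // v sv vu; apply: off; first exact: ltW.
exact: le_trans ut.
Qed.

Lemma transfer_in C (PC : P C) x : C x -> transfer C x = 1.
Proof.
move=> Cx; rewrite (transferE PC); have [cn _ _ /(_ Cx) nx _] := entry_pathP tgX PC x.
rewrite chi_const ?letter1//.
  by apply: ret_to_Pc_comp; exact: (comp_continuous cn cf).
by move=> u _ _; rewrite !nx.
Qed.

(** The path [p], extended at both ends by paths from [C], starts and ends in [C],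
    so that [chi_retract] applies. *)
Lemma letterY_conj C (PC : P C) (p : R -> X) s t : continuous p ->
  letterY C (fun u => f (p u)) s t = (transfer C (p s))^-1 * letterX C p s t * transfer C (p t).
Proof.
move=> cp; rewrite (letterYE PC) (letterXE PC) !(transferE PC) -letterV -!letterM.
congr letter; have [cn n0 n1 nx noff] := entry_pathP tgX PC (p s).
have [cm m0 m1 mx moff] := entry_pathP tgX PC (p t).
have rn v : (0 <= v)%R -> (v <= 1)%R -> ret tgX PC (entry_path tgX PC (p s) v) = ret tgX PC (p s).
  exact: ret_entry_path.
have rm v : (0 <= v)%R -> (v <= 1)%R -> ret tgX PC (entry_path tgX PC (p t) v) = ret tgX PC (p t).
  exact: ret_entry_path.
move: cn n0 n1 nx noff cm m0 m1 mx moff rn rm.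
move: (entry_path tgX PC (p s)) (entry_path tgX PC (p t)) => n m.
move=> cn n0 n1 nx noff cm m0 m1 mx moff rn rm.
pose q x := ret_to_Pc tgY (targetQ PC) (f x).
have cq : continuous q.
  exact: (comp_continuous cf (@ret_to_Pc_continuous R Y Q tgY _ (targetQ PC))).
(* Another piece goes into a different piece of [Y], along whose paths the retraction onto the
   target of [C] does not move. *)
have q_const C' : P C' -> C' <> C -> forall x y, C' x -> C' y -> q x = q y.
  move=> PC' ne x y C'x C'y.
  have [d [cd d0 d1 dD]] := piece_path tgY (targetQ PC') (target_sub PC' C'x) (target_sub PC' C'y).
  rewrite /q -d0 -d1; apply: ret_to_Pc_off => //.
  by move=> v _ _ Dv; apply: ne; exact: (target_inj (dD v) Dv).
have mZ : metrizable R (Pc Q) by exact: metrizable_subspace (dtg_metrizable tgY).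
pose W (w : R) := if (w <= 0)%R then n (1 * w + 1)%R else
  (if (w <= 1)%R then p ((t - s) * w + s)%R else m (-1 * w + 2)%R).
have caf a b : continuous (fun w : R => (a * w + b)%R).
  by apply: affine_continuous => w; exact: cvg_id.
have cW : continuous W.
  apply: concat_continuous; first exact: (comp_continuous (caf _ _) cn).
    apply: concat_continuous; [exact: (comp_continuous (caf _ _) cp)|exact: (comp_continuous (caf _ _) cm)|].
    have -> : (-1 * 1 + 2 = 1 :> R)%R by lra.
    by rewrite m1; congr p; lra.
  rewrite ler01 !mulr0 !add0r; exact: n1.
have W0 w : (w <= 0)%R -> W w = n (1 * w + 1)%R by rewrite /W => ->.
have W1 w : (0 <= w)%R -> (w <= 1)%R -> W w = p ((t - s) * w + s)%R.
  move=> w0 w1; rewrite /W w1; case: (leP w 0%R) => // w0'.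
  have -> : w = 0%R by lra.
  by rewrite !mulr0 !add0r n1.
have W2 w : (1 <= w)%R -> W w = m (-1 * w + 2)%R.
  move=> w1; rewrite /W ifF; last by apply/negbTE; lra.
  case: (leP w 1%R) => // w1'; have -> : w = 1%R by lra.
  have -> : (-1 * 1 + 2 = 1 :> R)%R by lra.
  by rewrite m1; congr p; lra.
have l0 : (0 <= 1 :> R)%R := ler01.
have l12 : (-1 <= 2 :> R)%R by lra.
have := @chi_retract R X P tgX _ q mZ cq C PC q_const W (-1)%R 2%R cW l12.
have -> : W (-1)%R = n 0%R by rewrite W0; [congr n; lra|lra].
have -> : W 2%R = m 0%R by rewrite W2; [congr m; lra|lra].
move=> /(_ n0 m0).
have cqW : continuous (fun u => q (W u)) by exact: (comp_continuous cW cq).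
have crW : continuous (fun u => q (ret tgX PC (W u))).
  have cr := @ret_continuous R X P tgX C PC.
  have crW : continuous (fun u => ret tgX PC (W u)) := comp_continuous cW cr.
  exact: (comp_continuous crW cq).
have qr x : q (ret tgX PC x) = Pc_map (ret_to_Pc tgX PC x).
  apply: val_inj; rewrite /q /= ret_id//.
  by apply: target_sub; exact: ret_in.
have cqn : continuous (fun u => q (n u)) by exact: (comp_continuous cn cq).
have cqm : continuous (fun u => q (m u)) by exact: (comp_continuous cm cq).
have cqp : continuous (fun u => q (p u)) by exact: (comp_continuous cp cq).
have crp : continuous (fun u => Pc_map (ret_to_Pc tgX PC (p u))) by exact: cX.
rewrite -(chiM (-1) 0%R 2%R cqW) -(chiM 0%R 1%R 2%R cqW).
rewrite -(chiM (-1) 0%R 2%R crW) -(chiM 0%R 1%R 2%R crW).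
have -> : chi (fun u => q (W u)) (-1)%R 0%R = chi (fun u => q (n u)) 0%R 1%R.
  rewrite (eq_chi (c' := fun u => q (n (1 * u + 1)%R))) //; [|exact: (comp_continuous (caf _ _) cqn)|].
    by rewrite (chi_comp (c := fun u => q (n u)) (k := fun u => 1 * u + 1)%R)//; congr chi; lra.
  by move=> u _ u0; rewrite W0.
have -> : chi (fun u => q (W u)) 0%R 1%R = chi (fun u => q (p u)) s t.
  rewrite (eq_chi (c' := fun u => q (p ((t - s) * u + s)%R))) //; [|exact: (comp_continuous (caf _ _) cqp)|].
    by rewrite (chi_comp (c := fun u => q (p u)) (k := fun u => (t - s) * u + s)%R)//; congr chi; lra.
  by move=> u u0 u1; rewrite W1.
have -> : chi (fun u => q (W u)) 1%R 2%R = (chi (fun u => q (m u)) 0%R 1%R)^-1.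
  rewrite (eq_chi (c' := fun u => q (m (-1 * u + 2)%R))) //; [|exact: (comp_continuous (caf _ _) cqm)|lra|].
    rewrite (chi_comp (c := fun u => q (m u)) (k := fun u => -1 * u + 2)%R)// -chiV//.
    by congr chi; lra.
  by move=> u u1 _; rewrite W2.
have -> : chi (fun u => q (ret tgX PC (W u))) (-1)%R 0%R = 1.
  apply: chi_const => //.
  by move=> u u1 u0; rewrite !W0//; congr q; rewrite !rn//; lra.
have -> : chi (fun u => q (ret tgX PC (W u))) 0%R 1%R =
    chi (fun u => Pc_map (ret_to_Pc tgX PC (p u))) s t.
  rewrite (eq_chi (c' := fun u => Pc_map (ret_to_Pc tgX PC (p ((t - s) * u + s)%R)))) //; [|exact: (comp_continuous (caf _ _) crp)|].
    by rewrite (chi_comp (c := fun u => Pc_map (ret_to_Pc tgX PC (p u))) (k := fun u => (t - s) * u + s)%R)//; congr chi; lra.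
  by move=> u u0 u1; rewrite W1// qr.
have -> : chi (fun u => q (ret tgX PC (W u))) 1%R 2%R = 1.
  apply: chi_const => //; first by lra.
  by move=> u u1 u0; rewrite !W2//; congr q; rewrite !rm//; lra.
rewrite mul1g mulg1 => <-.
by rewrite !mulgA mulVg mul1g -mulgA mulVg mulg1.
Qed.

End letters.

Section developments.
Context {R : realType} {X : metricType R} {Y : topologicalType}.
Context {P : set (set X)} {Q : set (set Y)} {f : continuousType X Y}.
Hypotheses (tgX : disjointly_tree_graded R P) (tgY : disjointly_tree_graded R Q).
Hypotheses (fPQ : maps_pieces_into_pieces P Q f) (fsep : distinct_pieces_separated P Q f).
Variable F : seq (set X).
Hypothesis FP : forall C, C \in F -> P C.
Local Open Scope group_scope.
Implicit Types (C : set X) (s t u : R) (q p : R -> X).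
Local Notation G := (pieces_group (R := R) (X := X) (Q := Q)).
Local Notation letX := (letterX tgX fPQ).
Local Notation letY := (letterY tgY fPQ).
Local Notation trf := (transfer tgX tgY fPQ).

Definition piece_times q C : set R := [set t | C (q t)].
Definition target_times (r : R -> Y) C : set R := [set t | target_set fPQ C (r t)].

(** [devX'] has the letters of [devX], but isolates the larger sets of times at which [f \o q] is in
    a target; on these subdivisions it can be compared with [devY]. [devN] accumulates the
    transfers. *)
Definition devX q := develop F (piece_times q) (fun C s t => letX C q s t).
Definition devX' q := develop F (target_times (fun t => f (q t))) (fun C s t => letX C q s t).
Definition devY r := develop F (target_times r) (fun C s t => letY C r s t).
Definition devN q := develop F (target_times (fun t => f (q t)))
  (fun C s t => (trf C (q s))^-1 * trf C (q t)).

Let cf : continuous f. Proof. exact: cts_fun. Qed.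

Lemma piece_sub_target C x : C \in F -> C x -> target_set fPQ C (f x).
Proof. by move=> /FP PC Cx; rewrite (target_setE fPQ PC); exact: target_sub. Qed.

Lemma target_set_inj C C' y : C \in F -> C' \in F ->
  target_set fPQ C y -> target_set fPQ C' y -> C = C'.
Proof.
by move=> /FP PC /FP PC'; rewrite (target_setE fPQ PC) (target_setE fPQ PC'); exact: target_inj.
Qed.

Lemma target_set_closed C : C \in F -> closed (target_set fPQ C).
Proof. by move=> /FP PC; rewrite (target_setE fPQ PC); apply: (dtg_closed tgY); exact: targetQ. Qed.

Lemma increments_piece q : continuous q ->
  increments F (piece_times q) (fun C s t => letX C q s t).
Proof.
move=> cq; split.
- move=> C /FP PC; apply: closed_comp (dtg_closed tgX PC) => t _; exact: cq.
- by move=> C C' t /FP PC /FP PC'; exact: (piece_unique tgX PC PC').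
- by move=> C s t u _; exact: letterXM.
- by move=> C s t _ st; exact: letterX_off.
Qed.

Lemma target_times_closed r C : continuous r -> C \in F -> closed (target_times r C).
Proof.
by move=> cr /target_set_closed cC; apply: closed_comp cC => t _; exact: cr.
Qed.

Lemma increments_target r : continuous r ->
  increments F (target_times r) (fun C s t => letY C r s t).
Proof.
move=> cr; split.
- by move=> C; exact: target_times_closed.
- by move=> C C' t FC FC'; exact: target_set_inj.
- by move=> C s t u _; exact: letterYM.
- by move=> C s t _ st; exact: letterY_off.
Qed.

Let cfq q : continuous q -> continuous (fun t => f (q t)).
Proof. by move=> cq; exact: (comp_continuous cq cf). Qed.

Lemma increments_piece' q : continuous q ->
  increments F (target_times (fun t => f (q t))) (fun C s t => letX C q s t).
Proof.
move=> cq; split.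
- by move=> C; apply: target_times_closed; exact: cfq.
- by move=> C C' t FC FC'; exact: target_set_inj.
- by move=> C s t u _; exact: letterXM.
- move=> C s t FC st off; apply: letterX_off => // u su ut Cu.
  by apply: (off u su ut); exact: piece_sub_target.
Qed.

Lemma increments_transfer q : continuous q ->
  increments F (target_times (fun t => f (q t))) (fun C s t => (trf C (q s))^-1 * trf C (q t)).
Proof.
move=> cq; split.
- by move=> C; apply: target_times_closed; exact: cfq.
- by move=> C C' t FC FC'; exact: target_set_inj.
- by move=> C s t u _; rewrite mulgA mulgK.
- move=> C s t FC st off; have PC := FP FC.
  have := letterY_conj tgX tgY fPQ fsep PC s t cq.
  rewrite letterY_off//; last exact: cfq.
  rewrite letterX_off ?mulg1// => u su ut Cu.
  by apply: (off u su ut); exact: piece_sub_target.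
Qed.

Lemma devX_eq q s t : continuous q -> (s <= t)%R -> devX q s t = devX' q s t.
Proof.
move=> cq st; apply: (@develop_comp _ _ _ F _ _ _ _ set0 id s t).
- exact: increments_piece'.
- exact: increments_piece.
- by move=> x; exact: cvg_id.
- by [].
- by move=> C u FC _ _; exact: piece_sub_target.
- by [].
Qed.

Lemma devNM q s t u : continuous q -> devN q s t * devN q t u = devN q s u.
Proof. by move=> cq; exact: (developM set0 (increments_transfer cq)). Qed.

Let devN_isolated q C s t : continuous q -> (s <= t)%R ->
  isolates F (target_times (fun t => f (q t))) C s t ->
  devN q s t = increment F (fun C s t => (trf C (q s))^-1 * trf C (q t)) C s t.
Proof.
move=> cq st iso; rewrite /devN.
exact: (develop_isolated (increments_transfer cq) st iso).
Qed.

Lemma target_isolated (y : Y) : exists C, \forall z \near y,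
  forall j, j \in F -> j <> C -> ~ target_set fPQ j z.
Proof.
have [C CF] : exists C, forall j, j \in F -> j <> C -> ~ target_set fPQ j y.
  have [[C [FC Cx]]|none] := pselect (exists C, C \in F /\ target_set fPQ C y).
    by exists C => j Fj jC jx; apply: jC; exact: target_set_inj jx Cx.
  by exists set0 => j Fj _ jx; apply: none; exists j.
exists C; have : forall F' : seq (set X), {subset F' <= F} -> \forall z \near y,
    forall j, j \in F' -> j <> C -> ~ target_set fPQ j z.
  elim=> [|j F' IHF] sub; first by apply: nearW.
  have sub' : {subset F' <= F} by move=> k kF; apply: sub; rewrite inE kF orbT.
  have jF : j \in F by apply: sub; rewrite inE eqxx.
  have [->|/eqP ne] := eqVneq j C.
    apply: filterS (IHF sub') => z zF k; rewrite inE => /orP[/eqP ->//|kF].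
    exact: zF.
  have nj : \forall z \near y, ~ target_set fPQ j z.
    apply: (open_nbhs_nbhs (A := ~` target_set fPQ j)); split; last exact: CF.
    by apply: closed_openC; exact: target_set_closed.
  apply: filterS2 (IHF sub') nj => z zF zj k; rewrite inE => /orP[/eqP -> //|kF].
  exact: zF.
by apply.
Qed.

Lemma devN_near (x : X) : exists2 V, nbhs x V & potential_on devN V.
Proof.
have [C CV] := target_isolated (f x).
exists [set y | forall j, j \in F -> j <> C -> ~ target_set fPQ j (f y)].
  exact: cf CV.
exists (fun y => if C \in F then trf C y else 1) => q cq a b qV.
have E s t : (a < s)%R -> (s <= t)%R -> (t < b)%R -> devN q s t =
    (if C \in F then trf C (q s) else 1)^-1 * (if C \in F then trf C (q t) else 1).
  move=> as_ st tb; rewrite (devN_isolated (C := C))//.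
    by rewrite /increment; case: ifP => // _; rewrite invg1 mulg1.
  by move=> j jF jC u su ut; apply: (qV u) => //; [exact: lt_le_trans su|exact: le_lt_trans tb].
move=> s t as_ sb at_ tb; have [st|/ltW ts] := leP s t; first exact: E.
have -> : devN q s t = (devN q t s)^-1.
  exact: (developV set0 (increments_transfer cq)).
by rewrite E// invgM invgK.
Qed.

Lemma devN_in_piece C q s t : P C -> continuous q -> (s <= t)%R ->
  (forall u, (s <= u)%R -> (u <= t)%R -> C (q u)) ->
  devN q s t = increment F (fun C s t => (trf C (q s))^-1 * trf C (q t)) C s t.
Proof.
move=> PC cq st qC; apply: devN_isolated => // j jF jC u su ut ju; apply: jC.
have Pj := FP jF; move: ju; rewrite /target_times /= (target_setE fPQ Pj) => ju.
exact: (target_inj tgY fsep ju (target_sub fPQ PC (qC u su ut))).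
Qed.

Lemma devN_loop q : continuous q -> q 0%R = q 1%R -> devN q 0%R 1%R = 1.
Proof.
apply: (loop_potential tgX).
- by move=> p s t u; exact: devNM.
- exact: devN_near.
- move=> C PC p cp s t st pC pst; rewrite (devN_in_piece PC)// /increment pst.
  by case: ifP => // _; rewrite mulVg.
Qed.

(** The path is closed up inside [C], where all transfers are trivial, and [devN_loop] applies to
    the resulting loop. *)
Lemma devN_same_piece C p s t : C \in F -> continuous p -> C (p s) -> C (p t) -> devN p s t = 1.
Proof.
move=> FC cp Cs Ct; have PC := FP FC.
have [c [cc c0 c1 cC]] := piece_path tgX PC Ct Cs.
have caf a b : continuous (fun w : R => (a * w + b)%R).
  by apply: affine_continuous => w; exact: cvg_id.
pose q (w : R) := if (w <= 2^-1)%R then p (2 * (t - s) * w + s)%R else c (2 * w + -1)%R.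
have cq : continuous q.
  apply: concat_continuous; [exact: (comp_continuous (caf _ _) cp)|exact: (comp_continuous (caf _ _) cc)|].
  have -> : (2 * (t - s) / 2 + s = t)%R by lra.
  by rewrite -c0; congr c; lra.
have q0 : q 0%R = p s by rewrite /q ifT ?mulr0 ?add0r//; lra.
have q1 : q 1%R = p s.
  by rewrite /q ifF; [rewrite -c1; congr c; lra|apply/negbTE; lra].
have := devN_loop cq; rewrite q0 q1 => /(_ erefl).
rewrite -(devNM 0%R 2^-1%R 1%R cq).
have -> : devN q 2^-1%R 1%R = 1.
  have qC u : (2^-1 <= u)%R -> (u <= 1)%R -> C (q u).
    move=> u2 u1; rewrite /q; case: leP => // u2'.
    have -> : u = 2^-1%R by lra.
    have -> : (2 * (t - s) / 2 + s = t)%R by lra.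
    exact: Ct.
  rewrite (devN_in_piece PC)//; last by lra.
  rewrite /increment FC !(transfer_in _ _ _ PC) ?invg1 ?mulg1//; apply: qC; lra.
rewrite mulg1 => <-.
have h2 : (0 <= 2^-1 :> R)%R by lra.
rewrite /devN (@develop_comp _ _ _ F _ _ _ _ set0 (fun w => 2 * (t - s) * w + s)%R 0%R 2^-1%R
  (increments_transfer cp) (increments_transfer cq) (caf _ _) h2).
- congr develop; lra.
- by move=> C' u _ u0 u2; rewrite /target_times /q /= u2.
- by move=> C' u v _ u0 u2 v0 v2; rewrite /q u2 v2.
Qed.

(** By [letterY_conj] every letter is conjugated by transfers. Referred to time 0, the conjugating
    element is the accumulated transfer up to a visit of [C], which is the same for all visits by
    [devN_same_piece]. *)
Lemma word_decomposition p : continuous p -> exists U : set X -> G,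
  forall s t, (s <= t)%R -> exists w : seq (set X * path_group (R := R) (Q := Q)),
    devX' p s t = \big[*%g/1]_(l <- w) letter l.1 l.2 /\
    devY (fun u => f (p u)) s t = (devN p 0%R s)^-1 * conj_word id U w * devN p 0%R t.
Proof.
move=> cp; pose U C : G := if pselect (exists u, C (p u)) is left ex
  then devN p 0%R (sval (cid ex)) else 1.
have UE C x : C \in F -> C (p x) -> U C = devN p 0%R x.
  move=> CF Cx; rewrite /U; case: pselect => [ex|[]]; last by exists x.
  rewrite -(devNM 0%R (sval (cid ex)) x cp) (devN_same_piece CF cp _ Cx) ?mulg1//.
  exact: svalP (cid ex).
have DX := increments_piece' cp; have DY := increments_target (cfq cp).
have DN := increments_transfer cp.
exists U; apply: interval_chain => [s t u st tu [w [X1 Y1]] [w' [X2 Y2]]|x].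
  exists (w ++ w'); split.
    by rewrite big_cat -X1 -X2; apply/esym; exact: (developM set0 DX).
  have -> : devY (fun u => f (p u)) s u = devY (fun u => f (p u)) s t * devY (fun u => f (p u)) t u.
    by apply/esym; exact: (developM set0 DY).
  by rewrite Y1 Y2 /conj_word big_cat !mulgA mulgK.
have [d [C [d0 CK iso dE]]] := develop_near set0 DN x.
have [dC dC0 off] : exists2 dC : R, (0 < dC)%R & forall s t, (x - dC < s)%R -> (t < x + dC)%R ->
    (C \in F /\ C (p x)) \/ (C \in F -> forall u, (s <= u)%R -> (u <= t)%R -> ~ C (p u)).
  have [FC|nFC] := boolP (C \in F); last by exists 1%R => // s t _ _; right.
  have [Cx|nCx] := pselect (C (p x)); first by exists 1%R => // s t _ _; left.
  have [e e0 eC] := closed_gap (inc_closed (increments_piece cp) FC) nCx.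
  by exists e => // s t xs tx; right => _ u su ut; apply: (eC u); lra.
have [m m0 [m1 m2]] := min2_gt0 d0 dC0; exists m => // s t xs st tx.
have {}iso := iso s t ltac:(lra) ltac:(lra).
have XE : devX' p s t = increment F (fun C s t => letX C p s t) C s t by exact: (develop_isolated DX st iso).
have YE : devY (fun u => f (p u)) s t = increment F (fun C s t => letY C (fun u => f (p u)) s t) C s t.
  exact: (develop_isolated DY st iso).
have NE : devN p s t = increment F (fun C s t => (trf C (p s))^-1 * trf C (p t)) C s t.
  exact: (develop_isolated DN st iso).
have N0 : (devN p 0%R s)^-1 * devN p 0%R t = devN p s t.
  by apply: (mulgI (devN p 0%R s)); rewrite mulgA mulgV mul1g devNM.
have [FC|nFC] := boolP (C \in F); last first.
  exists [::]; rewrite XE YE /conj_word !big_nil mulg1 N0 NE /increment !ifN//.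
have PC := FP FC; rewrite /increment FC in XE YE NE.
have YX := letterY_conj tgX tgY fPQ fsep PC s t cp.
have [[_ Cx]|noff] := off s t ltac:(lra) ltac:(lra); last first.
  exists [::]; rewrite XE YE /conj_word !big_nil mulg1 N0 NE YX.
  by rewrite letterX_off ?mulg1//; exact: noff.
pose h := chi (fun u => Pc_map fPQ (ret_to_Pc tgX PC (p u))) s t.
have hE : letX C p s t = letter C h by exact: letterXE.
exists [:: (C, h)]; rewrite XE YE /conj_word !big_seq1 /= hE; split=> //.
(* As [p x] is in [C], its own transfer is trivial; this turns conjugation by [U C] into the local
   transfers at [s] and [t]. *)
have near_x u : (x - m < u)%R -> (u < x + m)%R -> (devN p 0%R u)^-1 * devN p 0%R x = (trf C (p u))^-1.
  move=> xu ux; have -> : (devN p 0%R u)^-1 * devN p 0%R x = devN p u x.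
    by apply: (mulgI (devN p 0%R u)); rewrite mulgA mulgV mul1g devNM.
  have -> : devN p u x = (trf C (p u))^-1 * trf C (p x).
    by rewrite /devN dE; [rewrite /increment FC|lra..].
  by rewrite (transfer_in _ _ _ PC Cx) mulg1.
rewrite (UE C x FC Cx) YX hE.
rewrite -[in LHS](near_x s) //; last by lra.
rewrite -[trf C (p t)]invgK -(near_x t) //; last by lra.
by rewrite invgM invgK !mulgA.
Qed.

End developments.

(** * Words of null homotopic loops *)

Section rectangles.
Context {R : realType} {T : topologicalType}.
Implicit Types (s t a b : R).

(** The concatenation is formed in [V], before [K] is applied, so that homotopies can be carried out
    in the plane. *)
Lemma chi_join (V : topologicalType) (f f' : R -> V) s t s' t' :
  continuous f -> continuous f' -> f t = f' s' ->
  exists h : R -> V, [/\ continuous h, h (-1) = f s, h 1 = f' t' &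
    forall (T : topologicalType) (K : V -> T), continuous K ->
    (chi (fun u => K (f u)) s t * chi (fun u => K (f' u)) s' t')%g =
    chi (fun u => K (h u)) (-1) 1].
Proof.
move=> cf cf' e; have caf (x y : R) : continuous (fun w : R => x * w + y).
  by apply: affine_continuous => w; exact: cvg_id.
pose h (w : R) := if w <= 0 then f ((t - s) * w + t) else f' ((t' - s') * w + s').
have ch : continuous h.
  apply: concat_continuous; [exact: (comp_continuous (caf _ _) cf)|exact: (comp_continuous (caf _ _) cf')|].
  by rewrite !mulr0 !add0r.
have h0 w : w <= 0 -> h w = f ((t - s) * w + t) by rewrite /h => ->.
have h1 w : 0 <= w -> h w = f' ((t' - s') * w + s').
  rewrite /h; case: (leP w 0) => // w0 w0'; have -> : w = 0 by lra.
  by rewrite !mulr0 !add0r.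
exists h; split=> //; [by rewrite h0; [congr f; lra|lra]|by rewrite h1; [congr f'; lra|lra]|].
move=> U K cK; have cKf : continuous (fun u => K (f u)) by exact: (comp_continuous cf cK).
have cKf' : continuous (fun u => K (f' u)) by exact: (comp_continuous cf' cK).
have cKh : continuous (fun u => K (h u)) by exact: (comp_continuous ch cK).
rewrite -(chiM (-1) 0 1 cKh); congr (_ * _)%g.
  rewrite (@eq_chi R U (fun u => K (h u)) (fun u => K (f ((t - s) * u + t))) (-1) 0 cKh
    (comp_continuous (caf _ _) cKf)); [|lra|by move=> u _ u0; rewrite h0].
  by rewrite (chi_comp (c := fun u => K (f u)) (k := fun u => (t - s) * u + t))//; congr chi; lra.
rewrite (@eq_chi R U (fun u => K (h u)) (fun u => K (f' ((t' - s') * u + s'))) 0 1 cKh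
  (comp_continuous (caf _ _) cKf')); [|lra|by move=> u u0 _; rewrite h1].
by rewrite (chi_comp (c := fun u => K (f' u)) (k := fun u => (t' - s') * u + s'))//; congr chi; lra.
Qed.

Lemma chi_planar (K : R * R -> T) (f g : R -> R * R) s t :
  continuous K -> continuous f -> continuous g -> f s = g s -> f t = g t ->
  chi (fun u => K (f u)) s t = chi (fun u => K (g u)) s t.
Proof.
move=> cK cf cg es et; pose a u := s + (t - s) * u.
have ca : continuous (fun z : R * R => a z.1).
  apply: (@comp_continuous _ _ _ fst a); first by move=> z; exact: cvg_fst.
  by apply: affine_continuousC => u; exact: cvg_id.
have cfa : continuous (fun z : R * R => f (a z.1)) := comp_continuous ca cf.
have cga : continuous (fun z : R * R => g (a z.1)) := comp_continuous ca cg.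
have cl : continuous (fun z : R * R =>
    ((f (a z.1)).1 + z.2 * ((g (a z.1)).1 - (f (a z.1)).1),
     (f (a z.1)).2 + z.2 * ((g (a z.1)).2 - (f (a z.1)).2))).
  have c1 (h : R * R -> R * R) : continuous h -> continuous (fun z => (h z).1).
    by move=> ch; apply: (comp_continuous ch) => z; exact: cvg_fst.
  have c2 (h : R * R -> R * R) : continuous h -> continuous (fun z => (h z).2).
    by move=> ch; apply: (comp_continuous ch) => z; exact: cvg_snd.
  have lin (x y : R * R -> R) : continuous x -> continuous y ->
      continuous (fun z : R * R => x z + z.2 * (y z - x z)).
    move=> cx cy z; apply: cvgD; first exact: cx.
    by apply: cvgM; [exact: cvg_snd|apply: cvgB; [exact: cy|exact: cx]].
  by apply: pair_continuous; apply: lin; [exact: c1|exact: c1|exact: c2|exact: c2].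
apply: (@chi_homotopic _ _ _ _ _ _ _ _ (fun z => K ((f (a z.1)).1 + z.2 * ((g (a z.1)).1 - (f (a z.1)).1),
     (f (a z.1)).2 + z.2 * ((g (a z.1)).2 - (f (a z.1)).2)))).
- exact: (comp_continuous cf cK).
- exact: (comp_continuous cg cK).
- exact: (comp_continuous cl cK).
- by move=> u _ _ /=; rewrite !mul0r !addr0 -surjective_pairing.
- by move=> u _ _ /=; rewrite !mul1r !(addrC (f _).1) !(addrC (f _).2) !subrK -surjective_pairing.
- move=> v _ _ /=; have -> : a 0 = s by rewrite /a mulr0 addr0.
  by rewrite es !subrr !mulr0 !addr0 -surjective_pairing.
- move=> v _ _ /=; have -> : a 1 = t by rewrite /a mulr1 addrC subrK.
  by rewrite et !subrr !mulr0 !addr0 -surjective_pairing.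
Qed.

Lemma chi_rectangle (K : R * R -> T) s t a b : continuous K ->
  (chi (fun u => K (u, a)) s t * chi (fun v => K (t, v)) a b)%g =
  (chi (fun v => K (s, v)) a b * chi (fun u => K (u, b)) s t)%g.
Proof.
move=> cK.
have cl (c : R) : continuous (fun u : R => (u, c)).
  by apply: pair_continuous; [move=> u; exact: cvg_id|move=> u; exact: cvg_cst].
have cr (c : R) : continuous (fun u : R => (c, u)).
  by apply: pair_continuous; [move=> u; exact: cvg_cst|move=> u; exact: cvg_id].
have [h [ch h0 h1 hK]] := chi_join (f := fun u => (u, a)) (f' := fun v => (t, v)) s b (cl a) (cr t) erefl.
have [k [ck k0 k1 kK]] := chi_join (f := fun v => (s, v)) (f' := fun u => (u, b)) a t (cr s) (cl b) erefl.
rewrite (hK T K cK) (kK T K cK).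
by apply: chi_planar => //; rewrite ?h0 ?k0 ?h1 ?k1.
Qed.

End rectangles.

Lemma eq_chi_on (R : realType) (T : topologicalType) (c c' : R -> T) (a b s t : R) :
  continuous c -> continuous c' -> (forall u, a <= u -> u <= b -> c u = c' u) ->
  a <= s -> s <= b -> a <= t -> t <= b -> chi c s t = chi c' s t.
Proof.
move=> cc cc' E as_ sb at_ tb.
have [st|/ltW ts] := leP s t.
  by apply: eq_chi => // u su ut; apply: E; lra.
rewrite (chiV t s cc) (chiV t s cc'); congr (_^-1)%g.
by apply: eq_chi => // u su ut; apply: E; lra.
Qed.

Section null_homotopic.
Context {R : realType} {X : metricType R} {Y : topologicalType}.
Context {P : set (set X)} {Q : set (set Y)} {f : continuousType X Y}.
Hypotheses (tgX : disjointly_tree_graded R P) (tgY : disjointly_tree_graded R Q).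
Hypotheses (fPQ : maps_pieces_into_pieces P Q f) (fsep : distinct_pieces_separated P Q f).
Variable F : seq (set X).
Hypothesis FP : forall C, C \in F -> P C.
Local Open Scope group_scope.
Implicit Types (C : set X) (s t u : R).
Local Notation letY := (letterY tgY fPQ).
Local Notation dY := (devY tgY fPQ F).

Let DY (r : R -> Y) : continuous r ->
  increments F (target_times fPQ r) (fun C s t => letY C r s t).
Proof. exact: increments_target. Qed.

Let dYM r s t u : continuous r -> dY r s t * dY r t u = dY r s u.
Proof. by move=> cr; exact: (developM set0 (DY cr)). Qed.

Lemma devY_isolated C r s t : continuous r -> (s <= t)%R ->
  (forall u, (s <= u)%R -> (u <= t)%R -> forall j, j \in F -> j <> C -> ~ target_set fPQ j (r u)) ->
  dY r s t = increment F (fun C s t => letY C r s t) C s t.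
Proof.
move=> cr st iso; apply: (develop_isolated (DY cr) st) => j jF jC u su ut.
exact: iso.
Qed.

Lemma devY_cst (r : R -> Y) s t : continuous r -> (s <= t)%R -> constant_on r s t -> dY r s t = 1.
Proof.
move=> cr st con; have [C CV] := target_isolated tgY fPQ fsep FP (r s).
rewrite (@devY_isolated C)//; last first.
  by move=> u su ut; rewrite con//; exact: nbhs_singleton CV.
rewrite /increment; case: ifP => // /FP PC; rewrite (letterYE _ _ PC) chi_const ?letter1//.
  exact: ret_to_Pc_comp.
by move=> u su ut; rewrite con.
Qed.

(** Near each point of the square only one target matters, and [chi_rectangle] makes the word of a
    small rectangle trivial. The rectangles are chained along a strip, whose short sides are
    constant, and then over all strips. *)
Lemma devY_null (K : R * R -> Y) y : continuous K -> (forall v, K (0%R, v) = y) ->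
  (forall v, K (1%R, v) = y) -> (forall u, K (u, 1%R) = y) ->
  dY (fun u => K (u, 0%R)) 0%R 1%R = 1.
Proof.
move=> cK K0 K1 Ku.
have ch v : continuous (fun u => K (u, v)).
  apply: comp_continuous cK; apply: pair_continuous => u; [exact: cvg_id|exact: cvg_cst].
have cv u : continuous (fun v => K (u, v)).
  apply: comp_continuous cK; apply: pair_continuous => v; [exact: cvg_cst|exact: cvg_id].
rewrite -(@devY_cst (fun u => K (u, 1%R)) 0%R 1%R) //; last by move=> u _ _; rewrite !Ku.
pose E a b := dY (fun u => K (u, a)) 0%R 1%R = dY (fun u => K (u, b)) 0%R 1%R.
suff : E 0%R 1%R by [].
apply: interval_chain => [a b c _ _ E1 E2|v0|]; [exact: etrans E1 E2| |exact: ler01].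
pose rect d s t := forall a b, (v0 - d < a)%R -> (a <= b)%R -> (b < v0 + d)%R ->
  dY (fun u => K (u, a)) s t * dY (fun v => K (t, v)) a b =
  dY (fun v => K (s, v)) a b * dY (fun u => K (u, b)) s t.
pose E' s t := exists2 d, (0 < d)%R & rect d s t.
have [d d0 rd] : E' 0%R 1%R.
  apply: interval_chain; [move=> s t u st tu [d d0 r1] [e e0 r2]|move=> u0|exact: ler01].
    have [m m0 [m1 m2]] := min2_gt0 d0 e0; exists m => // a b va ab bv.
    rewrite -(dYM s t u (ch a)) -(dYM s t u (ch b)).
    rewrite -mulgA [X in _ * X]r2; [|lra|lra|lra].
    by rewrite !mulgA; congr (_ * _); apply: r1; lra.
  have [C CV] := target_isolated tgY fPQ fsep FP (K (u0, v0)).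
  have /nbhs_box[d d0 dC] := cK (u0, v0) _ CV.
  exists d => // s t us st tu; exists d => // a b va ab bv.
  rewrite !(@devY_isolated C) //; try (by move=> u ? ?; apply: dC; lra).
  rewrite /increment; case: ifP => // /FP PC; rewrite !(letterYE _ _ PC) -!letterM.
  congr letter; apply: (@chi_rectangle R _ (fun z => ret_to_Pc tgY (targetQ fPQ PC) (K z))).
  exact: (comp_continuous cK (@ret_to_Pc_continuous _ _ _ _ _ _)).
exists d => // a b va ab bv; have := rd a b va ab bv.
by rewrite !(@devY_cst (fun v => K (_, v))) ?mulg1 ?mul1g// => v _ _; rewrite ?K0 ?K1.
Qed.

(** The word of [f \o p] and the accumulated transfers of the loop [p] are both trivial, so
    [word_decomposition] leaves a trivial word with conjugated letters, to which [conj_word_inj]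
    applies. *)
Lemma devX_trivial (p : R -> X) (K : R * R -> Y) : continuous p -> p 0%R = p 1%R ->
  continuous K -> (forall u, (0 <= u)%R -> (u <= 1)%R -> K (u, 0%R) = f (p u)) ->
  (forall v, K (0%R, v) = f (p 0%R)) -> (forall v, K (1%R, v) = f (p 0%R)) ->
  (forall u, K (u, 1%R) = f (p 0%R)) ->
  devX tgX fPQ F p 0%R 1%R = 1.
Proof.
move=> cp p01 cK Kp K0 K1 Ku.
have cfp : continuous (fun u => f (p u)) by apply: (comp_continuous cp); exact: cts_fun.
have ch v : continuous (fun u => K (u, v)).
  apply: comp_continuous cK; apply: pair_continuous => u; [exact: cvg_id|exact: cvg_cst].
have Y1 : dY (fun u => f (p u)) 0%R 1%R = 1.
  rewrite -(devY_null cK K0 K1 Ku).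
  apply: (@develop_comp _ _ _ F _ _ _ _ set0 id) => //.
  - exact: DY.
  - exact: DY.
  - by move=> x; exact: cvg_id.
  - by move=> C u _ u0 u1; rewrite /target_times /= Kp.
  - move=> C u v FC u0 u1 v0 v1; have PC := FP FC; rewrite !(letterYE _ _ PC); congr letter.
    have c1 : continuous (fun u => ret_to_Pc tgY (targetQ fPQ PC) (f (p u))) := ret_to_Pc_comp cfp.
    have c2 : continuous (fun u => ret_to_Pc tgY (targetQ fPQ PC) (K (u, 0%R))) := ret_to_Pc_comp (ch 0%R).
    by apply: (eq_chi_on c1 c2 (a := 0%R) (b := 1%R)) => // w w0 w1; rewrite Kp.
have [U /(_ 0%R 1%R ler01)[w [X1 Y2]]] := word_decomposition tgX tgY fPQ fsep FP cp.
rewrite (devX_eq tgX tgY fPQ fsep FP cp ler01) X1.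
move: Y2; rewrite Y1 (devN_loop tgX tgY fPQ fsep FP cp p01) mulg1.
have -> : devN tgX tgY fPQ F p 0%R 0%R = 1.
  exact: (develop_refl set0 (increments_transfer tgX tgY fPQ fsep FP cp)).
rewrite invg1 mul1g => /esym.
exact: (conj_word_inj (leqnn (size w))).
Qed.

End null_homotopic.

(** * Small null homotopies *)

Section real_functions.
Context {R : realType} {V : topologicalType}.
Implicit Types u v : V -> R.

Lemma add_continuousF u v : continuous u -> continuous v -> continuous (fun z => u z + v z).
Proof. by move=> cu cv z; apply: cvgD; [exact: cu|exact: cv]. Qed.

Lemma sub_continuousF u v : continuous u -> continuous v -> continuous (fun z => u z - v z).
Proof. by move=> cu cv z; apply: cvgB; [exact: cu|exact: cv]. Qed.

Lemma mul_continuousF u v : continuous u -> continuous v -> continuous (fun z => u z * v z).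
Proof. by move=> cu cv z; apply: cvgM; [exact: cu|exact: cv]. Qed.

Lemma cst_continuousF (a : R) : continuous (fun _ : V => a).
Proof. by move=> z; exact: cvg_cst. Qed.

Lemma sqr_continuousF u : continuous u -> continuous (fun z => u z ^+ 2).
Proof. by move=> cu; apply: (@comp_continuous _ _ _ u (fun x => x ^+ 2) cu); exact: exprn_continuous. Qed.

Lemma sqrt_continuousF u : continuous u -> continuous (fun z => Num.sqrt (u z)).
Proof. by move=> cu; apply: (@comp_continuous _ _ _ u (@Num.sqrt R) cu) => x; exact: sqrt_continuous. Qed.

End real_functions.

Section fill_loops.
Context {R : realType} {A : metricType R}.
Implicit Types (s t u v : R).

Lemma mdist_le_diam (B : set A) (x y : A) : B x -> B y -> ((mdist x y)%:E <= diam B)%E.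
Proof. by move=> Bx By; apply: ereal_sup_ubound; exists (x, y). Qed.

Lemma diam_le (B : set A) (e : R) : (forall x y, B x -> B y -> mdist x y <= e) -> (diam B <= e%:E)%E.
Proof.
by move=> Be; apply: ge_ereal_sup => _ [[x y] [/= Bx By] <-]; rewrite lee_fin; exact: Be.
Qed.

Definition null_square (sigma : R -> A) (H : R * R -> A) : Prop :=
  [/\ continuous H, forall u, 0 <= u -> u <= 1 -> H (u, 0) = sigma u,
      forall u, 0 <= u -> u <= 1 -> H (u, 1) = sigma 0 &
      forall v, 0 <= v -> v <= 1 -> H (0, v) = sigma 0 /\ H (1, v) = sigma 0].

(** The loop starts at [(-1, 0)] and runs over the lower half circle for times up to [2^-1], then
    back over the upper one. Time is affine in the first coordinate, so no angles are needed. *)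
Definition circle_loop (sigma : R -> A) (z : circle R) : A :=
  if (set_val z).2 <= 0 then sigma (4^-1 * (set_val z).1 + 4^-1)
  else sigma (- 4^-1 * (set_val z).1 + 3 / 4).

Let cfst (B : set (R * R)) : continuous (fun z : B => (set_val z).1).
Proof.
move=> z; apply: (@continuous_comp _ _ _ set_val fst); first exact: continuous_set_val.
exact: cvg_fst.
Qed.

Let csnd (B : set (R * R)) : continuous (fun z : B => (set_val z).2).
Proof.
move=> z; apply: (@continuous_comp _ _ _ set_val snd); first exact: continuous_set_val.
exact: cvg_snd.
Qed.

Let circleE (z : circle R) : (set_val z).1 ^+ 2 + (set_val z).2 ^+ 2 = 1.
Proof. exact: (set_valP z). Qed.

Lemma circle_loop_continuous (sigma : R -> A) : continuous sigma -> sigma 0 = sigma 1 ->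
  continuous (circle_loop sigma).
Proof.
move=> cs s01; apply: paste_continuous; first exact: csnd.
- by apply: (comp_continuous _ cs); apply: affine_continuous; exact: cfst.
- by apply: (comp_continuous _ cs); apply: affine_continuous; exact: cfst.
move=> z z0; have := circleE z; rewrite z0 expr0n addr0 => /eqP.
rewrite sqrf_eq1 => /orP[] /eqP ->; first by congr sigma; lra.
have -> : 4^-1 * -1 + 4^-1 = 0 :> R by lra.
by rewrite s01; congr sigma; lra.
Qed.

(** The square is folded into the disk: [1 - v] is the distance to the center,
    for points that are not too close to it. *)
Lemma circle_loop_inessential (sigma : R -> A) H : sigma 0 = sigma 1 -> null_square sigma H ->
  inessential (circle_loop sigma).
Proof.
move=> s01 [cH H0 H1 Hs].
pose n (z : disk R) := Num.sqrt ((set_val z).1 ^+ 2 + (set_val z).2 ^+ 2).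
(* At radius at most [2^-1] the depth [tau] is 1, where [H] is constant; there the first coordinate
   need not be divided by the true radius. *)
pose m z := Num.max (n z) 2^-1.
pose x z := (set_val z).1 / m z.
pose tau z := Num.min 1 (2 * (1 - n z)).
have n0 z : 0 <= n z by exact: sqrtr_ge0.
have n1 z : n z <= 1.
  by rewrite -(sqrtr1 R); apply: ler_wsqrtr; exact: (set_valP z).
have m0 z : 0 < m z by rewrite lt_max; apply/orP; right; lra.
have nsq z : n z ^+ 2 = (set_val z).1 ^+ 2 + (set_val z).2 ^+ 2.
  by rewrite sqr_sqrtr// addr_ge0 ?sqr_ge0.
have mn z : n z <= m z by rewrite le_max lexx.
have xm z : x z * m z = (set_val z).1 by rewrite /x divfK// gt_eqF.
have x1 z : -1 <= x z /\ x z <= 1.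
  have := nsq z; have := mn z; have := m0 z; have := n0 z; rewrite -xm.
  move: (x z) (m z) (n z) (set_val z).2 => a b c d c0 b0 cb E.
  have cb2 : c * c <= b * b by nra.
  have ab : (a * b) * (a * b) <= b * b by nra.
  split; rewrite leNgt; apply/negP => h.
    have h' : a * b < - b by nra.
    have : 0 < (- (a * b) - b) * (b - a * b) by apply: mulr_gt0; lra.
    by rewrite mulrBr !mulrBl; lra.
  have h' : b < a * b by nra.
  have : 0 < (a * b - b) * (a * b + b) by apply: mulr_gt0; lra.
  by rewrite mulrDr !mulrBl; lra.
have t01 z : 0 <= tau z /\ tau z <= 1.
  by rewrite /tau le_min ge_min lexx ler01; have := n1 z; split => //=; lra.
have cn : continuous n.
  apply: sqrt_continuousF; apply: add_continuousF; apply: sqr_continuousF.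
    exact: cfst.
  exact: csnd.
have cm : continuous m by apply: maxr_continuous; [exact: cn|exact: cst_continuousF].
have cx : continuous x.
  apply: (@mul_continuousF _ _ (fun z => (set_val z).1) (fun z => (m z)^-1)); first exact: cfst.
  move=> z; have mz : m z != 0 by rewrite gt_eqF.
  exact: (continuous_comp (cm z) (inv_continuous mz)).
have ctau : continuous tau.
  apply: minr_continuous; first exact: cst_continuousF.
  apply: mul_continuousF; first exact: cst_continuousF.
  by apply: sub_continuousF; [exact: cst_continuousF|exact: cn].
pose g z := if (set_val z).2 <= 0 then H (4^-1 * x z + 4^-1, tau z)
  else H (- 4^-1 * x z + 3 / 4, tau z).
exists g; split.
  apply: paste_continuous; first exact: csnd.
  - apply: (comp_continuous _ cH); apply: (@pair_continuous _ _ _ (fun z => 4^-1 * x z + 4^-1) tau) => //.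
    exact: affine_continuous cx.
  - apply: (comp_continuous _ cH); apply: (@pair_continuous _ _ _ (fun z => - 4^-1 * x z + 3 / 4) tau) => //.
    exact: affine_continuous cx.
  move=> z z0; have [h|h] := leP (n z) 2^-1.
    have -> : tau z = 1 by rewrite /tau min_l//; lra.
    by have [? ?] := x1 z; rewrite !H1//; lra.
  have mE : m z = n z by rewrite /m max_l// ltW.
  have /eqP : x z ^+ 2 = 1.
    have := nsq z; rewrite z0 expr0n addr0 -xm mE exprMn => E.
    by apply: (mulIf (x := n z ^+ 2)); [rewrite expf_neq0// gt_eqF//; lra|rewrite mul1r].
  rewrite sqrf_eq1 => /orP[] /eqP ->.
    have -> : 4^-1 * 1 + 4^-1 = 2^-1 :> R by lra.
    by have -> : - 4^-1 * 1 + 3 / 4 = 2^-1 :> R by lra.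
  have -> : 4^-1 * -1 + 4^-1 = 0 :> R by lra.
  have -> : - 4^-1 * -1 + 3 / 4 = 1 :> R by lra.
  by have [t0 t1] := t01 z; have [-> ->] := Hs _ t0 t1.
move=> z; rewrite /g /circle_loop; set w := subfun _ z.
have wz : set_val w = set_val z by [].
have nw : n w = 1 by rewrite /n wz circleE sqrtr1.
have mw : m w = 1 by rewrite /m nw max_l//; lra.
have xw : x w = (set_val z).1 by rewrite /x mw divr1 wz.
have tw : tau w = 0 by rewrite /tau nw subrr mulr0 min_r.
have := x1 w; rewrite xw tw wz => -[? ?].
by case: ifP => _; rewrite H0//; lra.
Qed.

(** Points of the circle move along segments of the disk to [(-1, 0)], which carries [sigma 0]. Only
    values of [g] are taken, so the size does not grow. *)
Lemma null_square_of_disk (sigma : R -> A) (g : set_type (disk R) -> A) (e : R) : sigma 0 = sigma 1 ->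
  extends_to_disk g (circle_loop sigma) -> (diam (range g) < e%:E)%E ->
  exists2 H, null_square sigma H & forall z w, mdist (H z) (H w) < e.
Proof.
move=> s01 [cg ge] de.
pose cl (u : R) := Num.max 0 (Num.min u 1).
have cl01 u : 0 <= cl u /\ cl u <= 1.
  by rewrite le_max lexx ge_max ler01 ge_min lexx orbT.
have clE u : 0 <= u -> u <= 1 -> cl u = u by move=> u0 u1; rewrite /cl min_l ?max_r.
have ccl : continuous cl.
  apply: maxr_continuous; first by move=> u; exact: cvg_cst.
  by apply: minr_continuous => u; [exact: cvg_id|exact: cvg_cst].
(* [x] and [y] invert the parametrization of [circle_loop]. *)
pose x (u : R) := Num.min (4 * u - 1) (3 - 4 * u).
pose y (u : R) := if u <= 2^-1 then - Num.sqrt (1 - x u ^+ 2) else Num.sqrt (1 - x u ^+ 2).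
have x1 u : 0 <= u -> u <= 1 -> -1 <= x u /\ x u <= 1.
  by move=> u0 u1; rewrite /x; case: (leP (4 * u - 1) (3 - 4 * u)) => ?; split; lra.
have xy u : 0 <= u -> u <= 1 -> x u ^+ 2 + y u ^+ 2 = 1.
  move=> u0 u1; have [? ?] := x1 u u0 u1.
  have sq : 0 <= 1 - x u ^+ 2 by nra.
  by rewrite /y; case: ifP => _; rewrite ?sqrrN sqr_sqrtr//; lra.
have cid4 : continuous (fun u : R => 4 * u).
  by apply: mul_continuousF; [exact: cst_continuousF|move=> u; exact: cvg_id].
have cx : continuous x.
  apply: minr_continuous; apply: sub_continuousF => //; exact: cst_continuousF.
have cs : continuous (fun u => Num.sqrt (1 - x u ^+ 2)).
  apply: sqrt_continuousF; apply: sub_continuousF; first exact: cst_continuousF.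
  exact: sqr_continuousF.
have cy : continuous y.
  apply: (paste_continuous (u := id)) => //; first by move=> u; exact: cvg_id.
    by move=> u; apply: cvgN; exact: cs.
  move=> u ->; have -> : x 2^-1 = 1 by rewrite /x; case: leP => ?; lra.
  by rewrite expr1n subrr sqrtr0 oppr0.
pose e1 (z : R * R) := (1 - cl z.2) * x (cl z.1) - cl z.2.
pose e2 (z : R * R) := (1 - cl z.2) * y (cl z.1).
have ed z : (e1 z, e2 z) \in disk R.
  rewrite inE /disk /=; have [? ?] := cl01 z.2; have [u0 u1] := cl01 z.1.
  have := xy _ u0 u1; have [+ _] := x1 _ u0 u1; rewrite /e1 /e2.
  set a := x _; set b := y _; set c := cl z.2 => ha E.
  have c0 : 0 <= 1 - c by rewrite /c; lra.
  have a0 : 0 <= 1 + a by lra.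
  have : 0 <= c * (1 - c) * (1 + a) by apply: mulr_ge0 => //; exact: mulr_ge0.
  have Eb : b ^+ 2 = 1 - a ^+ 2 by lra.
  by rewrite exprMn Eb => ?; nra.
pose H z := g (SigSub (ed z)).
have cH : continuous H.
  have ccl1 : continuous (fun z : R * R => cl z.1).
    by apply: (@comp_continuous _ _ _ fst cl) => // z; exact: cvg_fst.
  have ccl2 : continuous (fun z : R * R => cl z.2).
    by apply: (@comp_continuous _ _ _ snd cl) => // z; exact: cvg_snd.
  have cxc : continuous (fun z : R * R => x (cl z.1)) := comp_continuous ccl1 cx.
  have cyc : continuous (fun z : R * R => y (cl z.1)) := comp_continuous ccl1 cy.
  apply: (comp_continuous _ cg); apply: continuous_to_set_type => /=.
  have c1m : continuous (fun z : R * R => 1 - cl z.2).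
    by apply: sub_continuousF => //; exact: cst_continuousF.
  apply: pair_continuous; last exact: mul_continuousF.
  by apply: sub_continuousF => //; exact: mul_continuousF.
have HE (z : circle R) w : (e1 w, e2 w) = set_val z -> H w = circle_loop sigma z.
  by move=> E; rewrite -ge /H; congr g; apply: val_inj.
have bC : ((-1, 0) : R * R) \in circle R by rewrite inE /circle /= sqrrN expr1n expr0n addr0.
have Hb w : e1 w = -1 -> e2 w = 0 -> H w = sigma 0.
  move=> E1 E2; rewrite (HE (SigSub bC)) /= ?E1 ?E2//.
  by rewrite /circle_loop /= lexx; congr sigma; lra.
exists H; last first.
  move=> z w; rewrite -lte_fin; apply: le_lt_trans de; apply: mdist_le_diam.
    by exists (SigSub (ed z)).
  by exists (SigSub (ed w)).
split=> //.
- move=> u u0 u1; have uC : (x u, y u) \in circle R by rewrite inE /circle /= xy.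
  rewrite (HE (SigSub uC)); last first.
    by rewrite /e1 /e2 /= !clE// !subr0 !mul1r.
  rewrite /circle_loop /= /y; case: (leP u 2^-1) => u2.
    rewrite oppr_le0 sqrtr_ge0; congr sigma; rewrite /x; case: leP => ?; lra.
  have xE : x u = 3 - 4 * u by rewrite /x; case: leP => ?; lra.
  case: (leP (Num.sqrt (1 - x u ^+ 2)) 0) => h; last by congr sigma; rewrite xE; lra.
  have : Num.sqrt (1 - x u ^+ 2) == 0 by rewrite eq_le h sqrtr_ge0.
  rewrite sqrtr_eq0 xE => h'; have -> : u = 1 by nra.
  have -> : 4^-1 * (3 - 4 * 1) + 4^-1 = 0 :> R by lra.
  exact: s01.
- by move=> u u0 u1; apply: Hb; rewrite /e1 /e2 /= (clE 1)// ?subrr ?mul0r ?sub0r.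
- move=> v v0 v1; have xm : x 0 = -1 by rewrite /x; case: leP => ?; lra.
  have xm1 : x 1 = -1 by rewrite /x; case: leP => ?; lra.
  have y0 : y 0 = 0 by rewrite /y xm sqrrN expr1n subrr sqrtr0 oppr0 if_same.
  have y1 : y 1 = 0 by rewrite /y xm1 sqrrN expr1n subrr sqrtr0 oppr0 if_same.
  by split; apply: Hb; rewrite /e1 /e2 /= !clE// ?xm ?xm1 ?y0 ?y1 ?mulr0//; lra.
Qed.

End fill_loops.

Section gap_homotopies.
Context {R : realType} {A : metricType R}.
Variables (K : set R) (l r : R).
Hypothesis cK : closed K.
Hypothesis Kl : forall t : R, t <= l -> K t.
Hypothesis Kr : forall t : R, r <= t -> K t.
Implicit Types (s t u v a b e : R) (c : R -> A) (H : R * R -> A).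

Definition path_homotopy c c' a b H : Prop :=
  [/\ continuous H, forall u, 0 <= u -> u <= 1 -> H (u, 0) = c (a + (b - a) * u),
      forall u, 0 <= u -> u <= 1 -> H (u, 1) = c' (a + (b - a) * u),
      forall u v, u <= 0 -> H (u, v) = c a & forall u v, 1 <= u -> H (u, v) = c b].

Lemma gap_unique a b a' b' t : is_gap K a b -> is_gap K a' b' -> a < t -> t < b -> a' < t -> t < b' ->
  a = a' /\ b = b'.
Proof.
move=> [ab Ka Kb Kab] [ab' Ka' Kb' Kab'] at_ tb at' tb'; split; apply/eqP; rewrite eq_le !leNgt.
  by apply/andP; split; apply/negP => h; [apply: (Kab' a)|apply: (Kab a')] => //; lra.
by apply/andP; split; apply/negP => h; [apply: (Kab b')|apply: (Kab' b)] => //; lra.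
Qed.

Lemma gap_at t : ~ K t -> exists a b, [/\ is_gap K a b, a < t & t < b].
Proof.
move=> nK; have [b tb gb] := last_in_gap cK Kl Kr nK.
exists (last_in cK Kl t), b; split=> //.
rewrite lt_neqAle last_in_le andbT; apply/eqP => E; apply: nK; rewrite -E; exact: last_in_in.
Qed.

(** Gaps may accumulate at a time of [K]; continuity there holds because homotopies over short gaps
    are small and therefore stay near the value of [c] at an end of the gap. *)
Lemma glue_homotopies c c' (H : R -> R -> R * R -> A) : continuous c -> continuous c' ->
  (forall t, K t -> c t = c' t) ->
  (forall a b, is_gap K a b -> path_homotopy c c' a b (H a b)) ->
  (forall e, 0 < e -> exists2 h, 0 < h & forall a b, is_gap K a b -> b - a < h ->
     forall z w, mdist (H a b z) (H a b w) < e) ->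
  exists G : R * R -> A, [/\ continuous G, forall t, G (t, 0) = c t, forall t, G (t, 1) = c' t &
    forall t v, K t -> G (t, v) = c t].
Proof.
move=> cc cc' ccK HP Hsmall.
pose gap t ab := [/\ is_gap K ab.1 ab.2, ab.1 < t & t < ab.2].
have [g gP] : exists g : R -> R * R, forall t, ~ K t -> gap t (g t).
  have /choice[g gP] : forall t, exists ab, ~ K t -> gap t ab; last by exists g.
  move=> t; have [Kt|nK] := pselect (K t); first by exists (0, 0).
  by have [a [b ab]] := gap_at nK; exists (a, b).
pose G z := if pselect (K z.1) then c z.1 else
  H (g z.1).1 (g z.1).2 ((z.1 - (g z.1).1) / ((g z.1).2 - (g z.1).1), z.2).
have GK t v : K t -> G (t, v) = c t by rewrite /G /=; case: pselect.
have GH a b t v : is_gap K a b -> a <= t -> t <= b -> G (t, v) = H a b ((t - a) / (b - a), v).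
  move=> gab; have [ab Ka Kb Kab] := gab; have [_ _ _ H0 H1] := HP a b gab.
  rewrite le_eqVlt => /orP[/eqP <- _|at_]; first by rewrite GK// subrr mul0r H0.
  rewrite le_eqVlt => /orP[/eqP ->|tb].
    by rewrite GK// divff ?H1//; lra.
  have nK := Kab t at_ tb; have [gt t1 t2] := gP t nK.
  have [E1 E2] := gap_unique gt gab t1 t2 at_ tb.
  by rewrite /G; case: pselect => [//|nK'] /=; rewrite E1 E2.
have cH a b : is_gap K a b -> continuous (fun z : R * R => H a b ((z.1 - a) / (b - a), z.2)).
  move=> gab; have [cH _ _ _ _] := HP a b gab.
  apply: (comp_continuous _ cH); apply: (@pair_continuous _ _ _ (fun z : R * R => (z.1 - a) / (b - a)) snd).
    move=> z; apply: cvgM; last exact: cvg_cst.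
    by apply: cvgB; [exact: cvg_fst|exact: cvg_cst].
  by move=> z; exact: cvg_snd.
have nearH a b x v e : is_gap K a b -> a <= x -> x <= b -> 0 < e -> exists2 d, 0 < d &
    forall t w, a <= t -> t <= b -> x - d < t -> t < x + d -> v - d < w -> w < v + d ->
    mdist (G (x, v)) (G (t, w)) < e.
  move=> gab ax xb e0; have /nbhs_box[d d0 dH] : nbhs (x, v) [set z : R * R |
      mdist (H a b ((x - a) / (b - a), v)) (H a b ((z.1 - a) / (b - a), z.2)) < e].
    apply: (cH a b gab (x, v) [set y | mdist (H a b ((x - a) / (b - a), v)) y < e]).
    by rewrite -ballEmdist; exact: nbhsx_ballx.
  by exists d => // t w at_ tb xt tx vw wv; rewrite !(GH a b)//; exact: dH.
have small e : 0 < e -> exists2 h, 0 < h & forall a b t w, is_gap K a b -> b - a < h ->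
    a <= t -> t <= b -> mdist (c a) (G (t, w)) < e /\ mdist (c b) (G (t, w)) < e.
  move=> /Hsmall[h h0 hH]; exists h => // a b t w gab ab at_ tb.
  have [ltab Ka Kb _] := gab.
  rewrite (GH a b t)//; split; first by rewrite -(GK a w Ka) (GH a b a)//; [exact: hH|exact: ltW].
  by rewrite -(GK b w Kb) (GH a b b)//; [exact: hH|exact: ltW].
have cnear x e : 0 < e -> exists2 d, 0 < d & forall t, x - d < t -> t < x + d -> mdist (c x) (c t) < e.
  move=> e0; apply: (@continuous_real_nbhs _ _ c x [set y | mdist (c x) y < e] cc).
  by rewrite -ballEmdist; exact: nbhsx_ballx.
have right x v e : K x -> 0 < e -> exists2 d, 0 < d & forall t w, x < t -> t < x + d ->
    v - d < w -> w < v + d -> mdist (G (x, v)) (G (t, w)) < e.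
  move=> Kx e0; have [[b gxb]|ngap] := pselect (exists b, is_gap K x b).
    have [xb _ _ _] := gxb; have [d d0 dP] := nearH x b x v e gxb (lexx x) (ltW xb) e0.
    have [m m0 [m1 m2]] := @min2_gt0 _ d (b - x) d0 ltac:(lra).
    by exists m => // t w xt tx vw wv; apply: dP; lra.
  have e20 : 0 < e / 2 by lra.
  have [h h0 hP] := small _ e20; have [d d0 dP] := cnear x _ e20.
  have [m m0 [m1 m2]] := min2_gt0 h0 d0.
  (* If no gap starts at [x], then [K] has times arbitrarily near to the right of [x], and the gaps
     before [k] are shorter than [h]. *)
  have [k [xk km Kk]] : exists k, [/\ x < k, k < x + m & K k].
    apply: contrapT => none; pose t := x + m / 2.
    have Kn k : x < k -> k < x + m -> ~ K k by move=> xk km Kk; apply: none; exists k.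
    have nK : ~ K t by apply: Kn; rewrite /t; lra.
    have [a [b [[ab Ka Kb Kab] at_ tb]]] := gap_at nK.
    have ax : a <= x by rewrite leNgt; apply/negP => h'; apply: (Kn a) => //; rewrite /t in at_; lra.
    have xa : x <= a.
      by rewrite leNgt; apply/negP => h'; apply: (Kab x) => //; rewrite /t in tb; lra.
    by apply: ngap; exists b; have -> : x = a by lra.
  exists (k - x) => [|t w xt tx vw wv]; first by lra.
  rewrite (GK x)//; have [Kt|nK] := pselect (K t).
    by rewrite GK//; apply: (@lt_trans _ _ (e / 2)); [apply: dP; lra|lra].
  have [a [b [gab at_ tb]]] := gap_at nK; have [ab Ka Kb Kab] := gab.
  have xa : x <= a by rewrite leNgt; apply/negP => h'; apply: (Kab x) => //; lra.
  have bk : b <= k by rewrite leNgt; apply/negP => h'; apply: (Kab k) => //; lra.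
  have := metric_triangle (c x) (c a) (G (t, w)).
  have := dP a ltac:(lra) ltac:(lra).
  have [] := hP a b t w gab ltac:(lra) (ltW at_) (ltW tb).
  by move=> *; lra.
have left x v e : K x -> 0 < e -> exists2 d, 0 < d & forall t w, x - d < t -> t < x ->
    v - d < w -> w < v + d -> mdist (G (x, v)) (G (t, w)) < e.
  move=> Kx e0; have [[b gxb]|ngap] := pselect (exists b, is_gap K b x).
    have [bx _ _ _] := gxb; have [d d0 dP] := nearH b x x v e gxb (ltW bx) (lexx x) e0.
    have [m m0 [m1 m2]] := @min2_gt0 _ d (x - b) d0 ltac:(lra).
    by exists m => // t w xt tx vw wv; apply: dP; lra.
  have e20 : 0 < e / 2 by lra.
  have [h h0 hP] := small _ e20; have [d d0 dP] := cnear x _ e20.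
  have [m m0 [m1 m2]] := min2_gt0 h0 d0.
  have [k [xk km Kk]] : exists k, [/\ x - m < k, k < x & K k].
    apply: contrapT => none; pose t := x - m / 2.
    have Kn k : x - m < k -> k < x -> ~ K k by move=> xk km Kk; apply: none; exists k.
    have nK : ~ K t by apply: Kn; rewrite /t; lra.
    have [a [b [[ab Ka Kb Kab] at_ tb]]] := gap_at nK.
    have ax : x <= b by rewrite leNgt; apply/negP => h'; apply: (Kn b) => //; rewrite /t in tb; lra.
    have xa : b <= x.
      by rewrite leNgt; apply/negP => h'; apply: (Kab x) => //; rewrite /t in at_; lra.
    by apply: ngap; exists a; have -> : x = b by lra.
  exists (x - k) => [|t w xt tx vw wv]; first by lra.
  rewrite (GK x)//; have [Kt|nK] := pselect (K t).
    by rewrite GK//; apply: (@lt_trans _ _ (e / 2)); [apply: dP; lra|lra].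
  have [a [b [gab at_ tb]]] := gap_at nK; have [ab Ka Kb Kab] := gab.
  have xa : b <= x by rewrite leNgt; apply/negP => h'; apply: (Kab x) => //; lra.
  have bk : k <= a by rewrite leNgt; apply/negP => h'; apply: (Kab k) => //; lra.
  have := metric_triangle (c x) (c b) (G (t, w)).
  have := dP b ltac:(lra) ltac:(lra).
  have [] := hP a b t w gab ltac:(lra) (ltW at_) (ltW tb).
  by move=> *; lra.
exists G; split=> //.
- move=> [x v] U /nbhs_ballP[e /= e0 eU].
  suff [d d0 dP] : exists2 d, 0 < d & forall t w, x - d < t -> t < x + d -> v - d < w -> w < v + d ->
      mdist (G (x, v)) (G (t, w)) < e.
    apply/nbhs_box; exists d => // t w xt tx vw wv; apply: eU.
    by rewrite ballEmdist; exact: dP.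
  have [Kx|nK] := pselect (K x); last first.
    have [a [b [gab ax xb]]] := gap_at nK.
    have [d d0 dP] := nearH a b x v e gab (ltW ax) (ltW xb) e0.
    have [m m0 [m1 [m2 m3]]] := @min3_gt0 _ d (x - a) (b - x) d0 ltac:(lra) ltac:(lra).
    by exists m => // t w xt tx vw wv; apply: dP; lra.
  have [d1 d10 dP1] := right x v e Kx e0; have [d2 d20 dP2] := left x v e Kx e0.
  have [m m0 [m1 m2]] := min2_gt0 d10 d20.
  exists m => // t w xt tx vw wv; have [tx'|tx'|->] := ltgtP t x.
  + by apply: dP2; lra.
  + by apply: dP1; lra.
  + by rewrite !GK// mdistxx.
- move=> t; have [Kt|nK] := pselect (K t); first by rewrite GK.
  have [a [b [gab at_ tb]]] := gap_at nK; have [_ H0 _ _ _] := HP a b gab.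
  rewrite (GH a b) ?ltW// H0; first by congr c; rewrite mulrC divfK; lra.
    by apply: divr_ge0; lra.
  by rewrite ler_pdivrMr; lra.
- move=> t; have [Kt|nK] := pselect (K t); first by rewrite GK// ccK.
  have [a [b [gab at_ tb]]] := gap_at nK; have [_ _ H1 _ _] := HP a b gab.
  rewrite (GH a b) ?ltW// H1; first by congr c'; rewrite mulrC divfK; lra.
    by apply: divr_ge0; lra.
  by rewrite ler_pdivrMr; lra.
Qed.

End gap_homotopies.

(** Chooses fillings that are small whenever a small filling exists. *)
Lemma near_minimal (R : realType) (U : Type) (good : U -> Prop) (d : U -> R -> Prop) :
  (forall x (e e' : R), d x e -> e <= e' -> d x e') -> (exists x, good x) ->
  ((forall e, 0 < e -> exists2 x, good x & d x e) -> exists2 x, good x & forall e, 0 < e -> d x e) ->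
  exists2 x, good x & forall e, 0 < e -> (exists2 x', good x' & d x' e) -> d x (2 * e).
Proof.
move=> dmono [x0 gx0] lim; pose D : set R := [set e | 0 < e /\ exists2 x, good x & d x e].
have [/lim[x gx dx]|] := pselect (forall e, 0 < e -> exists2 x, good x & d x e).
  by exists x => // e e0 _; apply: dx; lra.
move=> /existsNP[e0 /not_implyP[e00 none]].
have lbD e : D e -> e0 <= e.
  move=> [_ [x gx dx]]; rewrite leNgt; apply/negP => /ltW h.
  by apply: none; exists x => //; exact: dmono dx h.
have [[e1 De1]|Dn] := pselect (D !=set0); last first.
  by exists x0 => // e e'0 ex; case: Dn; exists e.
have hD : has_inf D by split; [exists e1|exists e0 => e; exact: lbD].
have i0 : e0 <= inf D by apply: lb_le_inf; [exists e1|move=> e; exact: lbD].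
(* The infimum of the possible sizes is at least [e0 > 0], so some size lies below twice the
   infimum; this is the origin of the factor 2. *)
have [|e2 [_ [x gx dx]] e2i] := @inf_adherent _ D (inf D) _ hD; first lra.
exists x => // e e'0 ex; apply: dmono dx _.
have : inf D <= e by apply: ge_inf; [exists e0 => y; exact: lbD|split].
by move=> ?; lra.
Qed.

Section assembly.
Context {R : realType} {A : metricType R}.
Hypothesis uv : uniformly_1_UV0 A.
Implicit Types (s t u v a b e : R) (c sigma : R -> A).

Lemma chi_null_square sigma : continuous sigma -> sigma 0 = sigma 1 -> chi sigma 0 1 = 1%g ->
  exists H, null_square sigma H.
Proof.
move=> cs s01 s1; have cc : continuous (cst (sigma 0) : R -> A) by move=> x; exact: cvg_cst.
have E : chi sigma 0 1 = chi (cst (sigma 0)) 0 1 by rewrite chi_cst.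
have [K [cK K0 K1 Kl Kr]] := chi_faithful cs cc erefl (esym s01) E.
exists K; split=> //; first by move=> u u0 u1; rewrite K0//; congr sigma; lra.
by move=> v _ _; rewrite Kl Kr s01.
Qed.

(** The uniform [UV_0] property, carried over from disks to squares; a trivial class makes the loop
    inessential. *)
Lemma small_null_square e : 0 < e -> exists2 d, 0 < d & forall sigma, continuous sigma ->
  sigma 0 = sigma 1 -> chi sigma 0 1 = 1%g ->
  (forall u v, 0 <= u -> u <= 1 -> 0 <= v -> v <= 1 -> mdist (sigma u) (sigma v) < d) ->
  exists2 H, null_square sigma H & forall z w, mdist (H z) (H w) < e.
Proof.
move=> e0; have [d [/andP[d0 de] dP]] := uv e0.
(* Halved, because distances below a bound only make the diameter at most this bound. *)
exists (d / 2) => [|sigma cs s01 s1 sd]; first by lra.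
have [H NH] := chi_null_square cs s01 s1.
have circ1 (z : circle R) : -1 <= (set_val z).1 /\ (set_val z).1 <= 1.
  have : (set_val z).1 ^+ 2 + (set_val z).2 ^+ 2 = 1 by exact: (set_valP z).
  by move=> ?; split; nra.
have cl z : exists2 u, 0 <= u /\ u <= 1 & circle_loop sigma z = sigma u.
  have [? ?] := circ1 z; rewrite /circle_loop; case: ifP => _.
    by exists (4^-1 * (set_val z).1 + 4^-1) => //; split; lra.
  by exists (- 4^-1 * (set_val z).1 + 3 / 4) => //; split; lra.
have [||g [ge gd]] := dP (circle_loop sigma) (circle_loop_continuous cs s01).
- exact: circle_loop_inessential NH.
- have hd : (diam (range (circle_loop sigma)) <= (d / 2)%:E)%E.
    apply: diam_le => _ _ [z _ <-] [w _ <-].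
    by have [u [? ?] ->] := cl z; have [v [? ?] ->] := cl w; apply: ltW; exact: sd.
  by apply: le_lt_trans hd _; rewrite lte_fin; lra.
exact: (null_square_of_disk s01 ge gd).
Qed.

Definition bigon c c' a b (w : R) : A :=
  if w <= 2^-1 then c ((b - a) * 2 * w + a) else c' (- (b - a) * 2 * w + (2 * b - a)).

Lemma bigon_continuous c c' a b : continuous c -> continuous c' -> c b = c' b ->
  continuous (bigon c c' a b).
Proof.
move=> cc cc' eb; apply: concat_continuous.
- by apply: (comp_continuous _ cc); apply: affine_continuous => x; exact: cvg_id.
- by apply: (comp_continuous _ cc'); apply: affine_continuous => x; exact: cvg_id.
have -> : (b - a) * 2 * 2^-1 + a = b :> R by lra.
by rewrite eb; congr c'; lra.
Qed.

Lemma bigon_ends c c' a b : c a = c' a -> bigon c c' a b 0 = c a /\ bigon c c' a b 1 = c a.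
Proof.
move=> ea; rewrite /bigon ifT; last by lra.
rewrite ifF; last by apply/negbTE; lra.
split; first by congr c; lra.
by rewrite ea; congr c'; lra.
Qed.

Lemma chi_bigon c c' a b : continuous c -> continuous c' -> c b = c' b ->
  chi c a b = chi c' a b -> chi (bigon c c' a b) 0 1 = 1%g.
Proof.
move=> cc cc' eb E; have cb := @bigon_continuous c c' a b cc cc' eb.
have caf x y : continuous (fun w : R => x * w + y) by apply: affine_continuous => w; exact: cvg_id.
rewrite -(chiM 0 2^-1 1 cb).
have -> : chi (bigon c c' a b) 0 2^-1 = chi c a b.
  rewrite (eq_chi (c' := fun w => c ((b - a) * 2 * w + a))) //; [|exact: (comp_continuous (caf _ _) cc)|].
    by rewrite (chi_comp (c := c) (k := fun w => (b - a) * 2 * w + a))//; congr chi; lra.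
  by move=> u _ u2; rewrite /bigon u2.
have -> : chi (bigon c c' a b) 2^-1 1 = chi c' b a.
  rewrite (eq_chi (c' := fun w => c' (- (b - a) * 2 * w + (2 * b - a)))) //; [|exact: (comp_continuous (caf _ _) cc')|lra|].
    by rewrite (chi_comp (c := c') (k := fun w => - (b - a) * 2 * w + (2 * b - a)))//; congr chi; lra.
  move=> u u2 _; rewrite /bigon; case: (leP u 2^-1) => // u2'.
  have -> : u = 2^-1 by lra.
  have -> : (b - a) * 2 * 2^-1 + a = b :> R by lra.
  by rewrite eb; congr c'; lra.
by rewrite E (chiV a b cc') mulgV.
Qed.

(** The square is folded around the midpoint of its lower side: the left side
    is sent to the three other sides and the right side to the midpoint. *)
Lemma bigon_homotopy c c' a b (N : R * R -> A) : c a = c' a -> c b = c' b ->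
  null_square (bigon c c' a b) N ->
  exists2 H, path_homotopy c c' a b H & forall z, exists w, H z = N w.
Proof.
move=> ea eb [cN N0 N1 Ns].
have [s0 s1] := bigon_ends b ea.
pose cl (u : R) := Num.max 0 (Num.min u 1).
have cl01 u : 0 <= cl u /\ cl u <= 1.
  by rewrite le_max lexx ge_max ler01 ge_min lexx orbT.
have clE u : 0 <= u -> u <= 1 -> cl u = u by move=> u0 u1; rewrite /cl min_l ?max_r.
have cl_lo u : u <= 0 -> cl u = 0 by move=> u0; rewrite /cl max_l// ge_min u0.
have cl_hi u : 1 <= u -> cl u = 1 by move=> u0; rewrite /cl min_r ?max_r.
have ccl : continuous cl.
  apply: maxr_continuous; first by move=> u; exact: cvg_cst.
  by apply: minr_continuous => u; [exact: cvg_id|exact: cvg_cst].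
pose b1 v := cl (3 * v + -1); pose b2 v := cl (Num.min (3 * v + 0) (-3 * v + 3)).
have caf x y : continuous (fun w : R => x * w + y) by apply: affine_continuous => w; exact: cvg_id.
have cb1 : continuous b1 by exact: (comp_continuous (caf 3 (-1)) ccl).
have cb2 : continuous b2.
  have cm : continuous (fun v : R => Num.min (3 * v + 0) (-3 * v + 3)) by apply: minr_continuous.
  exact: (comp_continuous cm ccl).
pose f (z : R * R) := (2^-1 + (1 - cl z.1) * (b1 z.2 - 2^-1), (1 - cl z.1) * b2 z.2).
have cfst (g : R -> R) : continuous g -> continuous (fun z : R * R => g z.1).
  by apply: (@comp_continuous _ _ _ fst) => z; exact: cvg_fst.
have csnd (g : R -> R) : continuous g -> continuous (fun z : R * R => g z.2).
  by apply: (@comp_continuous _ _ _ snd) => z; exact: cvg_snd.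
have c1 : continuous (fun z : R * R => 1 - cl z.1).
  by apply: sub_continuousF; [exact: cst_continuousF|exact: cfst].
have cf : continuous f.
  apply: pair_continuous; last by apply: mul_continuousF => //; exact: csnd.
  apply: add_continuousF; first exact: cst_continuousF.
  by apply: mul_continuousF => //; apply: sub_continuousF; [exact: csnd|exact: cst_continuousF].
exists (fun z => N (f z)); last by move=> z; exists (f z).
split; first exact: (comp_continuous cf cN).
- move=> u u0 u1; rewrite /f /b1 /b2 /= clE// (cl_lo (3 * 0 + -1)); last by lra.
  rewrite (cl_lo (Num.min _ _)); last by rewrite ge_min; apply/orP; left; lra.
  rewrite mulr0 N0; [|lra..]; rewrite /bigon ifT; last by lra.
  by congr c; lra.
- move=> u u0 u1; rewrite /f /b1 /b2 /= clE// (cl_hi (3 * 1 + -1)); last by lra.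
  rewrite (cl_lo (Num.min _ _)); last by rewrite ge_min; apply/orP; right; lra.
  rewrite mulr0 N0; [|lra..]; rewrite /bigon; case: (leP (2^-1 + (1 - u) * (1 - 2^-1)) 2^-1) => h.
    have -> : u = 1 by lra.
    have -> : (b - a) * 2 * (2^-1 + (1 - 1) * (1 - 2^-1)) + a = b :> R by lra.
    by rewrite eb; congr c'; lra.
  by congr c'; lra.
- move=> u v u0; rewrite /f /= cl_lo// -s0.
  have -> : 2^-1 + (1 - 0) * (b1 v - 2^-1) = b1 v by lra.
  rewrite subr0 mul1r; have [? ?] := cl01 (3 * v + -1).
  have [g0 g1] := cl01 (Num.min (3 * v + 0) (-3 * v + 3)).
  have [v1|v1] := leP v (1 / 3).
    by have -> : b1 v = 0; [rewrite /b1 cl_lo//; lra|have [] := Ns _ g0 g1].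
  have [v2|v2] := leP (2 / 3) v.
    by have -> : b1 v = 1; [rewrite /b1 cl_hi//; lra|have [] := Ns _ g0 g1].
  have -> : b2 v = 1 by rewrite /b2 cl_hi// le_min; apply/andP; split; lra.
  by rewrite N1.
- move=> u v u1; rewrite /f /= cl_hi// subrr !mul0r addr0 N0; [|lra..].
  rewrite /bigon ifT; last by lra.
  by congr c; lra.
Qed.

Lemma small_homotopy e : 0 < e -> exists2 d, 0 < d & forall c c' a b, continuous c -> continuous c' ->
  a <= b -> c a = c' a -> c b = c' b -> chi c a b = chi c' a b ->
  (forall u, a <= u -> u <= b -> mdist (c a) (c u) < d /\ mdist (c' a) (c' u) < d) ->
  exists2 H, path_homotopy c c' a b H & forall z w, mdist (H z) (H w) < e.
Proof.
move=> /small_null_square[d d0 dP]; exists (d / 2) => [|c c' a b cc cc' ab ea eb E cd]; first by lra.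
have [e0 e1] := bigon_ends b ea.
have near w : 0 <= w -> w <= 1 -> mdist (c a) (bigon c c' a b w) < d / 2.
  move=> w0 w1; rewrite /bigon; case: (leP w 2^-1) => w2; first by apply: (cd _ _ _).1; nra.
  by rewrite ea; apply: (cd _ _ _).2; nra.
have [|||u v u0 u1 v0 v1|N NN Ne] := dP (bigon c c' a b).
- exact: bigon_continuous.
- by rewrite e0 e1.
- exact: chi_bigon.
- have := metric_triangle (bigon c c' a b u) (c a) (bigon c c' a b v).
  rewrite (metric_sym _ (c a)); have := near u u0 u1; have := near v v0 v1.
  by move=> *; lra.
have [H HP HN] := bigon_homotopy ea eb NN; exists H => // z w.
by have [z' ->] := HN z; have [w' ->] := HN w.
Qed.

(** If there are arbitrarily small homotopies, both paths are constant on the interval and the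
    constant homotopy is optimal; otherwise [near_minimal] picks one within a factor 2 of the
    best. *)
Lemma near_minimal_homotopy c c' a b : continuous c -> continuous c' -> a <= b -> c a = c' a ->
  c b = c' b -> chi c a b = chi c' a b ->
  exists2 H, path_homotopy c c' a b H & forall e, 0 < e ->
    (exists2 H', path_homotopy c c' a b H' & forall z w, mdist (H' z) (H' w) < e) ->
    forall z w, mdist (H z) (H w) < 2 * e.
Proof.
move=> cc cc' ab ea eb E.
apply: (@near_minimal R (R * R -> A) (path_homotopy c c' a b) (fun H e => forall z w, mdist (H z) (H w) < e)).
- by move=> H e e' He ee z w; exact: lt_le_trans (He z w) ee.
- have [N NN] := chi_null_square (@bigon_continuous c c' a b cc cc' eb)
    (etrans (bigon_ends b ea).1 (esym (bigon_ends b ea).2)) (chi_bigon cc cc' eb E).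
  by have [H HP _] := bigon_homotopy ea eb NN; exists H.
move=> small; have con u : 0 <= u -> u <= 1 -> c (a + (b - a) * u) = c a /\ c' (a + (b - a) * u) = c a.
  move=> u0 u1; split; apply/esym/mdist_positivity/eqP; rewrite eq_le mdist_ge0 andbT leNgt; apply/negP.
    move=> /small[H [_ H0 _ Hl _] Hd]; have := Hd (0, 0) (u, 0).
    by rewrite Hl// H0// ltxx.
  move=> /small[H [_ _ H1 Hl _] Hd]; have := Hd (0, 0) (u, 1).
  by rewrite Hl// H1// ltxx.
exists (cst (c a)); last by move=> e e0 z w; rewrite mdistxx.
split=> //.
- by move=> z; exact: cvg_cst.
- by move=> u u0 u1; rewrite (con u u0 u1).1.
- by move=> u u0 u1; rewrite (con u u0 u1).2.
- have := con 1 ler01 (lexx 1); have -> : a + (b - a) * 1 = b by lra.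
  by move=> [-> _].
Qed.

(** Infinitely many homotopies are concatenated. Over short gaps both paths are short, so small
    homotopies exist by [small_homotopy], and the near minimal ones are small too; hence they can be
    glued. *)
Lemma chi_assemble (K : set R) c c' (l r : R) : closed K -> continuous c -> continuous c' -> l <= r ->
  K l -> K r -> (forall t, l <= t -> t <= r -> K t -> c t = c' t) ->
  (forall a b, l <= a -> b <= r -> is_gap K a b -> chi c a b = chi c' a b) ->
  chi c l r = chi c' l r.
Proof.
move=> clK cc cc' lr Kl Kr ccK gapE.
(* With both half-lines added, every time off the set lies in a gap between [l] and [r]; the paths
   are frozen outside by [cl]. *)
pose K' : set R := [set t | t <= l] `|` K `|` [set t | r <= t].
have cK' : closed K'.
  by apply: closedU; [apply: closedU => //; exact: closed_le|exact: closed_ge].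
have K'l t : t <= l -> K' t by left; left.
have K'r t : r <= t -> K' t by right.
have K'K t : l <= t -> t <= r -> K' t -> K t.
  by move=> lt tr [[/= tl|//]|/= rt]; [have -> : t = l by lra|have -> : t = r by lra].
have gap' a b : is_gap K' a b -> [/\ l <= a, b <= r & is_gap K a b].
  move=> [ab Ka Kb Kab].
  have la : l <= a.
    rewrite leNgt; apply/negP => al; pose m := Num.min l ((a + b) / 2).
    have [m1 m2] : m <= l /\ m <= (a + b) / 2 by rewrite /m !ge_min !lexx orbT.
    have am : a < m by rewrite /m lt_min al /=; lra.
    by apply: (Kab m) => //; [lra|exact: K'l].
  have br : b <= r.
    rewrite leNgt; apply/negP => rb; pose m := Num.max r ((a + b) / 2).
    have [m1 m2] : r <= m /\ (a + b) / 2 <= m by rewrite /m !le_max !lexx orbT.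
    have mb : m < b by rewrite /m gt_max rb /=; lra.
    by apply: (Kab m) => //; [lra|exact: K'r].
  split=> //; split=> //; [by apply: K'K => //; lra|by apply: K'K => //; lra|].
  by move=> x ax xb Kx; apply: (Kab x ax xb); left; right.
pose cl t := Num.max l (Num.min t r).
have clE t : l <= t -> t <= r -> cl t = t by move=> lt tr; rewrite /cl min_l// max_r.
have ccl : continuous cl.
  apply: maxr_continuous; first by move=> u; exact: cvg_cst.
  by apply: minr_continuous => u; [exact: cvg_id|exact: cvg_cst].
have cl_lo t : t <= l -> cl t = l by move=> tl; rewrite /cl max_l// ge_min tl.
have cl_hi t : r <= t -> cl t = r by move=> rt; rewrite /cl min_r// max_r.
pose d t := c (cl t); pose d' t := c' (cl t).
have cd : continuous d by exact: (comp_continuous ccl cc).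
have cd' : continuous d' by exact: (comp_continuous ccl cc').
have ddK t : K' t -> d t = d' t.
  have [tl|lt] := leP t l; first by rewrite /d /d' cl_lo// => _; apply: ccK.
  have [rt|tr] := leP r t; first by rewrite /d /d' cl_hi// => _; apply: ccK.
  by rewrite /d /d' clE ?ltW// => /(K'K _ (ltW lt) (ltW tr)); apply: ccK; exact: ltW.
have chid a b : l <= a -> a <= b -> b <= r -> chi d a b = chi c a b /\ chi d' a b = chi c' a b.
  by move=> la ab br; split; apply: eq_chi => // u au ub; rewrite /d /d' clE//; lra.
have [<- <-] := chid l r (lexx l) lr (lexx r).
have gapd a b : is_gap K' a b -> [/\ a <= b, d a = d' a, d b = d' b & chi d a b = chi d' a b].
  move=> gab; have [la br gK] := gap' a b gab; have [ab Ka Kb _] := gab.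
  have [-> ->] := chid a b la (ltW ab) br.
  by rewrite (gapE a b la br gK) !ddK// (ltW ab).
pose near_min a b H := path_homotopy d d' a b H /\ forall e, 0 < e ->
    (exists2 H', path_homotopy d d' a b H' & forall z w, mdist (H' z) (H' w) < e) ->
    forall z w, mdist (H z) (H w) < 2 * e.
have /choice[H HP] : forall ab : R * R, exists H, is_gap K' ab.1 ab.2 -> near_min ab.1 ab.2 H.
  move=> [a b]; have [/gapd[ab ea eb E]|ng] := pselect (is_gap K' a b); last by exists (cst (c 0)).
  by have [H HP HM] := near_minimal_homotopy cd cd' ab ea eb E; exists H.
have [G [cG G0 G1 GK]] : exists G : R * R -> A, [/\ continuous G, forall t, G (t, 0) = d t,
    forall t, G (t, 1) = d' t & forall t v, K' t -> G (t, v) = d t].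
  apply: (@glue_homotopies R A K' l r cK' K'l K'r d d' (fun a b => H (a, b)) cd cd' ddK).
    by move=> a b /(HP (a, b))[].
  move=> e e0; have e20 : 0 < e / 2 by lra.
  have [m m0 mP] := small_homotopy e20.
  have [h h0 hP] := segment_unif_continuous l r cc m0.
  have [h' h'0 hP'] := segment_unif_continuous l r cc' m0.
  have [n n0 [n1 n2]] := min2_gt0 h0 h'0.
  exists n => // a b gab abn z w; have [la br _] := gap' a b gab.
  have [ab ea eb E] := gapd a b gab.
  have [_ /(_ _ e20) HM] := HP (a, b) gab.
  have -> : e = 2 * (e / 2) by lra.
  apply: HM => /=; apply: mP => // u au ub; rewrite /d /d' !clE; [|lra..].
  have n' : `|a - u| < n by rewrite ler0_norm; lra.
  by split; [apply: hP|apply: hP']; lra.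
apply: (@chi_homotopic _ _ d l r d' l r (fun z => G (l + (r - l) * z.1, z.2))) => //.
- apply: (comp_continuous _ cG); apply: (@pair_continuous _ _ _ (fun z : R * R => l + (r - l) * z.1) snd).
    by apply: affine_continuousC => z; exact: cvg_fst.
  by move=> z; exact: cvg_snd.
- by move=> v _ _ /=; rewrite mulr0 addr0 GK//; exact: K'l.
- move=> v _ _ /=; have -> : l + (r - l) * 1 = r by lra.
  by rewrite GK//; exact: K'r.
Qed.

End assembly.

(** * Homotopies along convergent sequences of times *)

Section interpolation.
Context {R : realType}.
Implicit Types (x e : R) (n k m : nat).

Definition inv_succ n : R := n.+1%:R^-1.

Lemma inv_succ_gt0 n : 0 < inv_succ n. Proof. by rewrite invr_gt0 ltr0n. Qed.

Lemma inv_succ_lt n : inv_succ n.+1 < inv_succ n.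
Proof. by rewrite ltf_pV2 ?posrE ?ltr0n// ltr_nat. Qed.

Lemma inv_succ_le n k : (n <= k)%N -> inv_succ k <= inv_succ n.
Proof. by move=> nk; rewrite lef_pV2 ?posrE ?ltr0n// ler_nat. Qed.

Lemma inv_succ_small x : 0 < x -> exists n, inv_succ n < x.
Proof.
move=> x0; exists (Num.truncn x^-1); rewrite -[ltRHS]invrK ltf_pV2 ?posrE ?ltr0n ?invr_gt0//.
have xi0 : 0 <= x^-1 by rewrite invr_ge0 ltW.
by have /andP[] := truncn_itv xi0.
Qed.

(** A convergent sequence of times becomes a path of times, so that [chi_assemble] can be applied to
    it. *)
Lemma interpolate (s : nat -> R) (l : R) :
  (forall e, 0 < e -> exists n, forall k, (n <= k)%N -> `|s k - l| < e) ->
  exists2 phi : R -> R, continuous phi & phi 0 = l /\ forall n, phi (inv_succ n) = s n.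
Proof.
move=> sl; pose r := inv_succ.
(* The ramp [w i] grows from 0 at [r i] to 1 at [r i.+1], so the sum telescopes to [s N] at [r N]
   and interpolates linearly in between. *)
pose w i x := Num.max 0 (Num.min 1 ((r i - x) / (r i - r i.+1))).
have rr i : 0 < r i - r i.+1 by rewrite subr_gt0; exact: inv_succ_lt.
have w0 i x : r i <= x -> w i x = 0.
  move=> ix; rewrite /w max_l// ge_min; apply/orP; right.
  by rewrite pmulr_lle0 ?invr_gt0//; lra.
have w1 i x : x <= r i.+1 -> w i x = 1.
  by move=> xi; rewrite /w min_l ?max_r// ler_pdivlMr// mul1r; lra.
have w01 i x : 0 <= w i x /\ w i x <= 1.
  by rewrite /w le_max lexx ge_max ler01 ge_min lexx.
have cw i : continuous (w i).
  apply: maxr_continuous; first by move=> x; exact: cvg_cst.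
  apply: minr_continuous; first by move=> x; exact: cvg_cst.
  move=> x; apply: cvgM; last exact: cvg_cst.
  by apply: cvgB; [exact: cvg_cst|exact: cvg_id].
pose f N x := s 0%N + \sum_(i < N) w i x * (s i.+1 - s i).
have fS N x : f N.+1 x = f N x + w N x * (s N.+1 - s N) by rewrite /f big_ord_recr addrA.
have cf N : continuous (f N).
  elim: N => [|N IHN]; first by move=> x; rewrite /f; under eq_fun do rewrite big_ord0; exact: cvg_cst.
  have -> : f N.+1 = fun x => f N x + w N x * (s N.+1 - s N) by apply/funext => x; exact: fS.
  by move=> x; apply: cvgD; [exact: IHN|apply: cvgM; [exact: cw|exact: cvg_cst]].
have f_stable N M x : r N <= x -> (N <= M)%N -> f M x = f N x.
  move=> Nx; elim: M => [|M IHM]; first by rewrite leqn0 => /eqP ->.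
  rewrite leq_eqVlt => /orP[/eqP -> //|NM]; rewrite fS IHM// w0 ?mul0r ?addr0//.
  exact: le_trans (inv_succ_le _) Nx.
have f_hi N x : x <= r N -> f N x = s N.
  elim: N => [|N IHN] xN; first by rewrite /f big_ord0 addr0.
  rewrite fS w1// IHN; first by lra.
  by apply: le_trans xN _; apply: ltW; exact: inv_succ_lt.
have f_near k e x : (forall j, (k <= j)%N -> `|s j - l| < e) -> x <= r k ->
    forall N, (k <= N)%N -> `|f N x - l| < e.
  move=> sk xk; elim=> [|N IHN]; first by rewrite leqn0 => /eqP E; rewrite -E f_hi//; apply: sk.
  rewrite leq_eqVlt => /orP[/eqP E|kN]; first by rewrite -E f_hi//; apply: sk.
  have [xN|Nx] := leP x (r N); last by rewrite fS w0 ?mul0r ?addr0 ?IHN// ltW.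
  rewrite fS f_hi//; have := sk N kN; have := sk N.+1 (leqW kN).
  have [] := w01 N x; move: (w N x) (s N) (s N.+1) => a b c a0 a1.
  rewrite !ltr_norml => /andP[? ?] /andP[? ?]; apply/andP.
  have [bc|cb] := leP b c.
    have : 0 <= a * (c - b) /\ 0 <= (1 - a) * (c - b) by split; apply: mulr_ge0; lra.
    by move=> [? ?]; split; lra.
  have : 0 <= a * (b - c) /\ 0 <= (1 - a) * (b - c) by split; apply: mulr_ge0; lra.
  by move=> [? ?]; split; lra.
have /choice[n nP] : forall x, exists n, 0 < x -> r n < x.
  move=> x; have [x0|] := ltP 0 x; last by exists 0%N.
  by have [n nx] := inv_succ_small x0; exists n.
pose phi x := if x <= 0 then l else f (n x) x.
have phiE N x : 0 < x -> r N <= x -> phi x = f N x.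
  move=> x0 Nx; rewrite /phi leNgt x0 /=.
  have nx := ltW (nP x x0).
  by rewrite -(f_stable (n x) (maxn (n x) N))// ?leq_maxl// (f_stable N)// leq_maxr.
have phi0 : phi 0 = l by rewrite /phi lexx.
exists phi; last by split=> // k; rewrite (phiE k)// ?inv_succ_gt0// f_hi.
apply: sandwich_continuous => x U.
have [x0|] := ltP 0 x; last rewrite le_eqVlt => /orP[/eqP -> |x0].
- move=> Ux; have nx := nP x x0.
  have Uf : nbhs (f (n x) x) U by rewrite -(phiE (n x)) ?ltW.
  have [d d0 dU] := continuous_real_nbhs (cf (n x)) Uf.
  have rn0 := inv_succ_gt0 (n x).
  have [m m0 [m1 m2]] := @min2_gt0 _ d (x - r (n x)) d0 ltac:(lra).
  by exists m => // t xt tx; rewrite (phiE (n x)); [apply: dU; lra|rewrite /r in m2 *; lra|lra].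
- rewrite phi0 => /nbhs_real[e e0 eU]; have [k kP] := sl e e0.
  exists (r k) => [|t xt tx]; first exact: inv_succ_gt0.
  have [t0|t0] := leP t 0; first by rewrite /phi t0; apply: eU; lra.
  have nt := nP t t0.
  rewrite (phiE (maxn k (n t)))//; last first.
    by apply: le_trans (ltW nt); apply: inv_succ_le; exact: leq_maxr.
  have := f_near k e t kP ltac:(lra) (maxn k (n t)) (leq_maxl _ _).
  by rewrite ltr_norml => /andP[? ?]; apply: eU; lra.
- rewrite {1}/phi ltW// => Ul; exists (- x) => [|t xt tx]; first by lra.
  by rewrite /phi ifT; [exact: nbhs_singleton|lra].
Qed.

End interpolation.

Section limits.
Context {R : realType} {A : metricType R}.
Hypothesis uv : uniformly_1_UV0 A.
Implicit Types (c : R -> A) (s t : nat -> R) (x e : R).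

(** Equality of all consecutive classes does not give equality in the limit by algebra alone:
    infinitely many homotopies are assembled over the gaps of the times [1 / (n + 1)], with 0 as
    their limit. *)
Lemma chi_limit c c' s t (ls lt : R) : continuous c -> continuous c' ->
  (forall e, 0 < e -> exists n, forall k, (n <= k)%N -> `|s k - ls| < e) ->
  (forall e, 0 < e -> exists n, forall k, (n <= k)%N -> `|t k - lt| < e) ->
  (forall n, c (s n) = c' (t n)) ->
  (forall n, chi c (s n) (s n.+1) = chi c' (t n) (t n.+1)) ->
  c ls = c' lt -> chi c (s 0%N) ls = chi c' (t 0%N) lt.
Proof.
move=> cc cc' /interpolate[phi cphi [phi0 phin]] /interpolate[psi cpsi [psi0 psin]] E F El.
pose r := @inv_succ R.
pose K : set R := \bigcap_n ([set x | x <= r n.+1] `|` [set x | r n <= x]).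
have cK : closed K.
  by apply: closed_bigI => n _; apply: closedU; [exact: closed_le|exact: closed_ge].
have Kr n : K (r n).
  move=> k _; have [nk|kn] := leqP n k; first by right; exact: inv_succ_le.
  by left; exact: inv_succ_le.
have r0 : r 0%N = 1 by rewrite /r /inv_succ invr1.
have K0 : K 0 by move=> k _; left; apply: ltW; exact: inv_succ_gt0.
have KE x : 0 <= x -> x <= 1 -> K x -> x = 0 \/ exists n, x = r n.
  rewrite le_eqVlt => /orP[/eqP <- _ _|x0 x1 Kx]; [by left|right].
  have ex : exists n, r n <= x by have [n /ltW nx] := inv_succ_small x0; exists n.
  case: (ex_minnP ex) => -[|n] nx mn; first by exists 0%N; lra.
  exists n.+1; have [/= xn|/= xn] := Kx n Logic.I; first by apply/eqP; rewrite eq_le xn.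
  by have := mn n xn; rewrite ltnn.
have cf := comp_continuous cphi cc; have cg := comp_continuous cpsi cc'.
have : chi (fun x => c (phi x)) 0 1 = chi (fun x => c' (psi x)) 0 1.
  apply: (chi_assemble uv cK) => //; rewrite -?r0//.
    by move=> x x0; rewrite r0 => x1 /(KE x x0 x1)[->|[n ->]]; rewrite ?phi0 ?psi0// phin psin.
  move=> a b a0; rewrite r0 => b1 [ab Ka Kb Kab]; pose m := (a + b) / 2.
  have am : a < m by rewrite /m; lra.
  have mb : m < b by rewrite /m; lra.
  have [n [nm mn]] : exists n, r n.+1 < m /\ m < r n.
    apply: contrapT => none; apply: (Kab m am mb) => n _.
    have [h|h] := leP m (r n.+1); [by left|right].
    by rewrite /= leNgt; apply/negP => h'; apply: none; exists n.
  have -> : a = r n.+1.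
    apply/eqP; rewrite eq_le; have [/= ->|/= h] := Ka n Logic.I; last by lra.
    by rewrite leNgt; apply/negP => h; apply: (Kab _ h _ (Kr n.+1)); lra.
  have -> : b = r n.
    apply/eqP; rewrite eq_le; have [/= h|/= ->] := Kb n Logic.I; first by lra.
    by rewrite andbT leNgt; apply/negP => h; apply: (Kab _ _ h (Kr n)); lra.
  rewrite (chi_comp (r n.+1) (r n) cc cphi) (chi_comp (r n.+1) (r n) cc' cpsi) !phin !psin.
  by rewrite (chiV (s n) (s n.+1) cc) (chiV (t n) (t n.+1) cc') F.
rewrite (chi_comp 0 1 cc cphi) (chi_comp 0 1 cc' cpsi) -r0 phi0 psi0 phin psin.
by rewrite (chiV (s 0%N) ls cc) (chiV (t 0%N) lt cc'); exact: invg_inj.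
Qed.

End limits.

(** * Trivial words *)

Section induced_chi.
Context {R : realType} {T U : topologicalType} (g : continuousType T U).
Implicit Types (c : R -> T) (s t : R).
Local Notation I := (unit_itv R).

Let cg : continuous g. Proof. exact: cts_fun. Qed.

Lemma chi_map c c' s t s' t' : continuous c -> continuous c' -> c s = c' s' -> c t = c' t' ->
  chi c s t = chi c' s' t' -> chi (fun u => g (c u)) s t = chi (fun u => g (c' u)) s' t'.
Proof.
move=> cc cc' es et E; have [K [cK K0 K1 Kl Kr]] := chi_faithful cc cc' es et E.
apply: (@chi_homotopic _ _ _ _ _ _ _ _ (fun z => g (K z))).
- exact: (comp_continuous cc cg).
- exact: (comp_continuous cc' cg).
- exact: (comp_continuous cK cg).
- by move=> u u0 u1; rewrite K0.
- by move=> u u0 u1; rewrite K1.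
- by move=> v _ _; rewrite Kl.
- by move=> v _ _; rewrite Kr.
Qed.

(** The first path followed by the reverse of the second is a loop, to which injectivity on
    fundamental groups applies. *)
Lemma chi_pi1_inj c c' s t s' t' : pi1_injective R g -> continuous c -> continuous c' ->
  c s = c' s' -> c t = c' t' ->
  chi (fun u => g (c u)) s t = chi (fun u => g (c' u)) s' t' -> chi c s t = chi c' s' t'.
Proof.
move=> ginj cc cc' es et E.
have [h [ch h0 h1 hK]] := chi_join s s' cc cc' et.
have cgc : continuous (fun u => g (c u)) by exact: (comp_continuous cc cg).
have cgc' : continuous (fun u => g (c' u)) by exact: (comp_continuous cc' cg).
have cgh : continuous (fun u => g (h u)) by exact: (comp_continuous ch cg).
have cid' : continuous (@id T) by move=> x; exact: cvg_id.
suff h11 : chi h (-1) 1 = 1%g.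
  apply: (mulIg (chi c' t' s')); transitivity (chi h (-1) 1); first exact: hK T id cid'.
  by rewrite h11 (chiV s' t' cc') mulgV.
have gh1 : chi (fun u => g (h u)) (-1) 1 = 1%g.
  by rewrite -(hK U g cg) E (chiV s' t' cgc') mulgV.
have h10 : h 1 = h (-1) by rewrite h0 h1 es.
pose w (u : I) := h (-1 + (1 - -1) * ival u).
have cw : continuous w.
  by apply: (comp_continuous _ ch); apply: affine_continuousC; exact: ival_continuous.
have w0 : w zero = h (-1) by rewrite /w ival0 mulr0 addr0.
have w1 : w one = h (-1) by rewrite /w ival1 -[RHS]h10; congr h; lra.
pose p : {path I from h (-1) to h (-1)} := mk_path cw w0 w1.
have pc : path_homotopic (Defs.path_map g p) (Defs.path_map g (path_cst (h (-1)))).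
  have [|||||H [cH H0 H1 Hl Hr]] := @loop_class_inj R U (Defs.path_map g p) (Defs.path_map g (path_cst (h (-1)))).
  - exact: path_cts.
  - exact: path_cts.
  - by rewrite !path_zero.
  - by rewrite !path_one.
  - transitivity (chi (fun u => g (h u)) (-1) 1); first by [].
    by rewrite gh1 -(chi_cst (g (h (-1))) 0 1); congr loop_class.
  by exists H; split=> // v; rewrite ?Hl ?Hr ?path_zero ?path_one.
have /pi1P[H [cH H0 H1 Hl Hr]] : \pi_(pi1 R (h (-1))) p = \pi_(pi1 R (h (-1))) (path_cst (h (-1))).
  by apply: (ginj (h (-1))); rewrite !pi1_mapE; apply/pi1P.
have -> : chi h (-1) 1 = loop_class p by [].
rewrite -(chi_cst (h (-1)) 0 1); transitivity (loop_class (path_cst (h (-1)) : {path I from h (-1) to h (-1)})); last by [].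
apply: loop_class_homotopic; [exact: path_cts|exact: path_cts|].
by exists H; split=> // v; rewrite ?Hl ?Hr ?path_zero ?path_one.
Qed.

End induced_chi.

Section hat_pairs.
Context {R : realType} {X : metricType R} {Y : topologicalType}.
Context {P : set (set X)} {Q : set (set Y)} {f : continuousType X Y}.
Hypotheses (tgX : disjointly_tree_graded R P) (fPQ : maps_pieces_into_pieces P Q f).
Local Notation dvX := (devX tgX fPQ).
Local Notation letX := (letterX tgX fPQ).
Implicit Types (F : seq (set X)) (C : set X) (s t u : R) (p q : R -> X).

Lemma devXM F q s t u : (forall C, C \in F -> P C) -> continuous q ->
  (dvX F q s t * dvX F q t u)%g = dvX F q s u.
Proof. by move=> FP cq; exact: (developM set0 (increments_piece tgX fPQ FP cq)). Qed.

Lemma devXV F q s t : (forall C, C \in F -> P C) -> continuous q ->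
  dvX F q t s = ((dvX F q s t)^-1)%g.
Proof. by move=> FP cq; exact: (developV set0 (increments_piece tgX fPQ FP cq)). Qed.

Lemma devX_refl F q s : (forall C, C \in F -> P C) -> continuous q -> dvX F q s s = 1%g.
Proof. by move=> FP cq; exact: (develop_refl set0 (increments_piece tgX fPQ FP cq)). Qed.

Lemma devX_near F q x : (forall C, C \in F -> P C) -> continuous q -> exists2 d : R, 0 < d &
  (exists C, [/\ C \in F, C (q x) & forall s t, x - d < s -> s < x + d -> x - d < t -> t < x + d ->
     dvX F q s t = letX C q s t]) \/
  [/\ forall C, C \in F -> ~ C (q x), forall C u, C \in F -> x - d < u -> u < x + d -> ~ C (q u) &
     forall s t, x - d < s -> s < x + d -> x - d < t -> t < x + d -> dvX F q s t = 1%g].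
Proof.
move=> FP cq; have D := increments_piece tgX fPQ FP cq.
have [d [C [d0 CF iso dE]]] := develop_near set0 D x.
case: CF => [[CF Cx]|nF].
  exists d => //; left; exists C; split=> // s t xs sx xt tx.
  by rewrite /devX dE// /increment CF.
have [e e0 eC] : exists2 e, 0 < e & forall u, x - e < u -> u < x + e -> C \in F -> ~ C (q u).
  have [CF|] := boolP (C \in F); last by exists 1.
  by have [e e0 eK] := closed_gap (inc_closed D CF) (nF C CF); exists e => // u xu ux _; exact: eK.
have [m m0 [m1 m2]] := min2_gt0 d0 e0; exists m => //; right; split=> //.
  move=> C' u C'F xu ux; have [E|/eqP ne] := eqVneq C' C.
    by rewrite E; apply: eC; [lra|lra|rewrite -E].
  exact: (iso u u ltac:(lra) ltac:(lra) C' C'F ne).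
have dst s t : x - m < s -> s <= t -> t < x + m -> dvX F q s t = 1%g.
  move=> xs st tx; rewrite /devX dE; [|lra..]; rewrite /increment; case: ifP => // CF.
  by apply: letterX_off => // u su ut; apply: eC => //; lra.
move=> s t xs sx xt tx; have [st|/ltW ts] := leP s t; first exact: dst.
by rewrite (devXV t s FP cq) dst// invg1.
Qed.

Lemma letX_refl C q s : continuous q -> letX C q s s = 1%g.
Proof. by move=> cq; apply: (mulgI (letX C q s s)); rewrite letterXM// mulg1. Qed.

Lemma devX_single C q s t : P C -> continuous q -> dvX [:: C] q s t = letX C q s t.
Proof.
move=> PC cq; have FP : forall D, D \in [:: C] -> P D by move=> D; rewrite inE => /eqP ->.
have dst a b : a <= b -> dvX [:: C] q a b = letX C q a b.
  move=> ab; rewrite /devX.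
  rewrite (@develop_isolated _ _ _ _ _ _ (increments_piece tgX fPQ FP cq) C)//.
    by rewrite /increment inE eqxx.
  by move=> D; rewrite inE => /eqP.
have [st|/ltW ts] := leP s t; first exact: dst.
rewrite (devXV t s FP cq) dst//; apply: (mulgI (letX C q t s)).
by rewrite mulgV letterXM// letX_refl.
Qed.

(** Omitting pieces deletes their letters; in particular a word that is trivial for a larger set of
    pieces is trivial for a smaller one. *)
Lemma devX_keep F F' q s t : (forall C, C \in F' -> P C) -> {subset F <= F'} -> continuous q ->
  dvX F q s t = keep (fun C => C \in F) (dvX F' q s t).
Proof.
move=> FP' sub cq; have FP C : C \in F -> P C by move=> /sub/FP'.
pose E s t := dvX F q s t = keep (fun C => C \in F) (dvX F' q s t).
have dst a b : a <= b -> E a b.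
  move: a b; apply: interval_chain => [a b c ab bc Eab Ebc|x].
    by rewrite /E -(devXM a b c FP cq) -(devXM a b c FP' cq) keepM Eab Ebc.
  have [d d0 dP] := devX_near x FP cq; have [d' d'0 dP'] := devX_near x FP' cq.
  have [m m0 [m1 m2]] := min2_gt0 d0 d'0; exists m => // a b xa ab bx; rewrite /E.
  case: dP' => [[C [CF' Cx dE']]|[nC _ dE']]; (rewrite dE'; [|lra..]).
    rewrite (letterXE tgX fPQ (FP' _ CF')) keep_letter -(letterXE tgX fPQ (FP' _ CF')).
    case: dP => [[D [DF Dx dE]]|[nD _ dE]]; (rewrite dE; [|lra..]).
      by have <- : D = C; [exact: (piece_unique tgX (FP _ DF) (FP' _ CF') Dx Cx)|rewrite DF].
    by case: ifP => // CF; case: (nD C CF).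
  rewrite keep1; case: dP => [[D [DF Dx dE]]|[nD _ dE]]; last by rewrite dE //; lra.
  by case: (nC D (sub _ DF)).
have [st|/ltW ts] := leP s t; first exact: dst.
by rewrite (devXV t s FP cq) (devXV t s FP' cq) keepV dst.
Qed.

(** [p] closes up between [s] and [t], and its passages through the pieces, seen
    in the free products of the path groups of [Pc Q], cancel. *)
Definition hat_pair p s t : Prop :=
  same_value p s t /\ forall F, (forall C, C \in F -> P C) -> dvX F p s t = 1%g.

Lemma hat_letter p C s t : continuous p -> P C -> hat_pair p s t -> letX C p s t = 1%g.
Proof.
move=> cp PC [_ h]; rewrite -devX_single//; apply: h => D.
by rewrite inE => /eqP ->.
Qed.

Hypothesis uv : uniformly_1_UV0 (set_type (Pc P)).
Hypothesis finj : pi1_injective R (set_restr (maps_Pc_into_Pc fPQ)).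

(** Letters are classes in [Pc Q]; since [f] is injective on fundamental groups of [Pc P], they
    still detect homotopy in [Pc P], where [chi_assemble] is available. *)
Lemma letter_chi C (PC : P C) p q s t s' t' : continuous p -> continuous q ->
  p s = q s' -> p t = q t' -> letX C p s t = letX C q s' t' <->
  chi (fun u => ret_to_Pc tgX PC (p u)) s t = chi (fun u => ret_to_Pc tgX PC (q u)) s' t'.
Proof.
move=> cp cq es et; have crp := @ret_to_Pc_comp R X P tgX C PC p cp.
have crq := @ret_to_Pc_comp R X P tgX C PC q cq.
rewrite !(letterXE tgX fPQ PC); split.
  move=> /letter_inj E; apply: (chi_pi1_inj finj crp crq) E; first by rewrite es.
  by rewrite et.
move=> E; congr letter; apply: (chi_map (set_restr (maps_Pc_into_Pc fPQ)) crp crq) E.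
  by rewrite es.
by rewrite et.
Qed.

(** The passages of [p] through a piece may accumulate: this is where an infinite
    concatenation of homotopies is needed. *)
Lemma hat_pair_closed p s t : continuous p ->
  (forall d, 0 < d -> exists s' t', [/\ hat_pair p s' t', s - d < s', s' < s + d,
    t - d < t' & t' < t + d]) -> hat_pair p s t.
Proof.
move=> cp near; have sv : same_value p s t.
  by apply: same_value_closed => // d /near[s' [t' [[? _] ? ? ? ?]]]; exists s', t'.
have [_ _ _ pst] := sv.
have /choice[z zP] : forall n, exists z : R * R, [/\ hat_pair p z.1 z.2, `|z.1 - s| < inv_succ n &
    `|z.2 - t| < inv_succ n].
  move=> n; have [s' [t' [h ? ? ? ?]]] := near (inv_succ n) (inv_succ_gt0 n).
  by exists (s', t'); split=> //=; rewrite ltr_norml; apply/andP; split; lra.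
have lim (w : nat -> R) (l : R) : (forall n, `|w n - l| < inv_succ n) ->
    forall e, 0 < e -> exists n, forall k, (n <= k)%N -> `|w k - l| < e.
  move=> wP e /inv_succ_small[n ne]; exists n => k nk.
  by apply: lt_trans (wP k) _; apply: le_lt_trans ne; exact: inv_succ_le.
have lim1 := lim (fun n => (z n).1) s (fun n => let: And3 _ h _ := zP n in h).
have lim2 := lim (fun n => (z n).2) t (fun n => let: And3 _ _ h := zP n in h).
have eqz n : p (z n).1 = p (z n).2 by have [[[_ _ _ ->]]] := zP n.
have letz C n : P C -> letX C p (z n).1 (z n).2 = 1%g.
  by move=> PC; apply: hat_letter => //; case: (zP n).
have lets C : P C -> letX C p s t = 1%g.
  move=> PC; have crp := @ret_to_Pc_comp R X P tgX C PC p cp.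
  (* The letters between consecutive terms agree for both sequences of times, because the letter
     from [(z n).1] to [(z n).2] is trivial; [chi_limit] carries this to the limits. *)
  have E : letX C p (z 0%N).1 s = letX C p (z 0%N).2 t.
    apply/(letter_chi PC cp cp (eqz 0%N) pst).
    apply: (chi_limit uv crp crp lim1 lim2); last by rewrite pst.
      by move=> n; rewrite eqz.
    move=> n; apply/(letter_chi PC cp cp (eqz n) (eqz n.+1)).
    rewrite -[LHS]mulg1 -(letz C n.+1 PC) letterXM// -[RHS]mul1g -(letz C n PC) letterXM//.
  by rewrite -(letterXM tgX fPQ C s (z 0%N).2 t cp) -E -(letterXM tgX fPQ C s (z 0%N).1 _ cp) letz// mulg1 letterXM// letX_refl.
split=> // F FP; have [d d0 dP] := devX_near s FP cp; have [d' d'0 dP'] := devX_near t FP cp.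
have [m m0 [m1 m2]] := min2_gt0 d0 d'0.
have [s' [t' [h' ? ? ? ?]]] := near m m0; have := h'.2 F FP.
rewrite -(devXM s s' t FP cp) -(devXM s' t' t FP cp) => ->; rewrite mul1g.
case: dP => [[C [CF Cs dE]]|[nC _ dE]]; (rewrite dE; [|lra..]); last first.
  by case: dP' => [[C [CF Ct dE']]|[_ _ dE']]; [case: (nC C CF); rewrite pst|rewrite dE' ?mulg1 //; lra].
case: dP' => [[D [DF Dt dE']]|[nD _ _]]; last by case: (nD C CF); rewrite -pst.
rewrite dE'; [|lra..]; have PC := FP _ CF.
have <- : C = D by apply: (piece_unique tgX PC (FP _ DF) Cs); rewrite pst.
rewrite -(lets C PC) -(letterXM tgX fPQ C s s' t cp) -(letterXM tgX fPQ C s' t' t cp).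
by rewrite (hat_letter cp PC h') mul1g.
Qed.

End hat_pairs.

Section collapsed_path.
Context {R : realType} {X : metricType R} {Y : topologicalType}.
Context {P : set (set X)} {Q : set (set Y)} {f : continuousType X Y}.
Hypotheses (tgX : disjointly_tree_graded R P) (fPQ : maps_pieces_into_pieces P Q f).
Hypothesis uv : uniformly_1_UV0 (set_type (Pc P)).
Hypothesis finj : pi1_injective R (set_restr (maps_Pc_into_Pc fPQ)).
Variables (K : set R) (l r : R).
Hypotheses (cK : closed K) (Kl : forall t : R, t <= l -> K t) (Kr : forall t : R, r <= t -> K t).
Variable p : R -> X.
Hypothesis cp : continuous p.
Hypothesis gap_hat : forall a b : R, is_gap K a b -> hat_pair tgX fPQ p a b.
Local Notation dvX := (devX tgX fPQ).
Local Notation letX := (letterX tgX fPQ).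
Local Notation k := (last_in cK Kl).
Implicit Types (F : seq (set X)) (C : set X) (s t u a b : R).

Definition collapse t : X := p (k t).

Let gap_value a b : is_gap K a b -> p a = p b.
Proof. by move=> /gap_hat[[]]. Qed.

Lemma collapse_continuous : continuous collapse.
Proof. exact: (@last_in_comp_continuous R _ _ _ cK Kl Kr _ _ cp). Qed.

Lemma collapse_in t : K t -> collapse t = p t.
Proof. by move=> Kt; rewrite /collapse last_in_id. Qed.

Lemma collapse_gap a b u : is_gap K a b -> a <= u -> u <= b -> collapse u = p a.
Proof.
move=> gab au; have [ab Ka Kb Kab] := gab.
rewrite le_eqVlt => /orP[/eqP -> |ub]; first by rewrite collapse_in// (gap_value gab).
congr p; apply/eqP; rewrite eq_le (last_in_ge cK Kl Ka au) andbT leNgt; apply/negP => h.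
apply: (Kab (k u) h); last exact: last_in_in.
exact: le_lt_trans (last_in_le _ _ _) ub.
Qed.

Lemma collapse_last_in s t : k s <= t -> t <= s -> collapse t = collapse s.
Proof.
move=> st ts; congr p; apply/eqP; rewrite eq_le last_in_mono//=.
by apply: last_in_ge => //; exact: last_in_in.
Qed.

(** Both paths agree on [K]; over a gap the collapsed one is constant, while the other has a trivial
    letter, hence a null homotopic retraction by [letter_chi]. *)
Lemma collapse_chi C (PC : P C) s t : s <= t ->
  chi (fun u => ret_to_Pc tgX PC (collapse u)) s t =
  chi (fun u => ret_to_Pc tgX PC (p u)) (k s) (k t).
Proof.
move=> st; have cc := collapse_continuous.
have cr := @ret_to_Pc_comp R X P tgX C PC p cp.
have crc := @ret_to_Pc_comp R X P tgX C PC collapse cc.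
have stay u : chi (fun u => ret_to_Pc tgX PC (collapse u)) (k u) u = 1%g.
  apply: chi_const => //; first exact: last_in_le.
  by move=> v kv vu; rewrite (collapse_last_in kv vu) (collapse_last_in (lexx _))// last_in_le.
rewrite -[LHS]mul1g -(stay s) chiM// -(chiM (k s) (k t) t crc) stay mulg1.
apply: (chi_assemble uv cK) => //.
- exact: last_in_mono.
- exact: last_in_in.
- exact: last_in_in.
- by move=> u _ _ Ku; rewrite collapse_in.
move=> a b _ _ gab; have [ab Ka Kb _] := gab.
have -> : chi (fun u => ret_to_Pc tgX PC (p u)) a b = 1%g.
  have E : letX C p a b = letX C p a a.
    by rewrite letX_refl// (hat_letter cp PC (gap_hat gab)).
  have := (letter_chi tgX finj PC cp cp erefl (esym (gap_value gab))).1 E.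
  by move=> ->; rewrite chi_refl.
by apply: chi_const => //; [exact: ltW|move=> u au ub; rewrite !(collapse_gap gab)// ltW].
Qed.

Lemma collapse_letter C s t : P C -> s <= t -> letX C collapse s t = letX C p (k s) (k t).
Proof.
by move=> PC st; apply/(letter_chi tgX finj PC (@collapse_continuous) cp) => //; exact: collapse_chi.
Qed.

(** Locally [k] moves near one time up to skipping a gap ([last_in_near]), and words over gaps are
    trivial; so a single letter is compared, by [collapse_letter]. *)
Lemma collapse_devX F s t : (forall C, C \in F -> P C) -> s <= t ->
  dvX F collapse s t = dvX F p (k s) (k t).
Proof.
move=> FP; have cc := collapse_continuous; pose E s t := dvX F collapse s t = dvX F p (k s) (k t).
suff : s <= t -> E s t by [].
apply: interval_chain => [a b c ab bc Eab Ebc|x].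
  by rewrite /E -(devXM tgX fPQ a b c FP cc) -(devXM tgX fPQ (k a) (k b) (k c) FP cp) Eab Ebc.
have [d d0 dP] := devX_near tgX fPQ x FP cc; have [d' d'0 dP'] := devX_near tgX fPQ (k x) FP cp.
have [e e0 eP] := last_in_near cK Kl Kr x d'0.
have [m m0 [m1 m2]] := min2_gt0 d0 e0; exists m => // a b xa ab bx; rewrite /E.
have [a' [_ a1 a2 _ aE]] := eP a ltac:(lra) ltac:(lra).
have [b' [_ b1 b2 _ bE]] := eP b ltac:(lra) ltac:(lra).
have hE u v : v = k u \/ is_gap K (k u) v /\ u < v ->
    dvX F p (k u) v = 1%g /\ forall C, P C -> letX C p (k u) v = 1%g.
  case=> [->|[/gap_hat h _]]; last by split=> [|C PC]; [exact: h.2|exact: hat_letter].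
  by split=> [|C PC]; [exact: devX_refl|exact: letX_refl].
have [da la] := hE a a' aE; have [db lb] := hE b b' bE.
have -> : dvX F p (k a) (k b) = dvX F p a' b'.
  rewrite -(devXM tgX fPQ (k a) a' (k b) FP cp) da mul1g -(devXM tgX fPQ a' (k b) b' FP cp) db mulg1//.
case: dP => [[C [CF Cx dE]]|[nC _ dE]]; (rewrite dE; [|lra..]).
  have PC := FP C CF; case: dP' => [[D [DF Dx dE']]|[nD _ _]]; last by case: (nD C CF).
  rewrite dE' //; have -> : D = C by exact: (piece_unique tgX (FP _ DF) PC Dx Cx).
  rewrite collapse_letter// -(letterXM tgX fPQ C (k a) a' (k b) cp) la// mul1g.
  by rewrite -(letterXM tgX fPQ C a' (k b) b' cp) lb// mulg1.
by case: dP' => [[D [DF Dx _]]|[_ _ dE']]; [case: (nC D DF)|rewrite dE'].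
Qed.

End collapsed_path.

(** * Cut points *)

(** Words acting on the pairs of a prefix and a sign: a letter from a piece in
    [W] multiplies the sign by the values of [c] before and after it, so that
    outside of [W] the sign is constant and in [W] the sign times [c] is. *)
Section signed_action.
Variables (I : choiceType) (H B : groupType) (W : I -> bool) (c : free_product I H -> B).
Local Open Scope group_scope.
Local Notation FP := (free_product I H).

Definition sign_act (i : I) (h : H) (ab : FP * B) : FP * B :=
  (ab.1 * letter i h, ab.2 * (if W i then c ab.1 * (c (ab.1 * letter i h))^-1 else 1)).

Lemma sign_actP : family_action sign_act.
Proof.
apply: (@cocycle_action I H B (fun i h a => if W i then c a * (c (a * letter i h))^-1 else 1)).
  by move=> i a; case: ifP => // _; rewrite letter1 mulg1 mulgV.
move=> i x y a; case: ifP => _; last by rewrite mulg1.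
by rewrite letterM !mulgA mulgVK.
Qed.

Definition signed (a : FP) : FP * B := lift_act sign_act a (1, 1).

Lemma signed_fst a : (signed a).1 = a.
Proof.
rewrite /signed; elim/free_product_ind: a => [|a i h IHa]; first by rewrite (lift_act1 _ sign_actP).
by rewrite (lift_actM _ _ _ sign_actP) (lift_act_letter _ _ _ sign_actP) /= IHa.
Qed.

Definition sign a : B := (signed a).2.

Lemma sign_letter a i h : sign (a * letter i h) =
  sign a * (if W i then c a * (c (a * letter i h))^-1 else 1).
Proof.
by rewrite /sign /signed (lift_actM _ _ _ sign_actP) (lift_act_letter _ _ _ sign_actP) /= -/(signed a) signed_fst.
Qed.

End signed_action.

Section crossing.
Context {R : realType} {X : metricType R} {Y : topologicalType}.
Context {P : set (set X)} {Q : set (set Y)} {f : continuousType X Y}.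
Hypotheses (tgX : disjointly_tree_graded R P).
Hypotheses (fPQ : maps_pieces_into_pieces P Q f).
Local Notation dvX := (devX tgX fPQ).
Implicit Types (F : seq (set X)) (C : set X) (s t u v : R).
Variables (q : R -> X) (x : X) (V W : set X).
Hypotheses (cq : continuous q) (nPx : ~ Pc P x) (oV : open V) (oW : open W).
Hypothesis VW : forall y, (V y -> W y -> False) /\ (V y \/ W y <-> y <> x).
Hypothesis pieceVW : forall C, P C -> C `<=` V \/ C `<=` W.
Variables (l r s0 t0 : R).
Hypotheses (ls : l <= s0) (st : s0 <= t0) (tr : t0 <= r) (qlr : q l = q r) (Vs : V (q s0)) (Wt : W (q t0)).

(** Two passages through the cut point with equal prefixes, one between [s0] and [t0] and one
    outside. *)
Definition crossing_pair F u v : Prop :=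
  [/\ s0 <= u /\ u <= t0, (l <= v /\ v <= s0) \/ (t0 <= v /\ v <= r), q u = x, q v = x &
    dvX F q u v = 1%g].

(** If the passages inside and outside never shared a prefix, prefixes could be marked according to
    where they occur, and the signed action would give the trivial word a nontrivial effect. *)
Lemma crossing_pair_ex F : (forall C, C \in F -> P C) -> dvX F q l r = 1%g ->
  exists u v, crossing_pair F u v.
Proof.
move=> FP lr1; apply: contrapT => none; move: lr1; pose g t := dvX F q l t.
pose B : groupType := {perm bool}; pose kap : B := tperm true false.
have kap1 : kap <> 1%g by move=> /permP/(_ true); rewrite tpermL perm1.
have gM t u : g u = (g t * dvX F q t u)%g by rewrite /g devXM.
pose S a := exists u, [/\ s0 <= u, u <= t0, q u = x & g u = a].
(* The swap marks the prefixes at passages inside [[s0, t0]]. [h ka] glues the quantities preserved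
   on the two sides of [x], the sign in [V] and the sign times [c] in [W]; they match at a passage
   where [c] has the value [ka]. *)
pose c a : B := if pselect (S a) then kap else 1%g.
pose h (ka : B) t : B := (sign (fun C => `[< C `<=` W >]) c (g t) * (if pselect (V (q t)) then ka else c (g t)))%g.
have hE ka a b : a <= b -> (forall t, a <= t -> t <= b -> q t = x -> c (g t) = ka) -> h ka a = h ka b.
  move=> ab hx; pose E s t := a <= s -> t <= b -> h ka s = h ka t.
  suff : E a b by apply.
  apply: interval_chain ab => [s t u st' tu Est Etu as_ ub|y].
    by rewrite Est ?Etu//; [exact: le_trans st'|exact: le_trans tu ub].
  have [ya|ay] := ltP y a.
    by exists (a - y) => [|s t ys st' ty as_ tb]; [lra|have : a < a by lra]; rewrite ltxx.
  have [by_|yb] := ltP b y.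
    by exists (y - b) => [|s t ys st' ty as_ tb]; [lra|have : b < b by lra]; rewrite ltxx.
  have [d d0 dP] := devX_near tgX fPQ y FP cq.
  have [qx|/((VW (q y)).2.2)qVW] := pselect (q y = x).
    case: dP => [[C [/FP PC Cx _]]|[_ _ dE]]; first by case: nPx; exists C => //; rewrite -qx.
    exists d => // s t ys st' ty as_ tb.
    have gy u : y - d < u -> u < y + d -> g u = g y.
      by move=> yu uy; rewrite (gM y) dE ?mulg1 //; lra.
    have gs : g s = g y by apply: gy; lra.
    have gt : g t = g y by apply: gy; lra.
    by rewrite /h gs gt hx//; do 2 case: pselect => ?.
  have gE s t : y - d < s -> s < y + d -> y - d < t -> t < y + d ->
      (exists C w, [/\ P C, C (q y) & g t = (g s * letter C w)%g]) \/ g t = g s.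
    move=> ys sy yt ty; rewrite (gM s t); case: dP => [[C [CF Cy dE]]|[_ _ dE]].
      rewrite dE// (letterXE tgX fPQ (FP C CF)); left; exists C; eexists; split=> //; exact: FP.
    by right; rewrite dE// mulg1.
  case: qVW => [Vy|Wy].
    have [e e0 eV] := continuous_real_nbhs cq (open_nbhs_nbhs (conj oV Vy)).
    have [m m0 [m1 m2]] := min2_gt0 d0 e0; exists m => // s t ys st' ty as_ tb.
    have Vs' := eV s ltac:(lra) ltac:(lra); have Vt' := eV t ltac:(lra) ltac:(lra).
    rewrite /h; case: pselect => [?|//]; case: pselect => [?|//]; congr (_ * _)%g.
    have [[C [w [PC Cy ->]]]| ->//] := gE s t ltac:(lra) ltac:(lra) ltac:(lra) ltac:(lra).
    rewrite sign_letter ifF ?mulg1//; apply/asboolP => CW.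
    exact: (VW (q y)).1 Vy (CW _ Cy).
  have [e e0 eW] := continuous_real_nbhs cq (open_nbhs_nbhs (conj oW Wy)).
  have [m m0 [m1 m2]] := min2_gt0 d0 e0; exists m => // s t ys st' ty as_ tb.
  have Ws' := eW s ltac:(lra) ltac:(lra); have Wt' := eW t ltac:(lra) ltac:(lra).
  have nV u : W (q u) -> ~ V (q u) by move=> Wu Vu; exact: (VW (q u)).1 Vu Wu.
  rewrite /h; case: pselect => [/(nV s)//|?]; case: pselect => [/(nV t)//|?] /=.
  have [[C [w [PC Cy ->]]]| ->//] := gE s t ltac:(lra) ltac:(lra) ltac:(lra) ltac:(lra).
  have WC : `[< C `<=` W >] = true.
    by apply/asboolP; case: (pieceVW PC) => // /(_ _ Cy) /(nV y Wy).
  by rewrite sign_letter WC mulgA mulgVK.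
(* Outside passages are unmarked, so [h 1] is transported from [s0] back to [l], over to [r] by
   closing up, and to [t0]; inside, [h kap] is transported. Both agree at [t0], on the [W] side, but
   differ by the swap at [s0], on the [V] side. *)
move=> lr1; have h1 : h 1%g s0 = h 1%g t0.
  have c1 v : (l <= v /\ v <= s0) \/ (t0 <= v /\ v <= r) -> q v = x -> c (g v) = 1%g.
    move=> vr qv; rewrite /c; case: pselect => [[u [su ut qu guv]]|//].
    case: none; exists u, v; split=> //.
    by apply: (mulgI (g u)); rewrite -gM mulg1.
  rewrite -(hE 1%g l s0 ls); last by move=> t lt ts; apply: c1; left.
  rewrite (hE 1%g t0 r tr); last by move=> t lt ts; apply: c1; right.
  by rewrite /h /g devX_refl// lr1 qlr.
have hk : h kap s0 = h kap t0.
  apply: hE => // t s0t tt0 qt; rewrite /c; case: pselect => [//|[]]; by exists t.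
have nVt : ~ V (q t0) by move=> Vt; exact: (VW (q t0)).1 Vt Wt.
apply: kap1; move: h1; have -> : h 1%g t0 = h kap t0 by rewrite /h; case: (pselect (V (q t0))).
rewrite -hk /h; case: pselect => [?|//]; move/mulgI => //.
Qed.

Lemma crossing_pair_mono F F' u v : (forall C, C \in F' -> P C) -> {subset F <= F'} ->
  crossing_pair F' u v -> crossing_pair F u v.
Proof.
by move=> FP' sub [? ? ? ? E]; split=> //; rewrite (devX_keep tgX fPQ u v FP' sub cq) E keep1.
Qed.

Lemma crossing_pair_closed F u v : (forall C, C \in F -> P C) ->
  (forall d, 0 < d -> exists u' v', [/\ crossing_pair F u' v', u - d < u', u' < u + d,
    v - d < v' & v' < v + d]) -> crossing_pair F u v.
Proof.
move=> FP near.
have qx w : (forall d, 0 < d -> exists w', [/\ q w' = x, w - d < w' & w' < w + d]) -> q w = x.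
  move=> nw; apply: contrapT => /((VW (q w)).2.2)[Vw|Ww].
    have [d d0 dV] := continuous_real_nbhs cq (open_nbhs_nbhs (conj oV Vw)).
    have [w' [E ? ?]] := nw d d0; have := dV w' ltac:(lra) ltac:(lra); rewrite E => Vx.
    by case: ((VW x).2.1 (or_introl Vx)).
  have [d d0 dW] := continuous_real_nbhs cq (open_nbhs_nbhs (conj oW Ww)).
  have [w' [E ? ?]] := nw d d0; have := dW w' ltac:(lra) ltac:(lra); rewrite E => Wx.
  by case: ((VW x).2.1 (or_intror Wx)).
have qu : q u = x by apply: qx => d /near[u' [v' [[_ _ ? _ _] ? ? ? ?]]]; exists u'.
have qv : q v = x by apply: qx => d /near[u' [v' [[_ _ _ ? _] ? ? ? ?]]]; exists v'.
have trivial w : q w = x -> exists2 d : R, 0 < d & forall w', w - d < w' -> w' < w + d ->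
    dvX F q w w' = 1%g /\ dvX F q w' w = 1%g.
  move=> qw; have [d d0 [[C [/FP PC Cw _]]|[_ _ dE]]] := devX_near tgX fPQ w FP cq.
    by case: nPx; exists C => //; rewrite -qw.
  by exists d => // w' ww' w'w; split; apply: dE => //; lra.
have bnd u' v' : crossing_pair F u' v' -> s0 <= u' /\ u' <= t0 by case.
split=> //.
- split; rewrite leNgt; apply/negP => h.
    have [u' [v' [/bnd[? ?] ? ? ? ?]]] := near (s0 - u) ltac:(lra).
    by have : u' < u'; [lra|rewrite ltxx].
  have [u' [v' [/bnd[? ?] ? ? ? ?]]] := near (u - t0) ltac:(lra).
  by have : u' < u'; [lra|rewrite ltxx].
- have lt0 := le_trans ls st; have s0r := le_trans st tr.
  apply: contrapT => /not_orP[n1 n2].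
  have [d d0 dP] : exists2 d : R, 0 < d & forall v' : R, v - d < v' -> v' < v + d ->
      ~ ((l <= v' /\ v' <= s0) \/ (t0 <= v' /\ v' <= r)).
    have [vl|lv] := ltP v l.
      exists (l - v) => [|v' ? ? vr]; first by lra.
      by have : v < v; [case: vr => -[? ?]; lra|rewrite ltxx].
    have [rv|vr] := ltP r v.
      exists (v - r) => [|v' ? ? vr]; first by lra.
      by have : v < v; [case: vr => -[? ?]; lra|rewrite ltxx].
    have sv : s0 < v by rewrite ltNge; apply/negP => h; apply: n1.
    have vt : v < t0 by rewrite ltNge; apply/negP => h; apply: n2.
    have [m m0 [m1 m2]] := @min2_gt0 _ (v - s0) (t0 - v) ltac:(lra) ltac:(lra).
    exists m => // v' ? ? vr'.
    by have : v < v; [case: vr' => -[? ?]; lra|rewrite ltxx].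
  by have [u' [v' [[_ h _ _ _] ? ? h1 h2]]] := near d d0; exact: (dP v' h1 h2).
have [d d0 dP] := trivial u qu; have [d' d'0 dP'] := trivial v qv.
have [m m0 [m1 m2]] := min2_gt0 d0 d'0.
have [u' [v' [[_ _ _ _ E] ? ? ? ?]]] := near m m0.
rewrite -(devXM tgX fPQ u u' v FP cq) -(devXM tgX fPQ u' v' v FP cq) E mul1g.
have [-> _] := dP u' ltac:(lra) ltac:(lra).
by have [_ ->] := dP' v' ltac:(lra) ltac:(lra); rewrite mulg1.
Qed.

(** For larger finite sets of pieces the sets of crossing pairs decrease. They are nonempty and
    closed in a compact square, so they have a common point. *)
Lemma crossing_pair_all : (forall F, (forall C, C \in F -> P C) -> dvX F q l r = 1%g) ->
  exists u v, forall F, (forall C, C \in F -> P C) -> crossing_pair F u v.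
Proof.
move=> lr1; pose D : set (seq (set X)) := [set F | forall C, C \in F -> P C].
pose B F : set (R * R) := [set z | crossing_pair F z.1 z.2].
have D0 : D [::] by move=> C; rewrite in_nil.
have FB : ProperFilter (filter_from D B).
  apply: filter_from_proper.
    apply: filter_from_filter; first by exists [::].
    move=> F1 F2 D1 D2; have D12 : D (F1 ++ F2).
      by move=> C; rewrite mem_cat => /orP[/D1|/D2].
    exists (F1 ++ F2) => // z h; split; apply: crossing_pair_mono h => // C CF.
      by rewrite mem_cat CF.
    by rewrite mem_cat CF orbT.
  by move=> F DF; have [u [v uv]] := crossing_pair_ex DF (lr1 F DF); exists (u, v).
have cS : compact (`[l, r] `*` `[l, r] : set (R * R)).
  by apply: compact_setX; exact: segment_compact.
have [[u v] [_ cl]] : (`[l, r] `*` `[l, r]) `&` cluster (filter_from D B) !=set0.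
  apply: cS; exists [::] => // -[u v] [/= [? ?] vr _ _ _].
  move: (ls) (st) (tr) => ls' st' tr'.
  by split; rewrite /= in_itv /=; apply/andP; case: vr => -[? ?]; split; lra.
exists u, v => F DF; apply: crossing_pair_closed => // d d0.
have Fd : filter_from D B (B F) by exists F.
have nb : nbhs (u, v) [set z : R * R | [/\ u - d < z.1, z.1 < u + d, v - d < z.2 & z.2 < v + d]].
  by apply/nbhs_box; exists d.
have [[u' v'] [h [? ? ? ?]]] := cl _ _ Fd nb.
by exists u', v'.
Qed.

End crossing.

Section hat_lamination.
Context {R : realType} {X : metricType R} {Y : topologicalType}.
Context {P : set (set X)} {Q : set (set Y)} {f : continuousType X Y}.
Hypotheses (tgX : disjointly_tree_graded R P) (fPQ : maps_pieces_into_pieces P Q f).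
Hypothesis uv : uniformly_1_UV0 (set_type (Pc P)).
Hypothesis finj : pi1_injective R (set_restr (maps_Pc_into_Pc fPQ)).
Variable p : R -> X.
Hypothesis cp : continuous p.
Local Notation dvX := (devX tgX fPQ).
Local Notation letX := (letterX tgX fPQ).
Local Notation hat := (hat_pair tgX fPQ p).
Implicit Types (F : seq (set X)) (C : set X) (s t u v a b l r : R).

Lemma hat_lamination : exists L, [/\ lamination L, forall a b, L a b -> hat a b & maximal_in L hat].
Proof.
apply: maximal_lamination.
- by apply/(closed_box hat) => a b near; apply: (hat_pair_closed uv finj).
- by move=> a b [[]].
- by move=> a a0 a1; split=> // F FP; exact: devX_refl.
Qed.

Variable L : R -> R -> Prop.
Hypotheses (lamL : lamination L) (LE : forall a b, L a b -> hat a b) (mx : maximal_in L hat).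
Variables (l r : R).
Hypothesis Llr : L l r.
Local Notation rho := (region_path L l r p).
Local Notation K := (boundary L l r).
Local Notation k := (last_in (@boundary_closed R L l r) (@boundary_le R L l r)).

Let gL a b : L a b -> p a = p b. Proof. by move=> /LE[[]]. Qed.

Let gap_hat a b : is_gap K a b -> hat a b.
Proof. by move=> /(gap_leaf lamL)[/LE]. Qed.

Let lr : l <= r. Proof. by have [_ ? _] := leaf_range lamL Llr. Qed.

Let crho : continuous rho. Proof. exact: (region_path_continuous lamL cp gL). Qed.

Let rho_ends : rho l = rho r.
Proof.
rewrite (region_path_boundary p (@boundary_le R L l r l (lexx l))).
rewrite (region_path_boundary p (@boundary_ge R L l r r (lexx r))).
exact: gL.
Qed.

(** Collapsing the gaps does not change the class, and the letter of [p] along the leaf is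
    trivial. *)
Lemma region_chi C (PC : P C) : chi (fun u => ret_to_Pc tgX PC (rho u)) l r = 1%g.
Proof.
have Kl := @boundary_le R L l r; have Kr := @boundary_ge R L l r.
transitivity (chi (fun u => ret_to_Pc tgX PC (p u)) (k l) (k r)).
  exact: (@collapse_chi R X Y P Q f tgX fPQ uv finj K l r (@boundary_closed R L l r)
    (@boundary_le R L l r) Kr p cp gap_hat C PC l r lr).
rewrite !last_in_id//; [|exact: Kr|exact: Kl].
have h := hat_letter cp PC (LE Llr).
have E : letX C p l r = letX C p l l by rewrite h letX_refl.
by have := (letter_chi tgX finj PC cp cp erefl (esym (gL Llr))).1 E => ->; rewrite chi_refl//; exact: ret_to_Pc_comp.
Qed.

(** Otherwise a cut point outside of the pieces would separate the two values,
    and a pair of passages through it would give a chord inside the region. *)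
Lemma region_common_piece s t : l <= s -> s <= t -> t <= r ->
  rho s = rho t \/ exists C, [/\ P C, C (rho s) & C (rho t)].
Proof.
move=> ls st tr; apply: contrapT => /not_orP[ne nC].
have [x [V [W [nPx [oV oW] [Vs Wt] VW PVW]]]] : exists (x : X) (V W : set X),
    [/\ ~ Pc P x, open V /\ open W, V (rho s) /\ W (rho t),
    (forall y, (V y -> W y -> False) /\ (V y \/ W y <-> y <> x)) &
    forall C, P C -> C `<=` V \/ C `<=` W].
  by apply: (cut_point tgX ne) => C PC Cs Ct; apply: nC; exists C.
have Kl := @boundary_le R L l r; have Kr := @boundary_ge R L l r.
have dE F a b : (forall C, C \in F -> P C) -> a <= b -> dvX F rho a b = dvX F p (k a) (k b).
  exact: (@collapse_devX R X Y P Q f tgX fPQ uv finj K l r (@boundary_closed R L l r)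
    (@boundary_le R L l r) Kr p cp gap_hat F a b).
have lr1 F : (forall C, C \in F -> P C) -> dvX F rho l r = 1%g.
  move=> FP; rewrite dE// !last_in_id; [exact: (LE Llr).2|exact: Kr|exact: Kl].
have [u [v uvP]] := crossing_pair_all crho nPx oV oW VW PVW ls st tr rho_ends Vs Wt lr1.
have [//|[su ut] vr ru rv _] := uvP [::].
have nx w : rho w = x -> w <> s /\ w <> t.
  move=> rw; split=> E; move: Vs Wt; rewrite -E rw => A B.
    by case: ((VW x).2.1 (or_introl A)).
  by case: ((VW x).2.1 (or_intror B)).
have stay a : rho (k a) = rho a by rewrite /region_path last_in_id//; exact: last_in_in.
have kle a : k a <= a by exact: last_in_le.
have klo a : l <= a -> l <= k a by apply: last_in_ge; exact: Kl.
have Kk a : K (k a) by exact: last_in_in.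
have flat a b : k b <= a -> a <= b -> rho a = rho b.
  by move=> ka ab; apply: (collapse_last_in (K := K)).
have chord a b : l <= a -> a <= b -> b <= r -> rho a = x -> rho b = x ->
    (forall F, (forall C, C \in F -> P C) -> dvX F rho a b = 1%g) -> L (k a) (k b).
  move=> la ab br ra rb d1; have kab : k a <= k b by exact: last_in_mono.
  have kbr : k b <= r := le_trans (kle b) br.
  apply: (boundary_chord lamL mx Llr) => //; first exact: klo.
  have [l0 _ r1] := leaf_range lamL Llr.
  split; first split=> //; [exact: le_trans l0 (klo _ la)|exact: le_trans kbr r1| |].
    have := stay a; have := stay b; rewrite ra rb.
    by rewrite !(region_path_boundary p (Kk _)) => -> ->.
  by move=> F FP; rewrite -dE// d1.
(* Under a leaf strictly below [(l, r)] the path [rho] is constant; so a leaf over a time at which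
   [rho] is not at [x] is [(l, r)] itself. *)
have inside a b w : L (k a) (k b) -> l <= a -> b <= r -> rho a = x -> rho b = x ->
    a <= w -> w <= b -> rho w <> x -> k a = l /\ k b = r.
  move=> Lab la br ra rb aw wb nw.
  have [h|h] := leP (k b) w; first by case: nw; rewrite (flat w b).
  have [bel|nbel] := pselect (below L l r (k a) (k b)).
    case: nw; rewrite (region_path_below lamL gL bel) ?stay//; last exact: ltW.
    exact: le_trans (kle a) aw.
  have kbr : k b <= r := le_trans (kle b) br.
  have kla := klo a la.
  split; apply/eqP; rewrite eq_le ?kla ?kbr ?andbT /= leNgt; apply/negP => h'; apply: nbel; split=> //.
    by left.
  by right.
have [n1 n2] := nx u ru; have [n3 n4] := nx v rv.
have nrs : rho s <> x by move=> E; have [] := nx s E.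
have nrt : rho t <> x by move=> E; have [] := nx t E.
(* The chord between the passages covers [s] or [t], hence is [(l, r)]. In the first case [u] must
   reach [r] and thus equals [t]; in the second [last_in] is [l] at [u], so [rho] is at [x] already
   at time [s]. *)
case: vr => -[v1 v2].
  have vu : v <= u := le_trans v2 su.
  have Lvu : L (k v) (k u).
    apply: chord => //; first exact: le_trans ut tr.
    move=> F FP; have [_ _ _ _ E] := uvP F FP.
    by rewrite (devXV tgX fPQ u v FP crho) E invg1.
  have [_ kur] := inside v u s Lvu v1 (le_trans ut tr) rv ru v2 su nrs.
  have : u = t by apply/eqP; rewrite eq_le ut /=; have := kle u; rewrite kur => /(le_trans tr).
  by move/n2.
have uv' : u <= v := le_trans ut v1.
have Luv : L (k u) (k v).
  apply: chord => //; first exact: le_trans ls su.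
  by move=> F FP; have [_ _ _ _ E] := uvP F FP.
have [kul _] := inside u v t Luv (le_trans ls su) v2 ru rv ut v1 nrt.
by apply: nrs; rewrite (flat s u)// kul.
Qed.

(** A value other than [rho l] determines the piece of [rho l], and every further value shares this
    piece with [rho l]. *)
Lemma region_in_piece : constant_on rho l r \/
  exists2 C, P C & forall t, l <= t -> t <= r -> C (rho t).
Proof.
have [con|ncon] := pselect (constant_on rho l r); [by left|right].
move/existsNP: ncon => [w /not_implyP[lw /not_implyP[wr nw]]].
have [E|[C [PC Cl Cw]]] := region_common_piece (lexx l) lw wr; first by case: nw.
exists C => // t lt tr.
have [E|[D [PD Dl Dt]]] := region_common_piece (lexx l) lt tr; first by rewrite -E.
by rewrite (piece_unique tgX PC PD Cl Dl).
Qed.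

End hat_lamination.

(** * Contraction of loops *)

Section region_fillings.
Context {R : realType} {A : metricType R}.

Definition fills_small (h e : R) : Prop := forall sigma : R -> A, continuous sigma ->
  sigma 0 = sigma 1 -> chi sigma 0 1 = 1%g ->
  (forall u v : R, 0 <= u -> u <= 1 -> 0 <= v -> v <= 1 -> mdist (sigma u) (sigma v) < h) ->
  exists2 H, null_square sigma H & forall z w, mdist (H z) (H w) < e.

Lemma near_minimal_null_square (sigma : R -> A) : continuous sigma -> sigma 0 = sigma 1 ->
  chi sigma 0 1 = 1%g -> exists2 H, null_square sigma H & forall e : R, 0 < e ->
    (exists2 H', null_square sigma H' & forall z w, mdist (H' z) (H' w) < e) ->
    forall z w, mdist (H z) (H w) < 2 * e.
Proof.
move=> cs s01 s1.
apply: (@near_minimal R (R * R -> A) (null_square sigma) (fun H e => forall z w, mdist (H z) (H w) < e)).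
- by move=> H e e' He ee z w; exact: lt_le_trans (He z w) ee.
- exact: chi_null_square.
move=> small; exists (cst (sigma 0)); last by move=> e e0 z w; rewrite mdistxx.
split=> // [z|u u0 u1]; first exact: cvg_cst.
apply/mdist_positivity/eqP; rewrite eq_le mdist_ge0 andbT leNgt; apply/negP.
move=> /small[H [_ H0 _ _] Hd]; have := Hd (0, 0) (u, 0).
by rewrite !H0// ltxx.
Qed.

End region_fillings.

Section leaf_filling.
Context {R : realType} {X : metricType R} {P : set (set X)}.
Hypothesis tg : disjointly_tree_graded R P.
Implicit Types (l r s t u v e h d : R).

(** A nonconstant boundary path is filled inside its piece by a near minimal null homotopy, coned to
    a triangle. The last clause keeps its size within a factor 2 of any available bound, which
    yields equicontinuity over all leaves. *)
Lemma leaf_filling (rho : R -> X) l r : continuous rho -> l <= r -> rho l = rho r ->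
  (constant_on rho l r \/ exists2 C, P C & forall t, l <= t -> t <= r -> C (rho t)) ->
  (forall C (PC : P C), chi (fun u => ret_to_Pc tg PC (rho u)) l r = 1%g) ->
  exists G : R -> R -> X, [/\ forall t, l <= t -> t <= r -> G l t = rho l,
    forall s, l <= s -> s <= r -> G s r = rho l,
    forall s t, l <= s -> s <= t -> t <= r -> constant_on rho s t -> G s t = rho s,
    forall e, 0 < e -> exists2 d, 0 < d & triangle_within (fun _ _ => G) l r d e &
    forall h e, 0 < e -> @fills_small R (Pc P) h e ->
      (forall u v, l <= u -> u <= r -> l <= v -> v <= r -> mdist (rho u) (rho v) < h) ->
      forall d, triangle_within (fun _ _ => G) l r d (2 * e)].
Proof.
move=> crho lr rlr cases null.
have [con|ncon] := pselect (constant_on rho l r).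
  exists (fun _ _ => rho l); split=> //.
  - by move=> s t ls st tr _; rewrite (con s)//; exact: le_trans tr.
  - by move=> e e0; exists 1 => // s t s' t' *; rewrite mdistxx.
  - by move=> h e e0 _ _ d s t s' t' *; rewrite mdistxx; lra.
case: cases => // -[C PC Crho].
have [w [lw wr nw]] : exists w, [/\ l <= w, w <= r & rho w <> rho l].
  by move/existsNP: ncon => [w /not_implyP[? /not_implyP[? ?]]]; exists w.
have lr' : l < r.
  rewrite lt_neqAle lr andbT; apply/eqP => E; apply: nw; congr rho.
  by apply/eqP; rewrite eq_le lw E wr.
have [|phi [al [[cphi cal] [p0 p1] pm pE peq]]] := monotone_factorization crho lr'.
  by exists w => //; apply/andP.
have onto u : 0 <= u -> u <= 1 -> exists2 t, l <= t /\ t <= r & phi t = u.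
  move=> u0 u1; have cw : {within `[l, r], continuous phi} by exact: continuous_subspaceT.
  have [|t tI pt] := IVT (ltW lr') cw (v := u).
    by rewrite p0 p1 min_l ?max_r// u0.
  by move: tI; rewrite in_itv /= => /andP[? ?]; exists t.
have Cal u : 0 <= u -> u <= 1 -> C (al u).
  by move=> u0 u1; have [t [lt tr] <-] := onto u u0 u1; rewrite -pE//; exact: Crho.
pose sg u : Pc P := ret_to_Pc tg PC (al u).
have sgE u : 0 <= u -> u <= 1 -> set_val (sg u) = al u.
  by move=> u0 u1; rewrite /sg ret_to_Pc_val ret_id//; exact: Cal.
have csg : continuous sg by exact: ret_to_Pc_comp.
have al01 : al 0 = al 1 by rewrite -p0 -p1 -!pE.
have sg01 : sg 0 = sg 1 by rewrite /sg al01.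
have sg1 : chi sg 0 1 = 1%g.
  rewrite -p0 -p1 -(chi_comp l r csg cphi) -(null C PC).
  apply: eq_chi => //; [exact: (comp_continuous cphi csg)|exact: ret_to_Pc_comp|].
  by move=> u lu ur; rewrite /sg pE.
have [N [cN N0 N1 Ns] Nmin] := near_minimal_null_square csg sg01 sg1.
have phi01 t : l <= t -> t <= r -> 0 <= phi t /\ phi t <= 1.
  by move=> lt tr; rewrite -p0 -p1 !pm.
(* The coordinates pass through [phi], so the filling over an interval of constancy of [rho] has the
   value of [rho] there; this fits the fillings of lower regions. *)
pose T s t : Pc P := cone N (phi s) (phi t).
have T0 : set_val (sg 0) = rho l by rewrite sgE// -p0 -pE.
exists (fun s t => set_val (T s t)); split.
- move=> t lt tr; rewrite /T /cone p0; have [t0 t1] := phi01 t lt tr.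
  by rewrite !subr0 divr1 (Ns _ t0 t1).1 T0.
- move=> s ls sr; rewrite /T /cone p1; have [s0 s1] := phi01 s ls sr.
  have [->|ne] := eqVneq (phi s) 1.
    by rewrite subrr mul0r N0// -sg01 T0.
  by rewrite divff ?N1// subr_eq0 eq_sym.
- move=> s t ls st tr con; rewrite /T /cone.
  have [s0 s1] := phi01 s ls (le_trans st tr).
  have <- : phi s = phi t by apply/(peq s t st).
  by rewrite subrr mul0r N0// sgE// pE//; exact: le_trans tr.
- move=> e e0; have N1' v : 0 <= v -> v <= 1 -> N (1, v) = sg 0 by move=> v0 v1; have [] := Ns v v0 v1.
  have [d d0 dP] := cone_unif_continuous cN N1' e0.
  have [d' d'0 dP'] : exists2 d', 0 < d' & forall s t : R, l <= s -> s <= r -> `|s - t| < d' ->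
      `|phi s - phi t| < d.
    have [d' d'0 h] := @segment_unif_continuous R R^o phi l r cphi d d0.
    exists d' => // s t ls sr st.
    have : ball (phi s : R^o) d (phi t) by rewrite ballEmdist; exact: h.
    by [].
  exists d' => // s t s' t' ls st tr ls' st' tr' ss tt.
  have sr := le_trans st tr; have lt := le_trans ls st.
  have sr' := le_trans st' tr'; have lt' := le_trans ls' st'.
  have [a1 a2] := phi01 s ls sr; have [b1 b2] := phi01 t lt tr.
  have [c1 c2] := phi01 s' ls' sr'; have [e1 e2] := phi01 t' lt' tr'.
  have mE (x y : Pc P) : mdist (set_val x) (set_val y) = mdist x y by [].
  rewrite mE; apply: dP => //; [exact: pm|exact: pm| |].
    exact: (dP' s s' ls sr ss).
  exact: (dP' t t' lt tr tt).
- move=> h e e0 fs rs d s t s' t' _ _ _ _ _ _ _ _.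
  have mE (x y : Pc P) : mdist (set_val x) (set_val y) = mdist x y by [].
  rewrite mE; apply: Nmin => //; apply: fs => // u v u0 u1 v0 v1.
  rewrite -mE !sgE//; have [a [la ar] <-] := onto u u0 u1; have [b [lb br] <-] := onto v v0 v1.
  by rewrite -!pE//; exact: rs.
Qed.

End leaf_filling.

Section null_loops.
Context {R : realType} {X : metricType R} {Y : topologicalType}.
Context {P : set (set X)} {Q : set (set Y)} {f : continuousType X Y}.
Hypotheses (tgX : disjointly_tree_graded R P) (fPQ : maps_pieces_into_pieces P Q f).
Hypothesis uv : uniformly_1_UV0 (set_type (Pc P)).
Hypothesis finj : pi1_injective R (set_restr (maps_Pc_into_Pc fPQ)).
Variable p : R -> X.
Hypothesis cp : continuous p.
Implicit Types (s t u v a b l r d e h : R).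

Lemma hat_null : hat_pair tgX fPQ p 0 1 -> chi p 0 1 = 1%g.
Proof.
move=> hat01; have [L [lamL LE mx]] := hat_lamination tgX uv finj cp.
have gL a b : L a b -> p a = p b by move=> /LE[[]].
have rangeL a b : L a b -> [/\ 0 <= a, a <= b & b <= 1] by exact: leaf_range.
have L01 : L 0 1.
  apply: mx => // c d /rangeL[c0 cd d1]; rewrite /crosses; split=> -[h1 [h2 h3]].
    by have : d < d; [lra|rewrite ltxx].
  by have : c < c; [lra|rewrite ltxx].
pose rho l r := region_path L l r p.
have rhoB l r t : boundary L l r t -> rho l r t = p t by exact: region_path_boundary.
pose spec l r (G : R -> R -> X) := [/\ forall t, l <= t -> t <= r -> G l t = rho l r l,
    forall s, l <= s -> s <= r -> G s r = rho l r l,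
    forall s t, l <= s -> s <= t -> t <= r -> constant_on (rho l r) s t -> G s t = rho l r s,
    forall e, 0 < e -> exists2 d, 0 < d & triangle_within (fun _ _ => G) l r d e &
    forall h e, 0 < e -> @fills_small R (Pc P) h e ->
      (forall u v, l <= u -> u <= r -> l <= v -> v <= r -> mdist (rho l r u) (rho l r v) < h) ->
      forall d, triangle_within (fun _ _ => G) l r d (2 * e)].
have /choice[G GP] : forall lr : R * R, exists G, L lr.1 lr.2 -> spec lr.1 lr.2 G.
  move=> [l r]; have [Llr|nL] := pselect (L l r); last by exists (fun _ _ => p 0).
  have [_ lr _] := rangeL _ _ Llr.
  have crho : continuous (rho l r) := region_path_continuous lamL cp gL.
  have rlr : rho l r l = rho l r r.
    by rewrite !rhoB ?(gL _ _ Llr)//; [exact: boundary_ge|exact: boundary_le].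
  have [|C PC|G GP] := @leaf_filling R X P tgX (rho l r) l r crho lr rlr.
  - exact: (region_in_piece uv finj cp lamL LE mx Llr).
  - exact: (region_chi uv finj cp lamL LE Llr).
  - by exists G.
pose F l r := G (l, r).
have FP l r : L l r -> spec l r (F l r) := GP (l, r).
have F_left l r t : L l r -> l <= t -> t <= r -> F l r l t = p l.
  by move=> /FP[h _ _ _ _] lt tr; rewrite h// rhoB//; exact: boundary_le.
have F_right l r s : L l r -> l <= s -> s <= r -> F l r s r = p l.
  by move=> /FP[_ h _ _ _] lt tr; rewrite h// rhoB//; exact: boundary_le.
have F_below l r a b s t : L l r -> below L l r a b -> a <= s -> s <= t -> t <= b ->
    F l r s t = region_path L l r p s.
  move=> /FP[_ _ h _ _] bel as_ st tb; have [_ la br _] := bel.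
  apply: h => //; [exact: le_trans as_|exact: le_trans br|].
  move=> x sx xt; rewrite /rho (region_path_below lamL gL bel) ?(region_path_below lamL gL bel (s := s))//.
  - exact: le_trans st tb.
  - exact: le_trans as_ sx.
  - exact: le_trans xt tb.
have F_unif l r : L l r -> forall e, 0 < e -> exists2 d, 0 < d & triangle_within F l r d e.
  by move=> /FP[_ _ _ h _] e /h[d d0 dP]; exists d.
have F_small e : 0 < e -> exists2 h, 0 < h & forall l r, L l r ->
    (forall u v, l <= u -> u <= r -> l <= v -> v <= r ->
       mdist (region_path L l r p u) (region_path L l r p v) < h) ->
    forall d, triangle_within F l r d e.
  move=> e0; have e20 : 0 < e / 2 by lra.
  have [h h0 hP] := small_null_square uv e20.
  exists h => // l r /FP[_ _ _ _ small] rs d.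
  have := small h (e / 2) e20 hP rs d.
  by have -> : 2 * (e / 2) = e by lra.
have F_equi := equicontinuous_small lamL cp gL F_unif F_small.
have fuc := fill_unif_continuous lamL cp gL F_left F_right F_below F_equi.
pose cl (u : R) := Num.max 0 (Num.min u 1).
have cl01 u : 0 <= cl u /\ cl u <= 1.
  by rewrite le_max lexx ge_max ler01 ge_min lexx orbT.
have clE u : 0 <= u -> u <= 1 -> cl u = u by move=> u0 u1; rewrite /cl min_l ?max_r.
have ccl : continuous cl.
  apply: maxr_continuous; first by move=> u; exact: cvg_cst.
  by apply: minr_continuous => u; [exact: cvg_id|exact: cvg_cst].
have cl1 : continuous (fun z : R * R => cl z.1).
  by apply: (@comp_continuous _ _ _ fst cl) => // z; exact: cvg_fst.
have cl2 : continuous (fun z : R * R => cl z.2).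
  by apply: (@comp_continuous _ _ _ snd cl) => // z; exact: cvg_snd.
(* The square is mapped to the triangle: its lower side to the diagonal, which carries [p], its left
   and upper sides to the sides of the leaf [(0, 1)], and its right side to a corner. *)
pose b (z : R * R) := cl z.1 + cl z.2 * (1 - cl z.1).
have cb : continuous b.
  apply: add_continuousF => //; apply: mul_continuousF => //.
  by apply: sub_continuousF => //; exact: cst_continuousF.
have bP z : cl z.1 <= b z /\ b z <= 1.
  rewrite /b; have := cl01 z.1; have := cl01 z.2; move: (cl z.1) (cl z.2) => x y [y0 y1] [x0 x1].
  have : 0 <= y * (1 - x) by apply: mulr_ge0; lra.
  have : 0 <= (1 - y) * (1 - x) by apply: mulr_ge0; lra.
  by move=> ? ?; split; lra.
pose H z := fill L p F (cl z.1) (b z).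
have cH : continuous H.
  move=> z U /nbhs_ballP[e /= e0 eU]; have [d d0 dP] := fuc e e0.
  have near (g : R * R -> R) : continuous g -> \forall w \near z, `|g z - g w| < d.
    move=> cg; have : nbhs (g z) (ball (g z) d) by exact: nbhsx_ballx.
    by move=> /(cg z).
  apply: filterS2 (near _ cl1) (near _ cb) => w h1 h2; apply: eU.
  rewrite ballEmdist; have [b1 b2] := bP z; have [b3 b4] := bP w.
  apply: dP => //; exists 0, 1; split=> //.
    by rewrite le_min (cl01 z.1).1 (cl01 w.1).1.
  by rewrite ge_max b2 b4.
have p01 : p 0 = p 1 := gL _ _ L01.
rewrite -(chi_cst (p 0) 0 1); apply: (@chi_homotopic _ _ p 0 1 (cst (p 0)) 0 1 H) => //.
- by move=> x; exact: cvg_cst.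
- move=> u u0 u1; rewrite /H /b /= (clE u)// (clE 0)// mul0r !addr0 subr0 mul1r add0r.
  exact: fill_refl.
- move=> u u0 u1; rewrite /H /b /= (clE u)// (clE 1)// mul1r addrC subrK.
  exact: (fill_right lamL gL F_right L01).
- move=> v v0 v1; rewrite /H; have [b1 b2] := bP (0, v); move: b1; rewrite /= (clE 0)// => b1.
  exact: (fill_left lamL F_left L01).
- move=> v v0 v1; rewrite /H /b /= (clE 1)// subrr mulr0 addr0.
  exact: fill_refl.
Qed.

End null_loops.

(** * Reduction to kernels, and both implications *)

Section kernels.
Context {R : realType}.
Local Notation I := (unit_itv R).

Lemma pi1_injective_kernel (T U : topologicalType) (g : continuousType T U) :
  (forall (x : T) (p : {path I from x to x}),
     path_homotopic (Defs.path_map g p) (path_cst (g x)) -> path_homotopic p (path_cst x)) ->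
  pi1_injective R g.
Proof.
move=> ker x a b E; have [p pE] := pi1_surj (a * b^-1)%g.
have c1 : pi1_map g (a * b^-1)%g = 1%g.
  apply: (mulIg (pi1_map g b)); rewrite -pi1_map_mul mul1g -[RHS]E.
  by rewrite -mulgA mulVg mulg1.
have : (a * b^-1)%g = 1%g.
  rewrite pE; apply/pi1P; apply: ker; apply/pi1P.
  by rewrite -pi1_mapE -pE c1.
by move=> h; apply: (mulIg b^-1%g); rewrite h mulgV.
Qed.

Lemma chi_path_null (T : topologicalType) (x : T) (p : {path I from x to x}) :
  chi (fun u => p (clamp u)) 0 1 = 1%g -> path_homotopic p (path_cst x).
Proof.
have -> : chi (fun u => p (clamp u)) 0 1 = loop_class p.
  by congr loop_class; apply/funext => u; rewrite subr0 mul1r add0r clampK.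
rewrite -(chi_cst x 0 1) => E.
have [|||||H [cH H0 H1 Hl Hr]] := @loop_class_inj R T p (path_cst x : {path I from x to x}).
- exact: path_cts.
- exact: path_cts.
- by rewrite !path_zero.
- by rewrite !path_one.
- by rewrite E; congr loop_class.
by exists H; split=> // v; rewrite ?Hl ?Hr ?path_zero ?path_one.
Qed.

End kernels.

Theorem theorem1p4 (R : realType) (X : metricType R) (Y : topologicalType)
    (P : set (set X)) (Q : set (set Y)) (f : continuousType X Y)
    (tgX : disjointly_tree_graded R P) (tgY : disjointly_tree_graded R Q)
    (dX : path_diameter_metric X)
    (uvX : uniformly_1_UV0 (set_type (Pc P)))
    (fPQ : maps_pieces_into_pieces P Q f)
    (fsep : distinct_pieces_separated P Q f) :
  pi1_injective R f <->
  pi1_injective R (set_restr (maps_Pc_into_Pc fPQ)).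
Proof.
split=> inj; apply: pi1_injective_kernel => x p [H [cH H0 H1 Hl Hr]].
  have [C PC Cx] : Pc P (set_val x) by exact: set_valP.
  pose q u := set_val (p (clamp u)).
  have cp : continuous p by exact: path_cts.
  have cq : continuous q.
    apply: (@comp_continuous _ _ _ (fun u => p (clamp u)) set_val); last exact: continuous_set_val.
    by apply: clamp_comp_continuous => // u; exact: cvg_id.
  have qC u : C (q u).
    have [u0|u0] := leP u 0; first by rewrite /q clamp_le0// path_zero.
    apply: (path_in_piece tgX PC cq (ltW u0)) => //.
      by move=> t _ _; exact: set_valP.
      by rewrite /q clamp_le0// path_zero.
    exact: ltW.
  have cpv : continuous (fun u => set_val (p u)).
    exact: (comp_continuous cp (@continuous_set_val _ _)).
  have pv0 : set_val (p zero) = set_val x by rewrite path_zero.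
  have pv1 : set_val (p one) = set_val x by rewrite path_one.
  pose pv : {path unit_itv R from set_val x to set_val x} := mk_path cpv pv0 pv1.
  have fnull : path_homotopic (Defs.path_map f pv) (Defs.path_map f (path_cst (set_val x))).
    exists (fun z => set_val (H z)); split=> [|s|s|t|t].
    - exact: (comp_continuous cH (@continuous_set_val _ _)).
    - by rewrite H0.
    - by rewrite H1.
    - by rewrite Hl.
    - by rewrite Hr.
  have /pi1P[K [cK K0 K1 Kl Kr]] : \pi_(pi1 R (set_val x)) pv = \pi_(pi1 R (set_val x)) (path_cst (set_val x)).
    by apply: (inj (set_val x)); rewrite !pi1_mapE; apply/pi1P.
  have rE y : C (set_val y) -> ret_to_Pc tgX PC (set_val y) = y.
    by move=> Cy; apply: val_inj; rewrite /= ret_id.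
  exists (fun z => ret_to_Pc tgX PC (K z)); split=> [|s|s|t|t].
  - by apply: (comp_continuous cK); exact: ret_to_Pc_continuous.
  - by rewrite K0 /= rE//; have := qC (ival s); rewrite /q clampK.
  - by rewrite K1 /= rE.
  - by rewrite Kl rE.
  - by rewrite Kr rE.
apply: chi_path_null; pose q u := p (clamp u).
have cq : continuous q.
  by apply: clamp_comp_continuous; [exact: path_cts|move=> u; exact: cvg_id].
have q0 : q 0 = x by rewrite /q clamp_le0// path_zero.
have q1 : q 1 = x by rewrite /q clamp_ge1// path_one.
(* A single contraction of the image loop in [Y], extended to the plane by clamping, makes the words
   of [q] trivial for every finite set of pieces. *)
apply: (hat_null (tgX := tgX) uvX inj cq); split; first by split; rewrite ?q0 ?q1.
move=> F FP; pose K (z : R * R) := H (clamp z.1, clamp z.2).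
apply: (@devX_trivial R X Y P Q f tgX tgY fPQ fsep F FP q K) => //.
- by rewrite q0 q1.
- by apply: comp2_continuous => // z; [exact: cvg_fst|exact: cvg_snd].
- by move=> u _ _; rewrite /K /= (clamp_le0 (lexx 0)) H0.
- by move=> v; rewrite /K /= (clamp_le0 (lexx 0)) Hl q0.
- by move=> v; rewrite /K /= (clamp_ge1 (lexx 1)) Hr q0.
- by move=> u; rewrite /K /= (clamp_ge1 (lexx 1)) H1 q0.
Qed.
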